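(* Let $E=\mathbb{C}/\Lambda$ be a flat torus and let $\rho=4\pi l$ with $l\in\mathbb{Z}_{>0}$. Then the equation $\triangle u+e^u=\rho\,\delta_0$ on $E$ admits a type I solution if and only if $l$ is odd.
   Context: $\Lambda\subset\mathbb{C}$ is a lattice with $\mathbb{Z}$-basis $\omega_1,\omega_2$, $\mathrm{Im}(\omega_2/\omega_1)>0$. $\triangle=\partial_x^2+\partial_y^2$ and $\delta_0$ is the Dirac measure at $0\in E$; the equation means $\int_E(u\,\triangle h+e^u h)\,dx\,dy=\rho\,h(0)$ for all $h\in C^\infty(E)$, where $u$ is real-valued and $C^2$ on $E\smallsetminus\{0\}$, with $u$ and $e^u$ integrable. Developing maps: if $\rho=4\pi l$ with $l\in\mathbb{Z}_{>0}$, every solution $u$ (pulled back to $\mathbb{C}$) can be written $u(z)=\log\frac{8|f'(z)|^2}{(1+|f(z)|^2)^2}$ on $\mathbb{C}\smallsetminus\Lambda$ with $f$ a meromorphic function on $\mathbb{C}$, called a developing map of $u$; $f$ is unique up to the action of $\mathrm{PSU}(2)$ by linear fractional transformations. For every $\omega\in\Lambda$ there is a unique $T_\omega\in\mathrm{PSU}(2)$ with $f(z+\omega)=T_\omega f(z)$, and $\omega\mapsto T_\omega$ is a homomorphism $\Lambda\to\mathrm{PSU}(2)$ (the monodromy of $u$, well defined up to conjugation). The solution $u$ is of type I if the image of this homomorphism is isomorphic to the Klein four-group $(\mathbb{Z}/2\mathbb{Z})^2$, and of type II otherwise. *)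

(* Defs.v *)
From HB Require Import structures.
From mathcomp Require Import all_boot all_order all_algebra.
From mathcomp Require Import all_classical all_reals all_analysis.
From mathcomp Require Import complex.
Import Normc.
Set Implicit Arguments.
Unset Strict Implicit.
Unset Printing Implicit Defensive.
Import Order.TTheory GRing.Theory Num.Theory.
Import numFieldNormedType.Exports.
Local Open Scope classical_set_scope.
Local Open Scope ring_scope.
Local Open Scope complex_scope.

(** * The flat torus [C / Lambda]

    Functions on [C / Lambda] are represented by their pullbacks to [C], that
    is, by [Lambda]-periodic functions [R[i] -> R]; the origin of the torus
    pulls back to [Lambda].  Integrals over the torus are integrals over the
    half-open fundamental parallelogram. *)

Definition lattice (R : realType) (w1 w2 : R[i]) : set R[i] :=
  [set w | exists m n : int, w = w1 *~ m + w2 *~ n].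

Definition lattice_periodic (R : realType) (w1 w2 : R[i]) (V : Type)
    (g : R[i] -> V) : Prop :=
  forall z w, lattice w1 w2 w -> g (z + w) = g z.

Definition fundamental_domain (R : realType) (w1 w2 : R[i]) : set (R * R) :=
  [set p | exists s t : R, [/\ 0 <= s < 1, 0 <= t < 1 &
             p.1 +i* p.2 = s%:C * w1 + t%:C * w2]].

Definition in_coords (R : realType) (V : Type) (g : R[i] -> V) :
    R * R -> V :=
  fun p => g (p.1 +i* p.2).

Definition area (R : realType) :
    {measure set (measurableTypeR R * measurableTypeR R) -> \bar R} :=
  (@lebesgue_measure R \x @lebesgue_measure R)%E.

(** * Differentiability classes *)

Definition dx (R : realType) (g : R * R -> R) : R * R -> R := 'D_(1, 0) g.
Definition dy (R : realType) (g : R * R -> R) : R * R -> R := 'D_(0, 1) g.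

(** [U] is meant to be open. *)
Fixpoint class_C (R : realType) (k : nat) (U : set (R * R))
    (g : R * R -> R) : Prop :=
  (forall p, U p -> {for p, continuous g}) /\
  if k is k'.+1 then
    [/\ forall p, U p -> derivable g p (1, 0) /\ derivable g p (0, 1),
        class_C k' U (dx g) & class_C k' U (dy g)]
  else True.

Definition smooth (R : realType) (g : R * R -> R) : Prop :=
  forall k, class_C k setT g.

Definition laplacian (R : realType) (g : R * R -> R) : R * R -> R :=
  fun p => dx (dx g) p + dy (dy g) p.

(** * The equation [laplacian u + exp u = rho * delta_0] on [C / Lambda]

    The value of [u] on [Lambda] is irrelevant. *)

Definition mean_field_solution (R : realType) (w1 w2 : R[i]) (rho : R)
    (u : R[i] -> R) : Prop :=
  let E := fundamental_domain w1 w2 in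
  [/\ lattice_periodic w1 w2 u,
      class_C 2 [set p | ~ lattice w1 w2 (p.1 +i* p.2)] (in_coords u),
      (@area R).-integrable E (EFin \o in_coords u),
      (@area R).-integrable E (EFin \o (expR \o in_coords u)) &
      forall h : R[i] -> R, lattice_periodic w1 w2 h -> smooth (in_coords h) ->
        (\int[@area R]_(p in E)
           (in_coords u p * laplacian (in_coords h) p
            + expR (in_coords u p) * in_coords h p)%:E
         = (rho * h 0)%:E)%E].

(** * Meromorphic functions, as maps to the Riemann sphere

    [None] is the point at infinity. *)

Definition sphere (R : realType) := option R[i].

Definition sphere_inv (R : realType) (w : sphere R) : sphere R :=
  match w with
  | None => Some 0
  | Some a => if a == 0 then None else Some a^-1
  end.

Definition affine_part (R : realType) (f : R[i] -> sphere R) :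
    R[i]^o -> R[i]^o :=
  fun z => odflt 0 (f z).

(** Derivatives of maps [R[i]^o -> R[i]^o] are complex derivatives. *)
Definition holomorphic_near (R : realType) (f : R[i] -> sphere R)
    (z : R[i]^o) : Prop :=
  \forall w \near z, f w <> None /\ derivable (affine_part f) w 1.

Definition meromorphic (R : realType) (f : R[i] -> sphere R) : Prop :=
  forall z : R[i]^o,
    holomorphic_near f z \/
    (holomorphic_near (fun w => sphere_inv (f w)) z /\
     \forall w \near z^', f w <> None).

(** * Developing maps *)

Definition spherical_density_fin (R : realType) (f : R[i] -> sphere R)
    (z : R[i]^o) : R :=
  8 * normc (derive1 (affine_part f) z) ^+ 2
    / (1 + normc (affine_part f z) ^+ 2) ^+ 2.

(** The expression [8 |f'|^2 / (1 + |f|^2)^2] is invariant under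
    [f |-> 1 / f]; this gives its continuous extension to the poles of [f]. *)
Definition spherical_density (R : realType) (f : R[i] -> sphere R)
    (z : R[i]) : R :=
  if f z is None then spherical_density_fin (fun w => sphere_inv (f w)) z
  else spherical_density_fin f z.

(** Positivity is stated because [ln] is total, with [ln 0 = 0]. *)
Definition developing_map (R : realType) (w1 w2 : R[i]) (u : R[i] -> R)
    (f : R[i] -> sphere R) : Prop :=
  meromorphic f /\
  forall z, ~ lattice w1 w2 z ->
    0 < spherical_density f z /\ u z = ln (spherical_density f z).

(** * The group [PSU(2)] and the monodromy *)

Definition SU2 (R : realType) : set 'M[R[i]]_2 :=
  [set M | M *m (map_mx conjc M)^T = 1%:M /\ \det M = 1].

Definition mobius (R : realType) (M : 'M[R[i]]_2) (w : sphere R) : sphere R :=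
  let a := M ord0 ord0 in let b := M ord0 ord_max in
  let c := M ord_max ord0 in let d := M ord_max ord_max in
  match w with
  | None => if c == 0 then None else Some (a / c)
  | Some x => if c * x + d == 0 then None else Some ((a * x + b) / (c * x + d))
  end.

(** [PSU(2)] is realised as a group of linear fractional transformations of
    the sphere, the group law being composition; two matrices of [SU(2)] induce
    the same transformation iff they differ by a sign. *)
Definition PSU2 (R : realType) : set (sphere R -> sphere R) :=
  [set @mobius R M | M in @SU2 R].

Definition monodromy (R : realType) (w1 w2 : R[i]) (f : R[i] -> sphere R)
    (T : R[i] -> sphere R -> sphere R) : Prop :=
  forall w, lattice w1 w2 w ->
    PSU2 (T w) /\ forall z, f (z + w) = T w (f z).

(** [A] is closed under composition, and for this law it is a group isomorphic
    to [Z/2 x Z/2]. *)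
Definition klein_four (S : Type) (A : set (S -> S)) : Prop :=
  exists phi : 'Z_2 * 'Z_2 -> S -> S,
    [/\ injective phi,
        forall a b, phi (a + b) = phi a \o phi b &
        range phi = A].

(** Developing maps of [u] differ by an element of [PSU(2)], which conjugates
    the monodromy, so the choice of [f] is immaterial. *)
Definition type_I (R : realType) (w1 w2 : R[i]) (u : R[i] -> R) : Prop :=
  exists (f : R[i] -> sphere R) (T : R[i] -> sphere R -> sphere R),
    [/\ developing_map w1 w2 u f, monodromy w1 w2 f T &
        klein_four (T @` lattice w1 w2)].

(* Main.v *)
(** For [l = 2 m + 1], a series of secants gives a meromorphic [g] with
    [g (z + w1) = - g z], [g (z + w2) = 1 / g z] and [g' ^ 2 = c0 q(g)], where
    [q x = x ^ 4 - kap x ^ 2 + 1]; modulo poles, its critical points are [Lambda].  For a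
    suitable [gam] the equation [q W'' - m q' W' + (l (l - 1) x ^ 2 + gam) W = 0] has an
    even polynomial solution [P] of degree [2 m] and the odd solution [Q x = x ^ l P (1 / x)].
    Their Wronskian is a multiple of [q ^ m], so [f = Q(g) / P(g)] has [f'] proportional to
    [g' ^ l / P(g) ^ 2], with zeros of order [l] on [Lambda] only, and its monodromy is
    generated by [x |-> - x] and [x |-> 1 / x].

    Any [u = ln (8 |f'| ^ 2 / (1 + |f| ^ 2) ^ 2)] with [f'] of order [k > 0] on [Lambda] and
    [0] elsewhere solves the equation with [rho = 4 pi k]: [w = exp (u / k)] is of class
    [C^2], vanishes to second order on [Lambda] and satisfies
    [w lap w - |grad w| ^ 2 = - w ^ (k + 2) / k]; apply Green's formula to [k ln (w + eps)]
    and use that [eps / (w + eps) ^ 2] concentrates at the origin.  So [k = l] for a given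
    solution.

    If the order [k] of [f'] on [Lambda] were even, [f'] would have a meromorphic square
    root [s], and [(f / s, 1 / s)] would transform under [w1] and [w2] by commuting lifts of
    the monodromy to [SL(2)].  Nontrivial involutions lift to matrices of trace zero, and two
    commuting ones agree up to sign, so the monodromy would have at most two elements. *)
Require Import Defs.
From HB Require Import structures.
From mathcomp Require Import all_boot all_order all_algebra.
From mathcomp Require Import all_classical all_reals all_analysis.
From mathcomp Require Import complex measurable_realfun.
From mathcomp Require Import ring lra zify.
Import Normc.
Set Implicit Arguments.
Unset Strict Implicit.
Unset Printing Implicit Defensive.
Import Order.TTheory GRing.Theory Num.Theory.
Import numFieldNormedType.Exports.
Local Open Scope classical_set_scope.
Local Open Scope ring_scope.
Local Open Scope complex_scope.

(** Behind the polynomials stands the Lame equation with half-integral parameter: divided by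
    [g' ^ (l / 2)], both [P(g)] and [Q(g)] solve [y'' = (n (n + 1) wp + B) y] with [n = l / 2], and
    [gam] plays the part of [B]. Absence of logarithms is an algebraic condition of degree [m + 1]
    on [gam], so it can be met on every torus. The complex analysis uses neither residues nor power
    series. Goursat's theorem gives a Cauchy estimate with an unspecified constant, powers of the
    function remove the constant, and the resulting maximum principle, applied to difference
    quotients, gives removable singularities, holomorphy of derivatives and orders of zeros. On the
    real side the obstacle is the logarithmic singularity of [u]. Passing to [exp (u / k)] instead
    of [exp u] makes the zero exactly quadratic whatever [k] is; then [ln (w + eps)] is of class
    [C^2] on the whole plane, one explicit kernel serves every [k], and no disc has to be cut
    out. *)

Local Notation Re := complex.Re.
Local Notation Im := complex.Im.

(** * Complex differentiability *)

Section Basics.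
Variable R : realType.
Local Notation C := R[i].
Implicit Types (z w : C) (f g : C -> C).

Lemma normcE z : `|z| = (normc z)%:C.
Proof. by []. Qed.

Lemma normc_ge0 (z : R[i]) : 0 <= normc z.
Proof. by case: z => a b; apply: sqrtr_ge0. Qed.

Lemma normc_gt0 (z : R[i]) : z != 0 -> 0 < normc z.
Proof.
move=> z0; rewrite lt_neqAle normc_ge0 andbT eq_sym.
by apply: contra z0 => /eqP /eq0_normc ->.
Qed.

Lemma normc_eq0 (z : R[i]) : (normc z == 0) = (z == 0).
Proof.
apply/eqP/eqP; first exact: eq0_normc.
by move=> ->; exact: normc0.
Qed.

Lemma normcB (z w : R[i]) : normc (z - w) = normc (w - z).
Proof. by rewrite -normcN opprB. Qed.

Lemma normcX (z : R[i]) n : normc (z ^+ n) = normc z ^+ n.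
Proof. by elim: n => [|n IH]; rewrite ?expr0 ?normc1 // !exprS normcM IH. Qed.

Lemma normcR (x : R) : normc x%:C = `|x|.
Proof. by rewrite /normc /= expr0n addr0 sqrtr_sqr. Qed.

Lemma ler_normcB (z w : R[i]) : normc z - normc w <= normc (z - w).
Proof. by rewrite lerBlDr (le_trans _ (le_normcD _ _)) // subrK. Qed.

Lemma normc_Re (z : R[i]) : `|Re z| <= normc z.
Proof. by have := normc_ge_Re z; rewrite -[`|z|]/((normc z)%:C) lecR. Qed.

Lemma normc_Im (z : R[i]) : `|Im z| <= normc z.
Proof.
have := normc_Re (z * 'i%C); rewrite ReiNIm normrN normcM.
suff -> : normc ('i%C : R[i]) = 1 by rewrite mulr1.
by rewrite /normc /= expr0n expr1n add0r sqrtr1.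
Qed.

Lemma normc_sqr (z : R[i]) : normc z ^+ 2 = Re z ^+ 2 + Im z ^+ 2.
Proof. by case: z => a b; rewrite /= sqr_sqrtr // addr_ge0 // sqr_ge0. Qed.

Lemma normc_ReIm (z : R[i]) : normc z <= `|Re z| + `|Im z|.
Proof.
rewrite -ler_sqr ?nnegrE ?normc_ge0 ?addr_ge0//.
rewrite normc_sqr sqrrD !real_normK ?num_real//.
by rewrite -addrA [_ *+ 2 + _]addrC addrA lerDl mulrn_wge0 // mulr_ge0.
Qed.

(** The radius is real because the norm of [R[i]] takes its values in [R[i]], whose order is
    partial; [nearCP] translates back to filters. *)
Definition nearc z (P : C -> Prop) : Prop :=
  exists2 D : R, 0 < D & forall w, normc (w - z) < D -> P w.

Definition dnearc z (P : C -> Prop) : Prop := nearc z (fun w => w != z -> P w).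

Lemma nearc_imp z (P Q : C -> Prop) : (forall w, P w -> Q w) ->
  nearc z P -> nearc z Q.
Proof. by move=> PQ [D D0 H]; exists D => // w /H /PQ. Qed.

Lemma nearcT z (P : C -> Prop) : (forall w, P w) -> nearc z P.
Proof. by move=> PT; exists 1. Qed.

Lemma nearc_and z (P Q : C -> Prop) :
  nearc z P -> nearc z Q -> nearc z (fun w => P w /\ Q w).
Proof.
move=> [D D0 H] [D' D'0 H'].
exists (Num.min D D'); first by rewrite lt_min D0 D'0.
by move=> w; rewrite lt_min => /andP[/H ? /H' ?].
Qed.

Lemma nearc_self z (P : C -> Prop) : nearc z P -> P z.
Proof. by move=> [D D0]; apply; rewrite subrr normc0. Qed.

Lemma nearc_nearc z (P : C -> Prop) : nearc z P -> nearc z (fun w => nearc w P).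
Proof.
move=> [D D0 H]; exists D => // w wD; exists (D - normc (w - z)); first by rewrite subr_gt0.
move=> v vw; apply: H; have -> : v - z = (v - w) + (w - z) by ring.
by apply: le_lt_trans (le_normcD _ _) _; rewrite -ltrBrDr.
Qed.

Lemma nearc_shift z a (P : C -> Prop) : nearc (z + a) P -> nearc z (fun w => P (w + a)).
Proof.
move=> [D D0 H]; exists D => // w wD; apply: H.
by have -> : w + a - (z + a) = w - z by ring.
Qed.

Definition cont_at f z : Prop :=
  forall e : R, 0 < e -> nearc z (fun w => normc (f w - f z) < e).

Lemma cont_cst (k : C) z : cont_at (fun=> k) z.
Proof. by move=> e e0; apply: nearcT => w; rewrite subrr normc0. Qed.

Lemma cont_id z : cont_at id z.
Proof. by move=> e e0; exists e. Qed.

Lemma contD f g z : cont_at f z -> cont_at g z -> cont_at (fun w => f w + g w) z.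
Proof.
move=> F G e e0; have e2 : 0 < e / 2 by rewrite divr_gt0.
apply: nearc_imp (nearc_and (F _ e2) (G _ e2)) => w [a b].
have -> : f w + g w - (f z + g z) = (f w - f z) + (g w - g z) by ring.
by apply: le_lt_trans (le_normcD _ _) _; rewrite (splitr e) ltrD.
Qed.

Lemma contN f z : cont_at f z -> cont_at (fun w => - f w) z.
Proof.
by move=> F e /F; apply: nearc_imp => w; rewrite -opprD normcN.
Qed.

Lemma contB f g z : cont_at f z -> cont_at g z -> cont_at (fun w => f w - g w) z.
Proof. by move=> F G; apply: contD => //; apply: contN. Qed.

Lemma cont_near f g z : nearc z (fun w => f w = g w) -> cont_at f z -> cont_at g z.
Proof.
move=> fg F e e0; rewrite -(nearc_self fg).
by apply: nearc_imp (nearc_and fg (F _ e0)) => w [-> ].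
Qed.

Lemma cont_bound f z (M : R) : cont_at f z -> normc (f z) < M ->
  nearc z (fun w => normc (f w) < M).
Proof.
move=> F zM; have := F (M - normc (f z)); rewrite subr_gt0 => /(_ zM).
apply: nearc_imp => w h; rewrite -[f w](subrK (f z)).
by apply: le_lt_trans (le_normcD _ _) _; rewrite -ltrBrDr.
Qed.

Lemma contM f g z : cont_at f z -> cont_at g z -> cont_at (fun w => f w * g w) z.
Proof.
move=> F G e e0.
pose M := normc (f z) + normc (g z) + 1.
have f0 := normc_ge0 (f z); have g0 := normc_ge0 (g z).
have M0 : 0 < M by rewrite /M; lra.
have e2 : 0 < e / (M + M) by rewrite divr_gt0 // addr_gt0.
have fM : normc (f z) < M by rewrite /M; lra.
apply: nearc_imp (nearc_and (nearc_and (F _ e2) (G _ e2)) (cont_bound F fM)) => w [[a b] c].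
have -> : f w * g w - f z * g z = f w * (g w - g z) + (f w - f z) * g z by ring.
apply: le_lt_trans (le_normcD _ _) _; rewrite !normcM.
have -> : e = M * (e / (M + M)) + (e / (M + M)) * M.
  by field; rewrite gt_eqF //; lra.
apply: ltr_leD.
  apply: le_lt_trans (_ : M * normc (g w - g z) < _).
    by rewrite ler_wpM2r ?normc_ge0 // ltW.
  by rewrite ltr_pM2l.
apply: ler_pM; rewrite ?normc_ge0 //; first exact: ltW.
by rewrite /M; lra.
Qed.

Lemma cont_neq0 f z : cont_at f z -> f z != 0 -> nearc z (fun w => f w != 0).
Proof.
move=> F f0; have /F := normc_gt0 f0.
apply: nearc_imp => w; apply: contraL => /eqP ->.
by rewrite sub0r normcN ltxx.
Qed.

Lemma cont_away f z : cont_at f z -> f z != 0 ->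
  nearc z (fun w => normc (f z) / 2 < normc (f w)).
Proof.
move=> F f0; have f1 := normc_gt0 f0.
have /F : 0 < normc (f z) / 2 by rewrite divr_gt0.
apply: nearc_imp => w; rewrite normcB => h.
have := ler_normcB (f z) (f w); lra.
Qed.

Lemma contV f z : f z != 0 -> cont_at f z -> cont_at (fun w => (f w)^-1) z.
Proof.
move=> f0 F e e0; have f1 := normc_gt0 f0.
have e2 : 0 < e * (normc (f z) / 2 * normc (f z)) by rewrite !mulr_gt0 // divr_gt0.
apply: nearc_imp (nearc_and (nearc_and (F _ e2) (cont_away F f0)) (cont_neq0 F f0)) => w [[a b] c].
have -> : (f w)^-1 - (f z)^-1 = - (f w - f z) / (f w * f z).
  by field; rewrite c f0.
rewrite normcM normcN normcV normcM ltr_pdivrMr ?mulr_gt0 ?normc_gt0//.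
by apply: lt_trans a _; rewrite ltr_pM2l // ltr_pM2r.
Qed.

Lemma contX f n z : cont_at f z -> cont_at (fun w => f w ^+ n) z.
Proof.
move=> F; elim: n => [|n IH]; first exact: cont_cst.
have -> : (fun w => f w ^+ n.+1) = (fun w => f w * f w ^+ n).
  by apply: funext => w; rewrite exprS.
exact: contM.
Qed.

Lemma cont_comp f g z : cont_at f z -> cont_at g (f z) -> cont_at (fun w => g (f w)) z.
Proof.
move=> F G e /G [D D0 H]; apply: nearc_imp (F _ D0) => w; exact: H.
Qed.

(** Caratheodory's form of the derivative: differentiability with derivative [d] is continuity of
    this completed quotient at [z]. Sum, product and chain rules then become algebra on
    factorisations [f w = f z + (w - z) * G w]. *)
Definition slope f (d : C) z w : C := if w == z then d else (f w - f z) / (w - z).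

Definition cderiv f z d := cont_at (slope f d z) z.

Lemma slopeE f d z w : f w = f z + (w - z) * slope f d z w.
Proof.
rewrite /slope; case: eqVneq => [->|wz]; first by rewrite subrr mul0r addr0.
by rewrite mulrC divfK ?subr_eq0// addrC subrK.
Qed.

Lemma slopezz f d z : slope f d z z = d.
Proof. by rewrite /slope eqxx. Qed.

Lemma cderiv_slope f z d G : cont_at G z -> G z = d ->
  nearc z (fun w => f w = f z + (w - z) * G w) -> cderiv f z d.
Proof.
move=> cG Gz H; apply: cont_near cG; apply: nearc_imp H => w.
rewrite /slope; case: eqVneq => [->//|wz ->].
by rewrite addrC addKr mulrC mulKf // subr_eq0.
Qed.

Lemma cderiv_cont f z d : cderiv f z d -> cont_at f z.
Proof.
move=> F; have -> : f = (fun w => f z + (w - z) * slope f d z w).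
  by apply: funext => w; rewrite -slopeE.
by exact: (contD (cont_cst (f z) z) (contM (contB (cont_id z) (cont_cst z z)) F)).
Qed.

Lemma cderiv_near f g z d : nearc z (fun w => f w = g w) -> cderiv f z d -> cderiv g z d.
Proof.
move=> fg F; apply: (cderiv_slope F (slopezz _ _ _)).
have fz := nearc_self fg; apply: nearc_imp fg => w <-; rewrite -fz; exact: slopeE.
Qed.

Lemma cderiv_cst k z : cderiv (fun=> k) z 0.
Proof.
apply: (@cderiv_slope _ _ _ (fun=> 0)) => //; first exact: cont_cst.
by apply: nearcT => w; rewrite mulr0 addr0.
Qed.

Lemma cderiv_id z : cderiv id z 1.
Proof.
apply: (@cderiv_slope _ _ _ (fun=> 1)) => //; first exact: cont_cst.
by apply: nearcT => w; rewrite mulr1 addrC subrK.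
Qed.

Lemma cderivD f g z a b : cderiv f z a -> cderiv g z b ->
  cderiv (fun w => f w + g w) z (a + b).
Proof.
move=> F G; apply: (cderiv_slope (contD F G)); first by rewrite !slopezz.
apply: nearcT => w; rewrite {1}(slopeE f a z w) {1}(slopeE g b z w); ring.
Qed.

Lemma cderivN f z a : cderiv f z a -> cderiv (fun w => - f w) z (- a).
Proof.
move=> F; apply: (cderiv_slope (contN F)); first by rewrite !slopezz.
apply: nearcT => w; rewrite {1}(slopeE f a z w); ring.
Qed.

Lemma cderivB f g z a b : cderiv f z a -> cderiv g z b ->
  cderiv (fun w => f w - g w) z (a - b).
Proof. by move=> F G; exact: (cderivD F (cderivN G)). Qed.

Lemma cderivM f g z a b : cderiv f z a -> cderiv g z b ->
  cderiv (fun w => f w * g w) z (a * g z + f z * b).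
Proof.
move=> F G.
apply: (cderiv_slope (contD (contM F (cderiv_cont G)) (contM (cont_cst (f z) z) G))).
  by rewrite !slopezz.
apply: nearcT => w; rewrite {1}(slopeE f a z w) {2}(slopeE g b z w) {1}(slopeE g b z w); ring.
Qed.

Lemma cderivX f z a n : cderiv f z a ->
  cderiv (fun w => f w ^+ n) z (n%:R * f z ^+ n.-1 * a).
Proof.
move=> F; elim: n => [|n IH].
  by rewrite mul0r mul0r; exact: cderiv_cst.
have -> : (fun w => f w ^+ n.+1) = (fun w => f w * f w ^+ n).
  by apply: funext => w; rewrite exprS.
have := cderivM F IH; congr (cderiv _ _ _).
case: n {IH} => [|n].
  by rewrite !expr0; ring.
by rewrite -[n.+2.-1]/n.+1%N -[n.+1.-1]/n -(natr1 n.+1) exprS; ring.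
Qed.

Lemma cderivV f z a : f z != 0 -> cderiv f z a ->
  cderiv (fun w => (f w)^-1) z (- a / f z ^+ 2).
Proof.
move=> f0 F; have Fc := cderiv_cont F.
have H : cont_at (fun w => - (slope f a z w * (f w * f z)^-1)) z.
  apply: contN; apply: contM => //; apply: contV; first exact: mulf_neq0.
  by apply: contM => //; exact: cont_cst.
apply: (cderiv_slope H); first by rewrite !slopezz expr2 mulNr.
apply: nearc_imp (cont_neq0 Fc f0) => w fw.
have E : f w - f z = (w - z) * slope f a z w by rewrite {1}(slopeE f a z w) addrC addKr.
have -> : (f z)^-1 + (w - z) * - (slope f a z w / (f w * f z)) =
  (f z)^-1 - ((w - z) * slope f a z w) / (f w * f z) by ring.
by rewrite -E; field; rewrite fw f0.
Qed.

Lemma cderiv_comp f g z a b : cderiv f z a -> cderiv g (f z) b ->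
  cderiv (fun w => g (f w)) z (b * a).
Proof.
move=> F G; have Fc := cderiv_cont F.
apply: (cderiv_slope (contM (cont_comp Fc G) F)).
  by rewrite !slopezz.
apply: nearcT => w; rewrite {1}(slopeE g b (f z) (f w)) {1}(slopeE f a z w); ring.
Qed.

Lemma cderiv_unique f z a b : cderiv f z a -> cderiv f z b -> a = b.
Proof.
move=> F G; apply/eqP; rewrite -subr_eq0; apply/negPn/negP => ab.
have H := contB F G.
have : slope f a z z - slope f b z z != 0 by rewrite !slopezz.
move=> /(cont_neq0 H) [D D0 K].
pose w : C := z + (D / 2)%:C.
have wz : w - z = (D / 2)%:C by rewrite /w addrC addKr.
have D2 : 0 < D / 2 by apply: divr_gt0.
have wD : normc (w - z) < D by rewrite wz normcR gtr0_norm //; lra.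
have := K w wD.
have : w != z.
  by rewrite -subr_eq0 wz; apply/eqP => -[] /eqP; rewrite gt_eqF.
by rewrite /slope => /negbTE ->; rewrite subrr eqxx.
Qed.

Lemma cderiv_bound f z d (e : R) : 0 < e -> cderiv f z d ->
  nearc z (fun w => normc (f w - (f z + (w - z) * d)) <= e * normc (w - z)).
Proof.
move=> e0 /(_ e e0); apply: nearc_imp => w.
rewrite slopezz {1}(slopeE f d z w) => H.
have -> : f z + (w - z) * slope f d z w - (f z + (w - z) * d) = (slope f d z w - d) * (w - z) by ring.
by rewrite normcM; apply: ler_wpM2r; [exact: normc_ge0|exact: ltW].
Qed.

Lemma nearCP z (P : C -> Prop) :
  (\forall w \near (z : R[i]^o), P w) <-> nearc z P.
Proof.
split.
- case/nbhs_ballP => e /= e0 H; exists (Re e).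
    by move: e0; rewrite ltcE /= => /andP[_].
  move=> w wz; apply: H; rewrite /ball /= normcE ltcE /= normcB wz andbT.
  by move: e0; rewrite ltcE /= => /andP[].
- case=> D D0 H; apply/nbhs_ballP; exists D%:C; first by rewrite /= ltcR.
  by move=> w; rewrite /ball /= normcE ltcR normcB; apply: H.
Qed.

Lemma dnearCP z (P : C -> Prop) :
  (\forall w \near (z : R[i]^o)^', P w) <-> dnearc z P.
Proof. by rewrite near_withinE; exact: nearCP. Qed.

Lemma cvg_dnearP (f : C -> C) z d :
  ((f : R[i]^o -> R[i]^o) @ (z : R[i]^o)^' --> (d : R[i]^o)) <->
  forall e : R, 0 < e -> dnearc z (fun w => normc (f w - d) < e).
Proof.
split.
- move=> /(@cvgrPdist_lt _ _ _ _ (dnbhs_filter _)) H e e0.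
  have /H : 0 < (e%:C : R[i]) by rewrite ltcR.
  by move/dnearCP; apply: nearc_imp => w h /h; rewrite normcE ltcR normcB.
- move=> H; apply: (proj2 (@cvgrPdist_lt _ _ _ _ (dnbhs_filter _) _ _)) => e e0.
  move: (e0); rewrite ltcE => /andP[/eqP ei er]; apply/dnearCP.
  apply: nearc_imp (H _ er) => w h /h; rewrite normcE ltcE /= => h'.
  by rewrite ei eqxx /= normcB.
Qed.

Lemma cderiv_cvg f z d : cderiv f z d <->
  ((fun h : C => h^-1 * (f (h + z) - f z)) : R[i]^o -> R[i]^o) @ (0 : R[i]^o)^' --> (d : R[i]^o).
Proof.
split.
- move=> F; apply/cvg_dnearP => e /F [D D0 H].
  exists D => // w; rewrite subr0 => wD w0.
  have := H (w + z); rewrite addrK slopezz => /(_ wD).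
  rewrite /slope -subr_eq0 addrK (negbTE w0) /=.
  by rewrite mulrC.
- move=> /cvg_dnearP F e e0; have [D D0 H] := F e e0; rewrite slopezz.
  exists D => // w wD; rewrite /slope; case: eqVneq => [_|wz].
    by rewrite subrr normc0.
  have := H (w - z); rewrite subr0 subr_eq0 => /(_ wD wz).
  by rewrite subrK mulrC.
Qed.

Lemma cderivE f z d : cderiv f z d <->
  derivable (f : R[i]^o -> R[i]^o) (z : R[i]^o) (1 : R[i]^o) /\
  derive1 (f : R[i]^o -> R[i]^o) (z : R[i]^o) = d.
Proof.
have E : (fun h : R[i]^o => h^-1 *: (((f : R[i]^o -> R[i]^o) \o shift (z : R[i]^o)) (h *: (1 : R[i]^o)) - f z))
   = (fun h : C => h^-1 * (f (h + z) - f z)).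
  by apply: funext => h; rewrite /= -[_ *: (1 : R[i]^o)]/(_ * 1) mulr1.
split.
- move=> /cderiv_cvg H; split; first by rewrite /derivable E; apply/cvg_ex; exists d.
  by rewrite /derive1; apply: cvg_lim.
- move=> []; rewrite /derivable E /derive1 => /cvg_ex[l L] dE; apply/cderiv_cvg.
  suff -> : d = l by [].
  by rewrite -dE; apply: cvg_lim L.
Qed.

End Basics.

(** * Integrals over rectangles and the theorem of Goursat *)

Section Integrals.
Variable R : realType.
Local Notation C := R[i].
Local Notation mu := (@lebesgue_measure R).
Implicit Types (h : R -> C) (a b c d t : R).

Lemma eq_ReIm (z w : C) : Re z = Re w -> Im z = Im w -> z = w.
Proof. by case: z w => [? ?] [? ?] /= -> ->. Qed.

Definition contR h t : Prop :=
  forall e : R, 0 < e -> exists2 D : R, 0 < D &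
    forall s, `|s - t| < D -> normc (h s - h t) < e.

Lemma contR_comp (f : C -> C) (p : R -> C) t :
  (forall s, normc (p s - p t) = `|s - t|) -> cont_at f (p t) -> contR (f \o p) t.
Proof.
move=> pE F e /F [D D0 H]; exists D => // s sD.
by apply: H; rewrite pE.
Qed.

Lemma contRZ k h t : contR h t -> contR (fun s => k * h s) t.
Proof.
move=> H e e0; have k0 := normc_ge0 k.
have k1 : 0 < normc k + 1 by lra.
have [D D0 {}H] := H _ (divr_gt0 e0 k1).
exists D => // s /H; rewrite -mulrBr normcM => hs.
apply: le_lt_trans (_ : (normc k + 1) * normc (h s - h t) < _).
  by rewrite ler_wpM2r ?normc_ge0//; lra.
by rewrite mulrC -ltr_pdivlMr.
Qed.

Lemma contR_Re h t : contR h t -> {for t, continuous (fun s => Re (h s))}.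
Proof.
move=> H; apply/cvgrPdist_lt => e e0; have [D D0 {}H] := H e e0.
apply/nbhs_ballP; exists D => //= s; rewrite /ball /= distrC => /H hs.
rewrite distrC -raddfB; exact: le_lt_trans (normc_Re _) hs.
Qed.

Lemma contR_Im h t : contR h t -> {for t, continuous (fun s => Im (h s))}.
Proof.
move=> H; apply/cvgrPdist_lt => e e0; have [D D0 {}H] := H e e0.
apply/nbhs_ballP; exists D => //= s; rewrite /ball /= distrC => /H hs.
rewrite distrC -raddfB; exact: le_lt_trans (normc_Im _) hs.
Qed.

Lemma cont_integrable (g : R -> R) a b : (forall t, a <= t <= b -> {for t, continuous g}) ->
  mu.-integrable `[a, b]%classic (EFin \o g).
Proof.
move=> H; apply: continuous_compact_integrable; first exact: segment_compact.
by apply: continuous_in_subspaceT => t; rewrite inE /= in_itv /=; apply: H.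
Qed.

Definition cint h a b : C :=
  (\int[mu]_(t in `[a, b]) Re (h t)) +i* (\int[mu]_(t in `[a, b]) Im (h t)).

Definition contI h a b := forall t, a <= t <= b -> contR h t.

Lemma contI_Re h a b : contI h a b -> mu.-integrable `[a, b]%classic (EFin \o (fun t => Re (h t))).
Proof. by move=> H; apply: cont_integrable => t /H; exact: contR_Re. Qed.

Lemma contI_Im h a b : contI h a b -> mu.-integrable `[a, b]%classic (EFin \o (fun t => Im (h t))).
Proof. by move=> H; apply: cont_integrable => t /H; exact: contR_Im. Qed.

Lemma eq_cint h k a b : (forall t, a <= t <= b -> h t = k t) -> cint h a b = cint k a b.
Proof.
move=> E; rewrite /cint; congr (_ +i* _); apply: eq_Rintegral => t;
  by rewrite inE /= in_itv /= => /E ->.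
Qed.

Lemma cintD h k a b : contI h a b -> contI k a b ->
  cint (fun t => h t + k t) a b = cint h a b + cint k a b.
Proof.
move=> H K; rewrite /cint.
have -> : (fun t => Re (h t + k t)) = (fun t => Re (h t) + Re (k t)).
  by apply: funext => t; case: (h t) => ? ?; case: (k t).
have -> : (fun t => Im (h t + k t)) = (fun t => Im (h t) + Im (k t)).
  by apply: funext => t; case: (h t) => ? ?; case: (k t).
by rewrite !RintegralD //; [exact: contI_Im|exact: contI_Im|exact: contI_Re|exact: contI_Re].
Qed.

Lemma cintZ (u : C) h a b : contI h a b -> cint (fun t => u * h t) a b = u * cint h a b.
Proof.
move=> H; rewrite /cint.
have iR := contI_Re H; have iI := contI_Im H.
have iZ (g : R -> R) v : mu.-integrable `[a, b]%classic (EFin \o g) ->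
   mu.-integrable `[a, b]%classic (EFin \o (fun t => v * g t)).
  by move=> ig; have := @integrableZl _ _ R mu _ (measurable_itv `[a, b]) v _ ig.
have -> : (fun t => Re (u * h t)) = (fun t => Re u * Re (h t) - Im u * Im (h t)).
  by apply: funext => t; case: (h t) => ? ?; case: (u).
have -> : (fun t => Im (u * h t)) = (fun t => Re u * Im (h t) + Im u * Re (h t)).
  by apply: funext => t; case: (h t) => ? ?; case: (u).
rewrite RintegralB ?RintegralD ?RintegralZl //; try exact: iZ.
by case: u.
Qed.

Lemma cintN h a b : contI h a b -> cint (fun t => - h t) a b = - cint h a b.
Proof.
move=> H; rewrite -mulN1r -cintZ //.
by apply: eq_cint => t _; rewrite mulN1r.
Qed.

Lemma Rint_cst (u : R) a b : a <= b -> \int[mu]_(t in `[a, b]) u = u * (b - a).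
Proof.
move=> ab; rewrite Rintegral_cst //; congr (_ * _).
suff H : mu `[a, b]%classic = (b - a)%:E by exact: (congr1 fine H).
rewrite lebesgue_measure_itv /= lte_fin.
case: ltP => [_|ba]; first by rewrite -EFinB.
by have -> : a = b; [apply/le_anti; rewrite ab ba|rewrite subrr].
Qed.

Lemma cint_cst (u : C) a b : a <= b -> cint (fun=> u) a b = u * (b - a)%:C.
Proof.
move=> ab; rewrite /cint !Rint_cst //; case: u => x y.
by apply: eq_ReIm => /=; ring.
Qed.

Lemma Rintegral_split (g : R -> R) a m b : a <= m <= b ->
  mu.-integrable `[a, b]%classic (EFin \o g) ->
  \int[mu]_(t in `[a, b]) g t = \int[mu]_(t in `[a, m]) g t + \int[mu]_(t in `[m, b]) g t.
Proof.
move=> /andP[am mb] ig.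
have := Rintegral_itvB ig (x := m); rewrite !bnd_simp => /(_ am mb).
rewrite Rintegral_itv_obnd_cbnd.
  by move=> <-; rewrite addrC subrK.
by apply: integrableS ig => //; apply: subset_itvr; rewrite bnd_simp.
Qed.

Lemma cint_split h a m b : a <= m <= b -> contI h a b ->
  cint h a b = cint h a m + cint h m b.
Proof.
by move=> amb H; rewrite /cint (Rintegral_split amb (contI_Re H)) (Rintegral_split amb (contI_Im H)).
Qed.

(** The factor 2 comes from bounding the real and imaginary parts separately; constants are of no
    importance in the estimates below. *)
Lemma cint_bound h a b (M : R) : a <= b -> contI h a b ->
  (forall t, a <= t <= b -> normc (h t) <= M) -> normc (cint h a b) <= 2 * M * (b - a).
Proof.
move=> ab H hM.
have aux (g : R -> R) : mu.-integrable `[a, b]%classic (EFin \o g) ->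
    (forall t, a <= t <= b -> `|g t| <= M) -> `| \int[mu]_(t in `[a, b]) g t | <= M * (b - a).
  move=> ig gM; apply: (le_trans (@le_normr_Rintegral _ _ R mu _ g (measurable_itv `[a, b]) ig)).
  rewrite -Rint_cst //.
  apply: le_Rintegral => //.
  - exact: integrable_norm ig.
  - by apply: cont_integrable => t _; exact: cvg_cst.
apply: le_trans (normc_ReIm _) _.
have -> : 2 * M * (b - a) = M * (b - a) + M * (b - a) by ring.
apply: lerD; apply: aux; [exact: contI_Re| |exact: contI_Im|] => t /hM; apply: le_trans.
  exact: normc_Re.
exact: normc_Im.
Qed.

End Integrals.

(** * Subdivision of rectangles *)

Section Bisection.
Variable R : realType.
Implicit Types a b c d x y : R.

Lemma nested_intervals (u v : nat -> R) : (forall n, u n <= u n.+1) ->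
  (forall n, v n.+1 <= v n) -> (forall n, u n <= v n) ->
  exists x, forall n, u n <= x <= v n.
Proof.
move=> uS vS uv.
have um n k : u n <= u (n + k)%N.
  by elim: k => [|k IH]; rewrite ?addn0// addnS (le_trans IH).
have vm n k : v (n + k)%N <= v n.
  by elim: k => [|k IH]; rewrite ?addn0// addnS (le_trans _ IH).
have uvm n m : u n <= v m.
  by apply: le_trans (um n m) _; apply: le_trans (uv _) _; rewrite addnC vm.
exists (sup (range u)) => n; apply/andP; split.
  apply: ub_le_sup; last by exists n.
  by exists (v 0) => _ [k _ <-]; exact: uvm.
by apply: ge_sup; [exists (u 0), 0|move=> _ [k _ <-]; exact: uvm].
Qed.

Lemma halving_small (s e : R) : 0 < e -> exists n, s / 2 ^+ n < e.
Proof.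
move=> e0; exists (Num.bound (s / e)).
rewrite ltr_pdivrMr ?exprn_gt0// mulrC -ltr_pdivrMr//.
have [se|se] := ltP (s / e) 0; first by apply: lt_trans se _; rewrite exprn_gt0.
apply: lt_le_trans (archi_boundP se) _.
by rewrite -natrX ler_nat ltnW // ltn_expl.
Qed.

Variable P : R -> R -> R -> R -> Prop.

Lemma bisection a b c d : a <= b -> c <= d ->
  (forall a b c d, a <= b -> c <= d ->
     P a ((a + b) / 2) c ((c + d) / 2) -> P ((a + b) / 2) b c ((c + d) / 2) ->
     P a ((a + b) / 2) ((c + d) / 2) d -> P ((a + b) / 2) b ((c + d) / 2) d ->
     P a b c d) ->
  (forall x y, a <= x <= b -> c <= y <= d -> exists2 e, 0 < e &
     forall a' b' c' d', a <= a' -> a' <= x -> x <= b' -> b' <= b ->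
       c <= c' -> c' <= y -> y <= d' -> d' <= d ->
       b' - a' < e -> d' - c' < e -> P a' b' c' d') ->
  P a b c d.
Proof.
move=> ab cd quarter loc; apply: contrapT => nP.
pose T := ((R * R) * (R * R))%type.
pose bad (r : T) := [/\ r.1.1 <= r.1.2, r.2.1 <= r.2.2 & ~ P r.1.1 r.1.2 r.2.1 r.2.2].
pose half (r r' : T) := [/\ r.1.1 <= r'.1.1 /\ r'.1.2 <= r.1.2,
   r.2.1 <= r'.2.1 /\ r'.2.2 <= r.2.2, r'.1.2 - r'.1.1 = (r.1.2 - r.1.1) / 2 &
   r'.2.2 - r'.2.1 = (r.2.2 - r.2.1) / 2].
have step r : bad r -> exists r', bad r' /\ half r r'.
  case: r => [[a' b'] [c' d']] [/= ab' cd' nP'].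
  apply: contrapT => H.
  have K r' : half ((a', b'), (c', d')) r' -> r'.1.1 <= r'.1.2 -> r'.2.1 <= r'.2.2 ->
     P r'.1.1 r'.1.2 r'.2.1 r'.2.2.
    by move=> h h1 h2; apply: contrapT => h3; apply: H; exists r'.
  apply: nP'; apply: quarter => //.
  - by apply: (K ((a', (a' + b') / 2), (c', (c' + d') / 2))); rewrite /half /=; try split; try split; lra.
  - by apply: (K (((a' + b') / 2, b'), (c', (c' + d') / 2))); rewrite /half /=; try split; try split; lra.
  - by apply: (K ((a', (a' + b') / 2), ((c' + d') / 2, d'))); rewrite /half /=; try split; try split; lra.
  - by apply: (K (((a' + b') / 2, b'), ((c' + d') / 2, d'))); rewrite /half /=; try split; try split; lra.
pose next (r : T) : T := xget r [set r' | bad r' /\ half r r'].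
have nextP r : bad r -> bad (next r) /\ half r (next r).
  by move=> /step rr; exact: (@xgetPex _ r [set r' | bad r' /\ half r r'] rr).
pose s n := iter n next ((a, b), (c, d)).
have bs n : bad (s n) by elim: n => [|n IH]; [split|exact: (nextP _ IH).1].
have hs n : half (s n) (s n.+1) := (nextP _ (bs n)).2.
have [x xP] : exists x, forall n, (s n).1.1 <= x <= (s n).1.2.
  by apply: nested_intervals => n; [case: (hs n) => -[]|case: (hs n) => -[]|case: (bs n)].
have [y yP] : exists x, forall n, (s n).2.1 <= x <= (s n).2.2.
  by apply: nested_intervals => n; [case: (hs n) => _ []|case: (hs n) => _ []|case: (bs n)].
have w1 n : (s n).1.2 - (s n).1.1 = (b - a) / 2 ^+ n.
  elim: n => [|n IH]; first by rewrite expr0 divr1.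
  by case: (hs n) => _ _ -> _; rewrite IH exprSr invfM mulrA.
have w2 n : (s n).2.2 - (s n).2.1 = (d - c) / 2 ^+ n.
  elim: n => [|n IH]; first by rewrite expr0 divr1.
  by case: (hs n) => _ _ _ ->; rewrite IH exprSr invfM mulrA.
have s1 n : a <= (s n).1.1 /\ (s n).1.2 <= b.
  elim: n => [//|n [IH1 IH2]]; case: (hs n) => -[h1 h2] _ _ _; split; lra.
have s2 n : c <= (s n).2.1 /\ (s n).2.2 <= d.
  elim: n => [//|n [IH1 IH2]]; case: (hs n) => _ [h1 h2] _ _; split; lra.
have [e e0 K] := loc x y (xP 0) (yP 0).
have [n nP1] := halving_small ((b - a) + (d - c)) e0.
have pos1 : 0 <= (b - a) / 2 ^+ n by rewrite divr_ge0 ?exprn_ge0 ?subr_ge0.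
have pos2 : 0 <= (d - c) / 2 ^+ n by rewrite divr_ge0 ?exprn_ge0 ?subr_ge0.
rewrite mulrDl in nP1.
have [_ _] := bs n; apply.
have /andP[x1 x2] := xP n; have /andP[y1 y2] := yP n.
have [a1 a2] := s1 n; have [c1 c2] := s2 n.
by apply: K; rewrite ?w1 ?w2 //; lra.
Qed.

End Bisection.

(** * Contour integrals along rectangles *)

Section Goursat.
Variable R : realType.
Local Notation C := R[i].
Implicit Types (f g : C -> C) (a b c d x y : R) (z w : C).

Definition in_rect a b c d z := a <= Re z <= b /\ c <= Im z <= d.

(** The contour integral along the boundary, run through counterclockwise. *)
Definition rint f a b c d : C :=
  cint (fun x => f (x +i* c)) a b - cint (fun x => f (x +i* d)) a b
  + 'i%C * (cint (fun y => f (b +i* y)) c d - cint (fun y => f (a +i* y)) c d).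

Definition cont_rect f a b c d := forall z, in_rect a b c d z -> cont_at f z.

Lemma hcontI f a b c d y : cont_rect f a b c d -> c <= y <= d ->
  contI (fun x => f (x +i* y)) a b.
Proof.
move=> F yP t tP; apply: (@contR_comp _ f (fun x => x +i* y)).
  move=> s; have -> : s +i* y - t +i* y = (s - t)%:C by apply: eq_ReIm => /=; ring.
  exact: normcR.
by apply: F; split.
Qed.

Lemma vcontI f a b c d x : cont_rect f a b c d -> a <= x <= b ->
  contI (fun y => f (x +i* y)) c d.
Proof.
move=> F xP t tP; apply: (@contR_comp _ f (fun y => x +i* y)).
  move=> s; have -> : x +i* s - x +i* t = (s - t)%:C * 'i%C by apply: eq_ReIm => /=; ring.
  rewrite normcM normcR; suff -> : normc ('i%C : C) = 1 by rewrite mulr1.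
  by rewrite /normc /= expr0n expr1n add0r sqrtr1.
by apply: F; split.
Qed.

Lemma cont_rectS f a b c d a' b' c' d' : cont_rect f a b c d ->
  a <= a' -> b' <= b -> c <= c' -> d' <= d -> cont_rect f a' b' c' d'.
Proof. by move=> F h1 h2 h3 h4 z [/andP[? ?] /andP[? ?]]; apply: F; split; lra. Qed.

Definition bdry a b c d z :=
  in_rect a b c d z /\ [|| Re z == a, Re z == b, Im z == c | Im z == d].

Definition cont_bdry f a b c d := forall z, bdry a b c d z -> cont_at f z.

Lemma cont_rect_bdry f a b c d : cont_rect f a b c d -> cont_bdry f a b c d.
Proof. by move=> F z [/F]. Qed.

Lemma side_cont f a b c d : a <= b -> c <= d -> cont_bdry f a b c d ->
  [/\ contI (fun x => f (x +i* c)) a b, contI (fun x => f (x +i* d)) a b,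
   contI (fun y => f (b +i* y)) c d & contI (fun y => f (a +i* y)) c d].
Proof.
move=> ab cd F; split=> t tP.
(* The lemma for full rectangles is applied to the rectangle reduced to one boundary point. *)
- apply: (@hcontI f t t c c c) => [z [/= z1 z2]||]; rewrite ?lexx //.
  have e1 : Re z = t by apply/eqP; rewrite eq_le andbC.
  have e2 : Im z = c by apply/eqP; rewrite eq_le andbC.
  by apply: F; split; rewrite ?e2 ?eqxx ?orbT //; split; rewrite ?e1 ?e2 // lexx.
- apply: (@hcontI f t t d d d) => [z [/= z1 z2]||]; rewrite ?lexx //.
  have e1 : Re z = t by apply/eqP; rewrite eq_le andbC.
  have e2 : Im z = d by apply/eqP; rewrite eq_le andbC.
  by apply: F; split; rewrite ?e2 ?eqxx ?orbT //; split; rewrite ?e1 ?e2 // lexx ?andbT.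
- apply: (@vcontI f b b t t b) => [z [/= z1 z2]||]; rewrite ?lexx //.
  have e1 : Re z = b by apply/eqP; rewrite eq_le andbC.
  have e2 : Im z = t by apply/eqP; rewrite eq_le andbC.
  by apply: F; split; rewrite ?e1 ?eqxx ?orbT //; split; rewrite ?e1 ?e2 // lexx ?andbT.
- apply: (@vcontI f a a t t a) => [z [/= z1 z2]||]; rewrite ?lexx //.
  have e1 : Re z = a by apply/eqP; rewrite eq_le andbC.
  have e2 : Im z = t by apply/eqP; rewrite eq_le andbC.
  by apply: F; split; rewrite ?e1 ?eqxx ?orbT //; split; rewrite ?e1 ?e2 // lexx ?andbT.
Qed.

Lemma eq_rint f g a b c d : a <= b -> c <= d ->
  (forall z, bdry a b c d z -> f z = g z) -> rint f a b c d = rint g a b c d.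
Proof.
move=> ab cd E; rewrite /rint.
rewrite (@eq_cint _ (fun x => f (x +i* c)) (fun x => g (x +i* c)) a b); last first.
  by move=> t tP; apply: E; rewrite /bdry /in_rect /= ?eqxx ?orbT ?lexx.
rewrite (@eq_cint _ (fun x => f (x +i* d)) (fun x => g (x +i* d)) a b); last first.
  by move=> t tP; apply: E; rewrite /bdry /in_rect /= ?eqxx ?orbT ?lexx ?andbT.
rewrite (@eq_cint _ (fun y => f (b +i* y)) (fun y => g (b +i* y)) c d); last first.
  by move=> t tP; apply: E; rewrite /bdry /in_rect /= ?eqxx ?orbT ?lexx ?andbT.
rewrite (@eq_cint _ (fun y => f (a +i* y)) (fun y => g (a +i* y)) c d) //.
by move=> t tP; apply: E; rewrite /bdry /in_rect /= ?eqxx ?orbT ?lexx ?andbT.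
Qed.

Lemma rintD f g a b c d : a <= b -> c <= d -> cont_bdry f a b c d -> cont_bdry g a b c d ->
  rint (fun z => f z + g z) a b c d = rint f a b c d + rint g a b c d.
Proof.
move=> ab cd /(side_cont ab cd)[f1 f2 f3 f4] /(side_cont ab cd)[g1 g2 g3 g4].
rewrite /rint !cintD //; ring.
Qed.

Lemma rintZ (u : C) f a b c d : a <= b -> c <= d -> cont_bdry f a b c d ->
  rint (fun z => u * f z) a b c d = u * rint f a b c d.
Proof.
move=> ab cd /(side_cont ab cd)[f1 f2 f3 f4].
rewrite /rint !cintZ //; ring.
Qed.

Lemma rint_bound f a b c d (M : R) : a <= b -> c <= d -> cont_bdry f a b c d ->
  (forall z, bdry a b c d z -> normc (f z) <= M) ->
  normc (rint f a b c d) <= 4 * M * ((b - a) + (d - c)).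
Proof.
move=> ab cd /(side_cont ab cd)[f1 f2 f3 f4] B; rewrite /rint.
have h1 : normc (cint (fun x => f (x +i* c)) a b) <= 2 * M * (b - a).
  by apply: cint_bound => // t tP; apply: B; rewrite /bdry /in_rect /= ?eqxx ?orbT ?lexx.
have h2 : normc (cint (fun x => f (x +i* d)) a b) <= 2 * M * (b - a).
  by apply: cint_bound => // t tP; apply: B; rewrite /bdry /in_rect /= ?eqxx ?orbT ?lexx ?andbT.
have h3 : normc (cint (fun y => f (b +i* y)) c d) <= 2 * M * (d - c).
  by apply: cint_bound => // t tP; apply: B; rewrite /bdry /in_rect /= ?eqxx ?orbT ?lexx ?andbT.
have h4 : normc (cint (fun y => f (a +i* y)) c d) <= 2 * M * (d - c).
  by apply: cint_bound => // t tP; apply: B; rewrite /bdry /in_rect /= ?eqxx ?orbT ?lexx ?andbT.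
apply: le_trans (le_normcD _ _) _; rewrite normcM.
have -> : normc ('i%C : C) = 1 by rewrite /normc /= expr0n expr1n add0r sqrtr1.
rewrite mul1r.
have := le_normcD (cint (fun x => f (x +i* c)) a b) (- cint (fun x => f (x +i* d)) a b).
have := le_normcD (cint (fun y => f (b +i* y)) c d) (- cint (fun y => f (a +i* y)) c d).
rewrite !normcN; lra.
Qed.

Lemma rint_splith f a m b c d : a <= m <= b -> c <= d -> cont_rect f a b c d ->
  rint f a b c d = rint f a m c d + rint f m b c d.
Proof.
move=> /andP[am mb] cd F; rewrite /rint.
have hc : c <= c <= d by lra. have hd : c <= d <= d by lra.
have amb : a <= m <= b by lra.
rewrite (cint_split amb (hcontI F hc)) (cint_split amb (hcontI F hd)); ring.
Qed.

Lemma rint_splitv f a b c m d : a <= b -> c <= m <= d -> cont_rect f a b c d ->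
  rint f a b c d = rint f a b c m + rint f a b m d.
Proof.
move=> ab /andP[cm md] F; rewrite /rint.
have ha : a <= a <= b by lra. have hb : a <= b <= b by lra.
have cmd : c <= m <= d by lra.
rewrite (cint_split cmd (vcontI F ha)) (cint_split cmd (vcontI F hb)); ring.
Qed.

Lemma cont_affine (p q z0 : C) z : cont_at (fun w => p + (w - z0) * q) z.
Proof.
apply: contD; first exact: cont_cst.
by apply: contM; [apply: contB; [exact: cont_id|exact: cont_cst]|exact: cont_cst].
Qed.

Lemma cintB (h k : R -> C) a b : contI h a b -> contI k a b ->
  cint h a b - cint k a b = cint (fun t => h t - k t) a b.
Proof.
move=> H K; rewrite -(cintN K) -cintD //.
by move=> t tP; have := contRZ (-1) (K t tP); under eq_fun do rewrite mulN1r.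
Qed.

Lemma rint_affine (p q z0 : C) a b c d : a <= b -> c <= d ->
  rint (fun w => p + (w - z0) * q) a b c d = 0.
Proof.
move=> ab cd; rewrite /rint.
have F : cont_rect (fun w => p + (w - z0) * q) a b c d by move=> z _; exact: cont_affine.
have ha : a <= a <= b by lra. have hb : a <= b <= b by lra.
have hc : c <= c <= d by lra. have hd : c <= d <= d by lra.
rewrite (cintB (hcontI F hc) (hcontI F hd)) (cintB (vcontI F hb) (vcontI F ha)).
rewrite (@eq_cint _ _ (fun=> q * ('i%C * (c - d)%:C)) a b); last first.
  move=> t _; have -> : t +i* d = t +i* c - 'i%C * (c - d)%:C :> C by apply: eq_ReIm => /=; ring.
  ring.
rewrite (@eq_cint _ _ (fun=> q * (b - a)%:C) c d); last first.
  move=> t _; have -> : b +i* t = a +i* t + (b - a)%:C :> C by apply: eq_ReIm => /=; ring.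
  ring.
rewrite !cint_cst //.
have -> : (c - d)%:C = - (d - c)%:C :> C by apply: eq_ReIm => /=; ring.
ring.
Qed.

Definition hol f z := exists p : C, cderiv f z p.

Lemma hol_cont f z : hol f z -> cont_at f z.
Proof. by move=> [d /cderiv_cont]. Qed.

Lemma rint_quarter f a m b c n d : a <= m -> m <= b -> c <= n -> n <= d ->
  cont_rect f a b c d ->
  normc (rint f a b c d) <= normc (rint f a m c n) + normc (rint f a m n d) +
    (normc (rint f m b c n) + normc (rint f m b n d)).
Proof.
move=> am mb cn nd F.
have amb : a <= m <= b by rewrite am mb.
have cnd : c <= n <= d by rewrite cn nd.
rewrite (rint_splith amb (le_trans cn nd) F).
rewrite (@rint_splitv f a m c n d) //; last exact: (cont_rectS F).
rewrite (@rint_splitv f m b c n d) //; last exact: (cont_rectS F).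
apply: le_trans (le_normcD _ _) _; apply: lerD; exact: le_normcD.
Qed.

Lemma half_between (a b : R) : a <= b -> a <= (a + b) / 2 /\ (a + b) / 2 <= b.
Proof. by move=> ab; split; lra. Qed.

Lemma goursat f a b c d : a <= b -> c <= d ->
  (forall z, in_rect a b c d z -> hol f z) -> rint f a b c d = 0.
Proof.
move=> ab cd H.
have F : cont_rect f a b c d by move=> z /H; exact: hol_cont.
(* The right-hand side is additive under quartering, so the bound passes from the quarters to the
   whole rectangle; on small rectangles it holds because the affine part of [f] integrates to 0. *)
suff K e : 0 < e -> normc (rint f a b c d) <= e * ((b - a) ^+ 2 + (d - c) ^+ 2).
  apply: eq0_normc; apply/eqP; rewrite eq_le normc_ge0 andbT leNgt; apply/negP => r0.
  have s0 : 0 < (b - a) ^+ 2 + (d - c) ^+ 2 + 1 by rewrite ltr_wpDl // addr_ge0 // sqr_ge0.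
  have := K _ (divr_gt0 r0 s0).
  rewrite mulrAC ler_pdivlMr // ler_pM2l //; lra.
move=> e0.
pose P a' b' c' d' := [/\ a <= a', b' <= b, c <= c' & d' <= d] ->
  normc (rint f a' b' c' d') <= e * ((b' - a') ^+ 2 + (d' - c') ^+ 2).
suff : P a b c d by apply; split.
apply: bisection => //; rewrite /P.
- move=> a' b' c' d' ab' cd' q1 q2 q3 q4 [h1 h2 h3 h4].
  have F' := cont_rectS F h1 h2 h3 h4.
  have [m1 m2] := half_between ab'; have [n1 n2] := half_between cd'.
  apply: le_trans (rint_quarter m1 m2 n1 n2 F') _.
  have -> : e * ((b' - a') ^+ 2 + (d' - c') ^+ 2) =
    e * (((a' + b') / 2 - a') ^+ 2 + ((c' + d') / 2 - c') ^+ 2) +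
    e * (((a' + b') / 2 - a') ^+ 2 + (d' - (c' + d') / 2) ^+ 2) +
    (e * ((b' - (a' + b') / 2) ^+ 2 + ((c' + d') / 2 - c') ^+ 2) +
     e * ((b' - (a' + b') / 2) ^+ 2 + (d' - (c' + d') / 2) ^+ 2)) by field.
  by apply: lerD; apply: lerD; [apply: q1|apply: q3|apply: q2|apply: q4]; split;
    rewrite // ?(le_trans h1 m1) ?(le_trans h3 n1) ?(le_trans m2 h2) ?(le_trans n2 h4).
- move=> x y xP yP.
  have [p fp] := H (x +i* y) (conj xP yP).
  (* With [s] half the perimeter, [rint_bound] gives [4 * (e / 8 * s) * s], and [s ^+ 2 / 2] is at
     most the sum of the squares of the two sides. *)
  have e8 : 0 < e / 8 by rewrite divr_gt0.
  have [D D0 B] := cderiv_bound e8 fp.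
  exists (D / 2); first by rewrite divr_gt0.
  move=> a' b' c' d' h1 h2 h3 h4 h5 h6 h7 h8 w1 w2 _.
  pose A w := f (x +i* y) + (w - (x +i* y)) * p.
  have F' : cont_rect f a' b' c' d' by exact: (cont_rectS F).
  have FA : cont_rect A a' b' c' d' by move=> z _; exact: cont_affine.
  have FB : cont_rect (fun w => f w - A w) a' b' c' d'.
    by move=> z zP; apply: contB; [exact: F'|exact: FA].
  have Ef : f = (fun w => (f w - A w) + A w) by apply: funext => w; rewrite subrK.
  rewrite {1}Ef.
  have ab' : a' <= b' := le_trans h2 h3.
  have cd' : c' <= d' := le_trans h6 h7.
  rewrite rintD ?rint_affine ?addr0 //; try exact: cont_rect_bdry.
  apply: le_trans (_ : 4 * (e / 8 * ((b' - a') + (d' - c'))) * ((b' - a') + (d' - c')) <= _).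
    apply: (rint_bound ab' cd' (cont_rect_bdry FB)) => z [[/andP[z1 z2] /andP[z3 z4]] _].
    have zl : normc (z - (x +i* y)) <= (b' - a') + (d' - c').
      apply: le_trans (normc_ReIm _) _; clear - z1 z2 z3 z4 h2 h3 h6 h7.
      case: z z1 z2 z3 z4 => u v /= u1 u2 u3 u4.
      by apply: lerD; rewrite ler_norml; apply/andP; split; lra.
    apply: le_trans (B z _) _.
      by apply: le_lt_trans zl _; clear - w1 w2; lra.
    by rewrite ler_pM2l.
  have -> : 4 * (e / 8 * (b' - a' + (d' - c'))) * (b' - a' + (d' - c')) =
    e * ((b' - a' + (d' - c')) ^+ 2 / 2) by field.
  rewrite ler_pM2l //.
  have := sqr_ge0 ((b' - a') - (d' - c')).
  by move: (b' - a') (d' - c') => u v; rewrite !expr2; clear; lra.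
Qed.

End Goursat.

(** * The maximum principle *)

Section MaxPrinciple.
Variable R : realType.
Local Notation C := R[i].
Implicit Types (f g : C -> C) (a b c d x y r : R) (z w : C).

Definition inner a b c d z := a < Re z < b /\ c < Im z < d.

Lemma inner_rect a b c d z : inner a b c d z -> in_rect a b c d z.
Proof. by move=> [/andP[? ?] /andP[? ?]]; split; apply/andP; split; exact: ltW. Qed.

Lemma inner_bdry a b c d z w : inner a b c d z -> bdry a b c d w -> w != z.
Proof.
move=> [/andP[h1 h2] /andP[h3 h4]] [_ B]; apply/eqP => E; move: B; rewrite E.
by rewrite (gt_eqF h1) (lt_eqF h2) (gt_eqF h3) (lt_eqF h4).
Qed.

Lemma inner_lt a b c d z : inner a b c d z -> a < b /\ c < d.
Proof. by move=> [/andP[h1 h2] /andP[h3 h4]]; split; [exact: lt_trans h1 h2|exact: lt_trans h3 h4]. Qed.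

Lemma bounded_rect f a b c d : a <= b -> c <= d -> cont_rect f a b c d ->
  exists M : R, forall z, in_rect a b c d z -> normc (f z) <= M.
Proof.
move=> ab cd F.
pose P a' b' c' d' := [/\ a <= a', b' <= b, c <= c' & d' <= d] ->
  exists M : R, forall z, in_rect a' b' c' d' z -> normc (f z) <= M.
suff : P a b c d by apply; split.
apply: bisection => //; rewrite /P.
- move=> a' b' c' d' ab' cd' q1 q2 q3 q4 [h1 h2 h3 h4].
  have [m1 m2] := half_between ab'; have [n1 n2] := half_between cd'.
  have [M1 {}q1] : exists M : R, forall z, in_rect a' ((a' + b') / 2) c' ((c' + d') / 2) z -> normc (f z) <= M.
    by apply: q1; split => //; [exact: le_trans m2 h2|exact: le_trans n2 h4].
  have [M2 {}q2] : exists M : R, forall z, in_rect ((a' + b') / 2) b' c' ((c' + d') / 2) z -> normc (f z) <= M.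
    by apply: q2; split => //; [exact: le_trans h1 m1|exact: le_trans n2 h4].
  have [M3 {}q3] : exists M : R, forall z, in_rect a' ((a' + b') / 2) ((c' + d') / 2) d' z -> normc (f z) <= M.
    by apply: q3; split => //; [exact: le_trans m2 h2|exact: le_trans h3 n1].
  have [M4 {}q4] : exists M : R, forall z, in_rect ((a' + b') / 2) b' ((c' + d') / 2) d' z -> normc (f z) <= M.
    by apply: q4; split => //; [exact: le_trans h1 m1|exact: le_trans h3 n1].
  exists (Num.max (Num.max M1 M2) (Num.max M3 M4)) => z [/andP[z1 z2] /andP[z3 z4]].
  rewrite !le_max.
  case: (leP (Re z) ((a' + b') / 2)) => u; case: (leP (Im z) ((c' + d') / 2)) => v.
  + by rewrite q1 //; split; apply/andP.
  + by rewrite q3 ?orbT //; split; apply/andP; split => //; exact: ltW.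
  + by rewrite q2 ?orbT //; split; apply/andP; split => //; exact: ltW.
  + by rewrite q4 ?orbT //; split; apply/andP; split => //; exact: ltW.
- move=> x y xP yP.
  have [D D0 H] := F (x +i* y) (conj xP yP) 1 ltr01.
  exists (D / 2); first by rewrite divr_gt0.
  move=> a' b' c' d' h1 h2 h3 h4 h5 h6 h7 h8 w1 w2 _.
  exists (normc (f (x +i* y)) + 1) => z [/andP[z1 z2] /andP[z3 z4]].
  have zD : normc (z - (x +i* y)) < D.
    apply: le_lt_trans (normc_ReIm _) _; clear - z1 z2 z3 z4 h2 h3 h6 h7 w1 w2 D0.
    case: z z1 z2 z3 z4 => u v /= u1 u2 u3 u4; rewrite (splitr D).
    by apply: ltrD; rewrite ltr_norml; apply/andP; split; lra.
  rewrite -[f z](subrK (f (x +i* y))) addrC; apply: le_trans (le_normcD _ _) _.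
  by rewrite lerD2l ltW // H.
Qed.

(** Four rectangles avoiding [w] surround a square of half side [s] centred at [w], so the integral
    is that over the square; it is at most [16 * M * s] because [f] is bounded near [w]. *)
Lemma goursat1 f a b c d w : inner a b c d w -> cont_rect f a b c d ->
  (forall z, in_rect a b c d z -> z != w -> hol f z) -> rint f a b c d = 0.
Proof.
move=> wi F H; have [/andP[w1 w2] /andP[w3 w4]] := wi.
have [D D0 B] : nearc w (fun z => normc (f z) < normc (f w) + 1).
  by apply: cont_bound; [apply: F; exact: inner_rect|rewrite ltrDl].
pose M := normc (f w) + 1.
have M0 : 0 < M by rewrite /M ltr_wpDl ?normc_ge0.
have small s : 0 < s -> s < Re w - a -> s < b - Re w -> s < Im w - c -> s < d - Im w ->
    s + s < D -> normc (rint f a b c d) <= 16 * M * s.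
  move=> s0 s1 s2 s3 s4 s5.
  pose a' := Re w - s; pose b' := Re w + s; pose c' := Im w - s; pose d' := Im w + s.
  have ea : a <= a' by rewrite /a'; lra. have eb : b' <= b by rewrite /b'; lra.
  have ec : c <= c' by rewrite /c'; lra. have ed : d' <= d by rewrite /d'; lra.
  have ab' : a' <= b' by rewrite /a' /b'; lra. have cd' : c' <= d' by rewrite /c' /d'; lra.
  have cd : c <= d by lra. have a'b : a' <= b by lra.
  have c'd : c' <= d by lra.
  have zr u1 u2 v1 v2 : u1 <= u2 -> v1 <= v2 -> a <= u1 -> u2 <= b -> c <= v1 -> v2 <= d ->
     (forall z, in_rect u1 u2 v1 v2 z -> z != w) -> rint f u1 u2 v1 v2 = 0.
    move=> k1 k2 k3 k4 k5 k6 k7; apply: goursat => // z zr; apply: H; last exact: k7 zr.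
    by move: zr => [/andP[? ?] /andP[? ?]]; split; lra.
  have F1 : cont_rect f a' b c d by exact: (cont_rectS F).
  have F2 : cont_rect f a' b' c d by exact: (cont_rectS F).
  have F3 : cont_rect f a' b' c' d by exact: (cont_rectS F).
  have F4 : cont_rect f a' b' c' d' by exact: (cont_rectS F).
  rewrite (@rint_splith _ f a a' b c d) ?ea //.
  rewrite (zr a a' c d) ?add0r //; last first.
    by move=> z [/andP[_ z2] _]; apply/eqP => E; move: z2; rewrite E /a'; lra.
  rewrite (@rint_splith _ f a' b' b c d) ?ab' //.
  rewrite (zr b' b c d) ?addr0 //; [|lra|]; last first.
    by move=> z [/andP[z1 _] _]; apply/eqP => E; move: z1; rewrite E /b'; lra.
  rewrite (@rint_splitv _ f a' b' c c' d) ?ec //.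
  rewrite (zr a' b' c c') ?add0r //; last first.
    by move=> z [_ /andP[_ z2]]; apply/eqP => E; move: z2; rewrite E /c'; lra.
  rewrite (@rint_splitv _ f a' b' c' d' d) ?cd' //.
  rewrite (zr a' b' d' d) ?addr0 //; [|lra|]; last first.
    by move=> z [_ /andP[z1 _]]; apply/eqP => E; move: z1; rewrite E /d'; lra.
  have -> : 16 * M * s = 4 * M * ((b' - a') + (d' - c')) by rewrite /a' /b' /c' /d'; ring.
  apply: (rint_bound ab' cd' (cont_rect_bdry F4)) => z [[/andP[z1 z2] /andP[z3 z4]] _].
  apply: ltW; apply: B; apply: le_lt_trans (normc_ReIm _) _; apply: le_lt_trans s5.
  move: z1 z2 z3 z4; rewrite /a' /b' /c' /d'; clear.
  case: z => u v; case: w => u' v' /= ? ? ? ?.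
  by apply: lerD; rewrite ler_norml; apply/andP; split; lra.
apply: eq0_normc; apply/eqP; rewrite eq_le normc_ge0 andbT leNgt; apply/negP => r0.
pose m := Num.min (Num.min (Num.min (Re w - a) (b - Re w)) (Num.min (Im w - c) (d - Im w)))
    (Num.min (D / 2) (normc (rint f a b c d) / (16 * M))).
have m0 : 0 < m.
  by rewrite /m !lt_min !subr_gt0 w1 w2 w3 w4 !divr_gt0 // mulr_gt0.
have hm : m / 2 < m by lra.
have := small (m / 2) (divr_gt0 m0 (ltr0Sn _ _)).
move: (hm); rewrite {2}/m !lt_min => /andP[/andP[/andP[-> ->] /andP[-> ->]] /andP[k1 k2]].
move=> /(_ isT isT isT isT)/(_ _)/wrap[]; first by move: k1; rewrite ltr_pdivlMr //; lra.
move: k2; rewrite ltr_pdivlMr ?mulr_gt0 // mulrC; lra.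
Qed.

Lemma pos_Rintegral (h : R -> R) a b (e : R) : a < b -> 0 < e ->
  (forall t, a <= t <= b -> {for t, continuous h}) ->
  (forall t, a <= t <= b -> e <= h t) ->
  0 < \int[@lebesgue_measure R]_(t in `[a, b]) h t.
Proof.
move=> ab e0 hc he.
have : \int[@lebesgue_measure R]_(t in `[a, b]) e <= \int[@lebesgue_measure R]_(t in `[a, b]) h t.
  apply: le_Rintegral => //.
  - by apply: cont_integrable => t _; exact: cvg_cst.
  - exact: cont_integrable.
by rewrite Rint_cst ?(ltW ab) //; apply: lt_le_trans; rewrite mulr_gt0 // subr_gt0.
Qed.

Lemma neg_Rintegral (h : R -> R) a b (e : R) : a < b -> 0 < e ->
  (forall t, a <= t <= b -> {for t, continuous h}) ->
  (forall t, a <= t <= b -> e <= - h t) ->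
  \int[@lebesgue_measure R]_(t in `[a, b]) h t < 0.
Proof.
move=> ab e0 hc he.
have : \int[@lebesgue_measure R]_(t in `[a, b]) h t <= \int[@lebesgue_measure R]_(t in `[a, b]) (- e).
  apply: le_Rintegral => //.
  - exact: cont_integrable.
  - by apply: cont_integrable => t _; exact: cvg_cst.
  - by move=> t; rewrite /= in_itv /= => /he; rewrite lerNr.
rewrite Rint_cst ?(ltW ab) // => /le_lt_trans; apply.
by rewrite mulNr oppr_lt0 mulr_gt0 // subr_gt0.
Qed.

Lemma Im_cint (h : R -> C) a b : Im (cint h a b) = \int[@lebesgue_measure R]_(t in `[a, b]) Im (h t).
Proof. by []. Qed.

Lemma Re_cint (h : R -> C) a b : Re (cint h a b) = \int[@lebesgue_measure R]_(t in `[a, b]) Re (h t).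
Proof. by []. Qed.

Lemma Re_inv z : Re z^-1 = Re z / (Re z ^+ 2 + Im z ^+ 2).
Proof. by case: z. Qed.

Lemma Im_inv z : Im z^-1 = - Im z / (Re z ^+ 2 + Im z ^+ 2).
Proof. by case: z => u v; rewrite mulNr. Qed.

Lemma cont_inv_bdry a b c d z : inner a b c d z ->
  cont_bdry (fun w => (w - z)^-1) a b c d.
Proof.
move=> zi w wb; apply: contV; first by rewrite subr_eq0 (inner_bdry zi wb).
by apply: contB; [exact: cont_id|exact: cont_cst].
Qed.

(** The value of this integral is never computed: each of the four sides contributes a positive
    amount to its imaginary part. *)
Lemma winding_neq0 a b c d z : inner a b c d z ->
  rint (fun w => (w - z)^-1) a b c d != 0.
Proof.
move=> zi; have [ab cd] := inner_lt zi; have [/andP[z1 z2] /andP[z3 z4]] := zi.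
have [f1 f2 f3 f4] := side_cont (ltW ab) (ltW cd) (cont_inv_bdry zi).
have D0 t u : t != Re z \/ u != Im z -> 0 < (t - Re z) ^+ 2 + (u - Im z) ^+ 2.
  case=> H; [rewrite ltr_pwDl ?sqr_ge0 // | rewrite ltr_wpDl ?sqr_ge0 //];
  by rewrite exprn_even_gt0 //= subr_eq0.
pose L := (b - a) ^+ 2 + (d - c) ^+ 2.
have L0 : 0 < L by rewrite ltr_pwDl ?sqr_ge0 // exprn_gt0 // subr_gt0.
have DL t u : a <= t <= b -> c <= u <= d -> (t - Re z) ^+ 2 + (u - Im z) ^+ 2 <= L.
  have sq (p q : R) : - q <= p -> p <= q -> p ^+ 2 <= q ^+ 2.
    by move=> h1 h2; rewrite -subr_ge0 subr_sqr mulr_ge0 //; lra.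
  by move=> /andP[t1 t2] /andP[u1 u2]; apply: lerD; apply: sq; lra.
have lb k t u : 0 < k -> a <= t <= b -> c <= u <= d -> t != Re z \/ u != Im z ->
    k / L <= k / ((t - Re z) ^+ 2 + (u - Im z) ^+ 2).
  move=> k0 tP uP tu; rewrite ler_pM2l // lef_pV2 ?posrE ?D0 //; exact: DL.
have ha : a <= a <= b by rewrite lexx ltW. have hb : a <= b <= b by rewrite lexx ltW.
have hc : c <= c <= d by rewrite lexx ltW. have hd : c <= d <= d by rewrite lexx ltW.
have ImJ : 0 < Im (rint (fun w => (w - z)^-1) a b c d); last first.
  by apply/eqP => E; move: ImJ; rewrite E ltxx.
have ImE (p q r s : C) : Im (p - q + 'i%C * (r - s)) = Im p - Im q + (Re r - Re s).
  by case: p q r s => [? ?] [? ?] [? ?] [? ?] /=; ring.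
rewrite /rint ImE !Im_cint !Re_cint.
have S1 : 0 < \int[@lebesgue_measure R]_(t in `[a, b]) Im ((t +i* c - z)^-1).
  apply: (@pos_Rintegral _ a b ((Im z - c) / L)) => //; first by rewrite divr_gt0 // subr_gt0.
    by move=> t tP; apply: contR_Im; exact: f1.
  move=> t tP; rewrite Im_inv.
  have -> : - Im (t +i* c - z) = Im z - c by case: (z) => ? ? /=; ring.
  have -> : Re (t +i* c - z) = t - Re z by case: (z).
  have -> : Im (t +i* c - z) = c - Im z by case: (z).
  by apply: lb => //; [rewrite subr_gt0|right; rewrite (lt_eqF z3)].
have S2 : 0 < - \int[@lebesgue_measure R]_(t in `[a, b]) Im ((t +i* d - z)^-1).
  rewrite oppr_gt0.
  apply: (@neg_Rintegral _ a b ((d - Im z) / L)) => //; first by rewrite divr_gt0 // subr_gt0.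
    by move=> t tP; apply: contR_Im; exact: f2.
  move=> t tP; rewrite Im_inv mulNr opprK.
  have -> : Im (t +i* d - z) = d - Im z by case: (z).
  have -> : Re (t +i* d - z) = t - Re z by case: (z).
  by apply: lb => //; [rewrite subr_gt0|right; rewrite (gt_eqF z4)].
have S3 : 0 < \int[@lebesgue_measure R]_(t in `[c, d]) Re ((b +i* t - z)^-1).
  apply: (@pos_Rintegral _ c d ((b - Re z) / L)) => //; first by rewrite divr_gt0 // subr_gt0.
    by move=> t tP; apply: contR_Re; exact: f3.
  move=> t tP; rewrite Re_inv.
  have -> : Re (b +i* t - z) = b - Re z by case: (z).
  have -> : Im (b +i* t - z) = t - Im z by case: (z).
  by apply: lb => //; [rewrite subr_gt0|left; rewrite (gt_eqF z2)].
have S4 : 0 < - \int[@lebesgue_measure R]_(t in `[c, d]) Re ((a +i* t - z)^-1).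
  rewrite oppr_gt0.
  apply: (@neg_Rintegral _ c d ((Re z - a) / L)) => //; first by rewrite divr_gt0 // subr_gt0.
    by move=> t tP; apply: contR_Re; exact: f4.
  move=> t tP; rewrite Re_inv -mulNr.
  have -> : - Re (a +i* t - z) = Re z - a by case: (z) => ? ? /=; ring.
  have -> : Re (a +i* t - z) = a - Re z by case: (z).
  have -> : Im (a +i* t - z) = t - Im z by case: (z).
  by apply: lb => //; [rewrite subr_gt0|left; rewrite (lt_eqF z1)].
by rewrite -addrA addr_gt0 // addr_gt0 // addr_gt0.
Qed.

(** The slope of [f] at [z] has integral 0, so [f z] times the winding integral is the integral of
    [f w / (w - z)]. What matters is that [K] is chosen before [f]: it can then be applied to all
    powers of a function. *)
Lemma cauchy_estimate a b c d z : inner a b c d z ->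
  exists2 K : R, 0 < K & forall f (m : R),
    (forall w, in_rect a b c d w -> hol f w) ->
    (forall w, bdry a b c d w -> normc (f w) <= m) -> normc (f z) <= K * m.
Proof.
move=> zi; have [ab cd] := inner_lt zi; have [/andP[z1 z2] /andP[z3 z4]] := zi.
pose J := rint (fun w => (w - z)^-1) a b c d.
have J0 : 0 < normc J by apply: normc_gt0; exact: winding_neq0.
pose s := Num.min (Num.min (Re z - a) (b - Re z)) (Num.min (Im z - c) (d - Im z)).
have s0 : 0 < s by rewrite /s !lt_min !subr_gt0 z1 z2 z3 z4.
have bs w : bdry a b c d w -> s <= normc (w - z).
  have rw := normc_Re (w - z); have iw := normc_Im (w - z).
  have E1 : Re (w - z) = Re w - Re z by case: (w) (z) => ? ? [? ?].
  have E2 : Im (w - z) = Im w - Im z by case: (w) (z) => ? ? [? ?].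
  move=> [_ /or4P[] /eqP E].
  - by apply: le_trans rw; rewrite E1 E distrC gtr0_norm ?subr_gt0 // /s !ge_min lexx.
  - by apply: le_trans rw; rewrite E1 E gtr0_norm ?subr_gt0 // /s !ge_min lexx orbT.
  - by apply: le_trans iw; rewrite E2 E distrC gtr0_norm ?subr_gt0 // /s !ge_min lexx ?orbT.
  - by apply: le_trans iw; rewrite E2 E gtr0_norm ?subr_gt0 // /s !ge_min lexx ?orbT.
exists (4 * ((b - a) + (d - c)) / (s * normc J)).
  by rewrite divr_gt0 ?mulr_gt0 // addr_gt0 ?subr_gt0.
move=> f m H B.
have [p fp] := H _ (inner_rect zi).
have Gc : cont_rect (slope f p z) a b c d.
  move=> w wr; case: (eqVneq w z) => [->|wz]; first exact: fp.
  apply: (@cont_near _ (fun v => (f v - f z) / (v - z))).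
    exists (normc (w - z)); first by apply: normc_gt0; rewrite subr_eq0.
    move=> v vw; rewrite /slope; case: eqVneq => // E.
    by move: vw; rewrite E normcB ltxx.
  apply: contM; first by apply: contB; [apply: hol_cont; exact: H|exact: cont_cst].
  apply: contV; first by rewrite subr_eq0.
  by apply: contB; [exact: cont_id|exact: cont_cst].
have G0 : rint (slope f p z) a b c d = 0.
  apply: (goursat1 zi) => // w wr wz; have [q fq] := H w wr.
  have vz : w - z != 0 by rewrite subr_eq0.
  exists (q * (w - z)^-1 + (f w - f z) * (- 1 / (w - z) ^+ 2)).
  apply: (@cderiv_near _ (fun v => (f v - f z) * (v - z)^-1)).
    exists (normc (w - z)); first by apply: normc_gt0.
    move=> v vw; rewrite /slope; case: eqVneq => // E.
    by move: vw; rewrite E normcB ltxx.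
  apply: cderivM.
    by rewrite -[q]subr0; apply: cderivB => //; exact: cderiv_cst.
  apply: cderivV => //; rewrite -[1]subr0; apply: cderivB; [exact: cderiv_id|exact: cderiv_cst].
have ci := cont_inv_bdry zi.
have cf : cont_bdry (fun w => f w / (w - z)) a b c d.
  by move=> w wb; apply: contM; [apply: hol_cont; apply: H; case: wb|exact: ci].
have cz : cont_bdry (fun w => - f z * (w - z)^-1) a b c d.
  by move=> w wb; apply: contM; [exact: cont_cst|exact: ci].
have E : rint (slope f p z) a b c d = rint (fun w => f w / (w - z) + - f z * (w - z)^-1) a b c d.
  apply: eq_rint => [||w wb]; [exact: ltW|exact: ltW|].
  by rewrite /slope (negbTE (inner_bdry zi wb)); ring.
move: E; rewrite G0 (rintD (ltW ab) (ltW cd) cf cz) (rintZ _ (ltW ab) (ltW cd) ci) -/J.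
rewrite mulNr => /esym/eqP; rewrite subr_eq0 => /eqP E.
have := @rint_bound _ _ a b c d (m / s) (ltW ab) (ltW cd) cf.
rewrite E normcM => /(_ _)/wrap[].
  move=> w wb; rewrite normcM normcV; apply: ler_pM; rewrite ?normc_ge0 ?invr_ge0 ?normc_ge0 //.
    exact: B.
  by rewrite lef_pV2 ?posrE //; [exact: bs|exact: lt_le_trans (bs w wb)].
rewrite -ler_pdivlMr // => /le_trans; apply.
rewrite le_eqVlt; apply/orP; left; apply/eqP.
by field; rewrite (gt_eqF s0) (gt_eqF J0).
Qed.

Lemma hol_near f g z : nearc z (fun w => f w = g w) -> hol f z -> hol g z.
Proof. by move=> E [p fp]; exists p; exact: cderiv_near E fp. Qed.

Lemma holD f g z : hol f z -> hol g z -> hol (fun w => f w + g w) z.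
Proof. by move=> [p fp] [q gq]; exists (p + q); exact: cderivD. Qed.

Lemma holN f z : hol f z -> hol (fun w => - f w) z.
Proof. by move=> [p fp]; exists (- p); exact: cderivN. Qed.

Lemma holB f g z : hol f z -> hol g z -> hol (fun w => f w - g w) z.
Proof. by move=> [p fp] [q gq]; exists (p - q); exact: cderivB. Qed.

Lemma holM f g z : hol f z -> hol g z -> hol (fun w => f w * g w) z.
Proof. by move=> [p fp] [q gq]; eexists; apply: cderivM; eassumption. Qed.

Lemma holV f z : f z != 0 -> hol f z -> hol (fun w => (f w)^-1) z.
Proof. by move=> f0 [p fp]; eexists; apply: cderivV; eassumption. Qed.

Lemma holX f n z : hol f z -> hol (fun w => f w ^+ n) z.
Proof. by move=> [p fp]; eexists; apply: cderivX; eassumption. Qed.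

Lemma hol_comp f g z : hol f z -> hol g (f z) -> hol (fun w => g (f w)) z.
Proof. by move=> [p fp] [q gq]; exists (q * p); exact: cderiv_comp. Qed.

Lemma hol_cst (k : C) z : hol (fun=> k) z.
Proof. by exists 0; exact: cderiv_cst. Qed.

Lemma hol_id z : hol id z.
Proof. by exists 1; exact: cderiv_id. Qed.

Lemma hol_subc (k : C) z : hol (fun w => w - k) z.
Proof. exact: (holB (hol_id z) (hol_cst k z)). Qed.

Lemma hol_slope f p z w : w != z -> hol f w -> hol (slope f p z) w.
Proof.
move=> wz fw; apply: (@hol_near (fun v => (f v - f z) / (v - z))).
  exists (normc (w - z)); first by apply: normc_gt0; rewrite subr_eq0.
  move=> v vw; rewrite /slope; case: eqVneq => // E.
  by move: vw; rewrite E normcB ltxx.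
apply: (@holM (fun v => f v - f z) (fun v => (v - z)^-1)).
  exact: (holB fw (hol_cst (f z) w)).
by apply: (@holV (fun v => v - z)); [rewrite subr_eq0|exact: hol_subc].
Qed.

Lemma slope_cont_rect f p z a b c d : cderiv f z p ->
  (forall w, in_rect a b c d w -> w != z -> hol f w) ->
  cont_rect (slope f p z) a b c d.
Proof.
move=> fp H w wr; case: (eqVneq w z) => [->|wz]; first exact: fp.
by apply: hol_cont; apply: hol_slope => //; exact: H.
Qed.

(** For [m > 0] Bernoulli's inequality makes [(r / m) ^+ N] exceed [Q / P]; for [m = 0] the case
    [N = 1] is already contradictory. *)
Lemma pow_ratio (r m P Q : R) : 0 <= m -> m < r -> 0 < P ->
  ~ (forall N, r ^+ N * P <= Q * m ^+ N).
Proof.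
move=> m0 mr P0 H; have r0 : 0 < r by apply: le_lt_trans mr.
have [m1|m1] := ltP 0 m; last first.
  have mE : m = 0 by apply/le_anti; rewrite m1 m0.
  by have := H 1%N; rewrite mE expr0n mulr0 leNgt mulr_gt0 // exprn_gt0.
pose x := r / m - 1.
have x0 : 0 < x by rewrite subr_gt0 ltr_pdivlMr // mul1r.
have B N : 1 + N%:R * x <= (r / m) ^+ N.
  elim: N => [|N IH]; first by rewrite mul0r addr0 expr0.
  have e1 : r / m = 1 + x by rewrite /x; ring.
  rewrite exprS {1}e1 -natr1.
  apply: le_trans (_ : (1 + x) * (1 + N%:R * x) <= _); last by rewrite ler_pM2l // addr_gt0.
  have : 0 <= x * (N%:R * x) by rewrite mulr_ge0 ?(ltW x0) // mulr_ge0 // ltW.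
  have -> : (1 + x) * (1 + N%:R * x) = 1 + (N%:R + 1) * x + x * (N%:R * x) by ring.
  by rewrite lerDl.
have K N : 1 + N%:R * x <= Q / P.
  apply: le_trans (B N) _.
  by rewrite ler_pdivlMr // expr_div_n mulrAC ler_pdivrMr ?exprn_gt0.
pose N := Num.bound (Q / (P * x)).
have Q0 : 0 <= Q by have := H 0%N; rewrite !expr0 mul1r mulr1; apply: le_trans; exact: ltW.
have := archi_boundP (divr_ge0 Q0 (ltW (mulr_gt0 P0 x0))); rewrite -/N.
rewrite ltr_pdivrMr ?mulr_gt0 // => N1.
have := K N; rewrite ler_pdivlMr // => N2.
have : N%:R * (P * x) = N%:R * x * P by ring.
move: N1 N2; rewrite mulrDl mul1r; lra.
Qed.

Definition away (s : seq C) w : C := \prod_(v <- s) (w - v).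

Lemma hol_away s w : hol (away s) w.
Proof.
elim: s => [|v s IH].
  have -> : away [::] = fun=> 1 by apply: funext => z; rewrite /away big_nil.
  exact: hol_cst.
have -> : away (v :: s) = fun z => (z - v) * away s z.
  by apply: funext => z; rewrite /away big_cons.
by apply: holM => //; exact: hol_subc.
Qed.

Lemma away_neq0 s w : w \notin s -> away s w != 0.
Proof.
elim: s => [|v s IH]; first by rewrite /away big_nil oner_eq0.
rewrite inE negb_or => /andP[wv ws]; rewrite /away big_cons mulf_neq0 ?subr_eq0 //.
exact: IH.
Qed.

Lemma away_factor s w : w \in s -> exists t, forall z, away s z = (z - w) * away t z.
Proof.
elim: s => // v s IH; rewrite inE; case: eqVneq => [->|wv] /=.
  by move=> _; exists s => z; rewrite /away big_cons.
move=> /IH[t tE]; exists (v :: t) => z; rewrite /away !big_cons -/(away s z) -/(away t z) tE; ring.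
Qed.

Lemma hol_mul_root f z : cont_at f z -> hol (fun w => (w - z) * f w) z.
Proof.
move=> F; exists (f z); apply: (cderiv_slope F) => //.
by apply: nearcT => w; rewrite subrr mul0r add0r.
Qed.

Lemma near_notin (s : seq C) z : dnearc z (fun w => w \notin s).
Proof.
elim: s => [|v s IH]; first by exists 1.
case: (eqVneq v z) => [->|vz].
  by apply: nearc_imp IH => w h wz; rewrite inE negb_or wz h.
have := nearc_and IH (cont_neq0 (contB (cont_id z) (cont_cst v z)) _).
rewrite subr_eq0 eq_sym vz => /(_ isT); apply: nearc_imp => w [h1 h2] wz.
by rewrite inE negb_or h1 // andbT -subr_eq0.
Qed.

Lemma dnearc_ex z (P : C -> Prop) : dnearc z P -> exists2 w, w != z & P w.
Proof.
move=> [D D0 H]; pose w : C := z + (D / 2)%:C.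
have wz : w - z = (D / 2)%:C by rewrite /w addrC addKr.
have D2 : 0 < D / 2 by apply: divr_gt0.
have w0 : w != z.
  by rewrite -subr_eq0 wz; apply/eqP => -[] /eqP; rewrite gt_eqF.
exists w => //; apply: H => //; rewrite wz normcR gtr0_norm // ltr_pdivrMr //; lra.
Qed.

Lemma inner_near a b c d z : inner a b c d z -> nearc z (inner a b c d).
Proof.
move=> [/andP[h1 h2] /andP[h3 h4]].
exists (Num.min (Num.min (Re z - a) (b - Re z)) (Num.min (Im z - c) (d - Im z))).
  by rewrite !lt_min !subr_gt0 h1 h2 h3 h4.
move=> w; rewrite !lt_min => /andP[/andP[k1 k2] /andP[k3 k4]].
have := normc_Re (w - z); have := normc_Im (w - z).
have -> : Re (w - z) = Re w - Re z by case: (w) (z) => ? ? [? ?].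
have -> : Im (w - z) = Im w - Im z by case: (w) (z) => ? ? [? ?].
rewrite !ler_norml => /andP[i1 i2] /andP[r1 r2].
by split; apply/andP; split; lra.
Qed.

(** Powers of [f] are multiplied by a polynomial killing the exceptional points;
    the constant of [cauchy_estimate] disappears when taking roots. *)
Lemma max_principle f (s : seq C) a b c d (m : R) z : inner a b c d z ->
  cont_rect f a b c d ->
  (forall w, in_rect a b c d w -> w \notin s -> hol f w) ->
  (forall w, bdry a b c d w -> normc (f w) <= m) -> normc (f z) <= m.
Proof.
move=> zi F H B; have [/ltW ab /ltW cd] := inner_lt zi.
have m0 : 0 <= m.
  apply: le_trans (normc_ge0 (f (a +i* c))) (B _ _).
  by split; rewrite /in_rect /= ?lexx ?eqxx.
have [M M0] : exists M : R, forall w, in_rect a b c d w -> normc (away s w) <= M.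
  by apply: bounded_rect => // w _; apply: hol_cont; exact: hol_away.
have main w : inner a b c d w -> w \notin s -> normc (f w) <= m.
  move=> wi ws; rewrite leNgt; apply/negP => mf.
  have [K K0 E] := cauchy_estimate wi.
  apply: (pow_ratio m0 mf (normc_gt0 (away_neq0 ws)) (Q := K * M)) => N.
  rewrite -normcX -normcM -mulrA [M * _]mulrC.
  apply: (E (fun v => f v ^+ N * away s v)).
    move=> v vr; case: (boolP (v \in s)) => [vs|vs]; last first.
      by apply: holM; [apply: holX; exact: H|exact: hol_away].
    have [t tE] := away_factor vs.
    have -> : (fun u => f u ^+ N * away s u) = (fun u => (u - v) * (f u ^+ N * away t u)).
      by apply: funext => u; rewrite tE; ring.
    apply: hol_mul_root; apply: contM; first by apply: contX; exact: F.
    by apply: hol_cont; exact: hol_away.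
  move=> v vb; rewrite normcM normcX; apply: ler_pM; rewrite ?normc_ge0 ?exprn_ge0 ?normc_ge0 //.
    by apply: lerXn2r; rewrite ?nnegrE ?normc_ge0 //; exact: B.
  by apply: M0; case: vb.
case: (boolP (z \in s)) => [zs|]; last exact: main.
rewrite leNgt; apply/negP => mf.
have cz := F z (inner_rect zi).
have e0 : 0 < normc (f z) - m by rewrite subr_gt0.
have : dnearc z (fun w => [/\ w \notin s, inner a b c d w & normc (f w - f z) < normc (f z) - m]).
  apply: nearc_imp (nearc_and (near_notin s z) (nearc_and (inner_near zi) (cz _ e0))) => w.
  by move=> [h1 [h2 h3]] /h1.
move=> /dnearc_ex[w _ [w1 w2 w3]].
have := main w w2 w1; have := ler_normcB (f z) (f w); rewrite normcB; lra.
Qed.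

End MaxPrinciple.

(** * Local theory of holomorphic functions *)

Section Local.
Variable R : realType.
Local Notation C := R[i].
Implicit Types (f g h k : C -> C) (r : R) (z w u v : C).

Definition sq z r := in_rect (Re z - r) (Re z + r) (Im z - r) (Im z + r).
Definition sqi z r := inner (Re z - r) (Re z + r) (Im z - r) (Im z + r).
Definition sqb z r := bdry (Re z - r) (Re z + r) (Im z - r) (Im z + r).

Lemma ReB z w : Re (z - w) = Re z - Re w.
Proof. by case: z w => ? ? [? ?]. Qed.

Lemma ImB z w : Im (z - w) = Im z - Im w.
Proof. by case: z w => ? ? [? ?]. Qed.

Lemma sq_normc z r w : sq z r w -> normc (w - z) <= 2 * r.
Proof.
move=> [/andP[h1 h2] /andP[h3 h4]]; apply: le_trans (normc_ReIm _) _.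
rewrite ReB ImB (_ : 2 * r = r + r); last ring.
by apply: lerD; rewrite ler_norml; apply/andP; split; lra.
Qed.

Lemma normc_sq z r w : normc (w - z) <= r -> sq z r w.
Proof.
move=> h; have := le_trans (normc_Re _) h; have := le_trans (normc_Im _) h.
rewrite ReB ImB !ler_norml => /andP[? ?] /andP[? ?].
by split; apply/andP; split; lra.
Qed.

Lemma normc_sqi z r w : normc (w - z) < r -> sqi z r w.
Proof.
move=> h; have := le_lt_trans (normc_Re _) h; have := le_lt_trans (normc_Im _) h.
rewrite ReB ImB !ltr_norml => /andP[? ?] /andP[? ?].
by split; apply/andP; split; lra.
Qed.

Lemma sqb_normc z r w : sqb z r w -> r <= normc (w - z).
Proof.
move=> [_ B]; have := normc_Re (w - z); have := normc_Im (w - z); rewrite ReB ImB.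
move=> h1 h2; move: B => /or4P[] /eqP E; move: h1 h2; rewrite E !ler_norml;
  by move=> /andP[? ?] /andP[? ?]; lra.
Qed.

Lemma sqb_sq z r w : sqb z r w -> sq z r w.
Proof. by case. Qed.

Lemma nearc_sq z (P : C -> Prop) : nearc z P <->
  exists2 r, 0 < r & forall w, sq z r w -> P w.
Proof.
split=> [[D D0 H]|[r r0 H]]; last by exists r => // w /ltW /normc_sq /H.
by exists (D / 4); [rewrite divr_gt0|move=> w /sq_normc wD; apply: H; lra].
Qed.

Lemma sq_center z r : 0 < r -> sqi z r z.
Proof. by move=> r0; apply: normc_sqi; rewrite subrr normc0. Qed.

Lemma max_sq f (s : seq C) z r (m : R) w : sqi z r w ->
  (forall v, sq z r v -> cont_at f v) ->
  (forall v, sq z r v -> v \notin s -> hol f v) ->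
  (forall v, sqb z r v -> normc (f v) <= m) -> normc (f w) <= m.
Proof. exact: max_principle. Qed.

Lemma bounded_sq f z r : 0 < r -> (forall v, sq z r v -> cont_at f v) ->
  exists2 M : R, 0 < M & forall v, sq z r v -> normc (f v) <= M.
Proof.
move=> r0 F; have h1 : Re z - r <= Re z + r by lra.
have h2 : Im z - r <= Im z + r by lra.
have [M H] := bounded_rect h1 h2 F.
exists (`|M| + 1); first by rewrite ltr_wpDl.
by move=> v /H /le_trans; apply; rewrite (le_trans (ler_norm M)) // lerDl.
Qed.

(** The limit is the supremum of the numbers that bound [phi] from below near [z]. *)
Lemma real_lim (phi : C -> R) z :
  (forall e : R, 0 < e -> exists c : R, dnearc z (fun w => `|phi w - c| <= e)) ->
  exists l : R, forall e : R, 0 < e -> dnearc z (fun w => `|phi w - l| <= e).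
Proof.
move=> H; pose A := [set x : R | dnearc z (fun w => x <= phi w)].
have below c e : dnearc z (fun w => `|phi w - c| <= e) -> A (c - e).
  by apply: nearc_imp => w h /h; rewrite ler_norml => /andP[? ?]; lra.
have above c e x : dnearc z (fun w => `|phi w - c| <= e) -> A x -> x <= c + e.
  move=> K Ax; have : dnearc z (fun w => x <= c + e).
    apply: nearc_imp (nearc_and K Ax) => w [h1 h2] wz.
    by move: (h1 wz) (h2 wz); rewrite ler_norml => /andP[? ?] ?; lra.
  by move=> /dnearc_ex[].
have [c0 K0] := H 1 ltr01.
have A0 : has_sup A.
  by split; [exists (c0 - 1); exact: below|exists (c0 + 1) => x; exact: above].
exists (sup A) => e e0; have [c K] := H (e / 2) (divr_gt0 e0 (ltr0Sn _ _)).
have s1 : c - e / 2 <= sup A by apply: ub_le_sup; [case: A0|exact: below].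
have s2 : sup A <= c + e / 2 by apply: ge_sup; [case: A0|move=> x; exact: above].
apply: nearc_imp K => w h /h; rewrite !ler_norml => /andP[? ?].
by apply/andP; split; lra.
Qed.

Lemma complex_lim (phi : C -> C) z :
  (forall e : R, 0 < e -> exists c : C, dnearc z (fun w => normc (phi w - c) <= e)) ->
  exists l : C, forall e : R, 0 < e -> dnearc z (fun w => normc (phi w - l) < e).
Proof.
move=> H.
have [|a A] := @real_lim (fun w => Re (phi w)) z.
  move=> e e0; have [c K] := H e e0; exists (Re c).
  by apply: nearc_imp K => w h /h; rewrite -ReB; apply: le_trans; exact: normc_Re.
have [|b B] := @real_lim (fun w => Im (phi w)) z.
  move=> e e0; have [c K] := H e e0; exists (Im c).
  by apply: nearc_imp K => w h /h; rewrite -ImB; apply: le_trans; exact: normc_Im.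
exists (a +i* b) => e e0; have e4 : 0 < e / 4 by rewrite divr_gt0.
apply: nearc_imp (nearc_and (A _ e4) (B _ e4)) => w [h1 h2] wz.
apply: le_lt_trans (normc_ReIm _) _; rewrite ReB ImB /=.
have := h1 wz; have := h2 wz; lra.
Qed.

Lemma slope_lim_hol f z l :
  (forall e : R, 0 < e -> dnearc z (fun w => normc ((f w - f z) / (w - z) - l) < e)) ->
  cderiv f z l.
Proof.
move=> H e e0; apply: nearc_imp (H e e0) => w h; rewrite slopezz /slope.
by case: eqVneq => [_|/h //]; rewrite subrr normc0.
Qed.

Lemma slopeN f p z w : w != z -> slope f p z w = (f w - f z) / (w - z).
Proof. by rewrite /slope => /negbTE ->. Qed.

Lemma normc_div (p q : C) : normc (p / q) = normc p / normc q.
Proof. by rewrite normcM normcV. Qed.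

(** Three-point divided differences are bounded by the maximum principle, so the
    difference quotients at [z] form a Cauchy filter. *)
Lemma removable f z : cont_at f z -> dnearc z (hol f) -> hol f z.
Proof.
move=> cf hf.
have : nearc z (fun w => w != z -> hol f w) by [].
move=> /nearc_sq[r r0 H].
have F w : sq z r w -> cont_at f w.
  by move=> wr; case: (eqVneq w z) => [->//|wz]; apply: hol_cont; exact: H.
have [B B0 Bf] := bounded_sq r0 F.
have r2 : 0 < r / 2 by rewrite divr_gt0.
pose near_z u := normc (u - z) < r / 2.
have near_sqi u : near_z u -> sqi z r u by move=> h; apply: normc_sqi; rewrite /near_z in h; lra.
have bd u w : near_z u -> sqb z r w -> r / 2 <= normc (w - u).
  move=> uz /sqb_normc wz; rewrite /near_z in uz.
  have := le_normcD (w - u) (u - z); rewrite addrA subrK; lra.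
have bd_neq u w : near_z u -> sqb z r w -> w != u.
  move=> uz wb; apply/eqP => E; have := bd _ _ uz wb; rewrite E subrr normc0; lra.
pose psi u w := slope f (xget 0 [set p | cderiv f u p]) u w.
have fu u : near_z u -> u != z -> cderiv f u (xget 0 [set p | cderiv f u p]).
  by move=> uz u0; have := @xgetPex _ 0 _ (H _ (inner_rect (near_sqi _ uz)) u0).
have psic u : near_z u -> u != z -> forall w, sq z r w -> cont_at (psi u) w.
  move=> uz u0 w wr; case: (eqVneq w u) => [->|wu]; first exact: fu.
  apply: (@cont_near _ (fun v => (f v - f u) / (v - u))).
    exists (normc (w - u)); first by apply: normc_gt0; rewrite subr_eq0.
    move=> v vw; rewrite /psi /slope; case: eqVneq => // E.
    by move: vw; rewrite E normcB ltxx.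
  apply: contM; first by apply: contB; [exact: F|exact: cont_cst].
  apply: contV; first by rewrite subr_eq0.
  by apply: contB; [exact: cont_id|exact: cont_cst].
have psih u : near_z u -> u != z -> forall w, sq z r w -> w \notin [:: u; z] -> hol (psi u) w.
  move=> uz u0 w wr; rewrite !inE negb_or => /andP[wu wz].
  by apply: hol_slope => //; exact: H.
pose L := 4 * B / r.
have L0 : 0 < L by rewrite divr_gt0 ?mulr_gt0.
have psib u w : near_z u -> u != z -> sqb z r w -> normc (psi u w) <= L.
  move=> uz u0 wb; rewrite /psi slopeN ?(bd_neq u) // normc_div ler_pdivrMr; last first.
    by apply: lt_le_trans (bd _ _ uz wb).
  apply: le_trans (_ : L * (r / 2) <= _); last by rewrite ler_pM2l // bd.
  rewrite /L (_ : 4 * B / r * (r / 2) = B + B); last by field; rewrite gt_eqF.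
  apply: le_trans (le_normcD _ _) _; rewrite normcN; apply: lerD; apply: Bf.
    exact: sqb_sq.
  exact/inner_rect/near_sqi.
have lip u v : near_z u -> u != z -> near_z v -> normc (f v - f u) <= L * normc (v - u).
  move=> uz u0 vz; rewrite (slopeE f (xget 0 [set p | cderiv f u p]) u v).
  rewrite addrC addKr normcM mulrC ler_wpM2r ?normc_ge0 //.
  exact: (@max_sq (psi u) [:: u; z] z r L v (near_sqi _ vz) (psic _ uz u0) (psih _ uz u0) (fun w => psib u w uz u0)).
pose L2 := (4 * (2 * B + L * (3 * r))) / r ^+ 2.
have L20 : 0 < L2.
  apply: divr_gt0; last exact: exprn_gt0.
  by apply: mulr_gt0 => //; apply: addr_gt0; apply: mulr_gt0 => //; exact: mulr_gt0.
have key u v : near_z u -> u != z -> near_z v -> v != z ->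
    normc (psi u z - psi v z) <= L2 * normc (u - v).
  move=> uz u0 vz v0.
  apply: (@max_sq (fun w => psi u w - psi v w) [:: u; v; z] z r _ z (sq_center z r0)).
  - by move=> w wr; apply: contB; [exact: psic|exact: psic].
  - move=> w wr; rewrite !inE !negb_or => /and3P[wu wv wz].
    by apply: holB; apply: psih; rewrite // !inE negb_or ?wu ?wv.
  - move=> w wb; have wu := bd_neq _ _ uz wb; have wv := bd_neq _ _ vz wb.
    rewrite /psi !slopeN //.
    have -> : (f w - f u) / (w - u) - (f w - f v) / (w - v) =
       ((f w - f v) * (u - v) + (f v - f u) * (w - v)) / ((w - u) * (w - v)).
      by field; rewrite !subr_eq0 wu wv.
    have n1 := bd _ _ uz wb; have n2 := bd _ _ vz wb.
    have p1 : 0 < normc (w - u) by apply: lt_le_trans n1.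
    have p2 : 0 < normc (w - v) by apply: lt_le_trans n2.
    have n3 : normc (w - v) <= 3 * r.
      have -> : w - v = (w - z) + (z - v) by ring.
      apply: le_trans (le_normcD _ _) _; have := sq_normc (sqb_sq wb).
      by move: vz; rewrite /near_z normcB; lra.
    have fv := Bf _ (inner_rect (near_sqi _ vz)); have fw := Bf _ (sqb_sq wb).
    have n4 : normc (f w - f v) <= 2 * B.
      by apply: le_trans (le_normcD _ _) _; rewrite normcN; lra.
    have n5 := lip u v uz u0 vz; rewrite normcB in n5.
    have nn := normc_ge0 (u - v).
    rewrite normc_div normcM ler_pdivrMr ?mulr_gt0 //.
    apply: le_trans (_ : L2 * normc (u - v) * (r / 2 * (r / 2)) <= _); last first.
      apply: ler_wpM2l; first by rewrite mulr_ge0 // ltW.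
      by apply: ler_pM => //; exact: ltW.
    have -> : L2 * normc (u - v) * (r / 2 * (r / 2)) = 2 * B * normc (u - v) + L * normc (u - v) * (3 * r).
      by rewrite /L2; field; rewrite gt_eqF.
    apply: le_trans (le_normcD _ _) _; rewrite !normcM; apply: lerD.
      exact: ler_wpM2r.
    apply: ler_pM; rewrite ?normc_ge0 //.
    by rewrite normcB (normcB u v).
clearbody L2.
have [e e0|l Hl] := @complex_lim (fun u => psi u z) z.
  have [u0 [uz u0z]] : exists u, u != z /\ (near_z u /\ L2 * normc (u - z) <= e / 2).
    have : dnearc z (fun u => near_z u /\ L2 * normc (u - z) <= e / 2).
      exists (Num.min (r / 2) (e / (2 * L2))); first by rewrite lt_min r2 divr_gt0 // mulr_gt0.
      move=> u; rewrite lt_min => /andP[h1 h2] _; split => //.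
      by move: h2; rewrite ltr_pdivlMr ?mulr_gt0 //; lra.
    by move=> /dnearc_ex[u uz h]; exists u.
  move: u0z => [near_u0 u0e]; exists (psi u0 z).
  exists (Num.min (r / 2) (e / (2 * L2))); first by rewrite lt_min r2 divr_gt0 // mulr_gt0.
  move=> u; rewrite lt_min => /andP[h1 h2] u1.
  apply: le_trans (key u u0 h1 u1 near_u0 uz) _.
  have h3 : normc (u - u0) <= normc (u - z) + normc (u0 - z).
    have -> : u - u0 = (u - z) - (u0 - z) by ring.
    by apply: le_trans (le_normcD _ _) _; rewrite normcN.
  apply: le_trans (_ : L2 * (normc (u - z) + normc (u0 - z)) <= _); first by rewrite ler_pM2l.
  by move: h2; rewrite ltr_pdivlMr ?mulr_gt0 // mulrDr; lra.
exists l; apply: slope_lim_hol => e e0.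
have near_near : nearc z near_z by exists (r / 2).
apply: nearc_imp (nearc_and near_near (Hl e e0)) => u [un h] u0.
have := h u0; rewrite /psi slopeN 1?eq_sym //.
suff -> : (f z - f u) / (z - u) = (f u - f z) / (u - z) by [].
by rewrite -opprB -(opprB u z) invrN mulrNN.
Qed.

Definition dC f z : C := xget 0 [set p | cderiv f z p].

Lemma dCP f z : hol f z -> cderiv f z (dC f z).
Proof. by move=> [p fp]; exact: (@xgetPex _ 0 [set q | cderiv f z q] (ex_intro _ p fp)). Qed.

Lemma dC_eq f z p : cderiv f z p -> dC f z = p.
Proof. by move=> fp; apply: (@cderiv_unique _ f z) => //; apply: dCP; exists p. Qed.

(** The slope is holomorphic off [z] and continuous at [z], hence holomorphic by [removable]. *)
Lemma hol_factor f z : nearc z (hol f) -> exists G,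
  [/\ nearc z (hol G), G z = dC f z & forall w, f w = f z + (w - z) * G w].
Proof.
move=> hf; have fz := dCP (nearc_self hf).
exists (slope f (dC f z) z); split; [|exact: slopezz|exact: slopeE].
have d : dnearc z (hol (slope f (dC f z) z)).
  by apply: nearc_imp hf => w hw wz; exact: hol_slope.
apply: nearc_imp d => w hw; case: (eqVneq w z) => [->|/hw //].
apply: removable => //.
by apply: nearc_imp hf => v hv vz; exact: hol_slope.
Qed.

(** The derivative at [u] is the value at [u] of the slope based there, and the maximum principle
    bounds this value by difference quotients taken on the boundary of a fixed square. *)
Lemma dC_bounded f z : nearc z (hol f) ->
  exists2 L : R, 0 < L & nearc z (fun u => normc (dC f u) <= L).
Proof.
move=> /nearc_sq[r r0 H].
have F w : sq z r w -> cont_at f w by move=> /H /hol_cont.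
have [B B0 Bf] := bounded_sq r0 F.
exists (4 * B / r); first by rewrite divr_gt0 // mulr_gt0.
exists (r / 2); first by rewrite divr_gt0.
move=> u uz; have ui : sqi z r u by apply: normc_sqi; lra.
have fu := dCP (H _ (inner_rect ui)).
rewrite -(slopezz f (dC f u) u).
apply: (@max_sq _ [:: u] z r _ u ui).
- by apply: slope_cont_rect => // w wr _; exact: H.
- by move=> w wr; rewrite inE => wu; apply: hol_slope => //; exact: H.
- move=> w wb; have := sqb_normc wb => wz.
  have wu : r / 2 <= normc (w - u).
    by have := le_normcD (w - u) (u - z); rewrite addrA subrK; lra.
  have wu0 : w != u by apply/eqP => E; move: wu; rewrite E subrr normc0; lra.
  rewrite slopeN // normc_div ler_pdivrMr; last by apply: lt_le_trans wu; rewrite divr_gt0.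
  apply: le_trans (_ : 4 * B / r * (r / 2) <= _); last first.
    by rewrite ler_pM2l // divr_gt0 // mulr_gt0.
  rewrite (_ : 4 * B / r * (r / 2) = B + B); last by field; rewrite gt_eqF.
  apply: le_trans (le_normcD _ _) _; rewrite normcN; apply: lerD; apply: Bf.
    exact: sqb_sq.
  exact/inner_rect.
Qed.

Lemma dC_factor f z G : nearc z (hol G) -> (forall w, f w = f z + (w - z) * G w) ->
  nearc z (fun w => dC f w = G w + (w - z) * dC G w).
Proof.
move=> hG E; apply: nearc_imp hG => w /dCP gw.
have -> : f = fun w => f z + (w - z) * G w by apply: funext => u; exact: E.
have H := cderivD (cderiv_cst (f z) w) (cderivM (cderivB (cderiv_id w) (cderiv_cst z w)) gw).
by rewrite (dC_eq H); ring.
Qed.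

Lemma dC_cont f z : nearc z (hol f) -> cont_at (dC f) z.
Proof.
move=> hf; have [G [hG Gz E]] := hol_factor hf.
have [L L0 HL] := dC_bounded hG.
move=> e e0; have e2 : 0 < e / 2 by rewrite divr_gt0.
have small : nearc z (fun w => normc (w - z) * L < e / 2).
  by exists (e / 2 / L); [rewrite divr_gt0|move=> w; rewrite ltr_pdivlMr].
have Gc := hol_cont (nearc_self hG).
apply: nearc_imp (nearc_and (nearc_and HL (Gc _ e2)) (nearc_and small (dC_factor hG E))).
move=> w [[h1 h2] [h3 ->]].
have -> : dC f z = G z by rewrite Gz.
have -> : G w + (w - z) * dC G w - G z = (G w - G z) + (w - z) * dC G w by ring.
apply: le_lt_trans (le_normcD _ _) _; rewrite normcM.
have : normc (w - z) * normc (dC G w) <= normc (w - z) * L.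
  by apply: ler_wpM2l => //; exact: normc_ge0.
by move: h2 h3; lra.
Qed.

(** Differentiating the factorisation gives [G w + (w - z) * dC G w]; its second term is
    differentiable at [z] as soon as [dC G] is continuous there. *)
Lemma dC_hol1 f z : nearc z (hol f) -> hol (dC f) z.
Proof.
move=> hf; have [G [hG Gz E]] := hol_factor hf.
apply: (@hol_near _ (fun w => G w + (w - z) * dC G w)).
  by apply: nearc_imp (dC_factor hG E).
by apply: holD; [exact: nearc_self hG|apply: hol_mul_root; exact: dC_cont].
Qed.

Lemma dC_hol f z : nearc z (hol f) -> nearc z (hol (dC f)).
Proof. by move=> /nearc_nearc; apply: nearc_imp => w; exact: dC_hol1. Qed.

Lemma dC_near f g z : nearc z (fun w => f w = g w) -> nearc z (fun w => dC f w = dC g w).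
Proof.
move=> /nearc_nearc; apply: nearc_imp => w E.
have [[p fp]|nf] := pselect (hol f w).
  by rewrite (dC_eq fp) (dC_eq (cderiv_near E fp)).
have ng : ~ hol g w.
  by move=> gw; apply: nf; apply: hol_near gw; apply: nearc_imp E.
by rewrite /dC !xgetPN // => p hp; [apply: ng|apply: nf]; exists p.
Qed.

Definition has_order f z n := exists h,
  [/\ nearc z (hol h), h z != 0 & nearc z (fun w => f w = (w - z) ^+ n * h w)].

(** If division by [w - z] can be repeated for ever, the maximum principle bounds the [n]-th
    quotient by [B / r ^+ n]; at distance less than [r / 2] this gives [normc (f w) <= B / 2 ^+ n]
    for all [n]. *)
Lemma order_dichotomy f z : nearc z (hol f) ->
  nearc z (fun w => f w = 0) \/ exists n, has_order f z n.
Proof.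
move=> /nearc_sq[r r0 H].
have F w : sq z r w -> cont_at f w by move=> /H /hol_cont.
have [B B0 Bf] := bounded_sq r0 F.
have [//|no] := pselect (exists n, has_order f z n); first by right.
left; have all n : exists2 h, (forall w, sq z r w -> hol h w) &
    forall w, f w = (w - z) ^+ n * h w.
  elim: n => [|n [h hh E]]; first by exists f => // w; rewrite expr0 mul1r.
  have hz : h z = 0.
    apply/eqP/negPn/negP => h0; apply: no; exists n, h; split => //.
      by apply/nearc_sq; exists r.
    exact: nearcT.
  have hz' := dCP (hh z (inner_rect (sq_center z r0))).
  exists (slope h (dC h z) z); last first.
    by move=> w; rewrite E {1}(slopeE h (dC h z) z w) hz add0r exprSr mulrA.
  have d w : sq z r w -> w != z -> hol (slope h (dC h z) z) w.
    by move=> /hh hw wz; exact: hol_slope.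
  move=> w wr; case: (eqVneq w z) => [->|wz]; last exact: d.
  apply: removable => //.
  by have := @nearc_sq z (fun w => w != z -> hol (slope h (dC h z) z) w);
    move=> [_ K]; apply: K; exists r.
exists (r / 2); first by rewrite divr_gt0.
move=> w wz; apply: eq0_normc; apply/eqP; rewrite eq_le normc_ge0 andbT leNgt; apply/negP => f0.
have wi : sqi z r w by apply: normc_sqi; lra.
have step n : normc (f w) <= B / 2 ^+ n.
  have [h hh E] := all n.
  have hb : normc (h w) <= B / r ^+ n.
    apply: (@max_sq h [::] z r _ w wi) => [v /hh /hol_cont //|v /hh //|v vb].
    rewrite ler_pdivlMr ?exprn_gt0 //; apply: le_trans (Bf v (sqb_sq vb)).
    rewrite E normcM normcX mulrC ler_wpM2r ?normc_ge0 //.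
    apply: lerXn2r; rewrite ?nnegrE ?normc_ge0 //; [exact: ltW|exact: sqb_normc].
  rewrite E normcM normcX.
  apply: le_trans (_ : (r / 2) ^+ n * (B / r ^+ n) <= _).
    apply: ler_pM; rewrite ?normc_ge0 ?exprn_ge0 ?normc_ge0 //.
    by apply: lerXn2r; rewrite ?nnegrE ?normc_ge0 //; [lra|exact: ltW].
  rewrite expr_div_n le_eqVlt; apply/orP; left; apply/eqP.
  by field; rewrite !expf_neq0 ?gt_eqF.
have [n hn] := halving_small B f0.
by have := step n; move: hn; lra.
Qed.

Lemma has_order_nz f z n : has_order f z n -> dnearc z (fun w => f w != 0).
Proof.
move=> [h [hh h0 E]]; have hc := hol_cont (nearc_self hh).
apply: nearc_imp (nearc_and E (cont_neq0 hc h0)) => w [-> hw] wz.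
by rewrite mulf_neq0 // expf_neq0 // subr_eq0.
Qed.

Lemma zero_dichotomy f z : nearc z (hol f) ->
  nearc z (fun w => f w = 0) \/ dnearc z (fun w => f w != 0).
Proof.
by move=> /order_dichotomy[|[n /has_order_nz]]; [left|right].
Qed.

(** Uniform convergence on the boundary controls the slopes at [z] inside, by the maximum principle.
    They are uniformly Cauchy, so the difference quotient of the limit has itself a limit at [z]. *)
Lemma uniform_limit (fs : nat -> C -> C) f z r : 0 < r ->
  (forall n w, sq z r w -> hol (fs n) w) ->
  (forall e : R, 0 < e -> exists N, forall n w, (N <= n)%N -> sq z r w ->
     normc (fs n w - f w) <= e) ->
  hol f z.
Proof.
move=> r0 H U.
have zi := sq_center z r0.
pose k n := slope (fs n) (dC (fs n) z) z.
have dk n := dCP (H n z (inner_rect zi)).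
have kk e : 0 < e -> exists N, forall n m w, (N <= n)%N -> (N <= m)%N -> sqi z r w ->
    normc (k n w - k m w) <= e.
  move=> e0; have [N HN] := U (e * r / 4) (divr_gt0 (mulr_gt0 e0 r0) (ltr0Sn _ _)).
  exists N => n m w nN mN wi.
  apply: (@max_sq (fun w => k n w - k m w) [:: z] z r e w wi).
  - by move=> v vr; apply: contB; apply: (slope_cont_rect (dk _)) vr => u ur _; exact: H.
  - by move=> v vr; rewrite inE => vz; apply: holB; apply: hol_slope => //; exact: H.
  - move=> v vb; have vz := sqb_normc vb; have vr := sqb_sq vb.
    have v0 : v != z by apply/eqP => E; move: vz; rewrite E subrr normc0; lra.
    rewrite /k !slopeN // -mulrBl normc_div ler_pdivrMr; last by apply: lt_le_trans vz.
    have fE u : sq z r u -> normc (fs n u - fs m u) <= e * r / 2.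
      move=> ur; have -> : fs n u - fs m u = (fs n u - f u) - (fs m u - f u) by ring.
      apply: le_trans (le_normcD _ _) _; rewrite normcN.
      by have := HN n u nN ur; have := HN m u mN ur; lra.
    have -> : fs n v - fs n z - (fs m v - fs m z) = (fs n v - fs m v) - (fs n z - fs m z) by ring.
    apply: le_trans (le_normcD _ _) _; rewrite normcN.
    apply: le_trans (_ : e * r <= _); last by rewrite ler_pM2l.
    by have := fE v vr; have := fE z (inner_rect zi); lra.
pose q w := (f w - f z) / (w - z).
have klim e : 0 < e -> exists N, forall n w, (N <= n)%N -> sqi z r w -> w != z ->
    normc (k n w - q w) <= e.
  move=> e0; have e2 : 0 < e / 2 by rewrite divr_gt0.
  have [N HN] := kk _ e2.
  exists N => n w nN wi wz; have w0 : 0 < normc (w - z) by rewrite normc_gt0 // subr_eq0.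
  have [N' HN'] := U (e / 4 * normc (w - z)) (mulr_gt0 (divr_gt0 e0 (ltr0Sn _ _)) w0).
  pose m := maxn N N'.
  have -> : k n w - q w = (k n w - k m w) + (k m w - q w) by ring.
  apply: le_trans (le_normcD _ _) _.
  have h1 : normc (k n w - k m w) <= e / 2 by apply: HN => //; rewrite leq_maxl.
  have h2 : normc (k m w - q w) <= e / 2.
    rewrite /k /q slopeN // -mulrBl normc_div ler_pdivrMr //.
    have -> : fs m w - fs m z - (f w - f z) = (fs m w - f w) - (fs m z - f z) by ring.
    apply: le_trans (le_normcD _ _) _; rewrite normcN.
    have g1 := HN' m w (leq_maxr _ _) (inner_rect wi).
    have g2 := HN' m z (leq_maxr _ _) (inner_rect zi).
    have -> : e / 2 * normc (w - z) = e / 4 * normc (w - z) + e / 4 * normc (w - z) by field.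
    exact: lerD.
  lra.
have [e e0|l Hl] := @complex_lim q z.
  have e2 : 0 < e / 2 by rewrite divr_gt0.
  have [N HN] := klim _ e2; exists (k N z).
  have kc : cont_at (k N) z := dk N.
  have si : nearc z (sqi z r) by exists r => // w; exact: normc_sqi.
  apply: nearc_imp (nearc_and si (kc _ e2)) => w [wi h] wz.
  have h2 : normc (q w - k N w) <= e / 2 by rewrite normcB; exact: HN.
  have -> : q w - k N z = (q w - k N w) + (k N w - k N z) by ring.
  by apply: le_trans (le_normcD _ _) _; lra.
by exists l; exact: slope_lim_hol.
Qed.

End Local.

(** * Meromorphic functions *)

Section Meromorphic.
Variable R : realType.
Local Notation C := R[i].
Implicit Types (f g h k : C -> C) (r : R) (z w u v : C).

Lemma dnearc_and z (P Q : C -> Prop) :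
  dnearc z P -> dnearc z Q -> dnearc z (fun w => P w /\ Q w).
Proof.
move=> p q; apply: nearc_imp (nearc_and p q) => w [h1 h2] wz.
by split; [exact: h1|exact: h2].
Qed.

Lemma dnearc_imp z (P Q : C -> Prop) : (forall w, P w -> Q w) -> dnearc z P -> dnearc z Q.
Proof. by move=> PQ; apply: nearc_imp => w H wz; apply: PQ; exact: H. Qed.

Lemma nearc_dnearc z (P : C -> Prop) : nearc z P -> dnearc z P.
Proof. by apply: nearc_imp => w. Qed.

Lemma dnearc_open z (P : C -> Prop) : dnearc z P -> dnearc z (fun w => nearc w P).
Proof.
move=> /nearc_nearc; apply: nearc_imp => w H wz.
have : nearc w (fun v => v != z).
  have := cont_neq0 (contB (cont_id w) (cont_cst z w)).
  by rewrite subr_eq0 => /(_ wz); apply: nearc_imp => v; rewrite subr_eq0.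
by move=> h; apply: nearc_imp (nearc_and H h) => v [h1 /h1].
Qed.

Lemma dnearc_shift z a (P : C -> Prop) : dnearc (z + a) P -> dnearc z (fun w => P (w + a)).
Proof. by move=> /nearc_shift; apply: nearc_imp => w H wz; apply: H; rewrite (inj_eq (addIr a)). Qed.

Lemma dnearc_false z : ~ dnearc z (fun=> False).
Proof. by move=> /dnearc_ex[]. Qed.

(** Only the values on a punctured neighbourhood count. Meromorphic functions are thus plain
    functions with an arbitrary value at a pole, and identities between them are stated with
    [dnearc]. *)
Definition mer_at f z := exists n g,
  nearc z (hol g) /\ dnearc z (fun w => f w * (w - z) ^+ n = g w).

Lemma mer_hol f z : nearc z (hol f) -> mer_at f z.
Proof. by move=> hf; exists 0%N, f; split => //; apply: nearcT => w _; rewrite expr0 mulr1. Qed.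

Lemma mer_cst (k : C) z : mer_at (fun=> k) z.
Proof. by apply: mer_hol; apply: nearcT => w; exact: hol_cst. Qed.

Lemma mer_near f g z : dnearc z (fun w => f w = g w) -> mer_at f z -> mer_at g z.
Proof.
move=> E [n [h [hh H]]]; exists n, h; split => //.
by apply: dnearc_imp (dnearc_and E H) => w [<-].
Qed.

Lemma hol_pow z n w : hol (fun v => (v - z) ^+ n) w.
Proof. by apply: holX; exact: hol_subc. Qed.

Lemma merD f g z : mer_at f z -> mer_at g z -> mer_at (fun w => f w + g w) z.
Proof.
move=> [n [h [hh H]]] [m [k [hk K]]].
exists (n + m)%N, (fun w => h w * (w - z) ^+ m + k w * (w - z) ^+ n); split.
  by apply: nearc_imp (nearc_and hh hk) => w [h1 h2]; apply: holD; apply: holM => //; exact: hol_pow.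
apply: dnearc_imp (dnearc_and H K) => w [<- <-]; rewrite exprD; ring.
Qed.

Lemma merM f g z : mer_at f z -> mer_at g z -> mer_at (fun w => f w * g w) z.
Proof.
move=> [n [h [hh H]]] [m [k [hk K]]].
exists (n + m)%N, (fun w => h w * k w); split.
  by apply: nearc_imp (nearc_and hh hk) => w [h1 h2]; exact: holM.
apply: dnearc_imp (dnearc_and H K) => w [<- <-]; rewrite exprD; ring.
Qed.

Lemma merN f z : mer_at f z -> mer_at (fun w => - f w) z.
Proof.
move=> [n [h [hh H]]]; exists n, (fun w => - h w); split.
  by apply: nearc_imp hh => w; exact: holN.
by apply: dnearc_imp H => w <-; rewrite mulNr.
Qed.

Lemma merB f g z : mer_at f z -> mer_at g z -> mer_at (fun w => f w - g w) z.
Proof. by move=> F G; apply: merD => //; exact: merN. Qed.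

(** The order is [b - a]; two natural exponents avoid negative powers. *)
Definition mer_order f z := exists a b h,
  [/\ nearc z (hol h), h z != 0 & dnearc z (fun w => f w * (w - z) ^+ a = (w - z) ^+ b * h w)].

Lemma mer_dichotomy f z : mer_at f z -> dnearc z (fun w => f w = 0) \/ mer_order f z.
Proof.
move=> [n [g [hg E]]]; case: (order_dichotomy hg) => [g0|[b [h [hh h0 H]]]]; [left|right].
  apply: nearc_imp (nearc_and E g0) => w [h1 h2] wz.
  by have /eqP := h1 wz; rewrite h2 mulf_eq0 => /orP[/eqP //|]; rewrite expf_eq0 subr_eq0 (negbTE wz) andbF.
exists n, b, h; split => //.
by apply: dnearc_imp (dnearc_and E (nearc_dnearc H)) => w [-> ->].
Qed.

Lemma mer_order_nz f z : mer_order f z -> dnearc z (fun w => f w != 0).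
Proof.
move=> [a [b [h [hh h0 E]]]].
apply: nearc_imp (nearc_and E (cont_neq0 (hol_cont (nearc_self hh)) h0)) => w [h1 h2] wz.
have : (w - z) ^+ b * h w != 0 by rewrite mulf_neq0 // expf_neq0 // subr_eq0.
by rewrite -h1 // mulf_eq0 negb_or => /andP[].
Qed.

Lemma mer_zero f z : mer_at f z -> dnearc z (fun w => f w = 0) \/ dnearc z (fun w => f w != 0).
Proof. by move=> /mer_dichotomy[|/mer_order_nz]; [left|right]. Qed.

Lemma merV f z : mer_at f z -> mer_at (fun w => (f w)^-1) z.
Proof.
move=> F; case: (mer_dichotomy F) => [f0|[a [b [h [hh h0 E]]]]].
  by apply: mer_near (mer_cst 0 z); apply: dnearc_imp f0 => w ->; rewrite invr0.
exists b, (fun w => (w - z) ^+ a * (h w)^-1).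
have hn := cont_neq0 (hol_cont (nearc_self hh)) h0; split.
  by apply: nearc_imp (nearc_and hh hn) => w [h1 h2]; apply: holM; [exact: hol_pow|exact: holV].
have fn : dnearc z (fun w => f w != 0) by apply: mer_order_nz; exists a, b, h.
apply: nearc_imp (nearc_and (dnearc_and E fn) hn) => w [H hw] wz; have [e1 e2] := H wz.
apply: (mulIf hw); rewrite divfK //; apply: (mulfI e2).
by rewrite mulrA mulrA divff // mul1r e1.
Qed.

Lemma mer_shift f z a : mer_at f (z + a) -> mer_at (fun w => f (w + a)) z.
Proof.
move=> [n [g [hg E]]]; exists n, (fun w => g (w + a)); split.
  apply: nearc_imp (nearc_shift hg) => w hw.
  by apply: (@hol_comp _ (fun v => v + a) g) => //; apply: holD; [exact: hol_id|exact: hol_cst].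
apply: dnearc_imp (dnearc_shift E) => w <-.
by have -> : w + a - (z + a) = w - z by ring.
Qed.

Lemma dC_mul f g z : hol f z -> hol g z -> dC (fun w => f w * g w) z = dC f z * g z + f z * dC g z.
Proof. by move=> /dCP F /dCP G; apply: dC_eq; exact: cderivM. Qed.

Lemma mer_dC f z : mer_at f z -> mer_at (dC f) z.
Proof.
move=> [n [g [hg E]]].
exists (n + n)%N, (fun w => dC g w * (w - z) ^+ n - g w * (n%:R * (w - z) ^+ n.-1)); split.
  apply: nearc_imp (nearc_and hg (dC_hol hg)) => w [h1 h2].
  by apply: holB; apply: holM => //; [exact: hol_pow|apply: holM; [exact: hol_cst|exact: hol_pow]].
apply: nearc_imp (nearc_and hg (dnearc_open E)) => w [gw H] wz.
have wn : nearc w (fun v => v != z).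
  have := cont_neq0 (contB (cont_id w) (cont_cst z w)).
  by rewrite subr_eq0 => /(_ wz); apply: nearc_imp => v; rewrite subr_eq0.
have w0 : w - z != 0 by rewrite subr_eq0.
have p0 : (w - z) ^+ n != 0 by rewrite expf_neq0.
have fE : nearc w (fun v => g v * ((v - z) ^+ n)^-1 = f v).
  apply: nearc_imp (nearc_and (H wz) wn) => v [<- vz].
  by rewrite mulfK // expf_neq0 // subr_eq0.
have pd := cderivX n (cderivB (cderiv_id w) (cderiv_cst z w)).
have := cderiv_near fE (cderivM (dCP gw) (@cderivV _ (fun v => (v - z) ^+ n) w _ p0 pd)).
by move=> /dC_eq ->; rewrite subr0 mulr1 exprD; field.
Qed.

(** By [mer_zero] small rectangles are of two exclusive kinds, according to whether [f] vanishes
    near their points or not. Four quarters share their centre, so they are of the same kind, and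
    [bisection] extends this to the whole rectangle. *)
Lemma identity_rect f (a b c d : R) z0 : a <= b -> c <= d ->
  (forall z, in_rect a b c d z -> mer_at f z) -> in_rect a b c d z0 ->
  dnearc z0 (fun w => f w = 0) -> forall z, in_rect a b c d z -> dnearc z (fun w => f w = 0).
Proof.
move=> ab cd M z0r f0.
have excl z : dnearc z (fun w => f w = 0) -> dnearc z (fun w => f w != 0) -> False.
  move=> h1 h2; apply: (@dnearc_false z); apply: dnearc_imp (dnearc_and h1 h2) => w [-> ].
  by rewrite eqxx.
pose P a' b' c' d' := [/\ a <= a', b' <= b, c <= c' & d' <= d] ->
  (forall z, in_rect a' b' c' d' z -> dnearc z (fun w => f w = 0)) \/
  (forall z, in_rect a' b' c' d' z -> dnearc z (fun w => f w != 0)).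
have : P a b c d.
  apply: bisection => //; rewrite /P.
  - move=> a' b' c' d' ab' cd' q1 q2 q3 q4 [h1 h2 h3 h4].
    have [m1 m2] := half_between ab'; have [n1 n2] := half_between cd'.
    set m := (a' + b') / 2 in q1 q2 q3 q4 m1 m2 *; set n := (c' + d') / 2 in q1 q2 q3 q4 n1 n2 *.
    have {}q1 := q1 (And4 h1 (le_trans m2 h2) h3 (le_trans n2 h4)).
    have {}q2 := q2 (And4 (le_trans h1 m1) h2 h3 (le_trans n2 h4)).
    have {}q3 := q3 (And4 h1 (le_trans m2 h2) (le_trans h3 n1) h4).
    have {}q4 := q4 (And4 (le_trans h1 m1) h2 (le_trans h3 n1) h4).
    have pick z : in_rect a' b' c' d' z -> [\/ in_rect a' m c' n z, in_rect m b' c' n z,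
        in_rect a' m n d' z | in_rect m b' n d' z].
      move=> [/andP[z1 z2] /andP[z3 z4]].
      case: (leP (Re z) m) => [u|/ltW u]; case: (leP (Im z) n) => [v|/ltW v].
      + by constructor 1; split; apply/andP.
      + by constructor 3; split; apply/andP.
      + by constructor 2; split; apply/andP.
      + by constructor 4; split; apply/andP.
    have p1 : in_rect a' m c' n (m +i* n) by split; rewrite /= ?m1 ?n1 lexx.
    have p2 : in_rect m b' c' n (m +i* n) by split; rewrite /= ?m2 ?n1 lexx.
    have p3 : in_rect a' m n d' (m +i* n) by split; rewrite /= ?m1 ?n2 lexx.
    have p4 : in_rect m b' n d' (m +i* n) by split; rewrite /= ?m2 ?n2 lexx.
    case: q1 => q1; [left|right] => z /pick; case: q2 => q2; try by case: (excl _ (q1 _ p1) (q2 _ p2)) || case: (excl _ (q2 _ p2) (q1 _ p1)).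
    + case: q3 => q3; last by case: (excl _ (q1 _ p1) (q3 _ p3)).
      case: q4 => q4; last by case: (excl _ (q1 _ p1) (q4 _ p4)).
      by case; [exact: q1|exact: q2|exact: q3|exact: q4].
    + case: q3 => q3; first by case: (excl _ (q3 _ p3) (q1 _ p1)).
      case: q4 => q4; first by case: (excl _ (q4 _ p4) (q1 _ p1)).
      by case; [exact: q1|exact: q2|exact: q3|exact: q4].
  - move=> x y xP yP.
    have side (Q : C -> Prop) : dnearc (x +i* y) Q -> exists2 e : R, 0 < e &
        forall a' b' c' d', a' <= x -> x <= b' -> c' <= y -> y <= d' -> b' - a' < e -> d' - c' < e ->
        forall z, in_rect a' b' c' d' z -> dnearc z Q.
      move=> HQ; have [D D0 H] := dnearc_open HQ.
      exists (D / 2); first by rewrite divr_gt0.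
      move=> a' b' c' d' k1 k2 k3 k4 k5 k6 z zr.
      case: (eqVneq z (x +i* y)) => [->//|zx].
      apply: nearc_dnearc; apply: H => //.
      move: zr => [/andP[z1 z2] /andP[z3 z4]].
      apply: le_lt_trans (normc_ReIm _) _; rewrite ReB ImB (splitr D) /=.
      by apply: ltrD; rewrite ltr_norml; apply/andP; split; lra.
    case: (mer_zero (M _ (conj xP yP : in_rect a b c d (x +i* y)))) => /side[e e0 H].
    + exists e => // a' b' c' d' _ ? ? _ _ ? ? _ ? ? _; left; exact: H.
    + exists e => // a' b' c' d' _ ? ? _ _ ? ? _ ? ? _; right; exact: H.
move=> /(_ (And4 (lexx _) (lexx _) (lexx _) (lexx _)))[//|H].
by case: (excl z0 f0 (H _ z0r)).
Qed.

Lemma identity f z0 : (forall z, mer_at f z) -> dnearc z0 (fun w => f w = 0) ->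
  forall z, dnearc z (fun w => f w = 0).
Proof.
move=> M f0 z; pose r := normc (z - z0).
apply: (@identity_rect f (Re z0 - r) (Re z0 + r) (Im z0 - r) (Im z0 + r) z0) => //.
- by have := normc_ge0 (z - z0); rewrite -/r; lra.
- by have := normc_ge0 (z - z0); rewrite -/r; lra.
- by apply: normc_sq; rewrite subrr normc0 normc_ge0.
- exact: normc_sq.
Qed.

Lemma liouville f (M : R) : (forall z, hol f z) -> (forall z, normc (f z) <= M) ->
  forall z, f z = f 0.
Proof.
move=> hf fM z; apply/eqP; rewrite -subr_eq0 -normc_eq0 eq_le normc_ge0 andbT leNgt; apply/negP => f0.
have z0 : z != 0 by apply/eqP => E; move: f0; rewrite E subrr normc0 ltxx.
have nz := normc_gt0 z0.
have M0 : 0 <= M by apply: le_trans (fM 0); exact: normc_ge0.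
(* The first summand puts [z] inside the square; the second makes the bound [2 * M / r] on the slope
   too small for the difference [f z - f 0]. *)
pose r := normc z + 2 * (M + 1) * normc z / normc (f z - f 0).
have r0 : normc z < r by rewrite /r ltrDl divr_gt0 // !mulr_gt0 // ltr_wpDl.
have rpos : 0 < r by apply: lt_trans r0.
have zi : sqi 0 r z by apply: normc_sqi; rewrite subr0.
have d0 := dCP (hf 0).
have : normc (slope f (dC f 0) 0 z) <= 2 * M / r.
  apply: (@max_sq _ _ [:: 0] 0 r _ z zi).
  - by apply: slope_cont_rect => // w _ _; exact: hf.
  - by move=> w _; rewrite inE => w0; apply: hol_slope => //; exact: hf.
  - move=> w wb; have rw := sqb_normc wb.
    have wn : 0 < normc (w - 0) by apply: lt_le_trans rw.
    have w0 : w != 0 by apply/eqP => E; move: wn; rewrite E subrr normc0 ltxx.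
    rewrite slopeN // normc_div; apply: ler_pM; rewrite ?normc_ge0 ?invr_ge0 ?normc_ge0 //.
      apply: le_trans (le_normcD _ _) _; rewrite normcN.
      by have := fM w; have := fM 0; lra.
    by rewrite lef_pV2 ?posrE.
rewrite slopeN // normc_div subr0 ler_pdivrMr //.
have rE : r * normc (f z - f 0) = normc z * normc (f z - f 0) + 2 * (M + 1) * normc z.
  by rewrite /r; field; rewrite gt_eqF.
move=> h; have : r * normc (f z - f 0) <= 2 * M * normc z.
  apply: le_trans (ler_wpM2l (ltW rpos) h) _.
  rewrite le_eqVlt; apply/orP; left; apply/eqP.
  by clearbody r; field; rewrite (gt_eqF rpos).
have p1 : 0 < normc z * normc (f z - f 0) by rewrite mulr_gt0.
rewrite rE (_ : 2 * (M + 1) * normc z = 2 * M * normc z + 2 * normc z); last ring.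
lra.
Qed.

Definition extends_at f z := exists g, nearc z (hol g) /\ dnearc z (fun w => f w = g w).

(** The local extensions fit together into an entire function [F], and by periodicity every value of
    [F] is attained in a fixed disc, where it is bounded. *)
Lemma liouville_extend f (M : R) z0 : (forall z, extends_at f z) ->
  (forall z, exists2 w, normc (w - z0) <= M & forall v, f (v + (z - w)) = f v) ->
  exists c, forall z, dnearc z (fun w => f w = c).
Proof.
move=> ext per.
pose F z := xget 0 [set l | exists g, [/\ nearc z (hol g), dnearc z (fun w => f w = g w) & g z = l]].
have FE z g : nearc z (hol g) -> dnearc z (fun w => f w = g w) -> F z = g z.
  move=> hg E.
  have [g' [hg' E' <-]] : [set l | exists g, [/\ nearc z (hol g), dnearc z (fun w => f w = g w) & g z = l]] (F z).
    by apply: xgetPex; exists (g z), g.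
  apply/eqP; rewrite -subr_eq0; apply/negPn/negP => n0.
  have hB := hol_cont (holB (nearc_self hg') (nearc_self hg)).
  apply: (@dnearc_false z).
  apply: nearc_imp (nearc_and (cont_neq0 hB n0) (dnearc_and E E')) => w [h1 h2] /h2[e1 e2].
  by move: h1; rewrite -e1 -e2 subrr eqxx.
have Fnear z g : nearc z (hol g) -> dnearc z (fun w => f w = g w) -> nearc z (fun w => F w = g w).
  move=> hg E; have : dnearc z (fun w => F w = g w).
    apply: nearc_imp (nearc_and (nearc_nearc hg) (dnearc_open E)) => w [h1 h2] wz.
    by apply: FE => //; apply: nearc_dnearc; exact: h2.
  apply: nearc_imp => w H; case: (eqVneq w z) => [->|/H //]; exact: FE.
have hF z : hol F z.
  have [g [hg E]] := ext z; apply: hol_near (nearc_self hg).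
  by apply: nearc_imp (Fnear z g hg E).
have perF z : exists2 w, normc (w - z0) <= M & F z = F w.
  have [w wM H] := per z; exists w => //.
  have [g [hg E]] := ext w; rewrite (FE w g) //.
  rewrite (FE z (fun v => g (v + (w - z)))) /=; first by congr g; ring.
    have zw : z + (w - z) = w by ring.
    have hg' : nearc (z + (w - z)) (hol g) by rewrite zw.
    apply: nearc_imp (nearc_shift hg') => v hv.
    by apply: (@hol_comp _ (fun v => v + (w - z)) g) => //; apply: holD; [exact: hol_id|exact: hol_cst].
  have zw : z + (w - z) = w by ring.
  have E' : dnearc (z + (w - z)) (fun w => f w = g w) by rewrite zw.
  apply: dnearc_imp (dnearc_shift E') => v <-.
  by rewrite -(H (v + (w - z))); congr f; ring.
pose r := `|M| + 1.
have r0 : 0 < r by rewrite /r ltr_wpDl.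
have [B B0 HB] := @bounded_sq _ F z0 r r0 (fun v _ => hol_cont (hF v)).
have FB z : normc (F z) <= B.
  have [w wM ->] := perF z; apply: HB; apply: normc_sq; apply: le_trans wM _.
  by rewrite /r (le_trans (ler_norm _)) // lerDl.
exists (F 0) => z; have [g [hg E]] := ext z.
apply: nearc_imp (nearc_and (Fnear z g hg E) E) => w [h1 h2] /h2 ->.
by rewrite -h1; exact: (liouville hF FB).
Qed.

End Meromorphic.

(** * Series of secants *)

Section ComplexExponential.
Variable R : realType.
Local Notation C := R[i].
Implicit Types (x y : R) (z w u v : C).

Lemma real_deriv_bound (f : R -> R) (x d e : R) : is_derive x 1 f d -> 0 < e ->
  exists2 D : R, 0 < D & forall h, `|h| < D -> `|f (x + h) - f x - h * d| <= e * `|h|.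
Proof.
move=> [fd fE] e0.
have H : (fun h : R => h^-1 * (f (h + x) - f x)) @ 0^' --> d.
  have -> : (fun h : R => h^-1 * (f (h + x) - f x)) = (fun h : R => h^-1 *: ((f \o shift x) (h *: 1) - f x)).
    by apply: funext => h; rewrite /= -[h *: 1]/(h * 1) mulr1.
  by rewrite -fE.
move/cvgrPdist_le : H => /(_ e e0).
rewrite near_withinE => /nbhs_ballP[D D0 K]; exists D => // h hD.
have [->|h0] := eqVneq h 0; first by rewrite addr0 subrr mul0r subrr normr0 mulr0.
have := K h; rewrite /ball /= sub0r normrN => /(_ hD h0).
rewrite distrC [h + x]addrC => k.
have -> : f (x + h) - f x - h * d = h * (h^-1 * (f (x + h) - f x) - d) by field.
by rewrite normrM mulrC ler_wpM2r.
Qed.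

Definition ei z : C :=
  expR (- Im z) * cos (Re z) +i* (expR (- Im z) * sin (Re z)).

Lemma eiD z w : ei (z + w) = ei z * ei w.
Proof.
case: z w => [a b] [c d]; apply: eq_ReIm => /=; rewrite opprD expRD ?cosD ?sinD; ring.
Qed.

Lemma ei0 : ei 0 = 1.
Proof. by apply: eq_ReIm => /=; rewrite oppr0 expR0 ?cos0 ?sin0; ring. Qed.

Lemma eiN z : ei (- z) = (ei z)^-1.
Proof.
have E : ei (- z) * ei z = 1 by rewrite -eiD addNr ei0.
have n0 : ei z != 0 by apply/eqP => e; move: E; rewrite e mulr0 => /eqP; rewrite eq_sym oner_eq0.
by apply: (mulIf n0); rewrite E mulVf.
Qed.

Lemma ei_neq0 z : ei z != 0.
Proof.
have E : ei (- z) * ei z = 1 by rewrite -eiD addNr ei0.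
by apply/eqP => e; move: E; rewrite e mulr0 => /eqP; rewrite eq_sym oner_eq0.
Qed.

Lemma normc_ei z : normc (ei z) = expR (- Im z).
Proof.
apply/eqP; rewrite -(eqrXn2 (ltn0Sn 1)) ?normc_ge0 ?expR_ge0 //; apply/eqP.
by rewrite normc_sqr /= !exprMn -mulrDr cos2Dsin2 mulr1.
Qed.

Lemma cderiv_ei z : cderiv ei z ('i%C * ei z).
Proof.
(* The addition law carries the derivative from 0 to any point; at 0 the real derivatives of [expR],
   [cos] and [sin] are combined by hand. *)
suff H : cderiv ei 0 'i%C.
  have -> : ei = (fun w => ei z * ei (w - z)).
    by apply: funext => w; rewrite -eiD addrC subrK.
  have h0 : cderiv ei (z - z) 'i%C by rewrite subrr.
  have := cderivM (cderiv_cst (ei z) z)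
    (cderiv_comp (cderivB (cderiv_id z) (cderiv_cst z z)) h0).
  rewrite mul0r add0r subr0 mulr1 subrr ei0 mulr1 mulrC; exact.
apply: slope_lim_hol => e e0.
pose e' := Num.min (e / 8) (1 / 2).
have e'0 : 0 < e' by rewrite /e' lt_min !divr_gt0.
have [D1 D10 H1] := real_deriv_bound (is_derive_expR 0) e'0.
have [D2 D20 H2] := real_deriv_bound (is_derive_cos 0) e'0.
have [D3 D30 H3] := real_deriv_bound (is_derive_sin 0) e'0.
pose D := Num.min (Num.min D1 D2) (Num.min D3 (e' / 2)).
have D0 : 0 < D by rewrite /D !lt_min D10 D20 D30 divr_gt0.
exists D => // w; rewrite subr0 => wD w0.
have nw := normc_gt0 w0.
rewrite ei0 -(ltr_pM2r nw) -normcM mulrBl divfK //.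
case: w wD w0 nw => a b wD w0 nw.
have aw : `|a| <= normc (a +i* b) := normc_Re (a +i* b).
have bw : `|b| <= normc (a +i* b) := normc_Im (a +i* b).
move: wD; rewrite {1}/D !lt_min => /andP[/andP[d1 d2] /andP[d3 d4]].
have {}H1 : `|expR (- b) - 1 - - b| <= e' * `|b|.
  have := H1 (- b); rewrite normrN add0r expR0 mulr1; apply; exact: le_lt_trans d1.
have {}H2 : `|cos a - 1| <= e' * `|a|.
  have := H2 a; rewrite add0r cos0 sin0 oppr0 mulr0 subr0; apply; exact: le_lt_trans d2.
have {}H3 : `|sin a - a| <= e' * `|a|.
  have := H3 a; rewrite add0r cos0 sin0 subr0 mulr1; apply; exact: le_lt_trans d3.
set N := normc (a +i* b) in aw bw d1 d2 d3 d4 nw *.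
have e1 : e' <= e / 8 by rewrite /e' ge_min lexx.
have e2 : e' <= 1 / 2 by rewrite /e' ge_min lexx orbT.
clearbody e'.
have B1 : `|expR (- b)| <= 2.
  have h : `|b| < e' / 2 by exact: le_lt_trans d4.
  have : e' * `|b| <= 1 * `|b| by rewrite ler_wpM2r //; lra.
  have : expR (- b) = (expR (- b) - 1 - - b) + (1 - b) by ring.
  move=> ->; have := ler_normD (expR (- b) - 1 - - b) (1 - b).
  have := ler_normB (1 : R) b; rewrite normr1; lra.
have P1 : `|expR (- b) * (cos a - 1)| <= 2 * (e' * N).
  rewrite normrM; apply: ler_pM => //; apply: le_trans H2 _; rewrite ler_wpM2l //; exact: ltW.
have P2 : `|expR (- b) * (sin a - a)| <= 2 * (e' * N).
  rewrite normrM; apply: ler_pM => //; apply: le_trans H3 _; rewrite ler_wpM2l //; exact: ltW.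
have P3 : `|(expR (- b) - 1 - - b)| <= e' * N.
  by apply: le_trans H1 _; rewrite ler_wpM2l //; exact: ltW.
have P4 : `|(expR (- b) - 1) * a| <= e' * N.
  rewrite normrM mulrC; rewrite mulrC; apply: ler_pM => //.
  have -> : expR (- b) - 1 = (expR (- b) - 1 - - b) - b by ring.
  apply: le_trans (ler_normB _ _) _; apply: le_trans (lerD H1 (lexx _)) _.
  have h : `|b| < e' / 2 by exact: le_lt_trans d4.
  have : e' * `|b| <= 1 * `|b| by rewrite ler_wpM2r //; lra.
  lra.
apply: le_lt_trans (normc_ReIm _) _ => /=.
have -> : expR (- b) * cos a - 1 - (0 * a - 1 * b) = expR (- b) * (cos a - 1) + (expR (- b) - 1 - - b) by ring.
have -> : expR (- b) * sin a - 0 - (0 * b + 1 * a) = expR (- b) * (sin a - a) + (expR (- b) - 1) * a by ring.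
have := ler_normD (expR (- b) * (cos a - 1)) (expR (- b) - 1 - - b).
have := ler_normD (expR (- b) * (sin a - a)) ((expR (- b) - 1) * a).
have : e' * N <= e / 8 * N by rewrite ler_wpM2r // ltW.
have : 0 < e * N by exact: mulr_gt0.
by move: P1 P2 P3 P4; lra.
Qed.

Lemma hol_ei z : hol ei z.
Proof. by eexists; exact: cderiv_ei. Qed.

Lemma ei_pi z : ei (z + pi%:C) = - ei z.
Proof.
rewrite eiD (_ : ei pi%:C = -1) ?mulrN1 //.
by apply: eq_ReIm => /=; rewrite oppr0 expR0 ?cospi ?sinpi; ring.
Qed.

Lemma ei_pihalf z : ei (z + (pi / 2)%:C) = 'i%C * ei z.
Proof.
rewrite eiD mulrC (_ : ei (pi / 2)%:C = 'i%C) //.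
by apply: eq_ReIm => /=; rewrite oppr0 expR0 ?cos_pihalf ?sin_pihalf; ring.
Qed.

Lemma sin_eq0_pi x : sin x = 0 -> exists n : int, x = n%:~R * pi.
Proof.
move=> sx; pose n := Num.floor (x / pi); exists n.
have sn (m : nat) y : sin y = 0 -> sin (y + pi *+ m) = 0.
  by move=> h; elim: m => [|m IH]; rewrite ?addr0 // mulrSr addrA sinDpi IH oppr0.
have sB y : sin (y - pi) = - sin y.
  by have := sinDpi (y - pi); rewrite subrK => ->; rewrite opprK.
have snN (m : nat) y : sin y = 0 -> sin (y - pi *+ m) = 0.
  by move=> h; elim: m => [|m IH]; rewrite ?subr0 // mulrSr opprD addrA sB IH oppr0.
have E : sin (x - n%:~R * pi) = 0.
  case: n => m; first by rewrite -[m%:~R]/(m%:R) mulr_natl; exact: snN.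
  by rewrite NegzE mulrNz mulNr opprK -[(m.+1)%:~R]/(m.+1%:R) mulr_natl; exact: sn.
have pi0 := pi_gt0 R; have /andP[f1 f2] := floor_itv (x / pi).
rewrite -/n in f1 f2.
have h1 : 0 <= x - n%:~R * pi by rewrite subr_ge0 -ler_pdivlMr.
have h2 : x - n%:~R * pi < pi.
  by move: f2; rewrite ltr_pdivrMr // intrD mulrDl mul1r; lra.
apply/eqP; rewrite -subr_eq0 eq_le h1 andbT leNgt; apply/negP => h3.
by have := @sin_gt0_pi R (x - n%:~R * pi); rewrite h3 h2 E ltxx => /(_ isT).
Qed.

Lemma ei_sqr1 z : ei z ^+ 2 = 1 -> exists n : int, z = (n%:~R * pi)%:C.
Proof.
move=> E; have : normc (ei z) ^+ 2 = 1 by rewrite -normcX E normc1.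
rewrite normc_ei -expRM_natl => e1.
have im0 : Im z = 0.
  have : expR (2%:R * - Im z) = expR 0 by rewrite e1 expR0.
  by move=> /expR_inj; lra.
have e2 : ei (z + z) = 1 by rewrite eiD -expr2.
have rz : Re (z + z) = Re z + Re z by case: (z).
have iz : Im (z + z) = 0 by case: (z) im0 => ? ? /= ->; rewrite addr0.
have c2 : cos (Re z + Re z) = 1.
  have := congr1 (@complex.Re R) e2; rewrite /ei iz rz oppr0 expR0 mul1r /=; exact.
have : sin (Re z) ^+ 2 = 0.
  by have := cos2Dsin2 (Re z); move: c2; rewrite cosD -!expr2; lra.
move=> /eqP; rewrite expf_eq0 /= => /eqP /sin_eq0_pi[n nE]; exists n.
by apply: eq_ReIm => /=.
Qed.

End ComplexExponential.

(** * Complex sequences and geometric convergence *)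

Section Sequences.
Variable R : realType.
Local Notation C := R[i].
Implicit Types (u v : nat -> C).

Definition tends u (l : C) := forall e : R, 0 < e -> exists N, forall n, (N <= n)%N -> normc (u n - l) <= e.

Lemma tends_unique u l l' : tends u l -> tends u l' -> l = l'.
Proof.
move=> H H'; apply/eqP; rewrite -subr_eq0 -normc_eq0 eq_le normc_ge0 andbT leNgt; apply/negP => d0.
have e0 : 0 < normc (l - l') / 4 by rewrite divr_gt0.
have [N HN] := H _ e0; have [N' HN'] := H' _ e0.
have h1 := HN (maxn N N') (leq_maxl _ _); have h2 := HN' (maxn N N') (leq_maxr _ _).
have h3 : normc (l - l') <= normc (u (maxn N N') - l) + normc (u (maxn N N') - l').
  have -> : l - l' = (u (maxn N N') - l') - (u (maxn N N') - l) by ring.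
  by apply: le_trans (le_normcD _ _) _; rewrite normcN addrC.
lra.
Qed.

Lemma tendsD u v a b : tends u a -> tends v b -> tends (fun n => u n + v n) (a + b).
Proof.
move=> H K e e0; have e2 : 0 < e / 2 by rewrite divr_gt0.
have [N HN] := H _ e2; have [N' HN'] := K _ e2.
exists (maxn N N') => n; rewrite geq_max => /andP[/HN h1 /HN' h2].
have -> : u n + v n - (a + b) = (u n - a) + (v n - b) by ring.
by apply: le_trans (le_normcD _ _) _; lra.
Qed.

Lemma tends_cst (k : C) : tends (fun=> k) k.
Proof. by move=> e e0; exists 0%N => n _; rewrite subrr normc0 ltW. Qed.

Lemma tendsN u a : tends u a -> tends (fun n => - u n) (- a).
Proof. by move=> H e /H[N HN]; exists N => n /HN; rewrite -opprD normcN. Qed.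

Lemma real_cauchy (u : nat -> R) :
  (forall e, 0 < e -> exists N, forall n m, (N <= n)%N -> (N <= m)%N -> `|u n - u m| <= e) ->
  exists l, forall e, 0 < e -> exists N, forall n, (N <= n)%N -> `|u n - l| <= e.
Proof.
move=> H; pose A := [set x : R | exists N, forall n, (N <= n)%N -> x <= u n].
have bnd e N : 0 < e -> (forall n m, (N <= n)%N -> (N <= m)%N -> `|u n - u m| <= e) ->
    A (u N - e) /\ forall x, A x -> x <= u N + e.
  move=> e0 K; split.
    by exists N => n nN; have := K n N nN (leqnn _); rewrite ler_norml => /andP[? ?]; lra.
  move=> x [M HM]; have := HM (maxn M N) (leq_maxl _ _).
  by have := K (maxn M N) N (leq_maxr _ _) (leqnn _); rewrite ler_norml => /andP[? ?]; lra.
have [N0 K0] := H 1 ltr01; have [a0 b0] := bnd _ _ ltr01 K0.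
exists (sup A) => e e0; have e2 : 0 < e / 2 by rewrite divr_gt0.
have [N K] := H _ e2; have [a b] := bnd _ _ e2 K; exists N => n nN.
have s1 : u N - e / 2 <= sup A by apply: ub_le_sup => //; exists (u N0 + 1).
have s2 : sup A <= u N + e / 2 by apply: ge_sup => //; exists (u N0 - 1).
have := K n N nN (leqnn _); rewrite !ler_norml => /andP[? ?]; apply/andP; split; lra.
Qed.

Lemma tends_cauchy u :
  (forall e : R, 0 < e -> exists N, forall n m, (N <= n)%N -> (N <= m)%N -> normc (u n - u m) <= e) ->
  exists l, tends u l.
Proof.
move=> H.
have [e e0|a Ha] := @real_cauchy (fun n => Re (u n)).
  have [N HN] := H e e0; exists N => n m nN mN; rewrite -ReB.
  exact: le_trans (normc_Re _) (HN n m nN mN).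
have [e e0|b Hb] := @real_cauchy (fun n => Im (u n)).
  have [N HN] := H e e0; exists N => n m nN mN; rewrite -ImB.
  exact: le_trans (normc_Im _) (HN n m nN mN).
exists (a +i* b) => e e0; have e2 : 0 < e / 2 by rewrite divr_gt0.
have [N HN] := Ha _ e2; have [N' HN'] := Hb _ e2.
exists (maxn N N') => n; rewrite geq_max => /andP[/HN h1 /HN' h2].
by apply: le_trans (normc_ReIm _) _; rewrite ReB ImB /=; lra.
Qed.

Lemma geom_small (rho e : R) : 0 <= rho -> rho < 1 -> 0 < e -> exists N, rho ^+ N < e.
Proof.
move=> r0 r1 e0; apply: contrapT => H.
apply: (pow_ratio r0 r1 e0 (Q := 1)) => N; rewrite expr1n !mul1r leNgt; apply/negP => h.
by apply: H; exists N.
Qed.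

Definition psum u N : C := \sum_(n < N) u n.

Lemma psumS u N : psum u N.+1 = psum u N + u N.
Proof. by rewrite /psum big_ord_recr. Qed.

Lemma tends_geom u (K rho : R) N0 : 0 <= K -> 0 <= rho -> rho < 1 ->
  (forall n, (N0 <= n)%N -> normc (u n) <= K * rho ^+ n) ->
  exists2 L, tends (psum u) L &
    forall n, (N0 <= n)%N -> normc (psum u n - L) <= K * rho ^+ n / (1 - rho).
Proof.
move=> K0 r0 r1 H; have r1' : 0 < 1 - rho by rewrite subr_gt0.
have D n k : (N0 <= n)%N -> normc (psum u (n + k) - psum u n) <= K * (rho ^+ n - rho ^+ (n + k)) / (1 - rho).
  move=> nN; elim: k => [|k IH]; first by rewrite addn0 !subrr normc0 mulr0 mul0r.
  rewrite addnS psumS (_ : psum u (n + k) + u (n + k)%N - psum u n = (psum u (n + k) - psum u n) + u (n + k)%N); last ring.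
  apply: le_trans (le_normcD _ _) _; have := H (n + k)%N (leq_trans nN (leq_addr _ _)).
  have -> : K * (rho ^+ n - rho ^+ (n + k).+1) / (1 - rho) =
     K * (rho ^+ n - rho ^+ (n + k)) / (1 - rho) + K * rho ^+ (n + k).
    by rewrite exprS; field; rewrite gt_eqF.
  by move: IH; lra.
have D' n m : (N0 <= n)%N -> (n <= m)%N -> normc (psum u m - psum u n) <= K * rho ^+ n / (1 - rho).
  move=> nN nm; rewrite -(subnKC nm); apply: le_trans (D _ _ nN) _.
  rewrite ler_pM2r ?invr_gt0 // ler_wpM2l // lerBlDr lerDl; exact: exprn_ge0.
have [|L HL] := @tends_cauchy (psum u).
  move=> e e0; have e1 : 0 < e * (1 - rho) / (2 * (K + 1)).
    by rewrite divr_gt0 ?mulr_gt0 // ltr_wpDl.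
  have [N HN] := geom_small r0 r1 e1.
  pose M := maxn N0 N.
  have rM : K * rho ^+ M / (1 - rho) <= e / 2.
    rewrite ler_pdivrMr //; apply: le_trans (_ : K * rho ^+ N <= _).
      by apply: ler_wpM2l => //; apply: ler_wiXn2l => //; [exact: ltW|exact: leq_maxr].
    apply: le_trans (_ : K * (e * (1 - rho) / (2 * (K + 1))) <= _); first by apply: ler_wpM2l => //; exact: ltW.
    have K1 : 0 < K + 1 by rewrite ltr_wpDl.
    rewrite mulrA ler_pdivrMr ?mulr_gt0 //.
    have X0 : 0 <= e * (1 - rho) by rewrite mulr_ge0 // ltW.
    have -> : e / 2 * (1 - rho) * (2 * (K + 1)) = K * (e * (1 - rho)) + e * (1 - rho) by field.
    by rewrite lerDl.
  exists M => n m nM mM.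
  have h1 := D' M n (leq_maxl _ _) nM; have h2 := D' M m (leq_maxl _ _) mM.
  have -> : psum u n - psum u m = (psum u n - psum u M) - (psum u m - psum u M) by ring.
  by apply: le_trans (le_normcD _ _) _; rewrite normcN; lra.
exists L => // n nN; rewrite leNgt; apply/negP => h.
have h0 : 0 < (normc (psum u n - L) - K * rho ^+ n / (1 - rho)) / 2 by rewrite divr_gt0 // subr_gt0.
have [M HM] := HL _ h0.
have h1 := HM (maxn M n) (leq_maxl _ _); have h2 := D' n (maxn M n) nN (leq_maxr _ _).
have h3 : normc (psum u n - L) <= normc (psum u (maxn M n) - L) + normc (psum u (maxn M n) - psum u n).
  have -> : psum u n - L = (psum u (maxn M n) - L) - (psum u (maxn M n) - psum u n) by ring.
  by apply: le_trans (le_normcD _ _) _; rewrite normcN.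
by move: h h1 h2 h3; lra.
Qed.

End Sequences.

(** * The series of secants in the variable [x = ei z] *)

Section Secants.
Variable R : realType.
Local Notation C := R[i].
Variable tau : C.
Hypothesis tau0 : 0 < Im tau.
Implicit Types (x z w : C) (n N : nat).

Let q : C := ei tau.
Let r : R := normc q.

Lemma nome_gt0 : 0 < r.
Proof. by rewrite /r /q normc_ei expR_gt0. Qed.

Lemma nome_lt1 : r < 1.
Proof. by rewrite /r /q normc_ei expR_lt1 oppr_lt0. Qed.

Lemma nome_neq0 : q != 0.
Proof. exact: ei_neq0. Qed.

Definition qn n : C := q ^+ n.*2.+1.

Lemma normc_qn n : normc (qn n) = r ^+ n.*2.+1.
Proof. by rewrite /qn normcX. Qed.

Lemma qn_neq0 n : qn n != 0.
Proof. by rewrite expf_neq0 // nome_neq0. Qed.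

(** [secA n] and [secB n] are the functions [1/(2 cos)] centred at
    [(2n+1) tau] and [-(2n+1) tau], in the variable [x = ei z]. *)
Definition secA n x := qn n * x / (x ^+ 2 + qn n ^+ 2).
Definition secB n x := qn n * x / (1 + qn n ^+ 2 * x ^+ 2).
(** The term [secA 0] is set aside because it alone is singular at the pole under study; the rest of
    the series is holomorphic there. *)
Definition secU x n := secA n.+1 x + secB n x.

(** Once [normc (qn n) ^+ 2 <= m ^+ 2 / 2], the two denominators are at least [m ^+ 2 / 2] and
    [1 / 2] in modulus on the whole annulus, and the numerators decrease geometrically. *)
Lemma sec_bounds (m : R) : 0 < m -> m <= 1 -> exists N0, exists2 K : R, 0 < K &
  forall x n, m <= normc x -> normc x <= m^-1 -> (N0 <= n)%N ->
  [/\ x ^+ 2 + qn n ^+ 2 != 0, 1 + qn n ^+ 2 * x ^+ 2 != 0,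
      normc (secA n x) <= K * r ^+ n & normc (secB n x) <= K * r ^+ n].
Proof.
move=> m0 m1; have r0 := nome_gt0; have r1 := nome_lt1.
have m20 : 0 < m ^+ 2 / 2 by rewrite divr_gt0 // exprn_gt0.
have [N0 HN0] := geom_small (ltW r0) r1 m20.
exists N0, (2 / m ^+ 3); first by rewrite divr_gt0 // exprn_gt0.
move=> x n xm xM nN.
have q1 : r ^+ n.*2.+1 <= r ^+ n by apply: ler_wiXn2l; [exact: ltW|exact: ltW|rewrite -addnn ltnW // ltnS leq_addr].
have q2 : r ^+ n <= r ^+ N0 by apply: ler_wiXn2l; [exact: ltW|exact: ltW|].
have qp : 0 < r ^+ n.*2.+1 by rewrite exprn_gt0.
have q3 : (r ^+ n.*2.+1) ^+ 2 <= m ^+ 2 / 2.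
  apply: le_trans (_ : r ^+ n.*2.+1 <= _); last by lra.
  rewrite expr2 ler_piMl ?(ltW qp) //; apply: exprn_ile1; exact: ltW.
have mx2 : m ^+ 2 <= normc x ^+ 2.
  by apply: lerXn2r; rewrite ?nnegrE ?normc_ge0 // ltW.
have Mx2 : normc x ^+ 2 <= m ^- 2.
  by rewrite -exprVn; apply: lerXn2r; rewrite ?nnegrE ?normc_ge0 // invr_ge0 ltW.
have dA : m ^+ 2 / 2 <= normc (x ^+ 2 + qn n ^+ 2).
  have := ler_normcB (x ^+ 2) (- qn n ^+ 2); rewrite opprK normcN (normcX x) (normcX (qn n)) normc_qn; lra.
have dB : 1 / 2 <= normc (1 + qn n ^+ 2 * x ^+ 2).
  have := ler_normcB 1 (- (qn n ^+ 2 * x ^+ 2)); rewrite opprK normcN normc1 normcM (normcX x) (normcX (qn n)) normc_qn.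
  have : (r ^+ n.*2.+1) ^+ 2 * normc x ^+ 2 <= m ^+ 2 / 2 * m ^- 2.
    by apply: ler_pM; rewrite ?exprn_ge0 ?normc_ge0 // ltW.
  have -> : m ^+ 2 / 2 * m ^- 2 = 1 / 2 by field; rewrite gt_eqF.
  lra.
have pA : 0 < normc (x ^+ 2 + qn n ^+ 2) by apply: lt_le_trans dA.
have pB : 0 < normc (1 + qn n ^+ 2 * x ^+ 2) by apply: lt_le_trans dB.
have num : normc (qn n * x) <= r ^+ n * m^-1.
  by rewrite normcM normc_qn; apply: ler_pM => //; [exact: ltW|exact: normc_ge0].
have num0 : 0 <= r ^+ n * m^-1 by rewrite mulr_ge0 ?exprn_ge0 ?invr_ge0 // ltW.
split.
- by rewrite -normc_eq0 gt_eqF.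
- by rewrite -normc_eq0 gt_eqF.
- rewrite /secA normc_div ler_pdivrMr //; apply: le_trans num _.
  apply: le_trans (_ : 2 / m ^+ 3 * r ^+ n * (m ^+ 2 / 2) <= _).
    by rewrite le_eqVlt; apply/orP; left; apply/eqP; field; rewrite gt_eqF.
  by apply: ler_wpM2l => //; rewrite mulr_ge0 ?exprn_ge0 ?divr_ge0 ?exprn_ge0 // ltW.
- rewrite /secB normc_div ler_pdivrMr //; apply: le_trans num _.
  have mm : m^-1 <= m ^- 3.
    rewrite -!exprVn -{1}(expr1 m^-1); apply: ler_weXn2l => //.
    by rewrite -[1]invr1 lef_pV2 ?posrE.
  apply: le_trans (_ : 2 / m ^+ 3 * r ^+ n * (1 / 2) <= _).
    have -> : 2 / m ^+ 3 * r ^+ n * (1 / 2) = r ^+ n * m ^- 3 by field; rewrite gt_eqF.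
    by apply: ler_wpM2l => //; rewrite exprn_ge0 // ltW.
  by apply: ler_wpM2l => //; rewrite mulr_ge0 ?exprn_ge0 ?divr_ge0 ?exprn_ge0 // ltW.
Qed.

Lemma norm_window x : x != 0 -> exists2 m : R, 0 < m <= 1 & m < normc x < m^-1.
Proof.
move=> /normc_gt0 x0; have x1 : 0 < normc x + 1 by lra.
exists (Num.min (normc x / 2) (normc x + 1)^-1).
  rewrite lt_min divr_gt0 // invr_gt0 x1 /= ge_min; apply/orP; right.
  by rewrite invf_le1 // lerDr ltW.
have mn : 0 < Num.min (normc x / 2) (normc x + 1)^-1 by rewrite lt_min divr_gt0 // invr_gt0.
apply/andP; split; first by rewrite gt_min; apply/orP; left; lra.
apply: lt_le_trans (_ : normc x + 1 <= _); first lra.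
by rewrite -[X in X <= _]invrK lef_pV2 ?posrE ?invr_gt0 // ge_min lexx orbT.
Qed.

Lemma secU_bound (m : R) : 0 < m -> m <= 1 -> exists N0, exists2 K : R, 0 < K &
  forall x n, m <= normc x -> normc x <= m^-1 -> (N0 <= n)%N -> normc (secU x n) <= K * r ^+ n.
Proof.
move=> m0 m1; have [N0 [K K0 H]] := sec_bounds m0 m1.
exists N0, (2 * K); first by rewrite mulr_gt0.
move=> x n x1 x2 nN; have [_ _ _ b] := H x n x1 x2 nN.
have [_ _ a _] := H x n.+1 x1 x2 (leqW nN).
apply: le_trans (le_normcD _ _) _.
have : K * r ^+ n.+1 <= K * r ^+ n.
  by rewrite ler_pM2l //; apply: ler_wiXn2l; rewrite ?(ltW nome_gt0) ?(ltW nome_lt1).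
lra.
Qed.

Lemma secU_cvg x : x != 0 -> exists l, tends (psum (secU x)) l.
Proof.
move=> /norm_window[m /andP[m0 m1] /andP[x1 x2]].
have [N0 [K K0 H]] := secU_bound m0 m1.
have [L HL _] := tends_geom (ltW K0) (ltW nome_gt0) nome_lt1 (fun n => H x n (ltW x1) (ltW x2)).
by exists L.
Qed.

Definition sec_tail x : C := xget 0 [set l | tends (psum (secU x)) l].

Lemma sec_tailP x : x != 0 -> tends (psum (secU x)) (sec_tail x).
Proof. by move=> /secU_cvg h; exact: (@xgetPex _ 0 [set l | tends (psum (secU x)) l]). Qed.

Definition secS x : C := secA 0 x + sec_tail x.

Lemma secA_small x : x != 0 -> tends (fun n => secA n x) 0 /\ tends (fun n => secB n x) 0.
Proof.
move=> /norm_window[m /andP[m0 m1] /andP[x1 x2]].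
have [N0 [K K0 H]] := sec_bounds m0 m1.
have aux (f : nat -> C) : (forall n, (N0 <= n)%N -> normc (f n) <= K * r ^+ n) -> tends f 0.
  move=> fK e e0; have [N HN] := geom_small (ltW nome_gt0) nome_lt1 (divr_gt0 e0 K0).
  exists (maxn N0 N) => n; rewrite geq_max => /andP[n1 n2].
  rewrite subr0; apply: le_trans (fK n n1) _; rewrite mulrC -ler_pdivlMr //.
  apply: le_trans (ltW HN); apply: ler_wiXn2l => //; [exact/ltW/nome_gt0|exact/ltW/nome_lt1].
by split; apply: aux => n nN; case: (H x n (ltW x1) (ltW x2) nN).
Qed.

Lemma psum_secS x N : secA 0 x + psum (secU x) N = psum (secA^~ x) N.+1 + psum (secB^~ x) N.
Proof.
elim: N => [|N IH]; first by rewrite psumS /psum !big_ord0; ring.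
by rewrite psumS addrA IH !psumS /secU; ring.
Qed.

Lemma secS_tends x : x != 0 ->
  tends (fun N => psum (secA^~ x) N.+1 + psum (secB^~ x) N) (secS x).
Proof.
move=> x0; have H := tendsD (tends_cst (secA 0 x)) (sec_tailP x0).
by move=> e /H[N HN]; exists N => n /HN; rewrite psum_secS.
Qed.

(** Giving the extra term to the other family changes the partial sums by [secB N x - secA N x],
    which tends to 0. The symmetries of [secS] then follow from reindexing finite sums. *)
Lemma secS_tends' x : x != 0 ->
  tends (fun N => psum (secB^~ x) N.+1 + psum (secA^~ x) N) (secS x).
Proof.
move=> x0; have [sa sb] := secA_small x0.
have H := tendsD (tendsD (secS_tends x0) sb) (tendsN sa).
move=> e e0; have [N HN] := H e e0; exists N => n /HN.
by rewrite oppr0 !addr0 !psumS; congr (normc _ <= _); ring.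
Qed.

Lemma secA_inv n x : x != 0 -> secA n x^-1 = secB n x.
Proof.
move=> x0; rewrite /secA /secB.
have -> : x^-1 ^+ 2 + qn n ^+ 2 = (1 + qn n ^+ 2 * x ^+ 2) / x ^+ 2 by field.
move: (1 + qn n ^+ 2 * x ^+ 2) => Y.
have [->|E] := eqVneq Y 0; first by rewrite mul0r !invr0 !mulr0.
by field; rewrite E x0.
Qed.

Lemma secS_inv x : x != 0 -> secS x^-1 = secS x.
Proof.
move=> x0; have x0' : x^-1 != 0 by rewrite invr_eq0.
apply: (tends_unique _ (secS_tends' x0)).
move=> e /(secS_tends x0')[N HN]; exists N => n /HN.
have -> : psum (secA^~ x^-1) n.+1 = psum (secB^~ x) n.+1.
  by apply: eq_bigr => i _; exact: secA_inv.
have -> // : psum (secB^~ x^-1) n = psum (secA^~ x) n.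
by apply: eq_bigr => i _; rewrite -{2}(invrK x) secA_inv.
Qed.

Lemma secSN x : x != 0 -> secS (- x) = - secS x.
Proof.
move=> x0; have x0' : - x != 0 by rewrite oppr_eq0.
apply: (tends_unique (secS_tends x0')).
have H := tendsN (secS_tends x0).
move=> e /H[N HN]; exists N => n /HN.
have hA k : secA k (- x) = - secA k x by rewrite /secA sqrrN mulrN mulNr.
have hB k : secB k (- x) = - secB k x by rewrite /secB sqrrN mulrN mulNr.
have -> : psum (secA^~ (- x)) n.+1 = - psum (secA^~ x) n.+1.
  by rewrite /psum -sumrN; apply: eq_bigr => i _; rewrite hA.
have -> : psum (secB^~ (- x)) n = - psum (secB^~ x) n.
  by rewrite /psum -sumrN; apply: eq_bigr => i _; rewrite hB.
by rewrite (opprD (psum _ _)).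
Qed.

Lemma secA0_shift x : x != 0 -> secA 0 (q ^+ 2 * x) = secB 0 x.
Proof.
move=> x0; have q0 := nome_neq0; rewrite /secA /secB /qn /= expr1.
have -> : (q ^+ 2 * x) ^+ 2 + q ^+ 2 = q ^+ 2 * (1 + q ^+ 2 * x ^+ 2) by ring.
move: (1 + q ^+ 2 * x ^+ 2) => Y.
have [->|E] := eqVneq Y 0; first by rewrite mulr0 !invr0 !mulr0.
by field; rewrite E q0.
Qed.

Lemma secAS_shift n x : x != 0 -> secA n.+1 (q ^+ 2 * x) = secA n x.
Proof.
move=> x0; have q0 := nome_neq0; have qE : qn n.+1 = q ^+ 2 * qn n.
  by rewrite /qn doubleS -exprD.
rewrite /secA qE; move: (qn n) => p.
have -> : (q ^+ 2 * x) ^+ 2 + (q ^+ 2 * p) ^+ 2 = q ^+ 4 * (x ^+ 2 + p ^+ 2) by ring.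
move: (x ^+ 2 + p ^+ 2) => Y.
have [->|E] := eqVneq Y 0; first by rewrite mulr0 !invr0 !mulr0.
by field; rewrite E q0.
Qed.

Lemma secB_shift n x : x != 0 -> secB n (q ^+ 2 * x) = secB n.+1 x.
Proof.
move=> x0; have qE : qn n.+1 = q ^+ 2 * qn n.
  by rewrite /qn doubleS -exprD.
rewrite /secB qE; congr (_ / _); ring.
Qed.

(** Every centre moves by [- 2 tau]: the term [secA 0] turns into [secB 0] and each other term into
    its neighbour. The displaced term is absorbed by [secS_tends']. *)
Lemma secS_shift x : x != 0 -> secS (q ^+ 2 * x) = secS x.
Proof.
move=> x0; have x0' : q ^+ 2 * x != 0 by rewrite mulf_neq0 // expf_neq0 // nome_neq0.
apply: (tends_unique _ (secS_tends' x0)).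
move=> e /(secS_tends x0')[N HN]; exists N => n /HN.
have -> : psum (secA^~ (q ^+ 2 * x)) n.+1 = secB 0 x + psum (secA^~ x) n.
  rewrite /psum big_ord_recl /= secA0_shift //; congr (_ + _).
  by apply: eq_bigr => i _; rewrite secAS_shift.
have -> : psum (secB^~ (q ^+ 2 * x)) n = psum (secB^~ x) n.+1 - secB 0 x.
  rewrite /psum [in RHS]big_ord_recl /= addrC addKr.
  by apply: eq_bigr => i _; rewrite secB_shift.
suff -> : secB 0 x + psum (secA^~ x) n + (psum (secB^~ x) n.+1 - secB 0 x) =
  psum (secB^~ x) n.+1 + psum (secA^~ x) n by [].
ring.
Qed.

(** These points avoid the poles of the tail; the index [n.+1] allows the pole of [secA 0]. *)
Definition sec_good x := forall n, x ^+ 2 + qn n.+1 ^+ 2 != 0 /\ 1 + qn n ^+ 2 * x ^+ 2 != 0.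

Lemma near_window z : exists2 m : R, 0 < m <= 1 &
  nearc z (fun w => m <= normc (ei w) /\ normc (ei w) <= m^-1).
Proof.
have [m mP /andP[x1 x2]] := norm_window (ei_neq0 z); exists m => //.
have c := hol_cont (hol_ei z).
have c1 := cont_bound c x2.
have h2 : 0 < normc (ei z) - m by rewrite subr_gt0.
apply: nearc_imp (nearc_and c1 (c _ h2)) => w [h1 h3]; split; last exact: ltW.
by have := ler_normcB (ei z) (ei w); rewrite normcB; lra.
Qed.

Lemma near_good z : sec_good (ei z) -> nearc z (fun w => sec_good (ei w)).
Proof.
move=> gz; have [m /andP[m0 m1] W] := near_window z.
have [N0 [K K0 H]] := sec_bounds m0 m1.
have cA n : cont_at (fun w => ei w ^+ 2 + qn n ^+ 2) z.
  by apply: contD; [apply: contX; exact: hol_cont (hol_ei z)|exact: cont_cst].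
have cB n : cont_at (fun w => 1 + qn n ^+ 2 * ei w ^+ 2) z.
  apply: contD; first exact: cont_cst.
  by apply: contM; [exact: cont_cst|apply: contX; exact: hol_cont (hol_ei z)].
have fin N : nearc z (fun w => forall n, (n < N)%N ->
    ei w ^+ 2 + qn n.+1 ^+ 2 != 0 /\ 1 + qn n ^+ 2 * ei w ^+ 2 != 0).
  elim: N => [|N IH]; first by apply: nearcT.
  have [g1 g2] := gz N.
  apply: nearc_imp (nearc_and IH (nearc_and (cont_neq0 (cA N.+1) g1) (cont_neq0 (cB N) g2))).
  by move=> w [h1 [h2 h3]] n; rewrite ltnS leq_eqVlt => /predU1P[->//|]; exact: h1.
apply: nearc_imp (nearc_and W (fin N0)) => w [[w1 w2] h] n.
case: (ltnP n N0) => [/h //|nN].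
have [_ b _ _] := H (ei w) n w1 w2 nN.
by have [a _ _ _] := H (ei w) n.+1 w1 w2 (leqW nN).
Qed.

Lemma hol_frac (a b c d : C) z : c + d * ei z ^+ 2 != 0 ->
  hol (fun w => a * ei w / (c + d * ei w ^+ 2)) z.
Proof.
move=> nz; apply: holM.
  by apply: holM; [exact: hol_cst|exact: hol_ei].
apply: holV => //; apply: holD; first exact: hol_cst.
by apply: holM; [exact: hol_cst|apply: holX; exact: hol_ei].
Qed.

Lemma hol_secA n z : ei z ^+ 2 + qn n ^+ 2 != 0 -> hol (fun w => secA n (ei w)) z.
Proof.
move=> nz; have -> : (fun w => secA n (ei w)) = (fun w => qn n * ei w / (qn n ^+ 2 + 1 * ei w ^+ 2)).
  by apply: funext => w; rewrite /secA mul1r [_ ^+ 2 + _]addrC.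
by apply: (hol_frac _ 0); rewrite mul1r addrC.
Qed.

Lemma hol_secB n z : 1 + qn n ^+ 2 * ei z ^+ 2 != 0 -> hol (fun w => secB n (ei w)) z.
Proof. exact: (hol_frac _ 0). Qed.

Lemma hol_sec_tail1 z : sec_good (ei z) -> hol (fun w => sec_tail (ei w)) z.
Proof.
move=> gz; have [m /andP[m0 m1] W] := near_window z.
have [N0 [K K0 H]] := secU_bound m0 m1.
have := nearc_and W (near_good gz) => /nearc_sq[s s0 Hs].
apply: (@uniform_limit _ (fun n w => psum (secU (ei w)) n) _ z s s0).
  move=> n w ws; have [_ gw] := Hs w ws.
  elim: n => [|n IH].
    have -> : (fun w => psum (secU (ei w)) 0) = fun=> 0.
      by apply: funext => v; rewrite /psum big_ord0.
    exact: hol_cst.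
  have -> : (fun w => psum (secU (ei w)) n.+1) = fun w => psum (secU (ei w)) n + (secA n.+1 (ei w) + secB n (ei w)).
    by apply: funext => v; rewrite psumS.
  have [g1 g2] := gw n.
  by apply: holD => //; apply: holD; [exact: hol_secA|exact: hol_secB].
move=> e e0; have r1 : 0 < 1 - r by rewrite subr_gt0 nome_lt1.
have [N HN] := geom_small (ltW nome_gt0) nome_lt1 (divr_gt0 (mulr_gt0 e0 r1) K0).
exists (maxn N0 N) => n w; rewrite geq_max => /andP[n1 n2] /Hs[[w1 w2] _].
have [L HL B] := tends_geom (ltW K0) (ltW nome_gt0) nome_lt1 (fun n => H (ei w) n w1 w2).
rewrite (tends_unique (sec_tailP (ei_neq0 w)) HL).
apply: le_trans (B n n1) _; rewrite ler_pdivrMr // mulrC -ler_pdivlMr //.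
apply: le_trans (ltW HN); apply: ler_wiXn2l => //; [exact/ltW/nome_gt0|exact/ltW/nome_lt1].
Qed.

Lemma hol_sec_tail z : sec_good (ei z) -> nearc z (hol (fun w => sec_tail (ei w))).
Proof. by move=> /near_good; apply: nearc_imp => w; exact: hol_sec_tail1. Qed.

End Secants.

(** * Doubly periodic functions *)

Section Lattices.
Variable R : realType.
Local Notation C := R[i].
Implicit Types (a b w z : C).

Lemma periodic_mulz (V : Type) (f : C -> V) a : (forall z, f (z + a) = f z) ->
  forall (n : int) z, f (z + a *~ n) = f z.
Proof.
move=> H n z; have Hn (m : nat) y : f (y + a *+ m) = f y.
  by elim: m => [|m IH]; rewrite ?addr0 // mulrSr addrA H.
case: n => m; first exact: Hn.
by rewrite NegzE mulrNz -(Hn m.+1 (z - a *~ m.+1)) subrK.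
Qed.

Lemma lattice_per (V : Type) (f : C -> V) a b : (forall z, f (z + a) = f z) ->
  (forall z, f (z + b) = f z) -> lattice_periodic a b f.
Proof.
by move=> H K z _ [m [n ->]]; rewrite addrA (periodic_mulz K) (periodic_mulz H).
Qed.

Lemma latticeD a b z w : lattice a b z -> lattice a b w -> lattice a b (z + w).
Proof.
move=> [m [n ->]] [m' [n' ->]]; exists (m + m'), (n + n'); rewrite !mulrzDr; ring.
Qed.

Lemma latticeN a b z : lattice a b z -> lattice a b (- z).
Proof. by move=> [m [n ->]]; exists (- m), (- n); rewrite !mulrNz opprD. Qed.

Lemma lattice_l a b : lattice a b a.
Proof. by exists 1, 0; rewrite mulr0z addr0 mulr1z. Qed.

Lemma lattice_r a b : lattice a b b.
Proof. by exists 0, 1; rewrite mulr0z add0r mulr1z. Qed.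

Lemma Im_div_neq0 a b : 0 < Im (b / a) -> a != 0.
Proof. by apply: contraTneq => ->; rewrite invr0 mulr0 ltxx. Qed.

Lemma lattice_coords a b z : 0 < Im (b / a) -> exists s t : R, z = s%:C * a + t%:C * b.
Proof.
move=> h; have a0 := Im_div_neq0 h.
pose t := Im (z / a) / Im (b / a); pose s := Re (z / a) - t * Re (b / a).
exists s, t.
have E : z / a = s%:C + t%:C * (b / a).
  move: h @t @s; case: (z / a) (b / a) => u v [p q] /= h.
  by apply: eq_ReIm => /=; field; rewrite gt_eqF.
by rewrite -[LHS](divfK a0) E; field.
Qed.

Lemma intrC (n : int) : (n%:~R : R)%:C = n%:~R :> C.
Proof. by rewrite rmorph_int. Qed.

Lemma lattice_reduce a b z : 0 < Im (b / a) -> exists l (s t : R),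
  [/\ lattice a b l, 0 <= s < 1, 0 <= t < 1 & z = l + (s%:C * a + t%:C * b)].
Proof.
move=> h; have [s [t ->]] := lattice_coords z h.
exists (a *~ Num.floor s + b *~ Num.floor t), (s - (Num.floor s)%:~R), (t - (Num.floor t)%:~R).
have fl (u : R) : 0 <= u - (Num.floor u)%:~R < 1.
  have /andP[h1 h2] := floor_itv u; rewrite subr_ge0 h1 ltrBlDl.
  by move: h2; rewrite intrD.
split; [by exists (Num.floor s), (Num.floor t)|exact: fl|exact: fl|].
rewrite !rmorphB /= !intrC -(mulrzl a) -(mulrzl b); ring.
Qed.

Lemma lattice_near a b z z0 : 0 < Im (b / a) -> exists2 w,
  normc (w - z0) <= normc a + normc b & lattice a b (z - w).
Proof.
move=> h; have [l [s [t [hl /andP[s0 s1] /andP[t0 t1] E]]]] := lattice_reduce (z - z0) h.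
exists (z - l); last by have -> : z - (z - l) = l by ring.
have -> : z - l - z0 = s%:C * a + t%:C * b.
  have -> : z - l - z0 = (z - z0) - l by ring.
  by rewrite E; ring.
apply: le_trans (le_normcD _ _) _; rewrite !normcM !normcR !ger0_norm //.
by apply: lerD; rewrite ler_piMl ?normc_ge0 // ltW.
Qed.

Lemma liouville_lattice a b (f : C -> C) : 0 < Im (b / a) -> lattice_periodic a b f ->
  (forall z, extends_at f z) -> exists c, forall z, dnearc z (fun w => f w = c).
Proof.
move=> h per ext; apply: (@liouville_extend _ f (normc a + normc b) 0) => // z.
have [w w1 w2] := lattice_near z 0 h; exists w => // v; exact: per.
Qed.

Lemma extends_hol (f : C -> C) z : nearc z (hol f) -> extends_at f z.
Proof. by exists f; split => //; exact: nearcT. Qed.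

Lemma hol_shift (f : C -> C) c z : nearc (z + c) (hol f) -> nearc z (hol (fun w => f (w + c))).
Proof.
move=> /nearc_shift; apply: nearc_imp => w hw.
by apply: (@hol_comp _ (fun v => v + c) f) => //; apply: holD; [exact: hol_id|exact: hol_cst].
Qed.

Lemma extends_shift (f : C -> C) c z : extends_at f (z + c) -> extends_at (fun w => f (w + c)) z.
Proof.
move=> [g [hg E]]; exists (fun w => g (w + c)); split; first exact: hol_shift.
exact: (dnearc_shift E).
Qed.

Lemma per_opp (V : Type) (f : C -> V) c : (forall z, f (z + c) = f z) -> forall z, f (z + (- c)) = f z.
Proof. by move=> H z; rewrite -(H (z - c)) subrK. Qed.

Lemma extends_per (f : C -> C) c : (forall z, f (z + c) = f z) ->
  forall z, extends_at f (z + c) = extends_at f z.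
Proof.
move=> H z; apply/propext; split => E.
  by have := extends_shift E; rewrite (_ : (fun w => f (w + c)) = f) //; exact/funext.
have H' := per_opp H.
have := @extends_shift f (- c) (z + c); rewrite addrK => /(_ E).
by rewrite (_ : (fun w => f (w - c)) = f) //; exact/funext.
Qed.

Lemma mer_per_sign (f : C -> C) c : (forall z, f (z + c) = f z) \/ (forall z, f (z + c) = - f z) ->
  forall z, mer_at f (z + c) = mer_at f z.
Proof.
move=> H z; apply/propext; split => E.
  have := mer_shift E; case: H => H; first by rewrite (_ : (fun w => f (w + c)) = f) //; exact/funext.
  by move=> /merN; rewrite (_ : (fun w => - f (w + c)) = f) //; apply/funext => w; rewrite H opprK.
have := @mer_shift _ f (z + c) (- c); rewrite addrK => /(_ E).
case: H => H.
  by rewrite (_ : (fun w => f (w - c)) = f) //; exact/funext/(per_opp H).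
move=> /merN; rewrite (_ : (fun w => - f (w - c)) = f) //; apply/funext => w.
by rewrite -H subrK.
Qed.

End Lattices.

(** * Symmetries and poles of the secant series in the variable [z] *)

Section SecantFunction.
Variable R : realType.
Local Notation C := R[i].
Variable tau : C.
Hypothesis tau0 : 0 < Im tau.
Implicit Types (x z w : C) (n N : nat).

Let q : C := ei tau.

(** This is the sum of [1 / (2 cos (z - k tau))] over all odd integers [k], positive and
    negative. *)
Definition jS z : C := secS tau (ei z).
Definition jp : C := (pi / 2)%:C + tau.

Lemma jS_even z : jS (- z) = jS z.
Proof. by rewrite /jS eiN secS_inv // ei_neq0. Qed.

Lemma jS_pi z : jS (z + pi%:C) = - jS z.
Proof. by rewrite /jS ei_pi secSN // ei_neq0. Qed.

Lemma jS_2tau z : jS (z + (tau + tau)) = jS z.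
Proof. by rewrite /jS !eiD -expr2 mulrC secS_shift // ei_neq0. Qed.

Lemma ei_jp : ei jp = 'i%C * q.
Proof. by rewrite /jp addrC ei_pihalf. Qed.

Lemma sqr_iC : 'i%C ^+ 2 = -1 :> C.
Proof. exact: sqr_i. Qed.

Lemma good_jp : sec_good tau (ei jp).
Proof.
have r0 := nome_gt0 tau; have r1 := nome_lt1 tau0.
rewrite ei_jp => n; rewrite exprMn sqr_iC mulN1r; split.
  rewrite addrC subr_eq0; apply/eqP => /(congr1 (@normc R)).
  rewrite normcX normc_qn normcX -exprM => E.
  have : normc q ^+ 2 < normc q ^+ 2.
    rewrite -{1}E; by apply: ltr_iXn2l.
  by rewrite ltxx.
rewrite mulrN subr_eq0; apply/eqP => /(congr1 (@normc R)).
rewrite normc1 normcM (normcX (qn tau n) 2) (normcX q 2) (normc_qn tau n) -exprM -exprD => E.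
have : normc q ^+ (n.*2.+1 * 2 + 2) < 1 by apply: exprn_ilt1 => //; exact: ltW.
by rewrite -E ltxx.
Qed.

Lemma exprz_double (F : fieldType) (x : F) (k : int) : (x ^+ 4) ^ k = (x ^+ 2) ^ k * (x ^+ 2) ^ k.
Proof. by rewrite -expfzMl -exprD. Qed.

Lemma pole_of_jS z : ~ lattice pi%:C (tau + tau) (z - jp) -> nearc z (hol jS).
Proof.
move=> nl; have q0 := nome_neq0 tau.
(* The poles of all the terms are given by these equations: [k = n] is the pole of [secA n] and
   [k = - (n + 1)] that of [secB n]. *)
have key (k : int) : ei z ^+ 2 != - (q ^+ 2 * (q ^+ 4) ^ k).
  apply/eqP => E; apply: nl.
  have E1 : ei (z - jp - (tau + tau) *~ k) ^+ 2 = 1.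
    have e2 : ei ((tau + tau) *~ k) = (q ^+ 2) ^ k.
      have nat (n : nat) : ei ((tau + tau) *+ n) = (q ^+ 2) ^+ n.
        elim: n => [|n IH]; first by rewrite mulr0n expr0 ei0.
        by rewrite mulrSr eiD IH eiD -expr2 [RHS]exprSr.
      case: k {E} => n; first exact: nat.
      by rewrite NegzE mulrNz eiN -[(_ *~ n.+1%:Z)]/(_ *+ n.+1) nat -invr_expz.
    rewrite !eiD eiN eiN e2 ei_jp !exprMn E !exprVn exprMn sqr_iC.
    have -> : (q ^+ 4) ^ k = (q ^+ 2) ^ k * (q ^+ 2) ^ k by exact: exprz_double.
    have : (q ^+ 2) ^ k != 0 by rewrite expfz_neq0 // expf_neq0.
    by move: q0 => {E e2}; rewrite -/q; move: ((q ^+ 2) ^ k) q => Y p p0 Y0; field; rewrite p0 Y0.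
  have [m mE] := ei_sqr1 E1; exists m, k.
  have -> : z - jp = (z - jp - (tau + tau) *~ k) + (tau + tau) *~ k by rewrite subrK.
  by rewrite mE rmorphM /= intrC mulrzl.
have gA n : ei z ^+ 2 + qn tau n ^+ 2 != 0.
  have := key n%:Z; rewrite -addr_eq0 (_ : q ^+ 2 * (q ^+ 4) ^ n%:Z = qn tau n ^+ 2) //.
  rewrite -[(_ ^ n%:Z)]/(_ ^+ n) -exprM -exprD -exprM; congr (_ ^+ _); lia.
have gB n : 1 + qn tau n ^+ 2 * ei z ^+ 2 != 0.
  have := key (- n.+1%:Z); apply: contra => /eqP H; apply/eqP.
  have qq : qn tau n ^+ 2 != 0 by rewrite expf_neq0 // qn_neq0.
  apply: (mulfI qq); rewrite mulrN -[LHS](addKr 1) addrC H sub0r -[LHS]mulN1r -[RHS]mulN1r.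
  congr (_ * _); rewrite -invr_expz -[(_ ^ n.+1%:Z)]/(_ ^+ n.+1) -exprM /qn.
  rewrite -exprM mulrA -exprD (_ : (n.*2.+1 * 2 + 2 = 4 * n.+1)%N); last lia.
  by rewrite divff // expf_neq0.
have gz : sec_good tau (ei z) by move=> n; split; [exact: gA|exact: gB].
have ngA : nearc z (fun w => ei w ^+ 2 + qn tau 0 ^+ 2 != 0).
  have c : cont_at (fun w => ei w ^+ 2 + qn tau 0 ^+ 2) z.
    by apply: contD; [apply: contX; exact: hol_cont (hol_ei z)|exact: cont_cst].
  exact: cont_neq0 c (gA 0%N).
apply: nearc_imp (nearc_and ngA (hol_sec_tail tau0 gz)) => w [h1 h2].
by apply: holD => //; exact: hol_secA.
Qed.

(** Only [secA 0] is singular at [jp], and the derivative of its denominator is nonzero there, so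
    the pole is simple. *)
Lemma jS_pole : exists phi, [/\ nearc jp (hol phi), phi jp != 0 &
  dnearc jp (fun z => jS z * (z - jp) = phi z)].
Proof.
have q0 := nome_neq0 tau.
pose D := fun z => ei z ^+ 2 + q ^+ 2.
have hD z : hol D z by apply: holD; [apply: holX; exact: hol_ei|exact: hol_cst].
have [G [hG Gp E]] := @hol_factor R D jp (nearcT _ hD).
have D0 : D jp = 0 by rewrite /D ei_jp exprMn sqr_iC; ring.
have G0 : G jp != 0.
  have dD := cderivD (cderivX 2 (cderiv_ei jp)) (cderiv_cst (q ^+ 2) jp).
  rewrite Gp (dC_eq dD) addr0 /= expr1 ei_jp !mulf_neq0 ?pnatr_eq0 //;
    by rewrite -normc_eq0 /normc /= expr0n expr1n add0r sqrtr1 oner_eq0.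
exists (fun z => q * ei z / G z + (z - jp) * sec_tail tau (ei z)); split.
- have nG := cont_neq0 (hol_cont (nearc_self hG)) G0.
  apply: nearc_imp (nearc_and (nearc_and hG nG) (hol_sec_tail tau0 good_jp)) => z [[h1 h2] h3].
  apply: holD; last by apply: holM => //; exact: hol_subc.
  by apply: holM; [apply: holM; [exact: hol_cst|exact: hol_ei]|exact: holV].
- rewrite subrr mul0r addr0 !mulf_neq0 ?invr_eq0 ?G0 ?ei_neq0 //.
- have nG := cont_neq0 (hol_cont (nearc_self hG)) G0.
  apply: nearc_imp nG => z h1 zp; have z0 : z - jp != 0 by rewrite subr_eq0.
  have Dz : ei z ^+ 2 + q ^+ 2 = (z - jp) * G z by have := E z; rewrite D0 add0r.
  have qE : qn tau 0 = q by rewrite /qn expr1.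
  rewrite /jS /secS /secA qE Dz; move: h1 z0; clear.
  by move: (sec_tail tau (ei z)) (ei z) (G z) (z - jp) q => a b c d e h1 z0; field; rewrite z0 h1.
Qed.

End SecantFunction.

(** * Expansions about a centre of symmetry and linear changes of variable *)

Section LocalExpansion.
Variable R : realType.
Local Notation C := R[i].
Implicit Types (f g : C -> C) (s z w p : C).

Lemma nearc_refl p (P : C -> Prop) : nearc p P -> nearc p (fun z => P (p + p - z)).
Proof.
move=> [D D0 H]; exists D => // z zD; apply: H.
by rewrite (_ : p + p - z - p = p - z); [rewrite normcB|ring].
Qed.

Lemma cont_zero f p : cont_at f p -> dnearc p (fun z => f z = 0) -> f p = 0.
Proof.
move=> cf f0; apply/eqP/negPn/negP => n0; apply: (@dnearc_false _ p).
by apply: nearc_imp (nearc_and (cont_neq0 cf n0) f0) => z [h1 h2] /h2 E; rewrite E eqxx in h1.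
Qed.

(** The first quotient [G] is odd about [p], hence vanishes at [p] and can be divided once more; the
    second quotient is even again, so the lemma can be iterated. *)
Lemma even_factor f p : nearc p (hol f) -> dnearc p (fun z => f (p + p - z) = f z) ->
  exists g, [/\ nearc p (hol g), dnearc p (fun z => g (p + p - z) = g z) &
    forall z, f z = f p + (z - p) ^+ 2 * g z].
Proof.
move=> hf ev; have [G [hG Gp E]] := hol_factor hf.
have odd : dnearc p (fun z => G (p + p - z) + G z = 0).
  apply: nearc_imp ev => z H zp; have z0 : z - p != 0 by rewrite subr_eq0.
  apply: (mulfI z0); rewrite mulr0 mulrDr.
  have := E (p + p - z); rewrite H // (E z) (_ : p + p - z - p = - (z - p)); last ring.
  by move=> /addrI ->; ring.
have G0 : G p = 0.
  have cG := hol_cont (nearc_self hG).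
  have cr : cont_at (fun z => p + p - z) p by apply: contB; [exact: cont_cst|exact: cont_id].
  have cG' : cont_at G (p + p - p) by rewrite addrK.
  have := cont_zero (contD (cont_comp cr cG') cG) odd.
  rewrite addrK => h; have : G p *+ 2 = 0 by rewrite mulr2n.
  by move/eqP; rewrite mulrn_eq0 /= => /eqP.
have [g [hg gp E']] := hol_factor hG.
exists g; split => //.
- apply: nearc_imp odd => z H zp; have z0 : z - p != 0 by rewrite subr_eq0.
  have := H zp; rewrite (E' (p + p - z)) (E' z) G0 !add0r (_ : p + p - z - p = - (z - p)); last ring.
  by move=> h; apply: (mulfI z0); apply/eqP; rewrite -subr_eq0; apply/eqP; rewrite -[RHS]oppr0 -[in RHS]h; ring.
- by move=> z; rewrite {1}E E' G0 add0r expr2 mulrA.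
Qed.

Lemma dC_shift f c z : dC (fun w => f (w + c)) z = dC f (z + c).
Proof.
rewrite /dC; congr (xget 0 _); apply/seteqP; split => p /= fp.
  have h : cderiv (fun w => f (w + c)) (z + c - c) p by rewrite addrK.
  have := cderiv_comp (cderivB (cderiv_id (z + c)) (cderiv_cst c (z + c))) h.
  rewrite subr0 mulr1; apply: cderiv_near.
  by apply: nearcT => w; rewrite subrK.
have := cderiv_comp (cderivD (cderiv_id z) (cderiv_cst c z)) fp.
by rewrite addr0 mulr1.
Qed.

Lemma dCN f z : dC (fun w => - f w) z = - dC f z.
Proof.
have [h|h] := pselect (hol f z); first exact: (dC_eq (cderivN (dCP h))).
rewrite /dC !xgetPN ?oppr0 // => p hp; apply: h; first by exists p.
exists (- p); have := cderivN hp; apply: cderiv_near; apply: nearcT => w.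
by rewrite opprK.
Qed.

Lemma nearc_scale s z (P : C -> Prop) : nearc (s * z) P -> nearc z (fun w => P (s * w)).
Proof.
move=> [D D0 H]; have s1 : 0 < normc s + 1 by rewrite ltr_wpDl ?normc_ge0.
exists (D / (normc s + 1)); first by rewrite divr_gt0.
move=> w; rewrite ltr_pdivlMr // => wD; apply: H; rewrite -mulrBr normcM.
apply: le_lt_trans wD; rewrite mulrC ler_wpM2l ?normc_ge0 // lerDl //.
Qed.

Lemma dnearc_scale s z (P : C -> Prop) : s != 0 -> dnearc (s * z) P -> dnearc z (fun w => P (s * w)).
Proof.
move=> s0 /nearc_scale; apply: nearc_imp => w H wz; apply: H.
by rewrite (inj_eq (mulfI s0)).
Qed.

Lemma hol_scale f s z : hol f (s * z) -> hol (fun w => f (s * w)) z.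
Proof.
move=> h; apply: (@hol_comp _ (fun w => s * w) f) => //.
by apply: holM; [exact: hol_cst|exact: hol_id].
Qed.

Lemma mer_scale f s z : s != 0 -> mer_at f (s * z) -> mer_at (fun w => f (s * w)) z.
Proof.
move=> s0 [n [g [hg E]]]; exists n, (fun w => (s ^- n) * g (s * w)); split.
  apply: nearc_imp (nearc_scale hg) => w hw.
  by apply: holM; [exact: hol_cst|exact: hol_scale].
apply: dnearc_imp (dnearc_scale s0 E) => w <-; rewrite -mulrBr exprMn.
have : s ^+ n != 0 by rewrite expf_neq0.
by move: (s ^+ n) => S S0; field.
Qed.

Lemma dC_scale f s z : hol f (s * z) -> dC (fun w => f (s * w)) z = s * dC f (s * z).
Proof.
move=> /dCP h; have := cderiv_comp (cderivM (cderiv_cst s z) (cderiv_id z)) h.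
by rewrite mul0r add0r mulr1 => /dC_eq ->; rewrite mulrC.
Qed.

Lemma dnearc_extract z (P : Prop) : dnearc z (fun=> P) -> P.
Proof. by move=> /dnearc_ex[]. Qed.

End LocalExpansion.

(** * The Jacobi-type function *)

Section SecantODE.
Variable R : realType.
Local Notation C := R[i].
Variable tau : C.
Hypothesis tau0 : 0 < Im tau.
Implicit Types (x z w : C).

Local Notation S := (jS tau).
Local Notation p := (jp tau).
Local Notation Pi := (pi%:C : C).

Lemma Pi_neq0 : Pi != 0.
Proof. by apply/eqP => -[/eqP]; rewrite gt_eqF // pi_gt0. Qed.

Lemma ImDPi z : Im (z / Pi) = Im z / pi.
Proof.
have E : Pi^-1 = (pi^-1 : R)%:C by rewrite fmorphV.
by rewrite E; case: z => a b /=; ring.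
Qed.

Lemma lat_tau : 0 < Im (tau / Pi).
Proof. by rewrite ImDPi divr_gt0 // pi_gt0. Qed.

Lemma lat_2tau : 0 < Im ((tau + tau) / Pi).
Proof.
have -> : Im ((tau + tau) / Pi) = Im (tau / Pi) + Im (tau / Pi) by rewrite mulrDl; case: (tau / Pi).
by rewrite addr_gt0 // lat_tau.
Qed.

Lemma jS_mer z : mer_at S z.
Proof.
have [[m [n E]]|nl] := pselect (lattice Pi (tau + tau) (z - p)); last first.
  exact/mer_hol/pole_of_jS.
have per := @lattice_per _ _ (mer_at S) Pi (tau + tau)
  (mer_per_sign (or_intror (jS_pi tau0))) (mer_per_sign (or_introl (jS_2tau tau0))).
rewrite -[z](subrK p) addrC per; last by exists m, n.
have [phi [hphi _ E']] := jS_pole tau0.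
by exists 1%N, phi; split => //; apply: dnearc_imp E' => w <-; rewrite expr1.
Qed.

Lemma Pi_half : Pi = (pi / 2)%:C + (pi / 2)%:C.
Proof. by apply: eq_ReIm => /=; field. Qed.

Lemma jS_odd z : S (p + p - z) = - S z.
Proof.
have -> : p + p - z = - (z - (Pi + (tau + tau))) by rewrite Pi_half /jp; ring.
rewrite (jS_even tau0).
have := jS_pi tau0 (z - (Pi + (tau + tau))).
have -> : z - (Pi + (tau + tau)) + Pi = z - (tau + tau) by ring.
have := jS_2tau tau0 (z - (tau + tau)); rewrite subrK => ->.
by move=> ->; rewrite opprK.
Qed.

(** By [jS_odd] the function is odd about its pole, so [S z * (z - p)] is even there and has no term
    of degree 1 or 3. *)
Lemma jS_laurent : exists (c b : C) psi, [/\ c != 0, nearc p (hol psi) &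
  dnearc p (fun z => S z = c / (z - p) + b * (z - p) + (z - p) ^+ 3 * psi z)].
Proof.
have [phi [hphi phi0 E]] := jS_pole tau0.
have ev : dnearc p (fun z => phi (p + p - z) = phi z).
  have E' := nearc_refl E.
  apply: nearc_imp (nearc_and E E') => z [h1 h2] zp.
  rewrite -h1 // -h2; last first.
    by apply: contra zp; rewrite subr_eq => /eqP /addrI ->.
  rewrite jS_odd; ring.
have [g [hg gev E2]] := even_factor hphi ev.
have [h [hh _ E3]] := even_factor hg gev.
exists (phi p), (g p), h; split => //.
apply: dnearc_imp (_ : dnearc p (fun z => z != p /\ S z * (z - p) = phi z)); last first.
  by apply: nearc_imp E => z H zp; split => //; exact: H.
move=> z [zp H]; have z0 : z - p != 0 by rewrite subr_eq0.
apply: (mulIf z0); rewrite H E2 E3; move: z0 (phi p) (g p) (h z); clear.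
by move: (z - p) => t t0 a b c; field.
Qed.

Lemma jS_zero : S (p + tau) = 0.
Proof.
have -> : p + tau = (pi / 2)%:C + (tau + tau) by rewrite /jp; ring.
rewrite (jS_2tau tau0); have := jS_pi tau0 (- (pi / 2)%:C); rewrite (jS_even tau0).
have -> : - (pi / 2)%:C + Pi = (pi / 2)%:C by rewrite Pi_half addKr.
move=> /eqP; rewrite -addr_eq0 -mulr2n mulrn_eq0 => /eqP; exact.
Qed.

Lemma tau_not_lattice : ~ lattice Pi (tau + tau) tau.
Proof.
move=> [m [n E]]; have : ((n + n)%:~R - 1) * Im tau = 0.
  have := congr1 (@complex.Im R) E.
  rewrite -(mulrzl Pi) -(mulrzl (tau + tau)) -(intrC R m) -(intrC R n) intrD.
  move: (n%:~R : R) => u; case: (tau) => a b /= E'.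
  have {}E' : b = 2 * u * b by rewrite [LHS]E'; ring.
  by rewrite mulrBl mul1r {2}E'; ring.
move=> /eqP; rewrite mulf_eq0 (gt_eqF tau0) orbF subr_eq0 -[1]/(1%:~R) eqr_int => /eqP; lia.
Qed.

(** The product has the periods [Pi] and [tau], and the simple pole of one factor meets the zero
    [jS_zero] of the other, so Liouville's theorem applies. If [K] were 0, one factor would vanish
    identically. *)
Lemma jS_translate : exists2 K : C, K != 0 & forall z, dnearc z (fun w => S w * S (w + tau) = K).
Proof.
pose H z := S z * S (z + tau).
have [phi [hphi phi0 E]] := jS_pole tau0.
have hT : nearc p (hol (fun w => S (w + tau))).
  apply: hol_shift; apply: pole_of_jS => //.
  have -> : p + tau - p = tau by ring.
  exact: tau_not_lattice.
have [G [hG _ EG]] := hol_factor hT; rewrite jS_zero in EG.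
have HP z : H (z + Pi) = H z.
  by rewrite /H (jS_pi tau0) addrAC (jS_pi tau0) mulrNN.
have HT z : H (z + tau) = H z.
  by rewrite /H -addrA (jS_2tau tau0) mulrC.
have extp : extends_at H p.
  exists (fun z => phi z * G z); split.
    by apply: nearc_imp (nearc_and hphi hG) => z [h1 h2]; exact: holM.
  apply: dnearc_imp E => z <-; rewrite /H EG; ring.
have ext z : extends_at H z.
  have [l|nl] := pselect (lattice Pi tau (z - p)).
    have per := @lattice_per _ _ (extends_at H) Pi tau (extends_per HP) (extends_per HT).
    by rewrite -[z](subrK p) addrC per.
  apply: extends_hol.
  have sub v : lattice Pi (tau + tau) v -> lattice Pi tau v.
    by move=> [m [n ->]]; exists m, (n + n); rewrite mulrzDl mulrzDr.
  have h1 : nearc z (hol S) by apply: pole_of_jS => // /sub.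
  have h2 : nearc z (hol (fun w => S (w + tau))).
    apply: hol_shift; apply: pole_of_jS => // /sub h; apply: nl.
    have -> : z - p = (z + tau - p) + (- tau) by ring.
    by apply: latticeD => //; apply: latticeN; exact: lattice_r.
  by apply: nearc_imp (nearc_and h1 h2) => w [? ?]; exact: holM.
have [K HK] := liouville_lattice lat_tau (lattice_per HP HT) ext.
exists K => //; apply/eqP => K0.
have S0 : dnearc p (fun z => S (z + tau) = 0).
  have cphi := cont_neq0 (hol_cont (nearc_self hphi)) phi0.
  apply: nearc_imp (nearc_and cphi (nearc_and (HK p) E)) => z [h1 [h2 h3]] zp.
  have := h2 zp; rewrite K0 /H => /eqP; rewrite mulf_eq0 => /orP[/eqP h|/eqP //].
  by move: h1; rewrite -h3 // h mul0r eqxx.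
have mT z : mer_at (fun w => S (w + tau)) z by apply: mer_shift; exact: jS_mer.
have := identity mT S0 (p - tau) => /(@dnearc_imp _ _ _ _ (fun w h => h)) Z.
have Z' : dnearc p (fun z => S z = 0).
  have := @dnearc_shift _ p (- tau) (fun w => S (w + tau) = 0) Z.
  by apply: dnearc_imp => w; rewrite subrK.
have cphi := cont_neq0 (hol_cont (nearc_self hphi)) phi0.
apply: (@dnearc_false _ p).
apply: nearc_imp (nearc_and cphi (nearc_and Z' E)) => z [h1 [h2 h3]] zp.
by move: h1; rewrite -h3 // h2 // mul0r eqxx.
Qed.

Lemma jS_ode1 : exists c D E : C, c != 0 /\
  forall z, dnearc z (fun w => dC S w ^+ 2 = S w ^+ 4 / c ^+ 2 + D * S w ^+ 2 + E).
Proof.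
have [c [b [psi [c0 hpsi EL]]]] := jS_laurent.
(* With [t = z - p], the terms in [t ^ -4] of [dC S ^+ 2] and [S ^+ 4 / c ^+ 2] agree, and their
   difference starts with [- 6 * b * c / t ^+ 2], which this multiple of [S ^+ 2] cancels. *)
pose D := - (6 * b / c).
pose F z := dC S z ^+ 2 - (S z ^+ 4 / c ^+ 2 + D * S z ^+ 2).
have dP z : dC S (z + Pi) = - dC S z.
  by rewrite -dC_shift (_ : (fun w => S (w + Pi)) = fun w => - S w) ?dCN //; apply/funext => w; exact: (jS_pi tau0).
have dT z : dC S (z + (tau + tau)) = dC S z.
  by rewrite -dC_shift; congr (dC _ z); apply/funext => w; exact: (jS_2tau tau0).
have FP z : F (z + Pi) = F z.
  by rewrite /F dP (jS_pi tau0); ring.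
have FT z : F (z + (tau + tau)) = F z by rewrite /F dT (jS_2tau tau0).
have extp : extends_at F p.
  pose om z := 3 * psi z + (z - p) * dC psi z.
  (* This is what remains of [F] after the poles cancel, written with the regular parts
     [b + (z - p) ^+ 2 * om z] of [dC S] and [(z - p) * (b + (z - p) ^+ 2 * psi z)] of [S]. *)
  exists (fun z => - 2 * c * om z + (b + (z - p) ^+ 2 * om z) ^+ 2
    - (4 * c ^+ 3 * psi z + (b + (z - p) ^+ 2 * psi z) ^+ 2 * 6 * c ^+ 2
       + 4 * c * (b + (z - p) ^+ 2 * psi z) ^+ 3 * (z - p) ^+ 2 + (z - p) ^+ 4 * (b + (z - p) ^+ 2 * psi z) ^+ 4) / c ^+ 2
    + 6 * b / c * (2 * c * (b + (z - p) ^+ 2 * psi z) + (z - p) ^+ 2 * (b + (z - p) ^+ 2 * psi z) ^+ 2)); split.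
    apply: nearc_imp (nearc_and hpsi (dC_hol hpsi)) => z [h1 h2].
    have hs : hol (fun w => w - p) z := hol_subc p z.
    have k (u : C) : hol (fun=> u) z := hol_cst u z.
    have hom : hol om z by apply: holD; apply: holM.
    have hB : hol (fun z => b + (z - p) ^+ 2 * psi z) z.
      by apply: holD => //; apply: holM => //; exact: holX.
    have hB2 : hol (fun z => b + (z - p) ^+ 2 * om z) z.
      by apply: holD => //; apply: holM => //; exact: holX.
    apply: holD.
      apply: holB.
        by apply: holD; [exact: (holM (k _) hom)|exact: holX].
      apply: holM => //; apply: holD; last by apply: holM; exact: holX.
      apply: holD; last by apply: holM; [apply: holM => //; exact: holX|exact: holX].
      by apply: holD; [exact: (holM (k _) h1)|apply: holM => //; apply: holM => //; exact: holX].
    apply: holM => //; apply: holD; first exact: (holM (k _) hB).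
    by apply: holM; exact: holX.
  have hS : dnearc p (fun z => dC S z = - c / (z - p) ^+ 2 + b + (z - p) ^+ 2 * om z).
    apply: nearc_imp (nearc_and hpsi (dnearc_open EL)) => z [hz H] zp.
    have z0 : z - p != 0 by rewrite subr_eq0.
    have ds := cderivB (cderiv_id z) (cderiv_cst p z).
    have dd := cderivD (cderivD (cderivM (cderiv_cst c z) (@cderivV R (fun w => w - p) z _ z0 ds)) (cderivM (cderiv_cst b z) ds))
      (cderivM (cderivX 3 ds) (dCP hz)).
    have H' : nearc z (fun w => c / (w - p) + b * (w - p) + (w - p) ^+ 3 * psi w = S w).
      by apply: nearc_imp (H zp) => w ->.
    rewrite (dC_eq (cderiv_near H' dd)) /om /=.
    move: z0 (psi z) (dC psi z); clear; move: (z - p) => t t0 u v; field => //.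
  apply: nearc_imp (nearc_and EL hS) => z [h1 h2] zp.
  have z0 : z - p != 0 by rewrite subr_eq0.
  rewrite /F /D h1 // h2 // /om.
  move: z0 (psi z) (dC psi z) c0; clear; move: (z - p) => t t0 u v c0.
  by field; rewrite t0 c0.
have ext z : extends_at F z.
  have [l|nl] := pselect (lattice Pi (tau + tau) (z - p)).
    have per := @lattice_per _ _ (extends_at F) Pi (tau + tau) (extends_per FP) (extends_per FT).
    by rewrite -[z](subrK p) addrC per.
  apply: extends_hol; have hS := pole_of_jS tau0 nl.
  apply: nearc_imp (nearc_and hS (dC_hol hS)) => w [h1 h2].
  have k (u : C) : hol (fun=> u) w := hol_cst u w.
  apply: holB; first exact: holX.
  by apply: holD; apply: holM => //; exact: holX.
have [E HE] := liouville_lattice lat_2tau (lattice_per FP FT) ext.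
exists c, D, E; split => // z; apply: dnearc_imp (HE z) => w; rewrite /F => <-; ring.
Qed.

End SecantODE.

(** * The normalised Jacobi-type function of a lattice *)

Section Jacobi.
Variable R : realType.
Local Notation C := R[i].
Implicit Types (f g h : C -> C) (z w p : C).

Lemma nearc_neq w z : w != z -> nearc w (fun v => v != z).
Proof.
move=> wz; have := cont_neq0 (contB (cont_id w) (cont_cst z w)).
by rewrite subr_eq0 => /(_ wz); apply: nearc_imp => v; rewrite subr_eq0.
Qed.

Lemma mer_hol_punct f z : mer_at f z -> dnearc z (hol f).
Proof.
move=> [n [g [hg E]]].
apply: nearc_imp (nearc_and hg (dnearc_open E)) => w [gw H] wz.
apply: (@hol_near _ (fun v => g v * ((v - z) ^+ n)^-1)).
  apply: nearc_imp (nearc_and (H wz) (nearc_neq wz)) => v [<- vz].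
  by rewrite mulfK // expf_neq0 // subr_eq0.
by apply: holM => //; apply: (@holV _ (fun v => (v - z) ^+ n)); [rewrite expf_neq0 // subr_eq0|exact: hol_pow].
Qed.

Lemma dC_opp f z : dC (fun w => f (- w)) z = - dC f (- z).
Proof.
have [h|h] := pselect (hol f (- z)).
  have := cderiv_comp (cderivN (cderiv_id z)) (dCP h).
  by rewrite mulrN1 => /dC_eq.
rewrite /dC !xgetPN ?oppr0 // => q hq; apply: h; first by exists q.
exists (- q); have hq' : cderiv (fun w => f (- w)) (- - z) q by rewrite opprK.
have := cderiv_comp (cderivN (cderiv_id (- z))) hq'.
rewrite mulrN1; apply: cderiv_near; apply: nearcT => w; by rewrite opprK.
Qed.

(** Suppose [d] has finite order. The initial values exclude orders 0 and 1; if the order is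
    [n + 2], the second derivative has order [n], whereas [k * d] has order at least [n + 2]. *)
Lemma ode_unique (d k : C -> C) z : nearc z (hol d) -> nearc z (hol k) ->
  nearc z (fun w => dC (dC d) w = k w * d w) -> d z = 0 -> dC d z = 0 ->
  nearc z (fun w => d w = 0).
Proof.
move=> hd hk E d0 d1; case: (order_dichotomy hd) => [//|[n [h [hh h0 H]]]]; exfalso.
have dn m w : hol h w -> cderiv (fun v => (v - z) ^+ m * h v) w
    (m%:R * (w - z) ^+ m.-1 * h w + (w - z) ^+ m * dC h w).
  move=> hw; have := cderivM (cderivX m (cderivB (cderiv_id w) (cderiv_cst z w))) (dCP hw).
  by rewrite subr0 mulr1.
case: n H => [|[|n]] H.
- by move: h0; have := nearc_self H; rewrite expr0 mul1r d0 => <-; rewrite eqxx.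
- have := dn 1%N z (nearc_self hh); rewrite /= expr0 mul1r expr1 subrr mul0r addr0 mul1r.
  have E1 : nearc z (fun v => (v - z) ^+ 1 * h v = d v) by apply: nearc_imp H => v ->.
  by move=> /(cderiv_near E1)/dC_eq; rewrite d1 => E0; rewrite -E0 eqxx in h0.
- have H1 : nearc z (fun w => dC d w = n.+2%:R * (w - z) ^+ n.+1 * h w + (w - z) ^+ n.+2 * dC h w).
    apply: nearc_imp (nearc_and hh (nearc_nearc H)) => w [hw Hw].
    have E1 : nearc w (fun v => (v - z) ^+ n.+2 * h v = d v) by apply: nearc_imp Hw => v ->.
    exact: (dC_eq (cderiv_near E1 (dn n.+2 w hw))).
  have H2 : nearc z (fun w => dC (dC d) w = (w - z) ^+ n * (n.+2%:R * n.+1%:R * h w +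
      (w - z) * (2 * n.+2%:R * dC h w + (w - z) * dC (dC h) w))).
    apply: nearc_imp (nearc_and (nearc_and hh (dC_hol hh)) (nearc_nearc H1)) => w [[hw hw'] Hw].
    have E1 : nearc w (fun v => n.+2%:R * (v - z) ^+ n.+1 * h v + (v - z) ^+ n.+2 * dC h v = dC d v).
      by apply: nearc_imp Hw => v ->.
    have ds := cderivB (cderiv_id w) (cderiv_cst z w).
    have D1 := cderivM (cderivM (cderiv_cst n.+2%:R w) (cderivX n.+1 ds)) (dCP hw).
    have D2 := cderivM (cderivX n.+2 ds) (dCP hw').
    rewrite (dC_eq (cderiv_near E1 (cderivD D1 D2))) /= subr0.
    move: (dC (dC h) w) (dC h w) (h w); clear; rewrite !exprS.
    move: (w - z) (_ ^+ n) (n.+2%:R) (n.+1%:R) => t u v1 v2 a b c; ring.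
  pose B w := n.+2%:R * n.+1%:R * h w + (w - z) * (2 * n.+2%:R * dC h w + (w - z) * dC (dC h) w)
     - k w * (w - z) ^+ 2 * h w.
  have cs : cont_at (fun w => w - z) z by apply: contB; [exact: cont_id|exact: cont_cst].
  have ch := hol_cont (nearc_self hh); have ck := hol_cont (nearc_self hk).
  have ch1 := hol_cont (nearc_self (dC_hol hh)).
  have ch2 := hol_cont (nearc_self (dC_hol (dC_hol hh))).
  have cB : cont_at B z.
    apply: contB; last first.
      by apply: contM => //; apply: contM => //; exact: contX.
    apply: contD; first by apply: contM => //; exact: cont_cst.
    apply: contM => //; apply: contD; last exact: contM.
    by apply: contM => //; exact: cont_cst.
  have : dnearc z (fun w => B w = 0).
    apply: nearc_imp (nearc_and (nearc_and H H2) E) => w [[e1 e2] e3] wz.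
    have w0 : (w - z) ^+ n != 0 by rewrite expf_neq0 // subr_eq0.
    apply: (mulfI w0); rewrite mulr0 /B mulrBr -e2 e3 e1 !exprS; ring.
  move=> /(cont_zero cB); rewrite /B subrr mul0r expr2 !mulr0 mul0r subr0 addr0.
  by move=> /eqP; rewrite !mulf_eq0 (negbTE h0) orbF !pnatr_eq0.
Qed.

(** All that is used later about the secant series. The poles are the points of
    [p + lattice w1 (w2 + w2)], and [j_p] says that 0 is not among them. *)
Record jacobi (w1 w2 : C) g (c0 kap p : C) : Prop := Jacobi {
  j_mer : forall z, mer_at g z;
  j_hol : forall z, ~ lattice w1 (w2 + w2) (z - p) -> nearc z (hol g);
  j_pole : exists phi, [/\ nearc p (hol phi), phi p != 0 &
    dnearc p (fun z => g z * (z - p) = phi z)];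
  j_even : forall z, g (- z) = g z;
  j_w1 : forall z, g (z + w1) = - g z;
  j_2w2 : forall z, g (z + (w2 + w2)) = g z;
  j_w2 : forall z, dnearc z (fun w => g w * g (w + w2) = 1);
  j_ode : forall z, dnearc z (fun w => dC g w ^+ 2 = c0 * (g w ^+ 4 - kap * g w ^+ 2 + 1));
  j_c0 : c0 != 0;
  j_p : ~ lattice w1 (w2 + w2) (0 - p) }.

Lemma jacobi_exists (w1 w2 : C) : 0 < Im (w2 / w1) ->
  exists g c0 kap p, jacobi w1 w2 g c0 kap p.
Proof.
move=> h; have w10 := Im_div_neq0 h.
pose Pi : C := pi%:C; have Pi0 : Pi != 0 := Pi_neq0 R.
pose s := Pi / w1; have s0 : s != 0 by rewrite mulf_neq0 // invr_eq0.
pose tau := s * w2.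
have tau0 : 0 < Im tau.
  have -> : tau = Pi * (w2 / w1) by rewrite /tau /s; ring.
  have -> : Im (Pi * (w2 / w1)) = pi * Im (w2 / w1) by case: (w2 / w1) => a b /=; ring.
  by rewrite mulr_gt0 // pi_gt0.
have sw1 : s * w1 = Pi by rewrite /s divfK.
clearbody s.
pose S := jS tau; pose p := jp tau.
have [c [D [E [c1 ODE]]]] := jS_ode1 tau0.
have [K K0 HK] := jS_translate tau0.
have [phi [hphi phi0 EP]] := jS_pole tau0.
have Sm := jS_mer tau0.
(* Since the translate by [tau] is [K / S], the equation also holds for [K / S]. Comparing the two
   quartics gives [(E - K ^+ 2 / c ^+ 2) * (S ^+ 4 - K ^+ 2) = 0], and near the pole the second
   factor is not 0. *)
have EK : E = K ^+ 2 / c ^+ 2.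
  have ODE' : dnearc p (fun w => dC S (w + tau) ^+ 2 = S (w + tau) ^+ 4 / c ^+ 2 + D * S (w + tau) ^+ 2 + E).
    exact: (dnearc_shift (ODE (p + tau))).
  have big : nearc p (fun z => phi z ^+ 4 - K ^+ 2 * (z - p) ^+ 4 != 0).
    have cphi := hol_cont (nearc_self hphi).
    have c' : cont_at (fun z => phi z ^+ 4 - K ^+ 2 * (z - p) ^+ 4) p.
      apply: contB; first exact: contX.
      by apply: contM; [exact: cont_cst|apply: contX; apply: contB; [exact: cont_id|exact: cont_cst]].
    by apply: (cont_neq0 c'); rewrite subrr expr0n mulr0 subr0 expf_neq0.
  have all := nearc_and (nearc_and (nearc_and big EP) (nearc_and (ODE p) ODE'))
     (nearc_and (mer_hol_punct (Sm p)) (dnearc_open (HK p))).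
  apply: (@dnearc_extract _ p); apply: nearc_imp all.
  move=> z [[[b1 /(_ _)e1] [/(_ _)e2 /(_ _)e3]] [/(_ _)hS /(_ _)hK]] zp.
  have {}e1 := e1 zp; have {}e2 := e2 zp; have {}e3 := e3 zp; have {}hS := hS zp; have {}hK := hK zp.
  have eK := nearc_self hK.
  have Sz0 : S z != 0 by apply/eqP => e; move: eK; rewrite -/S e mul0r => /esym/eqP; rewrite (negbTE K0).
  have ST : S (z + tau) = K / S z by rewrite -eK mulrC mulKf.
  have dT : dC S (z + tau) = - K * dC S z / S z ^+ 2.
    rewrite -dC_shift.
    have hn : nearc z (fun w => K * (S w)^-1 = S (w + tau)).
      have nz := cont_neq0 (hol_cont hS) Sz0.
      by apply: nearc_imp (nearc_and hK nz) => w [<- nw]; rewrite mulrC mulKf.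
    have := cderiv_near hn (cderivM (cderiv_cst K z) (cderivV Sz0 (dCP hS))).
    by move=> /dC_eq ->; rewrite mul0r add0r; ring.
  rewrite dT ST in e3; rewrite -/S -/p in e1 e2.
  have S4 : S z ^+ 4 - K ^+ 2 != 0.
    apply: contra b1 => /eqP e; rewrite -e1 exprMn.
    have -> : S z ^+ 4 * (z - p) ^+ 4 - K ^+ 2 * (z - p) ^+ 4 = (S z ^+ 4 - K ^+ 2) * (z - p) ^+ 4 by ring.
    by rewrite e mul0r.
  move: e2 e3 S4 Sz0; move: (dC S z) (S z) => X Y e2 e3 S4 Y0; clear - e2 e3 S4 Y0 K0 c1.
  have e4 : X ^+ 2 = K ^+ 2 / c ^+ 2 + D * Y ^+ 2 + E / K ^+ 2 * Y ^+ 4.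
    have -> : X ^+ 2 = (- K * X / Y ^+ 2) ^+ 2 * (Y ^+ 4 / K ^+ 2) by field; rewrite K0 Y0.
    by rewrite e3; field; rewrite K0 Y0 c1.
  have : (E - K ^+ 2 / c ^+ 2) * (Y ^+ 4 - K ^+ 2) = 0.
    have e5 : Y ^+ 4 / c ^+ 2 + D * Y ^+ 2 + E = K ^+ 2 / c ^+ 2 + D * Y ^+ 2 + E / K ^+ 2 * Y ^+ 4.
      by rewrite -e2 -e4.
    have -> : (E - K ^+ 2 / c ^+ 2) * (Y ^+ 4 - K ^+ 2) = K ^+ 2 * ((K ^+ 2 / c ^+ 2 + D * Y ^+ 2 + E / K ^+ 2 * Y ^+ 4)
       - (Y ^+ 4 / c ^+ 2 + D * Y ^+ 2 + E)) by field; rewrite K0 c1.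
    by rewrite e5 subrr mulr0.
  by move=> /eqP; rewrite mulf_eq0 (negbTE S4) orbF subr_eq0 => /eqP.
(* Division by a square root of [K] turns the product of [S] with its translate into 1 and makes the
   quartic palindromic. *)
pose k0 := sqrtc K.
have k2 : k0 ^+ 2 = K := sqr_sqrtc K.
have k00 : k0 != 0 by rewrite sqrtc_eq0.
pose g z := S (s * z) / k0.
pose c0 := s ^+ 2 * K / c ^+ 2.
have c00 : c0 != 0.
  apply: mulf_neq0; last by rewrite invr_eq0; apply: expf_neq0.
  by apply: mulf_neq0 => //; apply: expf_neq0.
exists g, c0, (- s ^+ 2 * D / c0), (p / s).
have sp : s * (p / s) = p by rewrite mulrC divfK.
have lat z : lattice Pi (tau + tau) (s * z) -> lattice w1 (w2 + w2) z.
  move=> [m [n E1]]; exists m, n; apply: (mulfI s0); rewrite E1 mulrDr !mulrzAr mulrDr sw1 //.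
have latP z : ~ lattice w1 (w2 + w2) (z - p / s) -> ~ lattice Pi (tau + tau) (s * z - p).
  by move=> nl l; apply: nl; apply: lat; rewrite mulrBr sp.
split.
- by move=> z; apply: merM; [apply: mer_scale => //; exact: Sm|exact: mer_cst].
- move=> z /latP /(pole_of_jS tau0) /nearc_scale; apply: nearc_imp => w hw.
  by apply: holM; [exact: hol_scale|exact: hol_cst].
- exists (fun z => phi (s * z) / (s * k0)); split.
  + have hphi' : nearc (s * (p / s)) (hol phi) by rewrite sp.
    apply: nearc_imp (nearc_scale hphi') => w hw.
    by apply: holM; [exact: hol_scale|exact: hol_cst].
  + by rewrite sp mulf_neq0 // invr_eq0 mulf_neq0.
  + have EP' : dnearc (s * (p / s)) (fun z => S z * (z - p) = phi z) by rewrite sp.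
    apply: dnearc_imp (dnearc_scale s0 EP') => w <-.
    rewrite /g; move: (S (s * w)) s0 k00; clear; move=> X s0 k00; field; by rewrite s0 k00.
- by move=> z; rewrite /g mulrN /S (jS_even tau0).
- move=> z; have -> : g (z + w1) = jS tau (s * z + pi%:C) / k0 by rewrite /g (mulrDr s) sw1.
  by rewrite (jS_pi tau0) mulNr.
- move=> z; have -> : g (z + (w2 + w2)) = jS tau (s * z + (tau + tau)) / k0 by rewrite /g (mulrDr s) (mulrDr s w2).
  by rewrite (jS_2tau tau0).
- move=> z; apply: dnearc_imp (dnearc_scale s0 (HK (s * z))) => w e.
  have -> : g w * g (w + w2) = (S (s * w) * S (s * w + tau)) / k0 ^+ 2.
    by rewrite /g mulrDr -/tau; field.
  by rewrite e k2 divff.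
- move=> z; have hS := mer_hol_punct (Sm (s * z)).
  apply: nearc_imp (nearc_and (dnearc_scale s0 (ODE (s * z))) (dnearc_scale s0 hS)) => w [e1 e2] wz.
  have {}e1 := e1 wz; have {}e2 := e2 wz.
  have -> : dC g w = s * dC S (s * w) / k0.
    rewrite /g dC_mul; [|exact: hol_scale|exact: hol_cst].
    by rewrite dC_scale // (dC_eq (cderiv_cst _ _)) mulr0 addr0.
  rewrite exprMn exprMn e1 exprVn k2 EK /g /c0 -/S.
  rewrite !exprMn !exprVn (_ : k0 ^+ 4 = K ^+ 2); last by rewrite -k2 -exprM.
  rewrite k2; move: (S (s * w)) s0 K0 c1; clear; move=> X s0 K0 c1.
  by field; rewrite s0 K0 c1.
- exact: c00.
- move=> [m [n E1]]; have : ((n + n)%:~R + 1) * Im tau = 0.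
    have E2 : - p = Pi *~ m + (tau + tau) *~ n.
      by rewrite -[p in LHS]sp -mulrN -[X in s * X]sub0r E1 mulrDr !mulrzAr mulrDr sw1.
    have := congr1 (@complex.Im R) E2.
    rewrite /p /jp -(mulrzl Pi) -(mulrzl (tau + tau)) -(intrC R m) -(intrC R n) intrD.
    move: (n%:~R : R) => u; case: (tau) => x y /= E'.
    move: (m%:~R : R) E' => v E'; lra.
  move=> /eqP; rewrite mulf_eq0 (gt_eqF tau0) orbF addr_eq0 -[1]/(1%:~R) -mulrNz eqr_int => /eqP; lia.
Qed.

End Jacobi.

(** * Values and critical points of the Jacobi-type function *)

Section JacobiTheory.
Variable R : realType.
Local Notation C := R[i].
Variables (w1 w2 : C) (g : C -> C) (c0 kap p : C).
Hypothesis J : jacobi w1 w2 g c0 kap p.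
Hypothesis hw : 0 < Im (w2 / w1).
Implicit Types z w : C.

Local Notation L2 := (lattice w1 (w2 + w2)).

Lemma hol_dnearc_eq (f k : C -> C) z : hol f z -> hol k z ->
  dnearc z (fun w => f w = k w) -> f z = k z.
Proof.
move=> hf hk E; apply/eqP; rewrite -subr_eq0; apply/eqP.
apply: (cont_zero (contB (hol_cont hf) (hol_cont hk))).
by apply: dnearc_imp E => w ->; rewrite subrr.
Qed.

Lemma jac_hol0 : nearc 0 (hol g).
Proof. exact: (j_hol J (j_p J)). Qed.

Lemma jac_ode z : nearc z (hol g) -> dC g z ^+ 2 = c0 * (g z ^+ 4 - kap * g z ^+ 2 + 1).
Proof.
move=> hg; have h0 := nearc_self hg; have h1 := nearc_self (dC_hol hg).
apply: (@hol_dnearc_eq (fun w => dC g w ^+ 2) (fun w => c0 * (g w ^+ 4 - kap * g w ^+ 2 + 1)) z).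
- exact: holX.
- apply: holM; first exact: hol_cst.
  apply: holD; last exact: hol_cst.
  by apply: holB; [exact: holX|apply: holM; [exact: hol_cst|exact: holX]].
- exact: (j_ode J z).
Qed.

Lemma jac_not_const k : ~ dnearc p (fun z => g z = k).
Proof.
move=> E; have [phi [hphi phi0 Ephi]] := j_pole J.
have /negP[] := phi0; apply/eqP.
suff -> : phi p = k * (p - p) by rewrite subrr mulr0.
apply: (@hol_dnearc_eq _ (fun z => k * (z - p)) p (nearc_self hphi)).
  by apply: holM; [exact: hol_cst|exact: hol_subc].
by apply: dnearc_imp (dnearc_and E Ephi) => z [-> ->].
Qed.

(** If the derivative vanished near one point it would vanish near [p], and so would the quartic in
    [g]; multiplied by [(w - p) ^+ 4] the quartic tends to [phi p ^+ 4], which is not 0. *)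
Lemma jac_dC_nz z : dnearc z (fun w => dC g w != 0).
Proof.
case: (mer_zero (mer_dC (j_mer J z))) => // E; exfalso.
have E' := identity (fun z => mer_dC (j_mer J z)) E p.
have [phi [hphi phi0 Ephi]] := j_pole J; have /negP[] := phi0.
have hp := nearc_self hphi.
suff : phi p ^+ 4 - kap * phi p ^+ 2 * (p - p) ^+ 2 + (p - p) ^+ 4 = 0.
  by rewrite subrr !expr0n /= mulr0 subr0 addr0 => /eqP; rewrite expf_eq0 /=.
apply: (@hol_dnearc_eq (fun z => phi z ^+ 4 - kap * phi z ^+ 2 * (z - p) ^+ 2 + (z - p) ^+ 4) (fun=> 0)).
- have hs := hol_subc p p; apply: holD; last exact: holX.
  apply: holB; first exact: holX.
  by apply: holM; [apply: holM; [exact: hol_cst|exact: holX]|exact: holX].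
- exact: hol_cst.
- apply: dnearc_imp (dnearc_and (dnearc_and E' Ephi) (j_ode J p)) => w [[d0 <-] /esym].
  rewrite d0 expr0n /= => /eqP; rewrite mulf_eq0 (negbTE (j_c0 J)) /= => /eqP e.
  have -> : (g w * (w - p)) ^+ 4 - kap * (g w * (w - p)) ^+ 2 * (w - p) ^+ 2 + (w - p) ^+ 4
    = (w - p) ^+ 4 * (g w ^+ 4 - kap * g w ^+ 2 + 1) by ring.
  by rewrite e mulr0.
Qed.

Lemma jac_ode2 z : nearc z (hol g) -> dC (dC g) z = c0 * (2 * g z ^+ 3 - kap * g z).
Proof.
move=> hg; have h0 := nearc_self hg; have h1 := dC_hol hg; have h2 := dC_hol h1.
apply: (@hol_dnearc_eq (dC (dC g)) (fun w => c0 * (2 * g w ^+ 3 - kap * g w)) z).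
- exact: nearc_self h2.
- apply: holM; first exact: hol_cst.
  by apply: holB; apply: holM => //; [exact: hol_cst|exact: holX|exact: hol_cst].
- apply: nearc_imp (nearc_and (nearc_and (nearc_nearc hg) h1) (jac_dC_nz z)) => w [[hgw h1w] nz] wz.
  apply: (mulfI (nz wz)).
  have hw' := nearc_self hgw.
  have E : nearc w (fun v => c0 * (g v ^+ 4 - kap * g v ^+ 2 + 1) = dC g v ^+ 2).
    by apply: nearc_imp (nearc_nearc hgw) => v /jac_ode ->.
  have D1 := cderivX 2 (dCP h1w).
  have D2 := cderivM (cderiv_cst c0 w) (cderivD (cderivB (cderivX 4 (dCP hw'))
     (cderivM (cderiv_cst kap w) (cderivX 2 (dCP hw')))) (cderiv_cst 1 w)).
  have := cderiv_unique D1 (cderiv_near E D2); rewrite /= !mul0r !add0r addr0 expr1.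
  move: (dC (dC g) w) (dC g w) (g w) => u v t e.
  apply: (@mulfI _ (2 : C)); first by rewrite pnatr_eq0.
  by rewrite mulrA e; ring.
Qed.

Local Notation a := (g 0).

Lemma jac_d0 : dC g 0 = 0.
Proof.
have := dC_opp g 0; rewrite (_ : (fun w => g (- w)) = g); last exact/funext/(j_even J).
rewrite oppr0 => /eqP; rewrite -addr_eq0 -mulr2n -mulr_natl mulf_eq0 pnatr_eq0 /= => /eqP //.
Qed.

Lemma jac_root z : nearc z (hol g) -> dC g z = 0 -> g z ^+ 4 - kap * g z ^+ 2 + 1 = 0.
Proof.
move=> /jac_ode E d0; move: E; rewrite d0 expr0n /= => /esym/eqP.
by rewrite mulf_eq0 (negbTE (j_c0 J)) => /eqP.
Qed.

Lemma jac_a_neq0 : a != 0.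
Proof.
apply/eqP => a0; have := jac_root jac_hol0 jac_d0.
by rewrite a0 !expr0n /= mulr0 subr0 add0r => /eqP; rewrite oner_eq0.
Qed.

(** Otherwise the constant [a] would solve the same second-order equation with the same initial
    values as [g], so [g] would be constant, against its pole. *)
Lemma jac_dd0 : dC (dC g) 0 != 0.
Proof.
apply/eqP => e0; apply: (@jac_not_const a).
have hg := jac_hol0; have e1 := jac_ode2 hg.
have hda z : hol g z -> hol (fun w => g w - a) z.
  by move=> hz; apply: holB => //; exact: hol_cst.
have dE z : hol g z -> dC (fun w => g w - a) z = dC g z.
  by move=> hz; have := cderivB (dCP hz) (cderiv_cst a z); rewrite subr0 => /dC_eq.
suff H : nearc 0 (fun w => g w - a = 0).
  have := identity (fun z => merB (j_mer J z) (mer_cst a z)) (nearc_dnearc H) p.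
  by apply: dnearc_imp => w /eqP; rewrite subr_eq0 => /eqP.
apply: (@ode_unique _ (fun w => g w - a) (fun w => c0 * (2 * (g w ^+ 2 + g w * a + a ^+ 2) - kap))).
- by apply: nearc_imp hg => w; exact: hda.
- apply: nearc_imp hg => w hz; apply: holM; first exact: hol_cst.
  apply: holB; last exact: hol_cst.
  apply: holM; first exact: hol_cst.
  apply: holD; last exact: hol_cst.
  by apply: holD; [exact: holX|apply: holM => //; exact: hol_cst].
- apply: nearc_imp (nearc_nearc hg) => w hgw.
  have -> : dC (dC (fun w => g w - a)) w = dC (dC g) w.
    apply: dC_eq; apply: (cderiv_near _ (dCP (nearc_self (dC_hol hgw)))).
    by apply: nearc_imp hgw => v /dE.
  have -> : dC (dC g) w = dC (dC g) w - dC (dC g) 0 by rewrite e0 subr0.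
  by rewrite (jac_ode2 hgw) e1; ring.
- by rewrite subrr.
- by rewrite dE ?jac_d0 //; exact: nearc_self hg.
Qed.

(** The translate of [g] by [z1] solves the same second-order equation with the same values at 0, so
    [z1] is a period. Outside [L2] it would move the pole [p] to a regular point. *)
Lemma jac_unique z1 : nearc z1 (hol g) -> g z1 = a -> dC g z1 = 0 -> L2 z1.
Proof.
move=> hz gz dz; apply: contrapT => nl.
have nl' : ~ L2 (p + z1 - p) by rewrite (_ : p + z1 - p = z1) //; ring.
have hp := j_hol J nl'.
have hg := jac_hol0.
pose d t := g (t + z1) - g t.
have hz' : nearc 0 (fun t => hol g (t + z1)) by apply: (@nearc_shift _ 0 z1 (hol g)); rewrite add0r.
have hsh z : hol g (z + z1) -> hol (fun t => g (t + z1)) z.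
  move=> hq; apply: (@hol_comp _ (fun t => t + z1) g) => //.
  by apply: holD; [exact: hol_id|exact: hol_cst].
have dE z : hol g (z + z1) -> hol g z -> dC d z = dC g (z + z1) - dC g z.
  move=> h1 h2; rewrite -dC_shift; apply: dC_eq; apply: cderivB; exact/dCP/hsh || exact: dCP.
have H : nearc 0 (fun t => d t = 0).
  apply: (@ode_unique _ d (fun t => c0 * (2 * (g (t + z1) ^+ 2 + g (t + z1) * g t + g t ^+ 2) - kap))).
  - by apply: nearc_imp (nearc_and hz' hg) => t [/hsh h1 h2]; exact: holB.
  - apply: nearc_imp (nearc_and hz' hg) => t [/hsh h1 h2].
    apply: holM; first exact: hol_cst.
    apply: holB; last exact: hol_cst.
    apply: holM; first exact: hol_cst.
    apply: holD; last exact: holX.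
    by apply: holD; [exact: holX|exact: holM].
  - apply: nearc_imp (nearc_and (nearc_nearc hz') (nearc_nearc hg)) => t [ht hgt].
    have hgt' : nearc (t + z1) (hol g).
      have := nearc_shift (z := t + z1) (a := - z1) (P := fun t => hol g (t + z1)).
      rewrite addrK => /(_ ht); apply: nearc_imp => v; by rewrite subrK.
    have -> : dC (dC d) t = dC (dC g) (t + z1) - dC (dC g) t.
      have h1 := nearc_self (dC_hol hgt'); have h2 := nearc_self (dC_hol hgt).
      rewrite -dC_shift; apply: dC_eq.
      apply: (@cderiv_near _ (fun t => dC g (t + z1) - dC g t)).
        by apply: nearc_imp (nearc_and ht hgt) => v [h3 h4]; rewrite dE.
      apply: cderivB; last exact: dCP.
      by apply: dCP; apply: (@hol_comp _ (fun t => t + z1) (dC g)) => //; apply: holD; [exact: hol_id|exact: hol_cst].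
    by rewrite (jac_ode2 hgt') (jac_ode2 hgt) /d; ring.
  - by rewrite /d add0r gz subrr.
  - rewrite dE ?add0r ?dz ?jac_d0 ?subrr //; [exact: nearc_self hz|exact: nearc_self hg].
have Hp := identity (fun z => merB (mer_shift (j_mer J (z + z1))) (j_mer J z)) (nearc_dnearc H) p.
have [phi [hphi phi0 Ephi]] := j_pole J; have /negP[] := phi0; apply/eqP.
suff -> : phi p = g (p + z1) * (p - p) by rewrite subrr mulr0.
apply: (@hol_dnearc_eq _ (fun z => g (z + z1) * (z - p)) p (nearc_self hphi)).
  by apply: holM; [apply: hsh; exact: nearc_self hp|exact: hol_subc].
apply: dnearc_imp (dnearc_and Hp Ephi) => z [/eqP]; rewrite subr_eq0 => /eqP -> <- //.
Qed.

Lemma jac_L2_sign v : L2 v -> exists2 e : C, e ^+ 2 = 1 & forall z, g (z + v) = e * g z.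
Proof.
move=> [m [n ->]].
have H (k : nat) z : g (z + w1 *+ k) = (-1) ^+ k * g z.
  elim: k => [|k IH]; first by rewrite mulr0n addr0 expr0 mul1r.
  by rewrite mulrSr addrA (j_w1 J) IH exprS mulN1r mulNr.
have [e e1 He] : exists2 e : C, e ^+ 2 = 1 & forall z, g (z + w1 *~ m) = e * g z.
  case: (intP m) => [|k|k].
  - by exists 1; rewrite ?expr1n // => z; rewrite mulr0z addr0 mul1r.
  - by exists ((-1) ^+ k.+1); [rewrite sqrr_sign|move=> z; rewrite -pmulrn H].
  - exists ((-1) ^+ k.+1); first by rewrite sqrr_sign.
    move=> z; rewrite -[z in RHS](subrK (w1 *+ k.+1)) H mulrA -expr2 sqrr_sign mul1r.
    by rewrite mulrNz -pmulrn.
by exists e => // z; rewrite addrA (periodic_mulz (j_2w2 J)) He.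
Qed.

Lemma jac_pole_at v : L2 (v - p) -> exists phi, [/\ nearc v (hol phi), phi v != 0 &
    dnearc v (fun z => g z * (z - v) = phi z)].
Proof.
move=> /jac_L2_sign[e e1 He]; have [phi [hphi phi0 Ephi]] := j_pole J.
have vp : v - (v - p) = p by ring.
have e0 : e != 0 by apply: contra_eq_neq e1 => ->; rewrite expr0n eq_sym oner_eq0.
exists (fun z => e * phi (z - (v - p))); split.
- have H : nearc (v - (v - p)) (hol phi) by rewrite vp.
  apply: nearc_imp (nearc_shift H) => w hh; apply: holM; first exact: hol_cst.
  by apply: (@hol_comp _ (fun w => w - (v - p)) phi) => //; exact: hol_subc.
- by rewrite vp mulf_neq0.
- have H : dnearc (v - (v - p)) (fun z => g z * (z - p) = phi z) by rewrite vp.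
  apply: dnearc_imp (dnearc_shift H) => w <-.
  by rewrite mulrA -He subrK; congr (_ * _); ring.
Qed.

Lemma jac_inv_hol z : nearc z (hol g) -> g z != 0 -> ~ L2 (z + w2 - p).
Proof.
move=> hg gz /jac_pole_at[phi [hphi phi0 Ephi]].
suff : phi (z + w2) * g z = z - z by rewrite subrr => /eqP; rewrite mulf_eq0 (negbTE phi0) (negbTE gz).
apply: (@hol_dnearc_eq (fun w => phi (w + w2) * g w) (fun w => w - z) z).
- apply: holM; last exact: nearc_self hg.
  apply: (@hol_comp _ (fun w => w + w2) phi); last exact: nearc_self hphi.
  by apply: holD; [exact: hol_id|exact: hol_cst].
- exact: hol_subc.
- apply: dnearc_imp (dnearc_and (j_w2 J z) (dnearc_shift Ephi)) => w [e1 <-].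
  have -> : w + w2 - (z + w2) = w - z by ring.
  by rewrite mulrAC [g (w + w2) * _]mulrC e1 mul1r.
Qed.

Lemma jac_inv z : nearc z (hol g) -> nearc (z + w2) (hol g) -> g z * g (z + w2) = 1.
Proof.
move=> h1 h2; apply: (@hol_dnearc_eq (fun w => g w * g (w + w2)) (fun=> 1) z).
- apply: holM; first exact: nearc_self h1.
  apply: (@hol_comp _ (fun w => w + w2) g); last exact: nearc_self h2.
  by apply: holD; [exact: hol_id|exact: hol_cst].
- exact: hol_cst.
- exact: (j_w2 J z).
Qed.

Lemma half_not_L2 : ~ L2 w2.
Proof.
move=> [m [n E]]; have w10 := Im_div_neq0 hw.
have : ((n + n)%:~R - 1) * Im (w2 / w1) = 0.
  have E1 : w2 / w1 = m%:~R + ((w2 / w1) + (w2 / w1)) * n%:~R.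
    rewrite {1}E -(mulrzl w1) -(mulrzl (w2 + w2)); field; exact: w10.
  have := congr1 (@complex.Im R) E1.
  rewrite -(intrC R m) -(intrC R n) intrD.
  move: (n%:~R : R) => u; case: (w2 / w1) => x y /= E'.
  have {}E' : y = 2 * u * y by rewrite [LHS]E'; ring.
  by rewrite mulrBl mul1r {2}E'; ring.
move=> /eqP; rewrite mulf_eq0 (gt_eqF hw) orbF subr_eq0 -[1]/(1%:~R) eqr_int => /eqP; lia.
Qed.

Lemma jac_pole_zero z : L2 (z - p) -> nearc (z + w2) (hol g) /\ g (z + w2) = 0.
Proof.
move=> l; have nl : ~ L2 (z + w2 - p).
  move=> l'; apply: half_not_L2; have := latticeD l' (latticeN l).
  by rewrite (_ : z + w2 - p - (z - p) = w2) //; ring.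
have hg := j_hol J nl; split=> //.
have [phi [hphi phi0 Ephi]] := jac_pole_at l.
suff : phi z * g (z + w2) = z - z by rewrite subrr => /eqP; rewrite mulf_eq0 (negbTE phi0) => /eqP.
apply: (@hol_dnearc_eq (fun w => phi w * g (w + w2)) (fun w => w - z) z).
- apply: holM; first exact: nearc_self hphi.
  apply: (@hol_comp _ (fun w => w + w2) g); last exact: nearc_self hg.
  by apply: holD; [exact: hol_id|exact: hol_cst].
- exact: hol_subc.
- by apply: dnearc_imp (dnearc_and (j_w2 J z) Ephi) => w [e1 <-]; rewrite mulrAC e1 mul1r.
Qed.

Lemma L2_sub z : L2 z -> lattice w1 w2 z.
Proof.
move=> [m [n ->]]; exists m, (n + n); by rewrite mulrzDr mulrzDl.
Qed.

(** The quartic is even and palindromic, so its roots are [a], [- a] and their inverses. The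
    translations by [w1] and [w2] change the sign and invert, which reduces every case to the value
    [a] of [jac_unique]. *)
Lemma jac_crit z : nearc z (hol g) -> dC g z = 0 -> lattice w1 w2 z.
Proof.
move=> hg dz; have r1 := jac_root hg dz; have r0 := jac_root jac_hol0 jac_d0.
have a0 := jac_a_neq0.
have gz0 : g z != 0.
  by apply/eqP => e; move: r1; rewrite e !expr0n /= mulr0 subr0 add0r => /eqP; rewrite oner_eq0.
have step y : nearc y (hol g) -> dC g y = 0 -> g y ^+ 2 = a ^+ 2 -> lattice w1 w2 y.
  move=> hy dy /eqP; rewrite eqf_sqr => /orP[/eqP e|/eqP e].
    exact/L2_sub/jac_unique.
  have sh : (fun t => g (t + w1)) = (fun t => - g t) by apply/funext => t; rewrite (j_w1 J).
  have hy' : nearc (y + w1) (hol g).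
    have := nearc_shift (z := y + w1) (a := - w1) (P := hol g); rewrite addrK => /(_ hy).
    apply: nearc_imp => v hv.
    have -> : g = (fun t => - g (t - w1)) by apply/funext => t; rewrite -(j_w1 J) subrK.
    apply: holN; apply: (@hol_comp _ (fun t => t - w1) g) => //; exact: hol_subc.
  have dy' : dC g (y + w1) = 0.
    by rewrite -dC_shift sh; have := cderivN (dCP (nearc_self hy)); rewrite dy oppr0 => /dC_eq.
  have gy' : g (y + w1) = a by rewrite (j_w1 J) e opprK.
  have := latticeD (L2_sub (jac_unique hy' gy' dy')) (latticeN (lattice_l w1 w2)).
  by rewrite addrK.
have : (g z ^+ 2 - a ^+ 2) * (g z ^+ 2 * a ^+ 2 - 1) = 0.
  have -> : (g z ^+ 2 - a ^+ 2) * (g z ^+ 2 * a ^+ 2 - 1) =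
    a ^+ 2 * (g z ^+ 4 - kap * g z ^+ 2 + 1) - g z ^+ 2 * (a ^+ 4 - kap * a ^+ 2 + 1) by ring.
  by rewrite r1 r0 !mulr0 subrr.
move=> /eqP; rewrite mulf_eq0 !subr_eq0 => /orP[/eqP e|/eqP e]; first exact: step.
have hg' := j_hol J (jac_inv_hol hg gz0).
have gi := jac_inv hg hg'.
have dz' : dC g (z + w2) = 0.
  have o := jac_ode hg'; apply/eqP; suff : dC g (z + w2) ^+ 2 == 0 by rewrite expf_eq0.
  rewrite o mulf_eq0; apply/orP; right.
  have gw : g (z + w2) = (g z)^-1 by rewrite -[LHS]mul1r -(mulVf gz0) -mulrA gi mulr1.
  rewrite gw; apply/eqP; apply: (mulfI (expf_neq0 4 gz0)); rewrite mulr0 -[RHS]r1; field.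
  exact: gz0.
have := latticeD (step _ hg' dz' _) (latticeN (lattice_r w1 w2)); rewrite addrK; apply.
apply: (mulfI (expf_neq0 2 gz0)); rewrite -exprMn gi expr1n; exact: esym.
Qed.

End JacobiTheory.

(* [ring] is slow on literal polynomials unless the constants and 'X are opaque. *)
Ltac pring :=
  repeat match goal with |- context [polyC ?c] => move: (polyC c) => ? end;
  repeat match goal with |- context [polyX ?r] => move: (polyX r) => ? end;
  ring.

(** * Polynomial solutions of a Lame equation *)

Section Lame.
Variable R : realType.
Local Notation C := R[i].
Variables (m : nat) (kap : C).
Local Notation l := (m.*2.+1).
Implicit Types (gam x : C) (W V : {poly C}).

Local Notation quart := ('X^4 - kap *: 'X^2 + 1 : {poly C}).

(** The operator sends [X^j] to a combination of [X^(j + 2)], [X^j] and [X^(j - 2)]. The first and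
    second coefficients for [j = 2 k] are [lame_up k] and [gam - lame_mid k]; the third, for
    [j = 2 k + 2], is [lame_dn k]. *)
Definition lame_up (k : nat) : C := (k.*2%:R - l%:R) * (k.*2%:R + 1 - l%:R).
Definition lame_dn (k : nat) : C := k.*2.+2%:R * k.*2.+1%:R.
Definition lame_mid (k : nat) : C := kap * k.*2%:R * (k.*2%:R - l%:R).

(** Two consecutive coefficients of the power series solution, as polynomials in the unknown [gam].
    For [k' = 0] the entry [u] is 0, so the truncated predecessor does no harm. *)
Fixpoint lame_rec (k : nat) : {poly C} * {poly C} :=
  if k is k'.+1 then
    let: (u, v) := lame_rec k' in
    (v, - (lame_dn k')^-1 *: (lame_up k'.-1 *: u + ('X - (lame_mid k')%:P) * v))
  else (0, 1).

Definition lame_coef k := (lame_rec k).2.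

Lemma lame_dn_neq0 k : lame_dn k != 0.
Proof. by rewrite mulf_neq0 // pnatr_eq0. Qed.

Lemma lame_rec1 k : (lame_rec k.+1).1 = lame_coef k.
Proof. by rewrite /lame_coef /=; case: (lame_rec k). Qed.

Lemma lame_coefS k : lame_coef k.+1 =
  - (lame_dn k)^-1 *: (lame_up k.-1 *: (lame_rec k).1 + ('X - (lame_mid k)%:P) * lame_coef k).
Proof. by rewrite {1}/lame_coef /lame_coef /=; case: (lame_rec k). Qed.

Lemma size_lame_rec k : (size (lame_rec k).1 <= k)%N /\ size (lame_coef k) = k.+1.
Proof.
elim: k => [|k [IH1 IH2]]; first by split; [exact: eq_leq (size_poly0 _)|exact: size_poly1].
rewrite lame_rec1 IH2; split=> //; rewrite lame_coefS size_scale; last first.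
  by rewrite oppr_eq0 invr_eq0 lame_dn_neq0.
have s1 : size (('X - (lame_mid k)%:P) * lame_coef k) = k.+2.
  by rewrite size_monicM ?monicXsubC -?size_poly_eq0 ?IH2 // size_XsubC.
rewrite addrC size_polyDl s1 // ltnS; apply: (leq_trans (size_scale_leq _ _)); exact: (leq_trans IH1 (leqnSn k)).
Qed.

(** Because [lame_up m] is 0, the series terminates as soon as its coefficient of index [m + 1]
    vanishes. This is one equation of degree [m + 1] in [gam], solvable over the complex numbers. *)
Lemma lame_root : exists gam, root (lame_coef m.+1) gam.
Proof. by apply/closed_rootP; rewrite (size_lame_rec _).2. Qed.

Section Gam.
Variable gam : C.
Hypothesis hgam : root (lame_coef m.+1) gam.

Definition lame_a k : C := (lame_coef k).[gam].

Lemma lame_a0 : lame_a 0 = 1.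
Proof. by rewrite /lame_a /lame_coef /= hornerC. Qed.

Lemma lame_a1 : lame_dn 0 * lame_a 1 = - gam.
Proof.
rewrite /lame_a lame_coefS /= /lame_coef /= scaler0 add0r mulr1 hornerZ hornerXsubC.
by rewrite mulNr mulrN mulrA divff ?lame_dn_neq0 // mul1r /lame_mid mulr0 mul0r subr0.
Qed.

Lemma lame_aS k : lame_dn k.+1 * lame_a k.+2 =
  - (lame_up k * lame_a k + (gam - lame_mid k.+1) * lame_a k.+1).
Proof.
rewrite /lame_a lame_coefS lame_rec1 /= hornerZ hornerD hornerM hornerXsubC hornerZ.
by rewrite mulNr mulrN mulrA divff ?lame_dn_neq0 // mul1r.
Qed.

Lemma lame_end : lame_a m.+1 = 0.
Proof. exact/eqP. Qed.

Lemma lame_up_neq0 k : (k < m)%N -> lame_up k != 0.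
Proof.
move=> km; rewrite /lame_up mulf_neq0 //.
  by rewrite subr_eq0 eqr_nat; apply/eqP; lia.
by rewrite subr_eq0 natr1 eqr_nat; apply/eqP; lia.
Qed.

(** If it vanished, two consecutive coefficients would vanish and the recurrence, run downwards with
    [lame_up k] nonzero for [k < m], would reach [lame_a 0 = 1]. *)
Lemma lame_am_neq0 : lame_a m != 0.
Proof.
apply/eqP => am; have H k : (k <= m)%N -> lame_a (m - k) = 0 /\ lame_a (m - k).+1 = 0.
  elim: k => [|k IH] km; first by rewrite subn0 am lame_end.
  have [e1 e2] := IH (ltnW km); have e : (m - k = (m - k.+1).+1)%N by lia.
  rewrite e in e1 e2; split=> //; have := lame_aS (m - k.+1); rewrite e1 e2 !mulr0 addr0.
  move=> /esym/eqP; rewrite oppr_eq0 mulf_eq0 (negbTE (lame_up_neq0 _)) //; [by move=> /eqP|lia].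
by have := (H m (leqnn m)).1; rewrite subnn lame_a0 => /eqP; rewrite oner_eq0.
Qed.

Definition lame_pot : {poly C} := (l%:R * (l%:R - 1)) *: 'X^2 + gam%:P.

Definition lame_op W : {poly C} :=
  quart * W^`()^`() - m%:R * quart^`() * W^`() + lame_pot * W.

Lemma lame_opD W V : lame_op (W + V) = lame_op W + lame_op V.
Proof.
rewrite /lame_op; move: quart lame_pot => q s.
rewrite !derivD; move: (m%:R * q^`()) W^`()^`() V^`()^`() W^`() V^`() => c W2 V2 W1 V1; ring.
Qed.

Lemma lame_opZ (k : C) W : lame_op (k *: W) = k *: lame_op W.
Proof.
rewrite /lame_op; move: quart lame_pot => q s.
by rewrite !derivZ -!scalerAr scalerDr scalerBr.
Qed.

Lemma X_derivXn j : 'X * ('X^j)^`() = j%:R * 'X^j :> {poly C}.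
Proof.
case: j => [|j]; first by rewrite expr0 derivC mulr0 mul0r.
by rewrite derivXn -mulr_natl mulrCA -exprS.
Qed.

Lemma X2_derivXn j : 'X^2 * ('X^j)^`()^`() = j%:R * (j%:R - 1) * 'X^j :> {poly C}.
Proof.
case: j => [|[|j]].
- by rewrite expr0 derivC deriv0 mulr0 !mul0r.
- by rewrite expr1 derivX derivC subrr mulr0 mulr0 mul0r.
- rewrite !derivXn derivMn derivXn -[in RHS]natr1 addrK -[X in X *+ j.+2]mulr_natl -mulr_natl /=.
  rewrite !exprS; pring.
Qed.

Lemma quart_deriv : quart^`() = 4 * 'X^3 - 2 * kap%:P * 'X :> {poly C}.
Proof.
rewrite derivD derivB derivZ !derivXn derivC addr0 -mul_polyC /= expr1; pring.
Qed.

Lemma lame_opXn j : 'X^2 * lame_op 'X^j =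
  'X^j * (((j%:R - l%:R) * (j%:R + 1 - l%:R))%:P * 'X^4 + (gam - kap * j%:R * (j%:R - l%:R))%:P * 'X^2
          + (j%:R * (j%:R - 1))%:P).
Proof.
rewrite /lame_op /lame_pot quart_deriv mulrDr mulrBr.
have -> : 'X^2 * (quart * ('X^j)^`()^`()) = quart * ('X^2 * ('X^j)^`()^`()) by pring.
have -> : 'X^2 * (m%:R * (4 * 'X^3 - 2 * kap%:P * 'X) * ('X^j)^`()) =
  m%:R * (4 * 'X^4 - 2 * kap%:P * 'X^2) * ('X * ('X^j)^`()) :> {poly C} by pring.
rewrite X2_derivXn X_derivXn -!mul_polyC !(polyCD, polyCM, polyCB, polyCN) !polyC_natr.
have -> : l%:R = m%:R * 2 + 1 :> {poly C} by rewrite -muln2 -[in LHS]natr1 natrM.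
rewrite !polyC1; pring.
Qed.

Lemma lame_opZXn (k : C) j : 'X^2 * lame_op (k *: 'X^j) = k%:P * ('X^2 * lame_op 'X^j).
Proof. by rewrite lame_opZ -mul_polyC mulrCA. Qed.

Definition lame_P n : {poly C} := \sum_(k < n) lame_a k *: 'X^(k.*2).
Definition lame_Q n : {poly C} := \sum_(k < n) lame_a k *: 'X^(l - k.*2).

Lemma lame_PS n : lame_P n.+1 = lame_P n + lame_a n *: 'X^(n.*2).
Proof. by rewrite /lame_P big_ord_recr. Qed.

Lemma lame_QS n : lame_Q n.+1 = lame_Q n + lame_a n *: 'X^(l - n.*2).
Proof. by rewrite /lame_Q big_ord_recr. Qed.

(** The recurrence cancels all degrees except the two highest, and those vanish for [n = m].
    Multiplication by [X^2] avoids the exponent [j - 2]. *)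
Lemma lame_P_part n : 'X^2 * lame_op (lame_P n.+1) =
  'X^(n.*2) * 'X^2 * ((- (lame_dn n * lame_a n.+1))%:P + (lame_up n * lame_a n)%:P * 'X^2).
Proof.
elim: n => [|n IH].
  rewrite lame_PS /lame_P big_ord0 add0r lame_opZ lame_a0 scale1r lame_opXn lame_a1 opprK.
  rewrite /lame_up mulr1 !(mulr0, mul0r, subr0, polyC0, addr0); pring.
rewrite lame_PS lame_opD mulrDr IH lame_opZXn lame_opXn lame_aS opprK.
rewrite /lame_up /lame_mid /lame_dn doubleS.
rewrite !(exprS _ n.*2.+1) !(exprS _ n.*2).
rewrite !(polyCD, polyCM, polyCB, polyCN) !polyC_natr -!natr1 !polyC1; pring.
Qed.

(** The mirror image of [lame_P_part] under inversion of the variable, with the same coefficients;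
    the factor [X^(n.*2)] clears the subtraction in the exponents. *)
Lemma lame_Q_part n : (n <= m)%N -> 'X^(n.*2) * ('X^2 * lame_op (lame_Q n.+1)) =
  'X^l * ((- (lame_dn n * lame_a n.+1))%:P * 'X^2 + (lame_up n * lame_a n)%:P).
Proof.
elim: n => [|n IH] nm.
  rewrite lame_QS /lame_Q big_ord0 add0r lame_opZ lame_a0 scale1r lame_opXn lame_a1 opprK.
  rewrite subn0 /lame_up expr0 mul1r mulr1 !subrr.
  rewrite !(mulr0, mul0r, subr0, polyC0, addr0, add0r) !(polyCD, polyCM, polyCB, polyCN) !polyC_natr !polyC1; pring.
rewrite lame_QS lame_opD mulrDr mulrDr lame_opZXn doubleS.
have E : 'X^l = 'X^(l - n.*2.+2) * 'X^(n.*2.+2) :> {poly C} by rewrite -exprD subnK //; lia.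
have E2 : (l - n.*2.+2)%:R = l%:R - n.*2.+2%:R :> C by rewrite natrB //; lia.
rewrite lame_opXn.
have -> : 'X^(n.*2.+2) * ('X^2 * lame_op (lame_Q n.+1)) = 'X^2 * ('X^(n.*2) * ('X^2 * lame_op (lame_Q n.+1))).
  by rewrite !exprS; pring.
rewrite (IH (ltnW nm)) lame_aS opprK E2 E.
rewrite /lame_up /lame_mid /lame_dn doubleS.
rewrite !(polyCD, polyCM, polyCB, polyCN) !polyC_natr -!natr1 !polyC1; pring.
Qed.

Local Notation P := (lame_P m.+1).
Local Notation Q := (lame_Q m.+1).

Lemma lame_up_m : lame_up m = 0.
Proof. by rewrite /lame_up natr1 subrr mulr0. Qed.

Lemma lame_opP : lame_op P = 0.
Proof.
apply: (@mulfI _ 'X^2); first by rewrite -size_poly_eq0 size_polyXn.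
by rewrite lame_P_part lame_end lame_up_m mul0r !mulr0 oppr0 polyC0 mul0r addr0 !mulr0.
Qed.

Lemma lame_opQ : lame_op Q = 0.
Proof.
apply: (@mulfI _ 'X^2); first by rewrite -size_poly_eq0 size_polyXn.
apply: (@mulfI _ 'X^(m.*2)); first by rewrite -size_poly_eq0 size_polyXn.
by rewrite lame_Q_part // lame_end lame_up_m mul0r !mulr0 oppr0 polyC0 !mul0r addr0 !mulr0.
Qed.

Local Notation Wr := (P * Q^`() - P^`() * Q).

Lemma wronskian_ode : quart * Wr^`() = m%:R * quart^`() * Wr.
Proof.
have : P * lame_op Q - Q * lame_op P = 0 by rewrite lame_opP lame_opQ !mulr0 subrr.
rewrite /lame_op derivB !derivM.
set q := quart; move: lame_pot q^`() => s q'.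
move: P P^`() P^`()^`() Q Q^`() Q^`()^`() (m%:R : {poly C}) => u u' u'' v v' v'' M E.
apply/eqP; rewrite -subr_eq0 -E; apply/eqP; ring.
Qed.

(** The point 0 is regular for this first-order equation, as [quart] is 1 there. If
    [V = W * 'X^n.+1] with [W.[0]] nonzero, the lowest terms give [n.+1%:R * W.[0] = 0]. *)
Lemma quart_ode_unique V : quart * V^`() = m%:R * quart^`() * V -> V.[0] = 0 -> V = 0.
Proof.
move=> E V0; apply/eqP/negPn/negP => Vn.
have [n [W W0 EV]] : exists n, exists2 W : {poly C}, ~~ root W 0 & V = W * 'X ^+ n.
  by have [n [W + EV]] := multiplicity_XsubC V 0; rewrite Vn subr0 in EV * => W0; exists n, W.
have n0 : (0 < n)%N.
  by case: n EV => // EV; rewrite EV expr0 mulr1 in V0; rewrite /root V0 eqxx in W0.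
case: n n0 EV => // n _ EV.
have H : (quart * (W^`() * 'X + n.+1%:R * W) - m%:R * quart^`() * W * 'X) * 'X^n = 0.
  have := E; rewrite EV derivM derivXn /= -mulr_natl => /eqP; rewrite -subr_eq0 => /eqP E'.
  rewrite -E' (exprS _ n); move: quart^`() quart W^`() => q' q W'; pring.
move/eqP: H; rewrite mulf_eq0 orbC -size_poly_eq0 size_polyXn /= => /eqP.
move=> /(congr1 (fun p => p.[0])); rewrite hornerD hornerN hornerM [X in X - _]mulrC hornerD.
rewrite !hornerM !hornerX !mulr0 add0r subr0 !hornerE /= -polyC_natr hornerC.
rewrite !expr0n /= mulr0 subr0 add0r mulr1 => /eqP.
by rewrite mulf_eq0 pnatr_eq0 /= => W0'; rewrite /root W0' in W0.
Qed.

Lemma lame_P0 : P.[0] = 1.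
Proof.
rewrite /lame_P big_ord_recl /= lame_a0 scale1r expr0 hornerD hornerC horner_sum big1 ?addr0 //.
by move=> i _; rewrite hornerZ hornerXn expr0n /= mulr0.
Qed.

Lemma lame_Q0 : Q.[0] = 0.
Proof.
rewrite /lame_Q horner_sum big1 // => i _.
rewrite hornerZ hornerXn (_ : (l - i.*2 = (m - i).*2.+1)%N) ?exprS ?mul0r ?mulr0 //.
have := ltn_ord i; lia.
Qed.

Lemma lame_dQ0 : Q^`().[0] = lame_a m.
Proof.
rewrite lame_QS derivD derivZ (_ : (l - m.*2 = 1)%N); last lia.
rewrite expr1 derivX hornerD hornerZ hornerC mulr1 /lame_Q (big_morph _ (@derivD C) (@deriv0 C)) horner_sum big1 ?add0r // => i _.
rewrite derivZ derivXn hornerZ hornerMn hornerXn.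
rewrite (_ : ((l - i.*2).-1 = (m - i.+1).*2.+2)%N) ?exprS ?mul0r ?mul0rn ?mulr0 //.
have := ltn_ord i; lia.
Qed.

Lemma deriv_exp_ode (q : {poly C}) n (k : C) :
  q * (k *: q ^+ n)^`() = n%:R * q^`() * (k *: q ^+ n).
Proof.
rewrite derivZ deriv_exp -!mul_polyC; case: n => [|n] /=; first by rewrite mulr0n !mulr0 !mul0r.
by rewrite exprS -mulr_natl; move: q^`() => q'; pring.
Qed.

(** Both sides solve the equation of [wronskian_ode], and at 0 both equal [lame_a m], the derivative
    of [Q] there. *)
Lemma wronskian : Wr = lame_a m *: quart ^+ m.
Proof.
apply/eqP; rewrite -subr_eq0; apply/eqP; apply: quart_ode_unique.
  rewrite derivB mulrBr wronskian_ode [RHS]mulrBr; congr (_ - _).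
  exact: deriv_exp_ode.
rewrite hornerD hornerN hornerD hornerN !hornerM lame_P0 lame_Q0 lame_dQ0 mul1r mulr0 subr0.
rewrite hornerZ horner_exp !hornerE /= !expr0n /= mulr0 subr0 add0r expr1n mulr1 subrr //.
Qed.

Lemma lame_P_even x : P.[- x] = P.[x].
Proof.
rewrite /lame_P !horner_sum; apply: eq_bigr => i _; rewrite !hornerZ !hornerXn.
by rewrite -mul2n !exprM sqrrN.
Qed.

Lemma lame_Q_odd x : Q.[- x] = - Q.[x].
Proof.
rewrite /lame_Q !horner_sum -sumrN; apply: eq_bigr => i _; rewrite !hornerZ !hornerXn.
have -> : (l - i.*2 = (m - i).*2.+1)%N by have := ltn_ord i; lia.
by rewrite !exprS -mul2n !exprM sqrrN mulNr mulrN.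
Qed.

Lemma lame_QV x : x != 0 -> Q.[x] = x ^+ l * P.[x^-1].
Proof.
move=> x0; rewrite /lame_Q /lame_P !horner_sum mulr_sumr; apply: eq_bigr => i _.
rewrite !hornerZ !hornerXn mulrCA exprVn -expfB_cond ?(negbTE x0) //=.
have := ltn_ord i; lia.
Qed.

Lemma lame_PV x : x != 0 -> P.[x] = x ^+ l * Q.[x^-1].
Proof.
move=> x0; rewrite lame_QV ?invr_eq0 // invrK mulrA -exprMn divff // expr1n mul1r //.
Qed.

Lemma size_lame_P : (size P <= l)%N.
Proof.
rewrite /lame_P; apply: (leq_trans (size_sum _ _ _)); apply/bigmax_leqP => i _.
apply: (leq_trans (size_scale_leq _ _)); rewrite size_polyXn.
by have := ltn_ord i; lia.
Qed.

Hypothesis hkap : kap ^+ 2 != 4.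

(** By [hkap] the roots of the quartic are simple, and the exponents of the equation at such a root
    are 0 and [m + 1]. A solution vanishing there has therefore order [m + 1]. *)
Lemma lame_order x : root quart x -> root P x -> ('X - x%:P) ^+ m.+1 %| P.
Proof.
move=> qx0; have [q Eq] : exists q : {poly C}, quart = q * ('X - x%:P) by exact/factor_theorem.
move=> Px {qx0}.
have P0 : P != 0 by apply/eqP => e; have := lame_P0; rewrite e hornerC => /eqP; rewrite eq_sym oner_eq0.
have qx : q.[x] != 0.
  have e0 : quart.[x] = 0 by rewrite Eq hornerM hornerXsubC subrr mulr0.
  have e1 : quart^`().[x] = q.[x].
    by rewrite Eq derivM derivXsubC mulr1 hornerD hornerM hornerXsubC subrr mulr0 add0r.
  rewrite -e1 quart_deriv; apply: contra hkap => /eqP e2.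
  move: e0 e2; rewrite !hornerE /= => e0 e2.
  have e3 : x ^+ 2 * (2 * x ^+ 2 - kap) = 0.
    apply: (@mulfI _ (2 : C)); first by rewrite pnatr_eq0.
    by rewrite mulr0 -(mulr0 x) -e2; ring.
  have e4 : 2 * x ^+ 2 = kap.
    move/eqP: e3; rewrite mulf_eq0 expf_eq0 /= => /orP[/eqP x0|]; last by rewrite subr_eq0 => /eqP.
    by move: e0 => /eqP; rewrite x0 expr0n /= mulr0 subr0 add0r oner_eq0.
  have e5 : x ^+ 4 = 1.
    have -> : x ^+ 4 = 1 - (x ^+ 4 - kap * x * x + 1) by rewrite -e4; ring.
    by rewrite e0 subr0.
  apply/eqP; have -> : kap ^+ 2 = 4 * x ^+ 4 by rewrite -e4; ring.
  by rewrite e5 mulr1.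
have [n [W W0 EP]] : exists n, exists2 W : {poly C}, ~~ root W x & P = W * ('X - x%:P) ^+ n.
  by have [n [W + EP]] := multiplicity_XsubC P x; rewrite P0 => W0; exists n, W.
case: n EP => [EP|n EP]; first by rewrite EP expr0 mulr1 (negbTE W0) in Px.
suff En : n = m by rewrite EP En dvdp_mull.
set t := 'X - x%:P in Eq EP.
have dt : t^`() = 1 by rewrite derivXsubC.
have tx : t.[x] = 0 by rewrite hornerXsubC subrr.
have t0 : t != 0 by rewrite polyXsubC_eq0.
clearbody t.
have H : (q * (n.+1%:R * n%:R * W + 2 * n.+1%:R * t * W^`() + t ^+ 2 * W^`()^`())
   - m%:R * (q + q^`() * t) * (n.+1%:R * W + t * W^`())
   + lame_pot * t * W) * t ^+ n = 0.
  have := lame_opP; rewrite /lame_op EP Eq => <-.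
  have e1 : (W * t ^+ n.+1)^`() = W^`() * t ^+ n.+1 + n.+1%:R * W * t ^+ n.
    rewrite derivM deriv_exp dt mul1r /= (exprS t n); move: W^`() (t ^+ n) => W' tn; ring.
  have e2 : (t ^+ n)^`() * t = n%:R * t ^+ n.
    case: (n) => [|n']; first by rewrite expr0 derivC !mul0r.
    by rewrite deriv_exp dt mul1r /= exprS; move: (t ^+ n') => tn; ring.
  have e3 : (W * t ^+ n.+1)^`()^`() * t =
      W^`()^`() * t ^+ n.+2 + 2 * n.+1%:R * W^`() * t ^+ n.+1 + n.+1%:R * n%:R * W * t ^+ n.
    rewrite e1 derivD !derivM deriv_exp dt mul1r /=.
    rewrite (_ : n.+1%:R^`() = 0 :> {poly C}); last by rewrite -polyC_natr derivC.
    have -> : (W^`()^`() * t ^+ n.+1 + W^`() * (t ^+ n *+ n.+1) +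
      ((0 * W + n.+1%:R * W^`()) * t ^+ n + n.+1%:R * W * (t ^+ n)^`())) * t =
      (W^`()^`() * t ^+ n.+1 + W^`() * (t ^+ n *+ n.+1) +
      ((0 * W + n.+1%:R * W^`()) * t ^+ n)) * t + n.+1%:R * W * ((t ^+ n)^`() * t) by ring.
    by rewrite e2 !exprS; ring.
  have -> : q * t * (W * t ^+ n.+1)^`()^`() = q * ((W * t ^+ n.+1)^`()^`() * t) by ring.
  by rewrite e3 e1 derivM dt !exprS; ring.
move/eqP: H; rewrite mulf_eq0 expf_eq0 (negbTE t0) andbF orbF => /eqP.
move=> /(congr1 (fun p => p.[x])).
rewrite !(hornerD, hornerN, hornerM, tx, horner_exp) -!polyC_natr !hornerC.
rewrite !(mulr0, mul0r, addr0, expr0n) /=.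
move: W0; rewrite /root; move: (q.[x]) qx (W.[x]) => y y0 v v0 E; apply/eqP; rewrite -(eqr_nat C) -subr_eq0.
have : (n.+1%:R * (y * v)) * (n%:R - m%:R) == 0 :> C by rewrite -[X in _ == X]E; apply/eqP; ring.
by rewrite !mulf_eq0 (negbTE y0) (negbTE v0) pnatr_eq0.
Qed.

(** By the Wronskian a common zero is a root of the quartic. As [P] is even, [lame_order] makes it
    divisible by powers [m + 1] at both [x] and [- x], against its degree, at most [2 m]. *)
Lemma lame_coprime x : ~ (P.[x] = 0 /\ Q.[x] = 0).
Proof.
move=> [Px Qx].
have px : root quart x.
  have := congr1 (fun p => p.[x]) wronskian; rewrite hornerD hornerN !hornerM Px Qx mul0r mulr0 subrr.
  rewrite hornerZ horner_exp => /esym/eqP; rewrite mulf_eq0 (negbTE lame_am_neq0) /= expf_eq0.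
  by move=> /andP[].
have x0 : x != 0 by apply: contra_eq_neq Px => ->; rewrite lame_P0 oner_eq0.
have P0 : P != 0 by apply/eqP => e; have := lame_P0; rewrite e hornerC => /eqP; rewrite eq_sym oner_eq0.
have pNx : root quart (- x).
  move: px; rewrite /root !hornerE /= => px.
  by rewrite (_ : (- x) ^+ 4 - kap * (- x) * (- x) + 1 = x ^+ 4 - kap * x * x + 1) //; ring.
have d1 := lame_order px (introT eqP Px).
have d2 : ('X - (- x)%:P) ^+ m.+1 %| P.
  by apply: lame_order => //; apply/eqP; rewrite lame_P_even.
have cp : coprimep (('X - x%:P) ^+ m.+1) (('X - (- x)%:P) ^+ m.+1).
  apply: coprimep_expl; apply: coprimep_expr; apply: coprimep_XsubC2 => //.
  by rewrite subr_eq0 eq_sym -addr_eq0 -mulr2n -mulr_natl mulf_neq0 // pnatr_eq0.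
have : ('X - x%:P) ^+ m.+1 * ('X - (- x)%:P) ^+ m.+1 %| P by rewrite Gauss_dvdp // d1.
move=> /dvdp_leq => /(_ P0); rewrite size_proper_mul; last first.
  by rewrite !lead_coef_exp !lead_coefXsubC !expr1n mulr1 oner_eq0.
by rewrite !size_exp_XsubC => /leq_trans/(_ size_lame_P); lia.
Qed.

End Gam.

End Lame.

(** * The developing map *)

Section Charts.
Variable R : realType.
Local Notation C := R[i].
Implicit Types (f : C -> sphere R) (phi h : C -> C) (z w : C).

Definition dens phi z : R :=
  8 * normc (dC phi z) ^+ 2 / (1 + normc (phi z) ^+ 2) ^+ 2.

(** Near [z] the holomorphic function [phi] represents [f] or its inverse. Since [dens] does not
    change under inversion, poles need no separate treatment. *)
Definition chart f z phi :=
  nearc z (hol phi) /\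
  (nearc z (fun w => f w = Some (phi w)) \/
   nearc z (fun w => f w = sphere_inv (Some (phi w)))).

Lemma sphere_invK : involutive (@sphere_inv R).
Proof.
case=> [a|] /=; last by rewrite eqxx.
by have [->|a0] := eqVneq a 0 => //=; rewrite invr_eq0 (negbTE a0) invrK.
Qed.

Lemma density_fin_chart f phi z : nearc z (fun w => f w = Some (phi w)) -> hol phi z ->
  spherical_density_fin f z = dens phi z.
Proof.
move=> E hz; rewrite /spherical_density_fin /dens.
have E' : nearc z (fun w => phi w = affine_part f w).
  by apply: nearc_imp E => w Ew; rewrite /affine_part Ew.
have /cderivE[_ ->] := cderiv_near E' (dCP hz).
by rewrite -(nearc_self E').
Qed.

Lemma density_some f phi z : nearc z (fun w => f w = Some (phi w)) -> hol phi z ->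
  spherical_density f z = dens phi z.
Proof. by move=> E hz; rewrite /spherical_density (nearc_self E) (density_fin_chart E hz). Qed.

Lemma dens_inv phi z : hol phi z -> phi z != 0 -> dens (fun w => (phi w)^-1) z = dens phi z.
Proof.
move=> hz z0; rewrite /dens (dC_eq (cderivV z0 (dCP hz))).
rewrite normc_div normcN normcV (normcX (phi z) 2).
have : normc (phi z) != 0 by rewrite normc_eq0.
move: (normc (phi z)) (normc (dC phi z)) (normc_ge0 (phi z)) => x y x0 xn.
field; rewrite xn /= andbT gt_eqF // ltr_pwDl // exprn_ge0 //.
Qed.

Lemma density_inv f phi z : nearc z (fun w => f w = sphere_inv (Some (phi w))) ->
  hol phi z -> spherical_density f z = dens phi z.
Proof.
move=> E hz; have [z0|z0] := eqVneq (phi z) 0.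
  rewrite /spherical_density (nearc_self E) /= z0 eqxx; apply: density_fin_chart => //.
  by apply: nearc_imp E => w ->; rewrite sphere_invK.
rewrite -(dens_inv hz z0); apply: density_some; last exact: holV.
apply: nearc_imp (nearc_and E (cont_neq0 (hol_cont hz) z0)) => w [-> w0] /=.
by rewrite (negbTE w0).
Qed.

Lemma chart_density f phi z : chart f z phi ->
  nearc z (fun w => spherical_density f w = dens phi w).
Proof.
case=> hz [E|E]; apply: nearc_imp (nearc_and hz (nearc_nearc E)) => w [hw Ew].
  exact: density_some.
exact: density_inv.
Qed.

Lemma holomorphic_nearP f z : holomorphic_near f z <->
  nearc z (fun w => f w <> None /\ hol (affine_part f) w).
Proof.
split.
- by move=> /nearCP; apply: nearc_imp => w [h1 h2]; split => //; exists (derive1 (affine_part f) w); apply/cderivE.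
- by move=> H; apply/nearCP; apply: nearc_imp H => w [h1 [q /cderivE[h2 _]]].
Qed.

Lemma mer_chart f : meromorphic f -> forall z, exists phi, chart f z phi.
Proof.
move=> H z; case: (H z) => [/holomorphic_nearP E|[/holomorphic_nearP E _]].
  exists (affine_part f); split; first by apply: nearc_imp E => w [].
  by left; apply: nearc_imp E => w; rewrite /affine_part; case: (f w) => [a //|[]].
exists (affine_part (fun w => sphere_inv (f w))); split; first by apply: nearc_imp E => w [].
right; apply: nearc_imp E => w [h _]; rewrite -[LHS]sphere_invK; congr sphere_inv.
by move: h; rewrite /affine_part; case: (sphere_inv _).
Qed.

Lemma has_order_dC_nz phi z n : nearc z (hol phi) -> has_order (dC phi) z n ->
  dnearc z (fun w => phi w != 0).
Proof.
move=> hz ho; case: (zero_dichotomy hz) => // E; exfalso.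
apply: (@dnearc_false _ z); apply: nearc_imp (nearc_and (has_order_nz ho) (nearc_nearc E)) => w [h1 h2] /h1 /eqP; apply.
apply: dC_eq; apply: (@cderiv_near _ (fun=> 0)); last exact: cderiv_cst.
by apply: nearc_imp h2.
Qed.

(** A finite order of the derivative keeps [phi] from vanishing identically, that is, keeps [f] from
    being infinite on an open set. *)
Lemma chart_mer f : (forall z, exists phi n, chart f z phi /\ has_order (dC phi) z n) ->
  meromorphic f.
Proof.
move=> H z; have [phi [n [[hz [E|E]] ho]]] := H z.
  left; apply/holomorphic_nearP; apply: nearc_imp (nearc_and hz (nearc_nearc E)) => w [hw Ew].
  rewrite (nearc_self Ew); split=> //; apply: hol_near hw.
  by apply: nearc_imp Ew => v Ev; rewrite /affine_part Ev.
have E2 : nearc z (fun w => sphere_inv (f w) = Some (phi w)).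
  by apply: nearc_imp E => w ->; rewrite sphere_invK.
right; split.
  apply/holomorphic_nearP; apply: nearc_imp (nearc_and hz (nearc_nearc E2)) => w [hw Ew].
  rewrite (nearc_self Ew); split=> //; apply: hol_near hw.
  by apply: nearc_imp Ew => v Ev; rewrite /affine_part Ev.
apply/dnearCP; apply: nearc_imp (nearc_and E (has_order_dC_nz hz ho)) => w [-> /[apply] w0].
by rewrite /= (negbTE w0).
Qed.

Lemma chart_opp f z phi : chart f z phi -> chart (fun w => omap -%R (f w)) z (fun w => - phi w).
Proof.
case=> hz E; split; first by apply: nearc_imp hz => w; exact: holN.
case: E => E; [left|right]; apply: nearc_imp E => w -> //=; rewrite oppr_eq0.
by case: ifP => //= _; rewrite invrN.
Qed.

Lemma chart_inv f z phi : chart f z phi -> chart (fun w => sphere_inv (f w)) z phi.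
Proof.
case=> hz E; split=> //; case: E => E; [right|left]; apply: nearc_imp E => w -> //.
by rewrite sphere_invK.
Qed.

Lemma chart_shift f z a phi : chart f (z + a) phi ->
  chart (fun w => f (w + a)) z (fun w => phi (w + a)).
Proof.
case=> hz E; split.
  apply: nearc_imp (nearc_shift hz) => w hw; apply: (@hol_comp _ (fun v => v + a) phi) => //.
  by apply: holD; [exact: hol_id|exact: hol_cst].
by case: E => E; [left|right]; exact: nearc_shift E.
Qed.

Lemma dens_opp phi z : hol phi z -> dens (fun w => - phi w) z = dens phi z.
Proof. by move=> hz; rewrite /dens (dC_eq (cderivN (dCP hz))) !normcN. Qed.

Lemma density_opp f z phi : chart f z phi ->
  spherical_density (fun w => omap -%R (f w)) z = spherical_density f z.
Proof.
move=> c; rewrite (nearc_self (chart_density c)) (nearc_self (chart_density (chart_opp c))).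
by apply: dens_opp; exact: (nearc_self (proj1 c)).
Qed.

Lemma density_sphere_inv f z phi : chart f z phi ->
  spherical_density (fun w => sphere_inv (f w)) z = spherical_density f z.
Proof.
by move=> c; rewrite (nearc_self (chart_density c)) (nearc_self (chart_density (chart_inv c))).
Qed.

Lemma density_shift f z a phi : chart f (z + a) phi ->
  spherical_density (fun w => f (w + a)) z = spherical_density f (z + a).
Proof.
move=> c; rewrite (nearc_self (chart_density c)) (nearc_self (chart_density (chart_shift c))).
by rewrite /dens dC_shift.
Qed.

End Charts.

(** * The quotient of the two Lame solutions along the Jacobi-type function *)

Section Developing.
Variable R : realType.
Local Notation C := R[i].
Variables (w1 w2 : C) (g : C -> C) (c0 kap p : C).
Hypothesis J : jacobi w1 w2 g c0 kap p.
Hypothesis hw : 0 < Im (w2 / w1).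
Variables (m : nat) (gam : C).
Local Notation l := (m.*2.+1).
Hypothesis hgam : root (lame_coef m kap m.+1) gam.
Local Notation P := (lame_P m kap gam m.+1).
Local Notation Q := (lame_Q m kap gam m.+1).
Local Notation L2 := (lattice w1 (w2 + w2)).
Implicit Types z w x : C.

Lemma cderiv_horner (q : {poly C}) x : cderiv (horner q) x q^`().[x].
Proof.
elim/poly_ind: q => [|q k IH].
  rewrite deriv0 horner0; apply: (@cderiv_near _ (fun=> 0)); last exact: cderiv_cst.
  by apply: nearcT => w; rewrite horner0.
rewrite derivD derivM derivX derivC addr0 mulr1 hornerD hornerM hornerX.
have := cderivD (cderivM IH (cderiv_id x)) (cderiv_cst k x); rewrite mulr1 addr0.
by apply: cderiv_near; apply: nearcT => w; rewrite hornerMXaddC.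
Qed.

Lemma hol_horner (q : {poly C}) (k : C -> C) z : hol k z -> hol (fun w => q.[k w]) z.
Proof. by move=> hk; apply: (@hol_comp _ k (horner q)) => //; exists q^`().[k z]; exact: cderiv_horner. Qed.

Lemma dC_horner (q : {poly C}) (k : C -> C) z : hol k z ->
  cderiv (fun w => q.[k w]) z (q^`().[k z] * dC k z).
Proof. by move=> hk; exact: cderiv_comp (dCP hk) (cderiv_horner q (k z)). Qed.

Lemma jac_hol_np z : hol g z -> ~ L2 (z - p).
Proof.
move=> hg /(jac_pole_at J)[phi [hphi phi0 E]]; have /negP[] := phi0; apply/eqP.
suff -> : phi z = g z * (z - z) by rewrite subrr mulr0.
apply: (@hol_dnearc_eq _ _ (fun w => g w * (w - z))); [exact: nearc_self hphi| |].
  by apply: holM => //; exact: hol_subc.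
by apply: dnearc_imp E.
Qed.

(** If [kap ^+ 2] were 4, the quartic would be a square, [g 0] a double root of it and [dC (dC g) 0]
    would vanish. *)
Lemma jac_kap : kap ^+ 2 != 4.
Proof.
have r0 := jac_root J (jac_hol0 J) (jac_d0 J); have := jac_dd0 J.
rewrite (jac_ode2 J (jac_hol0 J)); apply: contra => /eqP k2.
have a0 := jac_a_neq0 J; move: (g 0) r0 a0 => a r0 a0.
have : (2 * a ^+ 2 - kap) ^+ 2 = 0.
  have -> : (2 * a ^+ 2 - kap) ^+ 2 = 4 * (a ^+ 4 - kap * a ^+ 2 + 1) + (kap ^+ 2 - 4) by ring.
  by rewrite r0 k2 mulr0 subrr addr0.
move=> /eqP; rewrite expf_eq0 /= => /eqP e.
have -> : c0 * (2 * a ^+ 3 - kap * a) = c0 * a * (2 * a ^+ 2 - kap) by ring.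
by rewrite e mulr0.
Qed.

Definition dev_rat x : sphere R := if P.[x] == 0 then None else Some (Q.[x] / P.[x]).

(** At a pole of [g] the value is that of the quotient at infinity: [Q] has degree [l], and [P] a
    smaller one. *)
Definition dev_map z : sphere R := if `[< L2 (z - p) >] then None else dev_rat (g z).

Lemma dev_rat_opp x : dev_rat (- x) = omap -%R (dev_rat x).
Proof. by rewrite /dev_rat lame_P_even (lame_Q_odd hgam); case: (P.[x] == 0) => //=; rewrite mulNr. Qed.

Lemma dev_rat0 : dev_rat 0 = Some 0.
Proof. by rewrite /dev_rat lame_P0 oner_eq0 (lame_Q0 hgam) mul0r. Qed.

Lemma dev_rat_inv x : x != 0 -> dev_rat x^-1 = sphere_inv (dev_rat x).
Proof.
move=> x0; have cp := lame_coprime hgam jac_kap (x := x).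
have xl : x ^+ l != 0 by rewrite expf_neq0.
have eP : P.[x^-1] = Q.[x] / x ^+ l by rewrite (lame_QV hgam) // mulrAC divff // mul1r.
have eQ : Q.[x^-1] = P.[x] / x ^+ l by rewrite (lame_PV hgam) // mulrAC divff // mul1r.
rewrite /dev_rat eP eQ; have [Px|Px] := eqVneq P.[x] 0.
  have Qx : Q.[x] != 0 by apply/eqP => Qx; apply: cp.
  by rewrite mulf_eq0 (negbTE Qx) invr_eq0 (negbTE xl) /= Px !mul0r.
have [Qx|Qx] := eqVneq Q.[x] 0; first by rewrite Qx mul0r eqxx /= mul0r eqxx.
rewrite /= !mulf_eq0 !invr_eq0 (negbTE Qx) (negbTE xl) (negbTE Px) /=; congr Some.
by move: Qx xl Px; move: P.[x] Q.[x] (x ^+ l) => u v t v0 t0 u0; field; rewrite v0 t0 u0.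
Qed.

Lemma L2_w1 z : L2 (z + w1) <-> L2 z.
Proof.
split=> [h|h]; last by apply: latticeD => //; exact: lattice_l.
by have := latticeD h (latticeN (lattice_l w1 (w2 + w2))); rewrite addrK.
Qed.

Lemma dev_map_w1 z : dev_map (z + w1) = omap -%R (dev_map z).
Proof.
rewrite /dev_map (_ : z + w1 - p = z - p + w1); last by ring.
have -> : `[< L2 (z - p + w1) >] = `[< L2 (z - p) >] by apply/asbool_equiv_eq/L2_w1.
by case: `[< _ >] => //; rewrite (j_w1 J) dev_rat_opp.
Qed.

Lemma dev_map_w2 z : dev_map (z + w2) = sphere_inv (dev_map z).
Proof.
rewrite /dev_map; case: asboolP => [l'|nl']; case: asboolP => [l|nl].
- by have [h _] := jac_pole_zero J hw l; case: (jac_hol_np (nearc_self h) l').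
- have hz := j_hol J nl; have g0 : g z = 0.
    by apply/eqP/negPn/negP => g0; apply: (jac_inv_hol J hz g0 l').
  by rewrite g0 dev_rat0 /= eqxx.
- by have [_ ->] := jac_pole_zero J hw l; rewrite dev_rat0.
- have e := jac_inv J (j_hol J nl) (j_hol J nl').
  have g0 : g z != 0 by apply: contra_eq_neq e => ->; rewrite mul0r eq_sym oner_eq0.
  have -> : g (z + w2) = (g z)^-1 by rewrite -[LHS]mul1r -(mulVf g0) -mulrA e mulr1.
  exact: dev_rat_inv.
Qed.

(** The quartic in [g] is [dC g ^+ 2 / c0], so the Wronskian makes the derivative of [Q / P] equal
    to [k * dC g ^+ l / P ^+ 2], and that of [P / Q] to [- k * dC g ^+ l / Q ^+ 2]. By
    [lame_coprime] one of the two denominators is nonzero at each point. *)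
Lemma dev_chart_np z : ~ L2 (z - p) -> exists phi h,
  [/\ chart dev_map z phi, nearc z (hol h), h z != 0 &
    nearc z (fun w => dC phi w = h w * dC g w ^+ l)].
Proof.
move=> nl; have hz := j_hol J nl; have h0 := nearc_self hz; have hz' := nearc_nearc hz.
have npz : nearc z (fun w => dev_map w = dev_rat (g w)).
  by apply: nearc_imp hz => w hgw; rewrite /dev_map; case: asboolP => // l; case: (jac_hol_np hgw).
have am := lame_am_neq0 hgam.
pose k : C := lame_a m kap gam m / c0 ^+ m.
have k0 : k != 0 by rewrite mulf_neq0 // invr_eq0 expf_neq0 // (j_c0 J).
have wr w : nearc w (hol g) -> P.[g w] * Q^`().[g w] - P^`().[g w] * Q.[g w] = k * dC g w ^+ m.*2.
  move=> hgw; have := congr1 (fun q => q.[g w]) (wronskian hgam).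
  rewrite hornerD hornerN !hornerM => ->; rewrite hornerZ horner_exp !hornerE /=.
  rewrite -mul2n exprM (jac_ode J hgw) exprMn /k; move: (j_c0 J) => c00.
  rewrite (_ : g w ^+ 4 - kap * g w * g w + 1 = g w ^+ 4 - kap * g w ^+ 2 + 1); last by ring.
  by move: (_ ^+ m) => X; field; rewrite expf_neq0.
have [Pz|Pz] := eqVneq P.[g z] 0; last first.
  have nP := cont_neq0 (hol_cont (hol_horner P h0)) Pz.
  exists (fun w => Q.[g w] / P.[g w]), (fun w => k / P.[g w] ^+ 2); split.
  - split.
      apply: nearc_imp (nearc_and hz nP) => w [hgw Pw]; apply: holM; first exact: hol_horner.
      by apply: (@holV _ (fun w => P.[g w])) => //; exact: hol_horner.
    by left; apply: nearc_imp (nearc_and npz nP) => w [-> Pw]; rewrite /dev_rat (negbTE Pw).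
  - apply: nearc_imp (nearc_and hz nP) => w [hgw Pw]; apply: holM; first exact: hol_cst.
    by apply: (@holV _ (fun w => P.[g w] ^+ 2)); [exact: expf_neq0|apply: holX; exact: hol_horner].
  - by rewrite mulf_neq0 // invr_eq0 expf_neq0.
  - apply: nearc_imp (nearc_and hz' nP) => w [hgw' Pw]; have hgw := nearc_self hgw'.
    rewrite (dC_eq (cderivM (dC_horner Q hgw) (@cderivV _ (fun v => P.[g v]) w _ Pw (dC_horner P hgw)))).
    rewrite (exprS (dC g w) m.*2); have := wr w hgw'; move: (dC g w ^+ m.*2) => X E.
    have -> : k / P.[g w] ^+ 2 * (dC g w * X) = (k * X) * dC g w / P.[g w] ^+ 2 by ring.
    by rewrite -E; move: Pw; move: P.[g w] P^`().[g w] => u u' u0; field.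
have Qz : Q.[g z] != 0.
  by apply/eqP => Qz; apply: (lame_coprime hgam jac_kap (x := g z)).
have nQ := cont_neq0 (hol_cont (hol_horner Q h0)) Qz.
exists (fun w => P.[g w] / Q.[g w]), (fun w => - k / Q.[g w] ^+ 2); split.
- split.
    apply: nearc_imp (nearc_and hz nQ) => w [hgw Qw]; apply: holM; first exact: hol_horner.
    by apply: (@holV _ (fun w => Q.[g w])) => //; exact: hol_horner.
  right; apply: nearc_imp (nearc_and npz nQ) => w [-> Qw]; rewrite /dev_rat /=.
  rewrite mulf_eq0 invr_eq0 (negbTE Qw) orbF; case: ifP => // _.
  by rewrite invfM invrK mulrC.
- apply: nearc_imp (nearc_and hz nQ) => w [hgw Qw]; apply: holM; first exact: hol_cst.
  by apply: (@holV _ (fun w => Q.[g w] ^+ 2)); [exact: expf_neq0|apply: holX; exact: hol_horner].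
- by rewrite mulf_neq0 ?oppr_eq0 // invr_eq0 expf_neq0.
- apply: nearc_imp (nearc_and hz' nQ) => w [hgw' Qw]; have hgw := nearc_self hgw'.
  rewrite (dC_eq (cderivM (dC_horner P hgw) (@cderivV _ (fun v => Q.[g v]) w _ Qw (dC_horner Q hgw)))).
  rewrite (exprS (dC g w) m.*2); have := wr w hgw'; move: (dC g w ^+ m.*2) => X E.
  have -> : - k / Q.[g w] ^+ 2 * (dC g w * X) = - (k * X) * dC g w / Q.[g w] ^+ 2 by ring.
  by rewrite -E; move: Qw; move: Q.[g w] Q^`().[g w] => u u' u0; field.
Qed.

Lemma has_order_mul (h k : C -> C) z n : nearc z (hol h) -> h z != 0 -> has_order k z n ->
  forall j, has_order (fun w => h w * k w ^+ j) z (n * j).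
Proof.
move=> hh h0 [q [hq q0 E]] j; exists (fun w => h w * q w ^+ j); split.
- by apply: nearc_imp (nearc_and hh hq) => w [? ?]; apply: holM => //; exact: holX.
- by rewrite mulf_neq0 // expf_neq0.
- by apply: nearc_imp E => w ->; rewrite exprMn exprM mulrCA.
Qed.

Lemma has_order0 (k : C -> C) z : nearc z (hol k) -> k z != 0 -> has_order k z 0.
Proof. by move=> hk k0; exists k; split=> //; apply: nearcT => w; rewrite expr0 mul1r. Qed.

Lemma has_order_near (h k : C -> C) z n : nearc z (fun w => k w = h w) -> has_order h z n -> has_order k z n.
Proof.
move=> E [q [hq q0 E']]; exists q; split=> //.
by apply: nearc_imp (nearc_and E E') => w [-> ->].
Qed.

Lemma dev_chart_off z : ~ lattice w1 w2 z -> exists phi,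
  chart dev_map z phi /\ has_order (dC phi) z 0.
Proof.
move=> nz; case: (pselect (L2 (z - p))) => [l|nl].
  have [hz2 gz2] := jac_pole_zero J hw l.
  have dz2 : dC g (z + w2) != 0.
    apply/eqP => d0; have := jac_ode J hz2; rewrite d0 gz2 !expr0n /= mulr0 subr0 add0r mulr1.
    by move=> /esym/eqP; rewrite (negbTE (j_c0 J)).
  have [phi [h [c hh h0 E]]] := dev_chart_np (jac_hol_np (nearc_self hz2)).
  have c' := chart_inv (chart_shift c).
  have e : (fun w => sphere_inv (dev_map (w + w2))) = dev_map.
    by apply/funext => w; rewrite dev_map_w2 sphere_invK.
  rewrite e in c'; exists (fun w => phi (w + w2)); split=> //.
  apply: has_order0; first by apply: dC_hol; case: c'.
  by rewrite dC_shift (nearc_self E) mulf_neq0 // expf_neq0.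
have [phi [h [c hh h0 E]]] := dev_chart_np nl; exists phi; split=> //.
apply: (has_order_near E); have hz := j_hol J nl.
have dz : dC g z != 0 by apply/eqP => /(jac_crit J hz).
by have := has_order_mul hh h0 (has_order0 (dC_hol hz) dz) l; rewrite mul0n.
Qed.

Lemma dev_chart0 : exists phi, chart dev_map 0 phi /\ has_order (dC phi) 0 l.
Proof.
have [phi [h [c hh h0 E]]] := dev_chart_np (j_p J); exists phi; split=> //.
apply: (has_order_near E); have hz := jac_hol0 J.
have o1 : has_order (dC g) 0 1.
  have [G [hG G0 EG]] := hol_factor (dC_hol hz); exists G; split=> //.
    by rewrite G0 (jac_dd0 J).
  by apply: nearcT => w; rewrite EG (jac_d0 J) add0r expr1.
by have := has_order_mul hh h0 o1 l; rewrite mul1n.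
Qed.

End Developing.

(** * Functions of class C^n on the plane *)

Section PlaneCalculus.
Variable R : realType.
Implicit Types (g h : R * R -> R) (p q : R * R) (a b c d : R).

(** Caratheodory's form of differentiability in two variables. As on the complex side it makes the
    product and chain rules algebraic; [gd_derive] recovers the partial derivatives. *)
Definition gd g p a b : Prop := exists A B : R * R -> R,
  [/\ {for p, continuous A}, {for p, continuous B}, A p = a, B p = b &
     \forall q \near p, g q = g p + (q.1 - p.1) * A q + (q.2 - p.2) * B q].

Lemma continuous_near g h p : (\forall q \near p, g q = h q) ->
  {for p, continuous g} -> {for p, continuous h}.
Proof.
move=> E cg; rewrite /prop_for /continuous_at -(nbhs_singleton E).
by apply: cvg_trans cg; apply: near_eq_cvg; apply: filterS E => q ->.
Qed.

Lemma near_all p (P : R * R -> Prop) : (forall q, P q) -> \forall q \near p, P q.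
Proof. by move=> H; apply: (@nearW _ (nbhs p)). Qed.

Lemma near_near p (P : R * R -> Prop) : (\forall q \near p, P q) ->
  \forall q \near p, \forall r \near q, P r.
Proof. exact: nbhs_interior. Qed.

Lemma cst_cont p a : {for p, continuous (fun=> a : R)}.
Proof. exact: cvg_cst. Qed.

Lemma fst_cont p : {for p, continuous (fun q : R * R => q.1)}.
Proof. exact: cvg_fst. Qed.

Lemma snd_cont p : {for p, continuous (fun q : R * R => q.2)}.
Proof. exact: cvg_snd. Qed.

Lemma addp_cont g h p : {for p, continuous g} -> {for p, continuous h} ->
  {for p, continuous (fun q => g q + h q)}.
Proof. move=> cg ch; exact: (cvgD cg ch). Qed.

Lemma mulp_cont g h p : {for p, continuous g} -> {for p, continuous h} ->
  {for p, continuous (fun q => g q * h q)}.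
Proof. move=> cg ch; exact: (cvgM cg ch). Qed.

Lemma gd_near g h p a b : (\forall q \near p, g q = h q) -> gd g p a b -> gd h p a b.
Proof.
move=> E [A [B [cA cB Ap Bp H]]]; exists A, B; split=> //.
by have E0 := nbhs_singleton E; apply: filterS2 E H => q <-; rewrite -E0.
Qed.

Lemma gd_cont g p a b : gd g p a b -> {for p, continuous g}.
Proof.
move=> [A [B [cA cB _ _ H]]].
apply: (@continuous_near (fun q => g p + (q.1 - p.1) * A q + (q.2 - p.2) * B q)).
  by apply: filterS H => q ->.
have sb (k : R * R -> R) r : {for p, continuous k} -> {for p, continuous (fun q => k q - r)}.
  by move=> ck; apply: addp_cont => //; exact: cst_cont.
apply: addp_cont.
  apply: addp_cont; first exact: cst_cont.
  by apply: mulp_cont => //; apply: sb; exact: fst_cont.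
by apply: mulp_cont => //; apply: sb; exact: snd_cont.
Qed.

Lemma gd_cst k p : gd (fun=> k) p 0 0.
Proof.
exists (fun=> 0), (fun=> 0); split=> //; try exact: cst_cont.
by apply: near_all => q; rewrite !mulr0 !addr0.
Qed.

Lemma gd_fst p : gd (fun q => q.1) p 1 0.
Proof.
exists (fun=> 1), (fun=> 0); split=> //; try exact: cst_cont.
by apply: near_all => q; ring.
Qed.

Lemma gd_snd p : gd (fun q => q.2) p 0 1.
Proof.
exists (fun=> 0), (fun=> 1); split=> //; try exact: cst_cont.
by apply: near_all => q; ring.
Qed.

Lemma gdD g h p a b c d : gd g p a b -> gd h p c d -> gd (fun q => g q + h q) p (a + c) (b + d).
Proof.
move=> [A [B [cA cB <- <- H]]] [A' [B' [cA' cB' <- <- H']]].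
exists (fun q => A q + A' q), (fun q => B q + B' q); split=> //; try exact: addp_cont.
by apply: filterS2 H H' => q -> ->; ring.
Qed.

Lemma gdM g h p a b c d : gd g p a b -> gd h p c d ->
  gd (fun q => g q * h q) p (a * h p + g p * c) (b * h p + g p * d).
Proof.
move=> G H; have ch := gd_cont H.
move: G H => [A [B [cA cB <- <- H]]] [A' [B' [cA' cB' <- <- H']]].
exists (fun q => A q * h q + g p * A' q), (fun q => B q * h q + g p * B' q); split=> //.
- by apply: addp_cont; apply: mulp_cont => //; exact: cst_cont.
- by apply: addp_cont; apply: mulp_cont => //; exact: cst_cont.
- apply: filterS2 H H' => q -> e.
  have -> : (g p + (q.1 - p.1) * A q + (q.2 - p.2) * B q) * h q =
    g p * h q + (q.1 - p.1) * (A q * h q) + (q.2 - p.2) * (B q * h q) by ring.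
  by rewrite {1}e; ring.
Qed.

Lemma gd_comp (psi : R -> R) g p a b c : is_derive (g p) 1 psi c -> gd g p a b ->
  gd (fun q => psi (g q)) p (c * a) (c * b).
Proof.
move=> D G; have cg := gd_cont G.
pose S y := if y == g p then c else (psi y - psi (g p)) / (y - g p).
have cS : {for g p, continuous S}.
  apply/(@cvgrPdist_le _ R^o) => e e0.
  have [E E0 HE] := real_deriv_bound D e0.
  near=> y; rewrite /S eqxx; have [_|ny] := eqVneq y (g p).
    by rewrite subrr normr0 ltW.
  have yn : y - g p != 0 by rewrite subr_eq0.
  rewrite distrC; have -> : (psi y - psi (g p)) / (y - g p) - c =
    (psi y - psi (g p) - (y - g p) * c) / (y - g p) by field.
  rewrite normrM normfV ler_pdivrMr ?normr_gt0 //.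
  have := HE (y - g p); rewrite [g p + _]addrC subrK; apply.
  by rewrite distrC; near: y; exact: (@cvgr_dist_lt _ R^o _ _ _ id (g p)).
move: G => [A [B [cA cB <- <- H]]].
have cSg : {for p, continuous (fun q => S (g q))} by apply: (@continuous_comp _ _ _ g S p cg).
exists (fun q => S (g q) * A q), (fun q => S (g q) * B q); split.
- exact: mulp_cont.
- exact: mulp_cont.
- by rewrite /S eqxx.
- by rewrite /S eqxx.
- apply: filterS H => q e.
  have -> : psi (g q) = psi (g p) + (g q - g p) * S (g q).
    rewrite /S; have [->|n] := eqVneq (g q) (g p); first by rewrite subrr mul0r addr0.
    by rewrite mulrC divfK ?subr_eq0 // addrC subrK.
  by rewrite {1}e; ring.
Unshelve. all: by end_near.
Qed.

Lemma gd_derive g p a b : gd g p a b ->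
  [/\ derivable g p (1, 0), derivable g p (0, 1), dx g p = a & dy g p = b].
Proof.
move=> [A [B [cA cB <- <- H]]].
have K (v : R * R) (k : R) : k = v.1 * A p + v.2 * B p ->
    (fun t : R => t^-1 *: (g (t *: v + p) - g p)) @ 0^' --> k.
  move=> ->.
  have cv : (fun t : R => t *: v + p) @ 0^' --> p.
    have : (fun t : R => t *: v + p) @ (0:R) --> (0:R) *: v + p.
      by apply: cvgD; [apply: cvgZ; [exact: cvg_id|exact: cvg_cst]|exact: cvg_cst].
    by rewrite scale0r add0r => /cvg_within_filter; apply.
  have E : \forall t \near (0:R)^', v.1 * A (t *: v + p) + v.2 * B (t *: v + p) =
       t^-1 *: (g (t *: v + p) - g p).
    have /cv H' := H; near=> t; have t0 : t != 0 by near: t; exact: nbhs_dnbhs_neq.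
    have -> : g (t *: v + p) = g p + ((t *: v + p).1 - p.1) * A (t *: v + p) + ((t *: v + p).2 - p.2) * B (t *: v + p).
      by near: t; exact: H'.
    rewrite /= addrK addrK; move: (A _) (B _) (g p) => x y z.
    rewrite /GRing.scale /=; field; exact: t0.
  apply: cvg_trans (near_eq_cvg E) _.
  by apply: cvgD; apply: cvgM; try exact: cvg_cst; [apply: (cvg_comp _ _ cv cA)|apply: (cvg_comp _ _ cv cB)].
have K1 := K (1, 0) (A p); have K2 := K (0, 1) (B p).
rewrite /= mul1r mul0r addr0 in K1; rewrite /= mul1r mul0r add0r in K2.
have {}K1 := K1 erefl; have {}K2 := K2 erefl.
split; [exact: cvgP K1|exact: cvgP K2|exact: (cvg_lim _ K1)|exact: (cvg_lim _ K2)].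
Unshelve. all: by end_near.
Qed.

Lemma gd_lap g gx gy p a b c d : (\forall q \near p, gd g q (gx q) (gy q)) ->
  gd gx p a b -> gd gy p c d -> laplacian g p = a + d.
Proof.
move=> H X Y; rewrite /laplacian.
have Ex : \forall q \near p, gx q = dx g q by apply: filterS H => q /gd_derive[_ _ ->].
have Ey : \forall q \near p, gy q = dy g q by apply: filterS H => q /gd_derive[_ _ _ ->].
by have [_ _ -> _] := gd_derive (gd_near Ex X); have [_ _ _ ->] := gd_derive (gd_near Ey Y).
Qed.

(** In contrast to [class_C], the partial derivatives are exhibited as functions and
    differentiability is total, so that stability under each operation is an induction. [class_C_Ck]
    converts. *)
Fixpoint Ck (n : nat) g p : Prop :=
  (\forall q \near p, {for q, continuous g}) /\
  if n is n'.+1 then exists gx gy,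
    [/\ \forall q \near p, gd g q (gx q) (gy q), Ck n' gx p & Ck n' gy p]
  else True.

Lemma Ck_cont n g p : Ck n g p -> {for p, continuous g}.
Proof. by case: n => [|n] [/nbhs_singleton]. Qed.

Lemma CkS n g p gx gy : (\forall q \near p, gd g q (gx q) (gy q)) ->
  Ck n gx p -> Ck n gy p -> Ck n.+1 g p.
Proof. by move=> H X Y; split; [apply: filterS H => q /gd_cont|exists gx, gy]. Qed.

Lemma Ck_pred n g p : Ck n.+1 g p -> Ck n g p.
Proof.
elim: n g => [|n IH] g [cg [gx [gy [H X Y]]]]; first by split.
by apply: (CkS H); exact: IH.
Qed.

Lemma Ck_near n g h p : (\forall q \near p, g q = h q) -> Ck n g p -> Ck n h p.
Proof.
move=> /near_near E; case: n => [|n] [cg H].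
  by split=> //; apply: filterS2 E cg => q; exact: continuous_near.
move: H => [gx [gy [H X Y]]]; apply: CkS X Y.
by apply: filterS2 E H => q; exact: gd_near.
Qed.

Lemma Ck_cst n k p : Ck n (fun=> k) p.
Proof.
elim: n k => [|n IH] k; first by split=> //; apply: near_all => q; exact: cst_cont.
by apply: (@CkS _ _ _ (fun=> 0) (fun=> 0)) => //; apply: near_all => q; exact: gd_cst.
Qed.

Lemma Ck_fst n p : Ck n (fun q => q.1) p.
Proof.
case: n => [|n]; first by split=> //; apply: near_all => q; exact: fst_cont.
apply: (@CkS _ _ _ (fun=> 1) (fun=> 0)); [|exact: Ck_cst|exact: Ck_cst].
by apply: near_all => q; exact: gd_fst.
Qed.

Lemma Ck_snd n p : Ck n (fun q => q.2) p.
Proof.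
case: n => [|n]; first by split=> //; apply: near_all => q; exact: snd_cont.
apply: (@CkS _ _ _ (fun=> 0) (fun=> 1)); [|exact: Ck_cst|exact: Ck_cst].
by apply: near_all => q; exact: gd_snd.
Qed.

Lemma CkD n g h p : Ck n g p -> Ck n h p -> Ck n (fun q => g q + h q) p.
Proof.
elim: n g h => [|n IH] g h [cg G] [ch H].
  by split=> //; apply: filterS2 cg ch => q; exact: addp_cont.
move: G H => [gx [gy [G Gx Gy]]] [hx [hy [H Hx Hy]]].
apply: (@CkS _ _ _ (fun q => gx q + hx q) (fun q => gy q + hy q)); try exact: IH.
by apply: filterS2 G H => q; exact: gdD.
Qed.

Lemma CkM n g h p : Ck n g p -> Ck n h p -> Ck n (fun q => g q * h q) p.
Proof.
elim: n g h => [|n IH] g h G H.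
  move: G H => [cg _] [ch _].
  by split=> //; apply: filterS2 cg ch => q; exact: mulp_cont.
have G' := Ck_pred G; have H' := Ck_pred H.
move: G H => [_ [gx [gy [G Gx Gy]]]] [_ [hx [hy [H Hx Hy]]]].
apply: (@CkS _ _ _ (fun q => gx q * h q + g q * hx q) (fun q => gy q * h q + g q * hy q));
  [|by apply: CkD; exact: IH..].
by apply: filterS2 G H => q; exact: gdM.
Qed.

Lemma CkZ n k g p : Ck n g p -> Ck n (fun q => k * g q) p.
Proof. by move=> G; apply: CkM => //; exact: Ck_cst. Qed.

Lemma Ck_expR n g p : Ck n g p -> Ck n (fun q => expR (g q)) p.
Proof.
elim: n g => [|n IH] g G.
  move: G => [cg _]; split=> //; apply: filterS cg => q cq.
  by apply: (@continuous_comp _ _ _ g expR q cq); exact: continuous_expR.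
have G' := Ck_pred G; move: G => [_ [gx [gy [G Gx Gy]]]].
apply: (@CkS _ _ _ (fun q => expR (g q) * gx q) (fun q => expR (g q) * gy q));
  [|by apply: CkM => //; exact: IH..].
by apply: filterS G => q; apply: gd_comp; exact: is_derive_expR.
Qed.

Lemma near_neq0 g p : {for p, continuous g} -> g p != 0 -> \forall q \near p, g q != 0.
Proof.
move=> cg g0; have e0 : 0 < `|g p| by rewrite normr_gt0.
have /(@cvgrPdist_lt _ R^o) /(_ _ e0) := cg; apply: filterS => q.
by apply: contraTneq => ->; rewrite subr0 ltxx.
Qed.

Lemma near_gt0 g p : {for p, continuous g} -> 0 < g p -> \forall q \near p, 0 < g q.
Proof.
move=> cg g0; have /(@cvgrPdist_lt _ R^o) /(_ _ g0) := cg; apply: filterS => q.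
by rewrite ltr_norml => /andP[_]; lra.
Qed.

Lemma is_derive_invr (x : R) : x != 0 -> is_derive x 1 (fun y => y^-1) (- (x^-1 * x^-1)).
Proof.
move=> x0; apply: is_derive_eq (@is_deriveV R id x 1 1 x0 (is_derive_id x 1)) _.
by rewrite -expr2 exprVn [_ *: _]mulr1.
Qed.

Lemma Ck_inv n g p : g p != 0 -> Ck n g p -> Ck n (fun q => (g q)^-1) p.
Proof.
move=> g0; elim: n => [|n IH] G.
  have n0 := near_neq0 (Ck_cont G) g0; move: G => [cg _]; split=> //.
  by apply: filterS2 cg n0 => q cq q0; exact: cvgV.
have n0 := near_neq0 (Ck_cont G) g0.
have G' := IH (Ck_pred G); move: G => [_ [gx [gy [G Gx Gy]]]].
apply: (@CkS _ _ _ (fun q => - ((g q)^-1 * (g q)^-1) * gx q) (fun q => - ((g q)^-1 * (g q)^-1) * gy q)).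
- by apply: filterS2 G n0 => q Gq q0; apply: gd_comp Gq; exact: is_derive_invr.
- apply: CkM => //; apply: (@Ck_near _ (fun q => -1 * ((g q)^-1 * (g q)^-1))).
    by apply: near_all => q; rewrite mulN1r.
  by apply: CkZ; exact: CkM.
- apply: CkM => //; apply: (@Ck_near _ (fun q => -1 * ((g q)^-1 * (g q)^-1))).
    by apply: near_all => q; rewrite mulN1r.
  by apply: CkZ; exact: CkM.
Qed.

Lemma Ck_ln n g p : 0 < g p -> Ck n g p -> Ck n (fun q => ln (g q)) p.
Proof.
move=> g0; case: n => [|n] G.
  have n0 := near_gt0 (Ck_cont G) g0; move: G => [cg _]; split=> //.
  by apply: filterS2 cg n0 => q cq q0; apply: (@continuous_comp _ R R g (@ln R) q cq); exact: continuous_ln.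
have n0 := near_gt0 (Ck_cont G) g0.
have G' : Ck n (fun q => (g q)^-1) p by apply: Ck_inv; [rewrite gt_eqF|exact: Ck_pred].
move: G => [_ [gx [gy [G Gx Gy]]]].
apply: (@CkS _ _ _ (fun q => (g q)^-1 * gx q) (fun q => (g q)^-1 * gy q)); [|exact: CkM..].
by apply: filterS2 G n0 => q Gq q0; apply: gd_comp Gq; exact: is_derive1_ln.
Qed.

Lemma class_C_Ck n (U : set (R * R)) g : (forall p, U p -> Ck n g p) -> class_C n U g.
Proof.
elim: n g => [|n IH] g H; first by split=> // p /H/Ck_cont.
have D p : U p -> exists gx gy, [/\ gd g p (gx p) (gy p), Ck n gx p, Ck n gy p,
    \forall q \near p, gx q = dx g q & \forall q \near p, gy q = dy g q].
  move=> /H[_ [gx [gy [G Gx Gy]]]]; exists gx, gy; split=> //.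
  - exact: nbhs_singleton G.
  - by apply: filterS G => q /gd_derive[_ _ ->].
  - by apply: filterS G => q /gd_derive[_ _ _ ->].
split; first by move=> p /H/Ck_cont.
split.
- by move=> p /D[gx [gy [/gd_derive[? ? _ _] _ _ _ _]]].
- by apply: IH => p /D[gx [gy [_ Gx _ E _]]]; exact: Ck_near E Gx.
- by apply: IH => p /D[gx [gy [_ _ Gy _ E]]]; exact: Ck_near E Gy.
Qed.

End PlaneCalculus.

(** * Holomorphic functions on the real plane and Liouville's equation *)

Section ComplexPlane.
Variable R : realType.
Local Notation C := R[i].
Implicit Types (f h phi : C -> C) (p q : R * R) (z : C).

Definition pt p : C := p.1 +i* p.2.

Lemma ptB p q : pt q - pt p = (q.1 - p.1) +i* (q.2 - p.2).
Proof. by apply: eq_ReIm. Qed.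

Lemma nearc_near p (Q : C -> Prop) : nearc (pt p) Q -> \forall q \near p, Q (pt q).
Proof.
move=> [D D0 H]; have D2 : 0 < D / 2 by rewrite divr_gt0.
near=> q; apply: H; apply: le_lt_trans (normc_ReIm _) _; rewrite ptB /=.
have h1 : `|p.1 - q.1| < D / 2.
  by near: q; exact: (@cvgr_dist_lt _ R^o _ _ _ (fun q : R * R => q.1) p.1 (@fst_cont R p)).
have h2 : `|p.2 - q.2| < D / 2.
  by near: q; exact: (@cvgr_dist_lt _ R^o _ _ _ (fun q : R * R => q.2) p.2 (@snd_cont R p)).
rewrite distrC [X in _ + X]distrC; lra.
Unshelve. all: by end_near.
Qed.

Lemma cont_at_near f p : cont_at f (pt p) ->
  {for p, continuous (fun q => Re (f (pt q)))} /\ {for p, continuous (fun q => Im (f (pt q)))}.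
Proof.
move=> cf; split; apply/(@cvgrPdist_lt _ R^o) => e e0;
  have := nearc_near (cf _ e0); apply: filterS => q; apply: le_lt_trans.
- by rewrite distrC -ReB normc_Re.
- by rewrite distrC -ImB normc_Im.
Qed.

(** The Cauchy-Riemann equations, read off the real and imaginary parts of the slope. *)
Lemma gd_hol f p : hol f (pt p) ->
  gd (fun q => Re (f (pt q))) p (Re (dC f (pt p))) (- Im (dC f (pt p))) /\
  gd (fun q => Im (f (pt q))) p (Im (dC f (pt p))) (Re (dC f (pt p))).
Proof.
move=> /dCP; rewrite /cderiv => /cont_at_near; set S := slope _ _ _ => -[cR cI].
have Sp : S (pt p) = dC f (pt p) by exact: slopezz.
have E q : f (pt q) = f (pt p) + ((q.1 - p.1) +i* (q.2 - p.2)) * S (pt q).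
  by rewrite -ptB; exact: slopeE.
have cIN : {for p, continuous (fun q => - Im (S (pt q)))} by exact: cvgN.
split.
- exists (fun q => Re (S (pt q))), (fun q => - Im (S (pt q))); rewrite Sp; split=> //.
  apply: near_all => q; rewrite [in LHS]E; move: (f (pt p)) (S (pt q)) => [a b] [c d] /=; ring.
- exists (fun q => Im (S (pt q))), (fun q => Re (S (pt q))); rewrite Sp; split=> //.
  apply: near_all => q; rewrite [in LHS]E; move: (f (pt p)) (S (pt q)) => [a b] [c d] /=; ring.
Qed.

Lemma Ck_opp n (g : R * R -> R) p : Ck n g p -> Ck n (fun q => - g q) p.
Proof.
move=> G; apply: (@Ck_near _ _ (fun q => -1 * g q)); last exact: CkZ.
by apply: near_all => q; rewrite mulN1r.
Qed.

Lemma Ck_hol n f p : nearc (pt p) (hol f) ->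
  Ck n (fun q => Re (f (pt q))) p /\ Ck n (fun q => Im (f (pt q))) p.
Proof.
elim: n f => [|n IH] f hf; have H := nearc_near hf.
  by split; split=> //; apply: filterS H => q /hol_cont/cont_at_near[].
have [Dr Di] := IH _ (dC_hol hf).
split.
- apply: (@CkS _ _ _ _ (fun q => Re (dC f (pt q))) (fun q => - Im (dC f (pt q)))) => //.
    by apply: filterS H => q /gd_hol[].
  exact: Ck_opp.
- apply: (@CkS _ _ _ _ (fun q => Im (dC f (pt q))) (fun q => Re (dC f (pt q)))) => //.
  by apply: filterS H => q /gd_hol[].
Qed.

Lemma Ck_normc2 n f p : nearc (pt p) (hol f) -> Ck n (fun q => normc (f (pt q)) ^+ 2) p.
Proof.
move=> /(Ck_hol n)[Hr Hi]; apply: Ck_near (CkD (CkM Hr Hr) (CkM Hi Hi)).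
by apply: near_all => q; rewrite normc_sqr !expr2.
Qed.

(** The argument [h] is the derivative of [phi], or, at a zero of the derivative, its nonvanishing
    factor; the second case isolates the logarithmic singularity. *)
Definition logdens h phi z : R := ln (8 * normc (h z) ^+ 2 / (1 + normc (phi z) ^+ 2) ^+ 2).

Lemma dens_den_gt0 phi z : 0 < 1 + normc (phi z) ^+ 2.
Proof. by rewrite ltr_pwDl // exprn_ge0 // normc_ge0. Qed.

Lemma dens_gt0 h phi z : h z != 0 -> 0 < 8 * normc (h z) ^+ 2 / (1 + normc (phi z) ^+ 2) ^+ 2.
Proof.
move=> h0; rewrite divr_gt0 ?exprn_gt0 ?dens_den_gt0 // mulr_gt0 // exprn_gt0 // normc_gt0 //.
Qed.

Lemma Ck_logdens n h phi p : nearc (pt p) (hol h) -> nearc (pt p) (hol phi) -> h (pt p) != 0 ->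
  Ck n (fun q => logdens h phi (pt q)) p.
Proof.
move=> hh hphi h0; apply: Ck_ln; first exact: dens_gt0.
have N := CkD (Ck_cst n 1 p) (Ck_normc2 n hphi).
apply: CkM; first by apply: CkZ; exact: Ck_normc2.
apply: (@Ck_near _ _ (fun q => ((1 + normc (phi (pt q)) ^+ 2) * (1 + normc (phi (pt q)) ^+ 2))^-1)).
  by apply: near_all => q; rewrite expr2.
by apply: Ck_inv; [rewrite gt_eqF // mulr_gt0 // dens_den_gt0|exact: CkM].
Qed.

(* On a chart with nonvanishing derivative the Liouville equation holds: with [h = dC phi],
   [ln |h|^2] is harmonic and [ln (1 + |phi|^2)] has laplacian [4 |h|^2 / (1 + |phi|^2)^2]. *)
Lemma liouville_eq phi p : nearc (pt p) (hol phi) -> dC phi (pt p) != 0 ->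
  exists ux uy uxx uxy uyx uyy,
  [/\ \forall q \near p, gd (fun q => logdens (dC phi) phi (pt q)) q (ux q) (uy q),
      gd ux p uxx uxy, gd uy p uyx uyy &
      uxx + uyy = - expR (logdens (dC phi) phi (pt p))].
Proof.
move=> hphi h0; have hh := dC_hol hphi; have hh' := dC_hol hh.
have nh0 := cont_neq0 (hol_cont (nearc_self hh)) h0.
set h := dC phi in h0 hh hh' nh0 *.
pose A q := Re (phi (pt q)); pose B q := Im (phi (pt q)).
pose H q := Re (h (pt q)); pose K q := Im (h (pt q)).
pose X q := Re (dC h (pt q)); pose Y q := Im (dC h (pt q)).
pose N q := 1 + (A q * A q + B q * B q).
pose M q := H q * H q + K q * K q.
have N0 q : 0 < N q by rewrite ltr_pwDl // -!expr2 addr_ge0 // sqr_ge0.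
have gA q : hol phi (pt q) -> gd A q (H q) (- K q) by move=> /gd_hol[].
have gB q : hol phi (pt q) -> gd B q (K q) (H q) by move=> /gd_hol[].
have gH q : hol h (pt q) -> gd H q (X q) (- Y q) by move=> /gd_hol[].
have gK q : hol h (pt q) -> gd K q (Y q) (X q) by move=> /gd_hol[].
pose c z := dC h z / h z.
have hc : nearc (pt p) (hol c).
  by apply: nearc_imp (nearc_and (nearc_and hh hh') nh0) => w [[a b] d]; apply: holM => //; exact: holV.
have cE q : h (pt q) != 0 -> Re (c (pt q)) = (X q * H q + Y q * K q) / M q /\
    Im (c (pt q)) = (Y q * H q - X q * K q) / M q.
  move=> hq; have M0 : M q != 0.
    by rewrite /M -!expr2 -normc_sqr expf_neq0 // normc_eq0.
  rewrite /c /X /Y /H /K; move: M0; rewrite /M /H /K.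
  move: (Re_inv (h (pt q))) (Im_inv (h (pt q))).
  case: ((h (pt q))^-1) => e f; case: (h (pt q)) => r s; case: (dC h (pt q)) => t u /= -> -> M0.
  by split; field; rewrite ?M0.
pose ux q := 2 * Re (c (pt q)) + - 4 * ((A q * H q + B q * K q) * (N q)^-1).
pose uy q := - 2 * Im (c (pt q)) + - 4 * ((B q * H q + - 1 * (A q * K q)) * (N q)^-1).
have gN q : hol phi (pt q) -> gd N q (2 * (A q * H q + B q * K q)) (2 * (B q * H q - A q * K q)).
  move=> hq; have := gdD (gd_cst 1 q) (gdD (gdM (gA q hq) (gA q hq)) (gdM (gB q hq) (gB q hq))).
  by congr (gd _ _ _ _); ring.
have gNV q : hol phi (pt q) -> gd (fun q => (N q)^-1) q
    (- (N q * N q)^-1 * (2 * (A q * H q + B q * K q))) (- (N q * N q)^-1 * (2 * (B q * H q - A q * K q))).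
  move=> hq; have := gd_comp (is_derive_invr (lt0r_neq0 (N0 q))) (gN q hq).
  by rewrite invfM.
have gM q : hol h (pt q) -> gd M q (2 * (X q * H q + Y q * K q)) (- 2 * (Y q * H q - X q * K q)).
  move=> hq; have := gdD (gdM (gH q hq) (gH q hq)) (gdM (gK q hq) (gK q hq)).
  by congr (gd _ _ _ _); ring.
have M0 q : h (pt q) != 0 -> 0 < M q.
  by move=> hq; rewrite /M -!expr2 -normc_sqr exprn_gt0 // normc_gt0.
have LE q : h (pt q) != 0 -> ln 8 + (ln (M q) + - 2 * ln (N q)) = logdens h phi (pt q).
  move=> hq; rewrite /logdens !normc_sqr !expr2 -/(H q) -/(K q) -/(A q) -/(B q) -/(N q) -/(M q).
  have m0 := M0 q hq; have n0 := N0 q.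
  rewrite ln_div ?posrE ?mulr_gt0 // lnM ?posrE // lnM ?posrE //; ring.
have near1 := nearc_near (nearc_and (nearc_and hphi hh) (nearc_nearc nh0)).
have hp := nearc_self hphi; have hhp := nearc_self hh; have hcp := nearc_self hc.
exists ux, uy.
have [gRc gIc] := gd_hol hcp.
have gux := gdD (gdM (gd_cst 2 p) gRc) (gdM (gd_cst (- 4) p) (gdM (gdD (gdM (gA p hp) (gH p hhp)) (gdM (gB p hp) (gK p hhp))) (gNV p hp))).
have guy := gdD (gdM (gd_cst (- 2) p) gIc) (gdM (gd_cst (- 4) p) (gdM (gdD (gdM (gB p hp) (gH p hhp))
   (gdM (gd_cst (- 1) p) (gdM (gA p hp) (gK p hhp)))) (gNV p hp))).
do 4 eexists; split; [|exact: gux|exact: guy|].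
- apply: filterS near1 => q [[hq hhq] nq']; have nq := nearc_self nq'.
  have [eR eI] := cE q nq; have m0 := M0 q nq.
  have D := gdD (gd_cst (ln 8) q) (gdD (gd_comp (is_derive1_ln m0) (gM q hhq))
     (gdM (gd_cst (- 2) q) (gd_comp (is_derive1_ln (N0 q)) (gN q hq)))).
  have E : \forall r \near q, ln 8 + (ln (M r) + - 2 * ln (N r)) = logdens h phi (pt r).
    by apply: filterS (nearc_near nq') => r; exact: LE.
  have := gd_near E D; congr (gd _ _ _ _); rewrite /ux /uy ?eR ?eI.
    by move: (N0 q) m0 => /lt0r_neq0 n0 /lt0r_neq0 m0; field; rewrite n0 m0.
  by move: (N0 q) m0 => /lt0r_neq0 n0 /lt0r_neq0 m0; field; rewrite n0 m0.
- rewrite /logdens lnK ?posrE ?dens_gt0 // !normc_sqr !expr2 -/(H p) -/(K p) -/(A p) -/(B p) -/(N p).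
  move: (N0 p); rewrite /N => /lt0r_neq0; move: (A p) (B p) (H p) (K p) (X p) (Y p) (Re _) (Im _) => a b r s x y t u n0.
  by field; exact: n0.
Qed.

End ComplexPlane.

(** * Integration over the torus *)

Section PlaneMeasure.
Variable R : realType.
Local Notation T := (measurableTypeR R * measurableTypeR R)%type.
Local Notation leb := (@lebesgue_measure R).
Local Notation area := (@area R).
Implicit Types (p q v : R * R) (g h : R * R -> R).

Lemma near_box p (P : R * R -> Prop) : (\forall q \near p, P q) ->
  exists2 D : R, 0 < D & forall q, `|q.1 - p.1| < D -> `|q.2 - p.2| < D -> P q.
Proof.
move=> /nbhs_ballP[D /= D0 H]; exists D => // q h1 h2; apply: H.
by split; rewrite /= /ball /= distrC.
Qed.

Definition box (x y e : R) : set (R * R) := [set q | `|q.1 - x| < e /\ `|q.2 - y| < e].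

Lemma measurable_box (x y e : R) : measurable (box x y e : set T).
Proof.
have -> : box x y e = `]x - e, x + e[%classic `*` `]y - e, y + e[%classic.
  by apply/seteqP; split=> q; rewrite /box /= !in_itv /= -!ltr_distl.
by apply: measurableX; exact: measurable_itv.
Qed.

(** An open set of the plane is the union of the boxes with rational data contained in it; these are
    countably many and belong to the product algebra. *)
Lemma cont_meas g : (forall p, {for p, continuous g}) -> measurable_fun [set: T] (g : T -> R).
Proof.
move=> cg; apply: (measurability _ (RGenOInfty.measurableE R)) => //.
move=> _ [_ [a ->] <-]; rewrite setTI.
pose F (r : rat * rat * rat) : set T := [set q | box (ratr r.1.1) (ratr r.1.2) (ratr r.2) q /\
   box (ratr r.1.1) (ratr r.1.2) (ratr r.2) `<=` g @^-1` `]a, +oo[%classic].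
have -> : g @^-1` `]a, +oo[%classic = \bigcup_r F r.
  apply/seteqP; split=> [p /= | p [r _ [h1 h2]]]; last exact: h2.
  rewrite in_itv /= andbT => ap.
  have : \forall q \near p, a < g q.
    have /(@cvgrPdist_lt _ R^o) /(_ (g p - a)) := cg p; rewrite subr_gt0 => /(_ ap).
    by apply: filterS => q; rewrite ltr_norml => /andP[_]; lra.
  move=> /near_box[D D0 H].
  have D2 : 0 < D / 2 by rewrite divr_gt0.
  have [e + ] := rat_in_itvoo D2; rewrite in_itv /= => /andP[e0 eD].
  have l1 (x : R) : x - ratr e < x + ratr e by lra.
  have [x + ] := rat_in_itvoo (l1 p.1); rewrite in_itv /= => /andP[xa xb].
  have [y + ] := rat_in_itvoo (l1 p.2); rewrite in_itv /= => /andP[ya yb].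
  exists (x, y, e) => //; split; first by split; rewrite /= ltr_distl; apply/andP; split; lra.
  move=> q [/= q1 q2]; rewrite in_itv /= andbT; apply: H.
    by move: q1; rewrite !ltr_norml => /andP[? ?]; apply/andP; split; lra.
  by move: q2; rewrite !ltr_norml => /andP[? ?]; apply/andP; split; lra.
have mF r : measurable (F r).
  case: (pselect (box (ratr r.1.1) (ratr r.1.2) (ratr r.2) `<=` g @^-1` `]a, +oo[%classic)) => h.
    rewrite (_ : F r = box (ratr r.1.1) (ratr r.1.2) (ratr r.2)); first exact: measurable_box.
    by apply/seteqP; split=> [q []|q].
  by rewrite (_ : F r = set0) //; apply/seteqP; split=> [q []|q].
exact: countable_bigcupT_measurable.
Qed.

Definition sh v : T -> T := fun p => (p.1 + v.1, p.2 + v.2).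

Lemma sh_sh u v p : sh u (sh v p) = sh (v.1 + u.1, v.2 + u.2) p.
Proof. by rewrite /sh /= !addrA. Qed.

Lemma measurable_sh v : measurable_fun setT (sh v).
Proof.
apply: measurable_fun_pair => /=.
  by apply: measurable_funD => //; exact: measurable_fst.
by apply: measurable_funD => //; exact: measurable_snd.
Qed.

Lemma measurable_sh_pre v (D : set T) : measurable D -> measurable (sh v @^-1` D).
Proof. by move=> mD; rewrite -[X in measurable X]setTI; exact: measurable_sh. Qed.

Lemma leb_shift (a : R) (A : set R) : measurable A ->
  pushforward leb ((fun x => x + a) : _ -> measurableTypeR R) A = leb A.
Proof.
move=> mA; apply/esym/lebesgue_measure_unique => //=.
  by apply: measurable_funD.
move=> mf _ [[x y]] _ <-; rewrite /pushforward.
have -> : (fun x => x + a) @^-1` `]x, y]%classic = `]x - a, y - a]%classic.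
  by apply/seteqP; split=> t /=; rewrite !in_itv /= => /andP[? ?]; apply/andP; split; lra.
rewrite !lebesgue_measure_itv /= !lte_fin ltrD2r; case: ifP => // _.
by rewrite -!EFinB; congr EFin; ring.
Qed.

Lemma area_shift v (A : set T) : measurable A -> pushforward area (sh v) A = area A.
Proof.
move=> mA; apply/esym; apply: product_measure_unique => //; first exact: measurable_sh.
move=> mf B D mB mD.
change ((leb \x leb)%E (sh v @^-1` (B `*` D)) = (leb B * leb D)%E).
have -> : sh v @^-1` (B `*` D) = ((fun x => x + v.1) @^-1` B) `*` ((fun x => x + v.2) @^-1` D).
  by apply/seteqP; split.
rewrite product_measure1E; last 2 first.
- by rewrite -[X in measurable X]setTI; apply: measurable_funD.
- by rewrite -[X in measurable X]setTI; apply: measurable_funD.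
by congr (_ * _)%E; exact: leb_shift.
Qed.

Lemma ge0_int_shift v (D : set T) (f : T -> \bar R) : measurable D -> measurable_fun setT f ->
  (forall p, 0 <= f p)%E ->
  (\int[area]_(p in sh v @^-1` D) f (sh v p) = \int[area]_(p in D) f p)%E.
Proof.
move=> mD mf f0.
have mf' : measurable_fun D f by exact: measurable_funS mf.
have f0' : {in D, forall y, (0 <= f y)%E} by move=> y _.
apply: (eq_trans (esym (@ge0_integral_pushforward _ _ T T R (sh v) (measurable_sh v) area D f mD mf' f0'))).
apply: eq_measure_integral; first exact: measurable_sh.
by move=> ? A mA _; exact: (area_shift v mA).
Qed.

End PlaneMeasure.

(** * Tiling the plane by lattice translates of a parallelogram *)

Section Tiling.
Variable R : realType.
Local Notation C := R[i].
Local Notation T := (measurableTypeR R * measurableTypeR R)%type.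
Local Notation area := (@area R).
Variables w1 w2 : C.
Hypothesis hw : 0 < Im (w2 / w1).
Local Notation E := (fundamental_domain w1 w2 : set T).
Implicit Types (p q v : R * R) (n : int * int).

Definition ct p : R := Im (pt p / w1) / Im (w2 / w1).
Definition cs p : R := Re (pt p / w1) - ct p * Re (w2 / w1).
Definition vec (z : C) : R * R := (Re z, Im z).
Definition lv n : R * R := vec (w1 *~ n.1 + w2 *~ n.2).

Lemma pt_vec z : pt (vec z) = z.
Proof. by case: z. Qed.

Lemma pt_sh v p : pt (sh v p) = pt p + pt v.
Proof. exact: eq_ReIm. Qed.

Lemma w1_neq0 : w1 != 0.
Proof. exact: Im_div_neq0 hw. Qed.

Lemma coords_eq p : pt p = (cs p)%:C * w1 + (ct p)%:C * w2.
Proof.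
have [s [t e]] := lattice_coords (pt p) hw.
have e1 : pt p / w1 = s%:C + t%:C * (w2 / w1) by rewrite e; field; exact: w1_neq0.
have et : ct p = t.
  rewrite /ct e1; move: hw; case: (w2 / w1) => x y /= y0; field; exact: lt0r_neq0.
have es : cs p = s by rewrite /cs et e1; case: (w2 / w1) => x y /=; ring.
by rewrite et es.
Qed.

Lemma coords_inj (s t : R) p : pt p = s%:C * w1 + t%:C * w2 -> cs p = s /\ ct p = t.
Proof.
move=> e; have e1 : pt p / w1 = s%:C + t%:C * (w2 / w1) by rewrite e; field; exact: w1_neq0.
have et : ct p = t.
  rewrite /ct e1; move: hw; case: (w2 / w1) => x y /= y0; field; exact: lt0r_neq0.
by split=> //; rewrite /cs et e1; case: (w2 / w1) => x y /=; ring.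
Qed.

Lemma coords_sh v p : cs (sh v p) = cs p + cs v /\ ct (sh v p) = ct p + ct v.
Proof.
apply: coords_inj; rewrite pt_sh (coords_eq p) (coords_eq v) !raddfD /=; ring.
Qed.

Lemma coords_lv n : cs (lv n) = n.1%:~R /\ ct (lv n) = n.2%:~R.
Proof. by apply: coords_inj; rewrite pt_vec !intrC (mulrzl w1) (mulrzl w2). Qed.

Lemma E_coords p : E p <-> (0 <= cs p < 1 /\ 0 <= ct p < 1).
Proof.
split=> [[s [t [hs ht e]]]|[hs ht]]; first by have [-> ->] := coords_inj e.
by exists (cs p), (ct p); split=> //; exact: coords_eq.
Qed.

Lemma coords_linear : exists a b c d : R, forall p, cs p = a * p.1 + b * p.2 /\ ct p = c * p.1 + d * p.2.
Proof.
pose u := w1^-1; pose y := Im (w2 / w1); pose x := Re (w2 / w1).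
exists (Re u - Im u / y * x), (- Im u - Re u / y * x), (Im u / y), (Re u / y) => p.
have y0 : y != 0 by rewrite gt_eqF.
have eI : Im (pt p / w1) = Im u * p.1 + Re u * p.2 by rewrite -/u; case: (u) => a b /=; ring.
have eR : Re (pt p / w1) = Re u * p.1 - Im u * p.2 by rewrite -/u; case: (u) => a b /=; ring.
rewrite /cs /ct eI eR -/x -/y; clearbody y x; by split; field.
Qed.

Lemma linear_cont (a b : R) p : {for p, continuous (fun q : R * R => a * q.1 + b * q.2)}.
Proof.
apply: addp_cont; apply: mulp_cont; [exact: cst_cont|exact: fst_cont|exact: cst_cont|exact: snd_cont].
Qed.

Lemma coords_cont p : {for p, continuous cs} /\ {for p, continuous ct}.
Proof.
have [a [b [c [d H]]]] := coords_linear; split.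
- by apply: (@continuous_near _ (fun q : R * R => a * q.1 + b * q.2)); [apply: near_all => q; case: (H q)|exact: linear_cont].
- by apply: (@continuous_near _ (fun q : R * R => c * q.1 + d * q.2)); [apply: near_all => q; case: (H q)|exact: linear_cont].
Qed.

Lemma measurable_E : measurable E.
Proof.
have -> : E = (cs @^-1` `[0, 1[%classic) `&` (ct @^-1` `[0, 1[%classic).
  by apply/seteqP; split=> p /=; rewrite !in_itv /= => /E_coords.
apply: measurableI.
  rewrite -[X in measurable X]setTI; apply: cont_meas => //; first by move=> p; case: (coords_cont p).
rewrite -[X in measurable X]setTI; apply: cont_meas => //; by move=> p; case: (coords_cont p).
Qed.

Lemma int_small (m : int) (x y : R) : 0 <= x < 1 -> 0 <= y < 1 -> y = x + m%:~R -> m = 0.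
Proof.
move=> /andP[x0 x1] /andP[y0 y1] e.
have l1 : (m%:~R : R) < 1%:~R by lra.
have l2 : ((-1)%:~R : R) < m%:~R by rewrite rmorphN /=; lra.
move: l1 l2; rewrite !ltr_int; lia.
Qed.

Lemma E_unique n p : E p -> E (sh (lv n) p) -> n = (0, 0).
Proof.
move=> /E_coords[s t] /E_coords; have [-> ->] := coords_sh (lv n) p.
have [-> ->] := coords_lv n => -[s' t'].
by case: n s' t' => a b /= s' t'; rewrite (int_small s s' erefl) (int_small t t' erefl).
Qed.

Lemma E_reduce p : exists n, E (sh (lv n) p).
Proof.
have [l [s [t [[m [n ->]] hs ht e]]]] := lattice_reduce (pt p) hw.
exists (- m, - n), s, t; split=> //; have := pt_sh (lv (- m, - n)) p; rewrite pt_vec /= /pt => ->.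
by rewrite -[X in X + _]/(pt p) e !mulrNz; ring.
Qed.

Definition pper (V : Type) (f : R * R -> V) := forall n p, f (sh (lv n) p) = f p.

(** Lattice translates of each parallelogram cut the other into pieces: translation by the lattice
    vector of code [k] carries [F k] onto [G k] without changing the integral. Naturals that code no
    pair of integers give empty pieces. *)
Lemma ge0_tile v (f : T -> \bar R) : measurable_fun setT f -> (forall p, 0 <= f p)%E -> pper f ->
  (\int[area]_(p in sh v @^-1` E) f p = \int[area]_(p in E) f p)%E.
Proof.
move=> mf f0 per; pose D : set T := sh v @^-1` E.
have mE := measurable_E; have mD : measurable D by exact: measurable_sh_pre.
pose F (k : nat) : set T := if pickle_inv k is Some n then E `&` (sh (lv n) @^-1` D) else set0.
pose G (k : nat) : set T := if pickle_inv k is Some n then (sh (lv (- n.1, - n.2)) @^-1` E) `&` D else set0.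
have shN n p : sh (lv (- n.1, - n.2)) (sh (lv n) p) = p.
  rewrite sh_sh /sh /lv /vec /= !mulrNz.
  case: p => a b /=; congr pair; move: (w1 *~ _) (w2 *~ _) => [x y] [x' y'] /=; ring.
have shN' n p : sh (lv n) (sh (lv (- n.1, - n.2)) p) = p.
  rewrite sh_sh /sh /lv /vec /= !mulrNz.
  case: p => a b /=; congr pair; move: (w1 *~ _) (w2 *~ _) => [x y] [x' y'] /=; ring.
have shC u u' p : sh u (sh u' p) = sh u' (sh u p).
  by rewrite !sh_sh /sh /=; congr pair; ring.
have mF k : measurable (F k).
  by rewrite /F; case: (pickle_inv k) => // n; apply: measurableI => //; exact: measurable_sh_pre.
have mG k : measurable (G k).
  by rewrite /G; case: (pickle_inv k) => // n; apply: measurableI => //; exact: measurable_sh_pre.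
have diff n n' q : E (sh (lv n) q) -> E (sh (lv n') q) -> n = n'.
  move=> h1 h2; have e : sh (lv n') q = sh (lv (n'.1 - n.1, n'.2 - n.2)) (sh (lv n) q).
    rewrite sh_sh /sh /lv /vec /= !mulrzBr.
    case: q {h1 h2} => a b /=; congr pair;
    move: (w1 *~ _) (w2 *~ _) (w1 *~ _) (w2 *~ _) => [? ?] [? ?] [? ?] [? ?] /=; ring.
  rewrite e in h2; have := E_unique h1 h2; case: n n' {h1 h2 e} => a b [a' b'] /= [/eqP + /eqP].
  by rewrite !subr_eq0 => /eqP -> /eqP ->.
have UF : \bigcup_k F k = E.
  apply/seteqP; split=> [p [k _]|p Ep].
    by rewrite /F; case: (pickle_inv k) => // n [].
  have [n En] := E_reduce (sh v p); exists (pickle n); first exact: I.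
  by rewrite /F pickleK_inv; split; [exact: Ep|rewrite /D /preimage /= shC; exact: En].
have UG : \bigcup_k G k = D.
  apply/seteqP; split=> [p [k _]|p Dp].
    by rewrite /G; case: (pickle_inv k) => // n [].
  have [[a b] En] := E_reduce p; exists (pickle (- a, - b)); first exact: I.
  by rewrite /G pickleK_inv /= !opprK; split; [exact: En|exact: Dp].
have pinv k n : @pickle_inv (int * int)%type k = Some n -> k = pickle n.
  by move=> e; have := @pickle_invK (int * int)%type k; rewrite e.
have tF : trivIset setT F.
  apply/trivIsetP => i j _ _; apply: contraPP => /eqP/set0P[p []]; rewrite /F.
  case ei : (pickle_inv i) => [n|//] [_ h1]; case ej : (pickle_inv j) => [n'|//] [_ h2].
  rewrite /D /preimage /= shC in h1; rewrite /D /preimage /= shC in h2.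
  by rewrite (pinv _ _ ei) (pinv _ _ ej) (diff _ _ _ h1 h2) eqxx.
have tG : trivIset setT G.
  apply/trivIsetP => i j _ _; apply: contraPP => /eqP/set0P[p []]; rewrite /G.
  case ei : (pickle_inv i) => [n|//] [h1 _]; case ej : (pickle_inv j) => [n'|//] [h2 _].
  rewrite (pinv _ _ ei) (pinv _ _ ej); have := diff _ _ _ h1 h2.
  by case: n n' {ei ej h1 h2} => a b [a' b'] /= [/oppr_inj -> /oppr_inj ->]; rewrite eqxx.
have I1 : (\int[area]_(p in D) f p = \sum_(k <oo) \int[area]_(p in G k) f p)%E.
  rewrite -[in LHS]UG; apply: ge0_integral_bigcup => //.
  by rewrite UG; exact: measurable_funS mf.
have I2 : (\int[area]_(p in E) f p = \sum_(k <oo) \int[area]_(p in F k) f p)%E.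
  rewrite -[in LHS]UF; apply: ge0_integral_bigcup => //.
  by rewrite UF; exact: measurable_funS mf.
apply: (eq_trans I1); apply: (eq_trans _ (esym I2)).
apply: eq_eseriesr => k _; rewrite /F /G; case: (pickle_inv k) => [n|]; last by rewrite !integral_set0.
rewrite -(ge0_int_shift (lv n)) //; last by apply: measurableI => //; exact: measurable_sh_pre.
rewrite preimage_setI.
have -> : sh (lv n) @^-1` (sh (lv (- n.1, - n.2)) @^-1` E) = E.
  by apply/seteqP; split=> p; rewrite /preimage /= shN.
by apply: eq_integral => p _; rewrite per.
Qed.

End Tiling.

(** * Integrals of periodic functions and Green's formula *)

Section PeriodicIntegrals.
Variable R : realType.
Local Notation C := R[i].
Local Notation T := (measurableTypeR R * measurableTypeR R)%type.
Local Notation area := (@area R).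
Variables w1 w2 : C.
Hypothesis hw : 0 < Im (w2 / w1).
Local Notation E := (fundamental_domain w1 w2 : set T).
Local Notation pper := (pper w1 w2).
Implicit Types (p q v e : R * R) (n : int * int) (g h : R * R -> R).

Definition dom v : set T := sh v @^-1` E.

Lemma sh0 p : sh (0, 0) p = p.
Proof. by case: p => a b; rewrite /sh /= !addr0. Qed.

Lemma dom0 : dom (0, 0) = E.
Proof. by apply/seteqP; split=> p; rewrite /dom /preimage /= sh0. Qed.

Lemma measurable_dom v : measurable (dom v).
Proof. by apply: measurable_sh_pre; exact: measurable_E. Qed.

Lemma tile v (f : T -> \bar R) : measurable_fun setT f -> pper f ->
  (\int[area]_(p in dom v) f p = \int[area]_(p in E) f p)%E.
Proof.
move=> mf per; rewrite [LHS]integralE [RHS]integralE; congr (_ - _)%E.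
- apply: (ge0_tile hw v) => //; first exact: measurable_funepos.
  by move=> n p; rewrite !funeposE per.
- apply: (ge0_tile hw v) => //; first exact: measurable_funeneg.
  by move=> n p; rewrite !funenegE per.
Qed.

Lemma integrable_tile v (f : T -> \bar R) : measurable_fun setT f -> pper f ->
  area.-integrable (dom v) f -> area.-integrable E f.
Proof.
move=> mf per /integrableP[_ H]; apply/integrableP; split; first exact: measurable_funS mf.
rewrite -(tile v) //; first exact: measurableT_comp.
by move=> n p /=; rewrite per.
Qed.

Lemma int_shift v (f : T -> \bar R) : measurable_fun setT f -> pper f ->
  (\int[area]_(p in E) f (sh v p) = \int[area]_(p in E) f p)%E.
Proof.
move=> mf per.
have ge0 (k : T -> \bar R) : measurable_fun setT k -> (forall p, 0 <= k p)%E -> pper k ->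
    (\int[area]_(p in E) k (sh v p) = \int[area]_(p in E) k p)%E.
  move=> mk k0 pk; apply: (eq_trans _ (tile (- v.1, - v.2) mk pk)).
  apply: (eq_trans _ (ge0_int_shift v (measurable_dom _) mk k0)).
  have -> : sh v @^-1` dom (- v.1, - v.2) = E.
    by apply/seteqP; split=> p; rewrite /dom /preimage /= sh_sh /= !subrr sh0.
  by [].
rewrite [LHS]integralE [RHS]integralE; congr (_ - _)%E.
- have pp : pper f^\+%E by move=> n p; rewrite !funeposE per.
  apply: (eq_trans _ (ge0 _ (measurable_funepos mf) (fun p => funepos_ge0 f p) pp)).
  by apply: eq_integral => p _; rewrite !funeposE.
- have pp : pper f^\-%E by move=> n p; rewrite !funenegE per.
  apply: (eq_trans _ (ge0 _ (measurable_funeneg mf) (fun p => funeneg_ge0 f p) pp)).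
  by apply: eq_integral => p _; rewrite !funenegE.
Qed.

Lemma dom_bounded v : exists2 M : R, 0 < M & forall p, dom v p -> `|p.1| <= M /\ `|p.2| <= M.
Proof.
exists (normc w1 + normc w2 + `|v.1| + `|v.2| + 1).
  by rewrite ltr_wpDl // !addr_ge0 ?normc_ge0.
move=> p [s [t [/andP[s0 s1] /andP[t0 t1] e]]].
have e' : pt p + pt v = s%:C * w1 + t%:C * w2 by rewrite -e /pt; exact: eq_ReIm.
have nz : normc (pt p + pt v) <= normc w1 + normc w2.
  rewrite e' (le_trans (le_normcD _ _)) // !normcM !normcR !ger0_norm // lerD //.
    by rewrite ler_piMl ?normc_ge0 // ltW.
  by rewrite ler_piMl ?normc_ge0 // ltW.
have b1 : `|p.1 + v.1| <= normc w1 + normc w2 by apply: le_trans nz; exact: (normc_Re (pt p + pt v)).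
have b2 : `|p.2 + v.2| <= normc w1 + normc w2 by apply: le_trans nz; exact: (normc_Im (pt p + pt v)).
have c1 : `|p.1| <= `|p.1 + v.1| + `|v.1| by rewrite -{1}(addrK v.1 p.1) ler_normB.
have c2 : `|p.2| <= `|p.2 + v.2| + `|v.2| by rewrite -{1}(addrK v.2 p.2) ler_normB.
have := normr_ge0 v.1; have := normr_ge0 v.2; split; lra.
Qed.

Lemma areaX (A B : set R) : measurable A -> measurable B ->
  area (A `*` B) = (@lebesgue_measure R A * @lebesgue_measure R B)%E.
Proof. by move=> mA mB; exact: product_measure1E. Qed.

Lemma dom_finite v : (area (dom v) < +oo)%E.
Proof.
have [M M0 H] := dom_bounded v.
apply: (@le_lt_trans _ _ (area (`[- M, M]%classic `*` `[- M, M]%classic))).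
  apply: le_measure; rewrite ?inE; [exact: measurable_dom|by apply: measurableX; exact: measurable_itv|].
  by move=> p /H[h1 h2]; split; rewrite /= in_itv /= -ler_norml.
rewrite areaX; [|exact: measurable_itv|exact: measurable_itv].
rewrite !lebesgue_measure_itv /=; case: ifP => _; last by rewrite mule0 ltry.
by rewrite -EFinB -EFinM ltry.
Qed.

Lemma cont_rect_bounded g (M : R) : (forall p, {for p, continuous g}) -> 0 <= M ->
  exists2 B : R, 0 < B & forall p, `|p.1| <= M -> `|p.2| <= M -> `|g p| <= B.
Proof.
move=> cg M0; pose f (z : C) : C := (g (Re z, Im z))%:C.
have cf z : cont_at f z.
  move=> e e0; have /(@cvgrPdist_lt _ R^o)/(_ _ e0)/near_box[D D0 H] := cg (Re z, Im z).
  exists D => // w wD; rewrite -raddfB normcR distrC; apply: H => /=.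
    by rewrite -ReB (le_lt_trans (normc_Re _)).
  by rewrite -ImB (le_lt_trans (normc_Im _)).
have Ml : - M <= M by lra.
have [B HB] := bounded_rect Ml Ml (fun z _ => cf z).
exists (`|B| + 1); first by rewrite ltr_wpDl.
move=> p p1 p2; have := HB (pt p); rewrite normcR /=.
have -> : (p.1, p.2) = p by case: p {p1 p2}.
move=> H; apply: (@le_trans _ _ B); last by rewrite (le_trans (ler_norm _)) // lerDl.
by apply: H; split; rewrite -ler_norml.
Qed.

Lemma int_cont v g : (forall p, {for p, continuous g}) -> area.-integrable (dom v) (EFin \o g).
Proof.
move=> cg; apply: measurable_bounded_integrable.
- exact: measurable_dom.
- exact: dom_finite.
- exact: measurable_funS (cont_meas cg).
- have [M M0 H] := dom_bounded v; have [B B0 HB] := cont_rect_bounded cg (ltW M0).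
  exists B; split; first exact: num_real.
  by move=> x xB p /H[p1 p2]; apply: ltW; apply: le_lt_trans xB; exact: HB.
Qed.

Lemma pper_bounded g : (forall p, {for p, continuous g}) -> pper g ->
  exists2 B : R, 0 < B & forall p, `|g p| <= B.
Proof.
move=> cg per; have [M M0 H] := dom_bounded (0, 0); have [B B0 HB] := cont_rect_bounded cg (ltW M0).
exists B => // p; have [n En] := E_reduce hw p; rewrite -(per n p).
by rewrite -dom0 in En; have [h1 h2] := H _ En; exact: HB.
Qed.

Lemma derive_line g p e t : derivable g (t *: e + p) e ->
  is_derive t 1 (fun s : R => g (s *: e + p)) ('D_e g (t *: e + p)).
Proof.
move=> dg.
have E1 : (fun s : R => s^-1 *: (g ((s *: (1 : R) + t) *: e + p) - g (t *: e + p))) =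
    (fun s : R => s^-1 *: (g (s *: e + (t *: e + p)) - g (t *: e + p))).
  by apply/funext => s; rewrite scalerDl addrA [s *: (1:R)]mulr1.
have D : derivable (fun s : R => g (s *: e + p)) t 1.
  by move: dg; rewrite /derivable -E1.
by split=> //; exact: (congr1 (fun k : R -> R => lim (k @ 0^')) E1).
Qed.

Lemma deriv_bound g e : (forall p, derivable g p e) -> forall p (d : R), 0 < d ->
  exists2 c : R, 0 < c < d & g (d *: e + p) - g p = d * 'D_e g (c *: e + p).
Proof.
move=> dg p d d0.
have D (t : R) : is_derive t 1 (fun s : R => g (s *: e + p)) ('D_e g (t *: e + p)) by exact: derive_line.
have [|c] := @MVT R (fun s : R => g (s *: e + p)) (fun t => 'D_e g (t *: e + p)) 0 d d0 (fun x _ => D x).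
  apply: derivable_within_continuous => x _; exact: (@ex_derive _ _ _ _ _ _ _ (D x)).
rewrite in_itv /= => hc; rewrite scale0r add0r subr0 mulrC => ->; by exists c.
Qed.

Lemma sh_scale d e p : sh (d * e.1, d * e.2) p = d *: e + p.
Proof. by rewrite /sh [RHS]surjective_pairing /= addrC [X in (_, X)]addrC. Qed.

Lemma pper_derive g e : pper g -> pper ('D_e g).
Proof.
move=> per n p.
have E1 : (fun s : R => s^-1 *: (g (s *: e + sh (lv w1 w2 n) p) - g (sh (lv w1 w2 n) p))) =
    (fun s : R => s^-1 *: (g (s *: e + p) - g p)).
  apply/funext => s; rewrite per -(per n (s *: e + p)); congr (_ *: (g _ - _)).
  by rewrite -!sh_scale !sh_sh; congr (sh _ _); rewrite /=; congr pair; ring.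
exact: (congr1 (fun k : R -> R => lim (k @ 0^')) E1).
Qed.

(** Difference quotients of a periodic function have integral 0 by translation invariance, and the
    mean value theorem bounds them by the supremum of the derivative. Dominated convergence thus
    replaces integration over the boundary of the parallelogram. *)
Lemma int_derive0 g e : (forall p, {for p, continuous g}) -> (forall p, derivable g p e) ->
  (forall p, {for p, continuous ('D_e g)}) -> pper g ->
  \int[area]_(p in E) ('D_e g p) = 0.
Proof.
move=> cg dg cD per; have mE := measurable_E hw.
have [B B0 HB] := pper_bounded cD (pper_derive e per).
pose d (m : nat) : R := m.+1%:R^-1; have d0 m : 0 < d m by rewrite invr_gt0.
pose qt (m : nat) p : R := (d m)^-1 * (g (sh (d m * e.1, d m * e.2) p) - g p).
have mg := cont_meas cg.
have cgs m p : {for p, continuous (fun q => g (sh (d m * e.1, d m * e.2) q))}.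
  have -> : (fun q => g (sh (d m * e.1, d m * e.2) q)) = (fun q => g (d m *: e + q)).
    by apply/funext => q; rewrite sh_scale.
  apply: (@continuous_comp _ _ _ (fun q => d m *: e + q) g p); last exact: cg.
  by apply: cvgD; [exact: cvg_cst|exact: cvg_id].
have cq m p : {for p, continuous (qt m)}.
  apply: mulp_cont; first exact: cst_cont.
  by apply: addp_cont => //; apply: cvgN; exact: cg.
have qb m p : `|qt m p| <= B.
  have [c _ e1] := deriv_bound dg p (d0 m).
  by rewrite /qt sh_scale e1 mulKf ?gt_eqF.
have ql p : qt ^~ p @ \oo --> 'D_e g p.
  apply/cvgrPdist_lt => eps eps0.
  have /(@cvgrPdist_lt _ R^o)/(_ _ eps0)/near_box[D D0 H] := cD p.
  pose M : R := `|e.1| + `|e.2| + 1.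
  have M0 : 0 < M by rewrite ltr_wpDl // addr_ge0.
  have [N _ HN] := @near_infty_natSinv_lt R (PosNum (divr_gt0 D0 M0)).
  exists N => // m Nm; have := HN m Nm => /= dm.
  have [c /andP[c0 cd] e1] := deriv_bound dg p (d0 m).
  have small x : `|x| <= M -> `|c * x| < D.
    move=> xM; rewrite normrM (ger0_norm (ltW c0)).
    apply: (@le_lt_trans _ _ (c * M)); first by rewrite ler_pM2l.
    by rewrite -ltr_pdivlMr // (lt_trans cd).
  rewrite /qt sh_scale e1 mulKf ?gt_eqF //; apply: H.
    have -> : (c *: e + p).1 - p.1 = c * e.1 by rewrite /= addrK.
    by apply: small; rewrite /M; have := normr_ge0 e.2; lra.
  have -> : (c *: e + p).2 - p.2 = c * e.2 by rewrite /= addrK.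
  by apply: small; rewrite /M; have := normr_ge0 e.1; lra.
have I0 m : (\int[area]_(p in E) (qt m p)%:E = 0)%E.
  have i1 := int_cont (0, 0) (cgs m); have i2 := int_cont (0, 0) cg; rewrite dom0 in i1 i2.
  have -> : (\int[area]_(p in E) (qt m p)%:E =
     (d m)^-1%:E * (\int[area]_(p in E) (g (sh (d m * e.1, d m * e.2) p))%:E - \int[area]_(p in E) (g p)%:E))%E.
    rewrite -integralB // -integralZl //; last exact: integrableB.
  have mF : measurable_fun setT (EFin \o g : T -> \bar R) by exact/measurable_EFinP.
  have pF : pper (EFin \o g) by move=> n p /=; rewrite per.
  have := int_shift (d m * e.1, d m * e.2) mF pF => /= ->.
  by rewrite subee ?mule0 //; exact: integrable_fin_num i2.
have mqt m : measurable_fun E (fun p : T => (qt m p)%:E).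
  by apply/measurable_EFinP; exact: measurable_funS (cont_meas (cq m)).
have mD : measurable_fun E (fun p : T => ('D_e g p)%:E).
  by apply/measurable_EFinP; exact: measurable_funS (cont_meas cD).
have iB : area.-integrable E (fun=> B%:E).
  by have := int_cont (0, 0) (fun p => @cst_cont R p B); rewrite dom0.
have [||_ _ L] := @dominated_convergence _ T R area E mE (fun m p => (qt m p)%:E) (fun p => ('D_e g p)%:E) (fun=> B%:E) mqt mD _ iB.
- by apply: aeW => p _; apply: cvg_EFin; [exact: nearW|exact: ql].
- by apply: aeW => p m _; rewrite abse_EFin lee_fin.
move: L; rewrite (_ : [sequence _]_n = (fun=> 0%E)); last by apply/funext => m /=; exact: I0.
by move=> L; rewrite /Rintegral -(cvg_lim (@ereal_hausdorff R) L) lim_cst.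
Qed.

Lemma class_C2_facts g : class_C 2 setT g ->
  [/\ forall p, {for p, continuous g}, forall p, derivable g p (1, 0), forall p, derivable g p (0, 1) &
   [/\ forall p, {for p, continuous (dx g)}, forall p, derivable (dx g) p (1, 0) & forall p, {for p, continuous (dx (dx g))}] /\
   [/\ forall p, {for p, continuous (dy g)}, forall p, derivable (dy g) p (0, 1) & forall p, {for p, continuous (dy (dy g))}]].
Proof.
move=> [c0 [d0 [cx [dx0 [cxx _] _]] [cy [dy0 _ [cyy _]]]]]; split.
- by move=> p; exact: c0.
- by move=> p; case: (d0 p I).
- by move=> p; case: (d0 p I).
- split; split=> p; [exact: cx|by case: (dx0 p I)|exact: cxx|exact: cy|by case: (dy0 p I)|exact: cyy].
Qed.

Lemma lap_cont g : class_C 2 setT g -> forall p, {for p, continuous (laplacian g)}.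
Proof. by move=> /class_C2_facts[_ _ _ [[_ _ cxx] [_ _ cyy]]] p; exact: (addp_cont (cxx p) (cyy p)). Qed.

Lemma pper_lap g : pper g -> pper (laplacian g).
Proof. by move=> per n p; rewrite /laplacian /dx /dy !(pper_derive _ (pper_derive _ per)). Qed.

Lemma subp_cont g h p : {for p, continuous g} -> {for p, continuous h} ->
  {for p, continuous (fun q => g q - h q)}.
Proof. move=> cg ch; exact: (cvgB cg ch). Qed.

(** The integrand is the derivative along [e] of [g * 'D_e h - h * 'D_e g], in which the mixed
    products cancel, so [int_derive0] applies. *)
Lemma green_dir g h e :
  (forall p, {for p, continuous g}) -> (forall p, derivable g p e) ->
  (forall p, {for p, continuous ('D_e g)}) -> (forall p, derivable ('D_e g) p e) ->
  (forall p, {for p, continuous ('D_e ('D_e g))}) -> pper g ->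
  (forall p, {for p, continuous h}) -> (forall p, derivable h p e) ->
  (forall p, {for p, continuous ('D_e h)}) -> (forall p, derivable ('D_e h) p e) ->
  (forall p, {for p, continuous ('D_e ('D_e h))}) -> pper h ->
  \int[area]_(p in E) (g p * 'D_e ('D_e h) p - h p * 'D_e ('D_e g) p) = 0.
Proof.
move=> cg dg cg1 dg1 cg2 pg ch dh ch1 dh1 ch2 ph.
pose F : R * R -> R := (g \* 'D_e h) - (h \* 'D_e g).
have dF p : derivable F p e.
  by apply: derivableB; apply: derivableM.
have DF p : 'D_e F p = g p * 'D_e ('D_e h) p - h p * 'D_e ('D_e g) p.
  rewrite deriveB; [|exact: derivableM|exact: derivableM].
  have -> : 'D_e (g \* 'D_e h) p = g p * 'D_e ('D_e h) p + 'D_e h p * 'D_e g p by exact: (deriveM (dg p) (dh1 p)).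
  have -> : 'D_e (h \* 'D_e g) p = h p * 'D_e ('D_e g) p + 'D_e g p * 'D_e h p by exact: (deriveM (dh p) (dg1 p)).
  by move: ('D_e g p) ('D_e h p) ('D_e ('D_e h) p) ('D_e ('D_e g) p) => a b c d; ring.
have cF p : {for p, continuous F}.
  exact: (subp_cont (mulp_cont (cg p) (ch1 p)) (mulp_cont (ch p) (cg1 p))).
have cDF p : {for p, continuous ('D_e F)}.
  rewrite (_ : 'D_e F = fun p => g p * 'D_e ('D_e h) p - h p * 'D_e ('D_e g) p); last exact/funext.
  exact: (subp_cont (mulp_cont (cg p) (ch2 p)) (mulp_cont (ch p) (cg2 p))).
have pF : pper F.
  move=> n p; set q := sh _ p.
  change (g q * 'D_e h q - h q * 'D_e g q = g p * 'D_e h p - h p * 'D_e g p).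
  by rewrite /q pg ph (pper_derive e pg) (pper_derive e ph).
rewrite -[RHS](int_derive0 cF dF cDF pF); congr Rintegral; exact/funext.
Qed.

Lemma green g h : class_C 2 setT g -> pper g -> class_C 2 setT h -> pper h ->
  \int[area]_(p in E) (g p * laplacian h p) = \int[area]_(p in E) (h p * laplacian g p).
Proof.
move=> Cg pg Ch ph; have mE := measurable_E hw.
have icont (k : R * R -> R) : (forall p, {for p, continuous k}) -> area.-integrable E (EFin \o k).
  by move=> ck; rewrite -dom0; exact: int_cont.
have lg := lap_cont Cg; have lh := lap_cont Ch.
have [cg dg dg' [[cg1 dg1 cg2] [cg1' dg1' cg2']]] := class_C2_facts Cg.
have [ch dh dh' [[ch1 dh1 ch2] [ch1' dh1' ch2']]] := class_C2_facts Ch.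
have I1 := green_dir cg dg cg1 dg1 cg2 pg ch dh ch1 dh1 ch2 ph.
have I2 := green_dir cg dg' cg1' dg1' cg2' pg ch dh' ch1' dh1' ch2' ph.
have cB (k k' : R * R -> R) : (forall p, {for p, continuous k}) -> (forall p, {for p, continuous k'}) -> forall p : R * R,
    {for p, continuous (fun p => k p - k' p)}.
  by move=> h1 h2 p; exact: (subp_cont (h1 p) (h2 p)).
have cM (k k' : R * R -> R) : (forall p, {for p, continuous k}) -> (forall p, {for p, continuous k'}) -> forall p : R * R,
    {for p, continuous (fun p => k p * k' p)}.
  by move=> h1 h2 p; exact: (mulp_cont (h1 p) (h2 p)).
pose A p := g p * dx (dx h) p - h p * dx (dx g) p.
pose B p := g p * dy (dy h) p - h p * dy (dy g) p.
have iA : area.-integrable E (EFin \o A) := icont _ (cB _ _ (cM _ _ cg ch2) (cM _ _ ch cg2)).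
have iB : area.-integrable E (EFin \o B) := icont _ (cB _ _ (cM _ _ cg ch2') (cM _ _ ch cg2')).
have igh := icont _ (cM _ _ cg lh); have ihg := icont _ (cM _ _ ch lg).
have S := RintegralD mE iA iB.
have A0 : \int[area]_(p in E) A p = 0 := I1.
have B0 : \int[area]_(p in E) B p = 0 := I2.
apply/eqP; rewrite -subr_eq0; apply/eqP.
apply: (eq_trans (esym (RintegralB mE igh ihg))).
have S0 := eq_trans S (eq_trans (f_equal2 (fun x y => x + y) A0 B0) (addr0 0)).
apply: (eq_trans _ S0).
apply: eq_Rintegral => p _; rewrite /A /B /laplacian.
by move: (g p) (h p) (dx (dx g) p) (dy (dy g) p) (dx (dx h) p) (dy (dy h) p) => x y c d r s; ring.
Qed.

End PeriodicIntegrals.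

(** * Concentration at the origin *)

Section Flux.
Variable R : realType.
Local Notation leb := (@lebesgue_measure R).
Local Notation area := (@area R).
Local Notation T := (measurableTypeR R * measurableTypeR R)%type.
Implicit Types (f F : R -> R) (p q : R * R) (x y d eps : R).

Lemma ftc f F (a b : R) : a < b -> (forall x, a <= x <= b -> is_derive x 1 F (f x)) ->
  (forall x, a <= x <= b -> {for x, continuous f}) ->
  \int[leb]_(x in `[a, b]) f x = F b - F a.
Proof.
move=> ab dF cf.
have cF x : a <= x <= b -> {for x, continuous F}.
  by move=> /dF D; apply: differentiable_continuous; apply/derivable1_diffP; exact: (@ex_derive _ _ _ _ _ _ _ D).
rewrite /Rintegral (@continuous_FTC2 R f F a b ab) //.
- apply: continuous_in_subspaceT => x; rewrite inE /= in_itv /= => h; exact: cf.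
- split.
  + move=> x; rewrite in_itv /= => /andP[h1 h2].
    have D : is_derive x 1 F (f x) by apply: dF; rewrite !ltW.
    exact: (@ex_derive _ _ _ _ _ _ _ D).
  + by apply: cvg_at_right_filter; apply: cF; rewrite lexx ltW.
  + by apply: cvg_at_left_filter; apply: cF; rewrite lexx ltW.
- move=> x; rewrite in_itv /= => /andP[h1 h2].
  have D : is_derive x 1 F (f x) by apply: dF; rewrite !ltW.
  by rewrite derive1E (@derive_val _ _ _ _ _ _ _ D).
Qed.

Definition sqr0 d : set T := `[- d, d]%classic `*` `[- d, d]%classic.

Lemma measurable_sqr0 d : measurable (sqr0 d).
Proof. by apply: measurableX; exact: measurable_itv. Qed.

Lemma sqr0_finite d : (area (sqr0 d) < +oo)%E.
Proof.
rewrite /sqr0 areaX; [|exact: measurable_itv|exact: measurable_itv].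
rewrite !lebesgue_measure_itv /=; case: ifP => _; last by rewrite mule0 ltry.
by rewrite -EFinB -EFinM ltry.
Qed.

Lemma sqr0_bounded d p : sqr0 d p -> `|p.1| <= d /\ `|p.2| <= d.
Proof. by move=> [] /=; rewrite !in_itv /= -!ler_norml. Qed.

Lemma int_sqr0 (g : R * R -> R) d : 0 <= d -> (forall p, {for p, continuous g}) ->
  area.-integrable (sqr0 d) (EFin \o g).
Proof.
move=> d0 cg; apply: measurable_bounded_integrable.
- exact: measurable_sqr0.
- exact: sqr0_finite.
- exact: measurable_funS (cont_meas cg).
- have [B B0 HB] := cont_rect_bounded cg d0.
  exists B; split; first exact: num_real.
  by move=> x xB p /sqr0_bounded[p1 p2]; apply: ltW; apply: le_lt_trans xB; exact: HB.
Qed.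

Lemma cont_section1 (g : R * R -> R) x y : {for (x, y), continuous g} -> {for y, continuous (fun t => g (x, t))}.
Proof.
move=> cg; apply: (@continuous_comp _ _ _ (fun t : R => (x, t)) g y) => //.
exact: (@cvg_pair R R R (nbhs y) (nbhs x) (nbhs y) _ _ _ (fun=> x) id (cvg_cst x) cvg_id).
Qed.

Lemma cont_section2 (g : R * R -> R) x y : {for (x, y), continuous g} -> {for x, continuous (fun t => g (t, y))}.
Proof.
move=> cg; apply: (@continuous_comp _ _ _ (fun t : R => (t, y)) g x) => //.
exact: (@cvg_pair R R R (nbhs x) (nbhs x) (nbhs y) _ _ _ id (fun=> y) cvg_id (cvg_cst y)).
Qed.

Lemma fubini_sqr0 (g : R * R -> R) d : 0 <= d -> (forall p, {for p, continuous g}) ->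
  \int[area]_(p in sqr0 d) g p =
    \int[leb]_(x in `[- d, d]) (\int[leb]_(y in `[- d, d]) g (x, y)) /\
  \int[area]_(p in sqr0 d) g p =
    \int[leb]_(y in `[- d, d]) (\int[leb]_(x in `[- d, d]) g (x, y)).
Proof.
move=> d0 cg; have ig := int_sqr0 d0 cg; have mS := measurable_sqr0 d.
pose f : T -> \bar R := (EFin \o g) \_ (sqr0 d).
have fE x y : f (x, y) = if (x \in `[- d, d]%classic) && (y \in `[- d, d]%classic) then (g (x, y))%:E else 0%E.
  rewrite /f /patch; congr (if _ then _ else _).
  by apply/idP/andP => [|[]]; rewrite !inE => -[].
have inte : (leb \x leb)%E.-integrable setT f.
  have H : area.-integrable setT f by exact: (proj1 (integrable_mkcond (EFin \o g : T -> \bar R) mS) ig).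
  exact: H.
have cst1 x (Ex : x \in `[- d, d]%classic) :
    (\int[leb]_y f (x, y) = (\int[leb]_(y in `[- d, d]) g (x, y))%:E)%E.
  rewrite /Rintegral fineK; last first.
    apply: integrable_fin_num => //; apply: cont_integrable => t _; apply: cont_section1; exact: cg.
  rewrite [RHS]integral_mkcond; apply: eq_integral => y _.
  by rewrite fE Ex /= /patch.
have cst2 y (Ey : y \in `[- d, d]%classic) :
    (\int[leb]_x f (x, y) = (\int[leb]_(x in `[- d, d]) g (x, y))%:E)%E.
  rewrite /Rintegral fineK; last first.
    apply: integrable_fin_num => //; apply: cont_integrable => t _; apply: cont_section2; exact: cg.
  rewrite [RHS]integral_mkcond; apply: eq_integral => x _.
  by rewrite fE Ey /= andbT /patch.
have I0 : (\int[area]_(p in sqr0 d) (g p)%:E = \int[leb \x leb]_p f p)%E.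
  by rewrite [LHS]integral_mkcond.
split; rewrite /Rintegral I0.
- rewrite -(integral12_prod_meas1 inte); congr fine.
  rewrite [RHS]integral_mkcond; apply: eq_integral => x _; rewrite /fubini_F /patch.
  case: ifPn => Ex; first exact: cst1.
  by rewrite integral0_eq // => y _; rewrite fE (negbTE Ex).
- rewrite -(integral21_prod_meas1 inte); congr fine.
  rewrite [RHS]integral_mkcond; apply: eq_integral => y _; rewrite /fubini_G /patch.
  case: ifPn => Ey; first exact: cst2.
  by rewrite integral0_eq // => x _; rewrite fE (negbTE Ey) andbF.
Qed.

Definition N2 p : R := p.1 * p.1 + p.2 * p.2.

Lemma N2_ge0 p : 0 <= N2 p.
Proof. by rewrite /N2 -!expr2 addr_ge0 // sqr_ge0. Qed.

Lemma N2_cont p : {for p, continuous N2}.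
Proof.
by apply: addp_cont; apply: mulp_cont; [exact: fst_cont|exact: fst_cont|exact: snd_cont|exact: snd_cont].
Qed.

Lemma inv_cont (g : R * R -> R) p : {for p, continuous g} -> g p != 0 -> {for p, continuous (fun q => (g q)^-1)}.
Proof. by move=> cg g0; exact: cvgV. Qed.

(** The derivative in [x] of [x / (2 (x ^ 2 + y ^ 2 + eps))]. Together with its mirror image it adds
    up to [eps / (N2 + eps) ^ 2], so the kernel is the divergence of an explicit field. *)
Definition flux_x eps p : R := (p.2 * p.2 - p.1 * p.1 + eps) * (2 * ((N2 p + eps) * (N2 p + eps)))^-1.

Lemma N2e_gt0 eps p : 0 < eps -> 0 < N2 p + eps.
Proof. by move=> e0; rewrite ltr_wpDl // N2_ge0. Qed.

Lemma N2e_cont eps p : {for p, continuous (fun q => N2 q + eps)}.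
Proof. by apply: addp_cont; [exact: N2_cont|exact: cst_cont]. Qed.

Lemma flux_x_cont eps p : 0 < eps -> {for p, continuous (flux_x eps)}.
Proof.
move=> e0; apply: mulp_cont.
  apply: addp_cont; last exact: cst_cont.
  apply: subp_cont; apply: mulp_cont; [exact: snd_cont|exact: snd_cont|exact: fst_cont|exact: fst_cont].
apply: inv_cont; last by rewrite gt_eqF // !mulr_gt0 // N2e_gt0.
apply: mulp_cont; first exact: cst_cont.
by apply: mulp_cont; exact: N2e_cont.
Qed.

Lemma flux_x_derive eps x y : 0 < eps ->
  is_derive x 1 (fun t : R => t * (2 * (t * t + (y * y + eps)))^-1) (flux_x eps (x, y)).
Proof.
move=> e0; have n0 : 0 < x * x + y * y + eps := N2e_gt0 (x, y) e0.
have Dtt := is_deriveM (is_derive_id x (1 : R)) (is_derive_id x (1 : R)).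
have Dc := is_deriveD Dtt (is_derive_cst (y * y + eps) x (1 : R)).
have D2 := is_deriveM (is_derive_cst (2 : R) x (1 : R)) Dc.
have nz : (cst (2 : R) * (id * id + cst (y * y + eps))) x != 0 :> R.
  by change (2 * (x * x + (y * y + eps)) != 0); rewrite gt_eqF // mulr_gt0 // addrA.
have DV := is_deriveV nz D2.
have DM := is_deriveM (is_derive_id x (1 : R)) DV.
apply: (is_derive_eq DM).
rewrite /flux_x /N2 /=.
change (x * (- (2 * (x * x + (y * y + eps))) ^- 2 * (2 * ((x * 1 + x * 1) + 0) + (x * x + (y * y + eps)) * 0))
  + (2 * (x * x + (y * y + eps)))^-1 * 1 = (y * y - x * x + eps) * (2 * ((x * x + y * y + eps) * (x * x + y * y + eps)))^-1).
move: n0 => /lt0r_neq0 n0; field.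
by rewrite n0.
Qed.

Lemma flux_inner eps d y : 0 < d -> 0 < eps ->
  \int[leb]_(x in `[- d, d]) flux_x eps (x, y) = d * (d * d + eps + y * y)^-1.
Proof.
move=> d0 e0; have dd : - d < d by rewrite gtrN.
have D x : - d <= x <= d -> is_derive x 1 (fun t : R => t * (2 * (t * t + (y * y + eps)))^-1) (flux_x eps (x, y)).
  by move=> _; exact: flux_x_derive.
have K x : - d <= x <= d -> {for x, continuous (fun t => flux_x eps (t, y))}.
  by move=> _; apply: cont_section2; exact: flux_x_cont.
apply: (eq_trans (ftc dd D K)).
have n0 : d * d + y * y + eps != 0 := lt0r_neq0 (N2e_gt0 (d, y) e0).
have n1 : d * d + eps + y * y != 0 by rewrite (addrAC (d * d)).
have e1 : d * d + (y * y + eps) = d * d + eps + y * y by ring.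
by rewrite mulrNN e1; move: (d * d + eps + y * y) n1 => t t0; field.
Qed.

Lemma flux_outer eps d : 0 < d -> 0 < eps -> let rho := Num.sqrt (d * d + eps) in
  \int[leb]_(y in `[- d, d]) (d * (d * d + eps + y * y)^-1) = 2 * (d / rho) * atan (d / rho).
Proof.
move=> d0 e0 rho; have dd : - d < d by rewrite gtrN.
have de : 0 < d * d + eps by rewrite ltr_pwDr // mulr_ge0 // ltW.
have r0 : 0 < rho by rewrite sqrtr_gt0.
have r2 : rho * rho = d * d + eps by rewrite -expr2 sqr_sqrtr // ltW.
have pos y : 0 < d * d + eps + y * y by rewrite ltr_pwDl // -expr2 sqr_ge0.
have D y : - d <= y <= d -> is_derive y 1 (fun y : R => (d / rho) * atan (y / rho)) (d * (d * d + eps + y * y)^-1).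
  move=> _.
  have Dl : is_derive y 1 (fun t : R => t / rho) rho^-1.
    apply: (is_derive_eq (is_deriveM (is_derive_id y (1 : R)) (is_derive_cst (rho^-1) y (1 : R)))).
    by change (y * 0 + rho^-1 * 1 = rho^-1); rewrite mulr0 add0r mulr1.
  have Da := @is_derive1_comp _ (@atan R) (fun t : R => t / rho) y _ _ (is_derive1_atan (y / rho)) Dl.
  have DD := is_deriveM (is_derive_cst (d / rho) y (1 : R)) Da.
  apply: (is_derive_eq DD).
  change ((d / rho) * ((1 + (y / rho) ^+ 2)^-1 * rho^-1) + atan (y / rho) * 0 = d * (d * d + eps + y * y)^-1).
  have p0 := pos y; rewrite -r2 in p0 *.
  have q0 : rho != 0 := lt0r_neq0 r0.
  have q1 : rho * rho + y * y != 0 := lt0r_neq0 p0.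
  have q2 : rho ^+ 2 + y ^+ 2 != 0 by rewrite !expr2.
  by move: (atan _) => t; field; rewrite q0 q1.
have K y : - d <= y <= d -> {for y, continuous (fun y : R => d * (d * d + eps + y * y)^-1)}.
  move=> _; apply: (@cvgM _ _ _ _ (fun=> d)); first exact: cvg_cst.
  apply: cvgV; first by rewrite gt_eqF.
  by apply: cvgD; [exact: cvg_cst|apply: cvgM; exact: cvg_id].
apply: (eq_trans (ftc dd D K)).
by rewrite mulNr atanN; ring.
Qed.

(** The two components of the field contribute equally, each by an arctangent. As [eps] tends to 0
    the quotient [d / rho] tends to 1 and the value to [4 * (pi / 4) = pi]. *)
Lemma J_eq eps d : 0 < d -> 0 < eps -> let rho := Num.sqrt (d * d + eps) in
  \int[area]_(p in sqr0 d) (eps * ((N2 p + eps) * (N2 p + eps))^-1) = 4 * (d / rho) * atan (d / rho).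
Proof.
move=> d0 e0 rho; have dl := ltW d0.
have cfx p : {for p, continuous (flux_x eps)} := flux_x_cont (p := p) e0.
pose fy p := flux_x eps (p.2, p.1).
have cfy p : {for p, continuous fy}.
  apply: (@continuous_comp _ _ _ (fun q : R * R => (q.2, q.1)) (flux_x eps) p); last exact: cfx.
  exact: (@cvg_pair (R * R)%type R R (nbhs p) (nbhs p.2) (nbhs p.1) _ _ _ snd fst (@snd_cont R p) (@fst_cont R p)).
have S := RintegralD (measurable_sqr0 d) (int_sqr0 dl cfx) (int_sqr0 dl cfy).
have E1 : \int[area]_(p in sqr0 d) (eps * ((N2 p + eps) * (N2 p + eps))^-1) =
   \int[area]_(p in sqr0 d) (flux_x eps p + fy p).
  apply: eq_Rintegral => p _; rewrite /fy /flux_x /N2 /=.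
  have := N2e_gt0 p e0; rewrite /N2 => /lt0r_neq0 n0; rewrite (addrC (p.2 * p.2) (p.1 * p.1)).
  by field.
have Ix : \int[area]_(p in sqr0 d) flux_x eps p = 2 * (d / rho) * atan (d / rho).
  rewrite (fubini_sqr0 dl cfx).2 -(flux_outer d0 e0).
  by apply: eq_Rintegral => y _; exact: flux_inner.
have Iy : \int[area]_(p in sqr0 d) fy p = 2 * (d / rho) * atan (d / rho).
  rewrite (fubini_sqr0 dl cfy).1 -(flux_outer d0 e0).
  by apply: eq_Rintegral => x _; exact: flux_inner.
apply: (eq_trans E1); apply: (eq_trans S); apply: (eq_trans (f_equal2 (fun x y => x + y) Ix Iy)).
by ring.
Qed.

End Flux.

(** * The concentrating kernel on squares *)

Section Squares.
Variable R : realType.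
Local Notation leb := (@lebesgue_measure R).
Local Notation area := (@area R).
Local Notation T := (measurableTypeR R * measurableTypeR R)%type.
Implicit Types (g m : R * R -> R) (p q : R * R) (x y d eps : R).

Lemma harm_gt0 n : 0 < @harmonic R n.
Proof. by rewrite /harmonic invr_gt0. Qed.

Lemma harm_le1 n : @harmonic R n <= 1.
Proof. by rewrite /harmonic invf_le1 // ler1n. Qed.

Lemma sqrt_ratio_cont d b : 0 < d -> 0 < b ->
  (fun e : R => b^-1 * (4 * (d / Num.sqrt (d * d + e / b)) * atan (d / Num.sqrt (d * d + e / b)))) e @[e --> 0]
    --> pi / b.
Proof.
move=> d0 b0.
have c1 : (fun e : R => d / Num.sqrt (d * d + e / b)) e @[e --> 0] --> d / Num.sqrt (d * d + 0 / b).
  apply: (@cvgM _ _ _ _ (fun=> d)); first exact: cvg_cst.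
  apply: cvgV.
    by rewrite mul0r addr0 -expr2 sqrtr_sqr normr_eq0 gt_eqF.
  apply: (@cvg_comp _ _ _ (fun e : R => d * d + e / b) (@Num.sqrt R) _ (nbhs (d * d + 0 / b))).
    by apply: cvgD; [exact: cvg_cst|apply: cvgM; [exact: cvg_id|exact: cvg_cst]].
  exact: sqrt_continuous.
have c2 : (fun e : R => atan (d / Num.sqrt (d * d + e / b))) e @[e --> 0] --> atan (d / Num.sqrt (d * d + 0 / b)).
  by apply: (@cvg_comp _ _ _ (fun e : R => d / Num.sqrt (d * d + e / b)) (@atan R) _ _ _ c1); exact: continuous_atan.
have e1 : d / Num.sqrt (d * d + 0 / b) = 1.
  by rewrite mul0r addr0 -expr2 sqrtr_sqr gtr0_norm // divff // gt_eqF.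
rewrite e1 in c1 c2; rewrite atan1 in c2.
have -> : pi / b = b^-1 * (4 * 1 * (pi / 4%:R)).
  by move: (pi : R) (lt0r_neq0 b0) => t bn; field.
apply: (@cvgM _ _ _ _ (fun=> b^-1)); first exact: cvg_cst.
apply: cvgM; last exact: c2.
by apply: (@cvgM _ _ _ _ (fun=> 4)); [exact: cvg_cst|exact: c1].
Qed.

(** The kernel belonging to the model [w = b * N2]; as [eps] tends to 0 it approaches [pi / b] times
    the Dirac measure at the origin. *)
Definition kern b eps p : R := eps * ((b * N2 p + eps) * (b * N2 p + eps))^-1.

Lemma bN2_gt0 b eps p : 0 <= b -> 0 < eps -> 0 < b * N2 p + eps.
Proof. by move=> b0 e0; rewrite ltr_wpDl // mulr_ge0 // N2_ge0. Qed.

Lemma kern_cont b eps p : 0 <= b -> 0 < eps -> {for p, continuous (kern b eps)}.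
Proof.
move=> b0 e0; apply: mulp_cont; first exact: cst_cont.
have c : {for p, continuous (fun q => b * N2 q + eps)}.
  by apply: addp_cont; [apply: mulp_cont; [exact: cst_cont|exact: N2_cont]|exact: cst_cont].
by apply: inv_cont; [exact: mulp_cont|rewrite gt_eqF // mulr_gt0 // bN2_gt0].
Qed.

Lemma kern_ge0 b eps p : 0 <= b -> 0 < eps -> 0 <= kern b eps p.
Proof. by move=> b0 e0; rewrite /kern mulr_ge0 ?ltW // invr_gt0 mulr_gt0 // bN2_gt0. Qed.

Lemma int_kern b eps d : 0 < d -> 0 < b -> 0 < eps ->
  \int[area]_(p in sqr0 d) kern b eps p =
    b^-1 * (4 * (d / Num.sqrt (d * d + eps / b)) * atan (d / Num.sqrt (d * d + eps / b))).
Proof.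
move=> d0 b0 e0; have eb : 0 < eps / b by rewrite divr_gt0.
rewrite -(J_eq d0 eb) -RintegralZl; [|exact: measurable_sqr0|].
  apply: eq_Rintegral => p _; rewrite /kern.
  have n1 := lt0r_neq0 (N2e_gt0 p eb); have n2 := lt0r_neq0 (bN2_gt0 p (ltW b0) e0).
  move: n1 n2 (lt0r_neq0 b0); move: (N2 p) => N n1 n2 n3.
  have E : N + eps / b = (b * N + eps) / b by field.
  by rewrite E; field; rewrite n2 n3.
apply: int_sqr0 => [|p]; first exact: ltW.
apply: mulp_cont; first exact: cst_cont.
by apply: inv_cont; [apply: mulp_cont; exact: N2e_cont|rewrite gt_eqF // mulr_gt0 // N2e_gt0].
Qed.

Lemma int_kern_le b eps d : 0 < d -> 0 < b -> 0 < eps ->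
  \int[area]_(p in sqr0 d) kern b eps p <= 2 * pi / b.
Proof.
move=> d0 b0 e0; rewrite (int_kern d0 b0 e0).
have eb : 0 < eps / b by rewrite divr_gt0.
have de : 0 < d * d + eps / b by rewrite ltr_pwDr // mulr_ge0 // ltW.
set s := Num.sqrt _; have s0 : 0 < s by rewrite sqrtr_gt0.
have s2 : s ^+ 2 = d * d + eps / b by rewrite sqr_sqrtr // ltW.
have ds : d / s <= 1.
  rewrite ler_pdivrMr // mul1r -(ler_pXn2r (n := 2)) ?nnegrE ?(ltW d0) ?(ltW s0) //.
  by rewrite s2 expr2 lerDl ltW.
have ds0 : 0 <= d / s by rewrite divr_ge0 // ltW.
have at2 : atan (d / s) <= pi / 2 := ltW (atan_ltpi2 _).
rewrite [2 * pi / b]mulrC ler_pM2l ?invr_gt0 //.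
have H : d / s * atan (d / s) <= d / s * (pi / 2) := ler_wpM2l ds0 at2.
have pp : 0 < pi :> R := pi_gt0 R.
have H' : d / s * (pi / 2) <= 1 * (pi / 2) by apply: ler_wpM2r => //; lra.
by rewrite -mulrA; move: H H'; move: (d / s * atan _) (d / s * (pi / 2)) => u v; lra.
Qed.

Lemma int_kern_cvg b d : 0 < d -> 0 < b ->
  (fun n => \int[area]_(p in sqr0 d) kern b (harmonic n) p) @ \oo --> pi / b.
Proof.
move=> d0 b0.
have E : (fun n => \int[area]_(p in sqr0 d) kern b (harmonic n) p) =
  (fun e : R => b^-1 * (4 * (d / Num.sqrt (d * d + e / b)) * atan (d / Num.sqrt (d * d + e / b)))) \o harmonic.
  by apply/funext => n; rewrite /= (int_kern d0 b0 (harm_gt0 n)).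
rewrite E; exact: (cvg_comp _ _ (@cvg_harmonic R) (sqrt_ratio_cont d0 b0)).
Qed.

Lemma le_int_sub_on (A B : set T) g : measurable A -> measurable B -> A `<=` B ->
  area.-integrable B (EFin \o g) -> (forall p, B p -> 0 <= g p) ->
  \int[area]_(p in A) g p <= \int[area]_(p in B) g p.
Proof.
move=> mA mB AB ig g0; have iA := integrableS mB mA AB ig.
apply: fine_le; [exact: integrable_fin_num|exact: integrable_fin_num|].
apply: ge0_subset_integral => //; exact: (measurable_int _ ig).
Qed.

Lemma le_int_sub (A B : set T) g : measurable A -> measurable B -> A `<=` B ->
  area.-integrable B (EFin \o g) -> (forall p, 0 <= g p) ->
  \int[area]_(p in A) g p <= \int[area]_(p in B) g p.
Proof. by move=> mA mB AB ig g0; apply: le_int_sub_on. Qed.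

(** Freezing the coefficients costs a small multiple of the kernel with the common lower bound [c].
    The factor [N] produced by the difference of the inverses is harmless because
    [N / (c * N + eps)] is at most [c^-1]. *)
Lemma kern_compare (t s N m a c eps eta : R) : 0 <= N -> 0 < c -> c <= m -> c <= a -> 0 < eps ->
  `|t - s| <= eta -> `|m - a| <= eta ->
  `|eps * t * ((N * m + eps) * (N * m + eps))^-1 - s * (eps * ((a * N + eps) * (a * N + eps))^-1)| <=
    eta * (1 + 2 * `|s| / c) * (eps * ((c * N + eps) * (c * N + eps))^-1).
Proof.
move=> N0 c0 cm ca e0 ts ma.
have eta0 : 0 <= eta := le_trans (normr_ge0 _) ts.
have z0 : 0 < c * N + eps by rewrite ltr_wpDl // mulr_ge0 // ltW.
have zx : c * N + eps <= N * m + eps by rewrite lerD2r mulrC ler_wpM2l.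
have zy : c * N + eps <= a * N + eps by rewrite lerD2r ler_wpM2r.
have x0 := lt_le_trans z0 zx; have y0 := lt_le_trans z0 zy.
set X := (N * m + eps)^-1; set Y := (a * N + eps)^-1; set Z := (c * N + eps)^-1.
have X0 : 0 < X by rewrite invr_gt0.
have Y0 : 0 < Y by rewrite invr_gt0.
have Z0 : 0 < Z by rewrite invr_gt0.
have XZ : X <= Z by rewrite lef_pV2.
have YZ : Y <= Z by rewrite lef_pV2.
have NZ : N * Z <= c^-1.
  have ci : 0 <= c^-1 * eps by rewrite mulr_ge0 ?invr_ge0 // ltW.
  by rewrite /Z ler_pdivrMr // mulrDr mulrA mulVf ?mul1r ?lerDl // gt_eqF.
rewrite !invfM -/X -/Y -/Z.
have -> : eps * t * (X * X) - s * (eps * (Y * Y)) =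
   eps * ((t - s) * (X * X) + s * ((N * (a - m)) * (X * Y) * (X + Y))).
  have E : X - Y = N * (a - m) * (X * Y).
    by rewrite /X /Y; field; rewrite (gt_eqF x0) (gt_eqF y0).
  by rewrite -E; ring.
rewrite normrM (gtr0_norm e0).
have -> : eta * (1 + 2 * `|s| / c) * (eps * (Z * Z)) = eps * (eta * (Z * Z) + `|s| * (eta * c^-1 * Z * (2 * Z))) by ring.
rewrite ler_pM2l //; apply: (le_trans (ler_normD _ _)); apply: lerD.
  rewrite normrM (ger0_norm (mulr_ge0 (ltW X0) (ltW X0))).
  by apply: ler_pM => //; [rewrite mulr_ge0 // ltW|apply: ler_pM => //; exact: ltW].
rewrite normrM; apply: ler_wpM2l => //.
rewrite normrM (gtr0_norm (addr_gt0 X0 Y0)); apply: ler_pM => //; [exact: ltW (addr_gt0 X0 Y0)| |by lra].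
rewrite !normrM (ger0_norm N0) (gtr0_norm X0) (gtr0_norm Y0) distrC.
have h1 : N * `|m - a| * (X * Y) <= N * eta * (Z * Z).
  apply: ler_pM; rewrite ?mulr_ge0 ?(ltW X0) ?(ltW Y0) //; first exact: ler_wpM2l.
  by apply: ler_pM => //; exact: ltW.
apply: (le_trans h1).
have -> : N * eta * (Z * Z) = eta * (N * Z) * Z by ring.
by apply: ler_wpM2r; [exact: ltW|exact: ler_wpM2l].
Qed.

Definition lnG eps p : R := ln (p.1 * p.1 + eps) + 2 * (p.1 * p.1) * (p.1 * p.1 + eps)^-1.

Lemma lnG_cont eps p : 0 < eps -> {for p, continuous (lnG eps)}.
Proof.
move=> e0.
have c1 : {for p, continuous (fun q : R * R => q.1 * q.1)} by apply: mulp_cont; exact: fst_cont.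
have c2 : {for p, continuous (fun q : R * R => q.1 * q.1 + eps)} by apply: addp_cont; [exact: c1|exact: cst_cont].
have x0 : 0 < p.1 * p.1 + eps by rewrite ltr_wpDl // -expr2 sqr_ge0.
apply: addp_cont.
  by apply: (@continuous_comp _ R R (fun q : R * R => q.1 * q.1 + eps) (@ln R) p c2); exact: continuous_ln.
apply: mulp_cont; first by apply: mulp_cont; [exact: cst_cont|exact: c1].
by apply: inv_cont => //; rewrite gt_eqF.
Qed.

Lemma int_lnG eps d : 0 < d -> 0 < eps ->
  \int[area]_(p in sqr0 d) lnG eps p = (2 * d * ln (d * d + eps)) * (2 * d).
Proof.
move=> d0 e0; have dd : - d < d by rewrite gtrN.
have cG p : {for p, continuous (lnG eps)} := lnG_cont (p := p) e0.
apply: (eq_trans (fubini_sqr0 (ltW d0) cG).2).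
have I y : \int[leb]_(x in `[- d, d]) lnG eps (x, y) = 2 * d * ln (d * d + eps).
  have D x : - d <= x <= d -> is_derive x 1 (fun t : R => t * ln (t * t + eps)) (lnG eps (x, y)).
    move=> _; have x0 : 0 < x * x + eps by rewrite ltr_wpDl // -expr2 sqr_ge0.
    have D2 : is_derive x 1 (fun t : R => t * t + eps) (2 * x).
      apply: (is_derive_eq (is_deriveD (is_deriveM (is_derive_id x (1 : R)) (is_derive_id x (1 : R))) (is_derive_cst eps x (1 : R)))).
      by change (x * 1 + x * 1 + 0 = 2 * x); ring.
    have D3 := @is_derive1_comp _ (@ln R) (fun t : R => t * t + eps) x _ _ (is_derive1_ln x0) D2.
    apply: (is_derive_eq (is_deriveM (is_derive_id x (1 : R)) D3)).
    change (x * ((x * x + eps)^-1 * (2 * x)) + ln (x * x + eps) * 1 = lnG eps (x, y)).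
    by rewrite /lnG /=; ring.
  have K x : - d <= x <= d -> {for x, continuous (fun t => lnG eps (t, y))}.
    by move=> _; apply: cont_section2; exact: cG.
  apply: (eq_trans (ftc dd D K)).
  by rewrite mulrNN; ring.
apply: (@eq_trans _ _ (\int[leb]_(y in `[- d, d]) (2 * d * ln (d * d + eps)))).
  by apply: eq_Rintegral => y _; exact: I.
rewrite Rintegral_cst; last exact: measurable_itv.
have M : leb `[- d, d]%classic = (d - - d)%:E.
  by have := @lebesgue_measure_itv R `[- d, d]; rewrite /= lte_fin dd -EFinB.
by congr (_ * _); apply: (eq_trans (f_equal fine M)) => /=; ring.
Qed.

Lemma area_pt p : area [set p] = 0%E.
Proof.
have -> : [set p] = [set p.1] `*` [set p.2] :> set (R * R).
  by apply/seteqP; split=> [q ->//|[x y] /= [-> ->]]; case: p.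
by rewrite areaX // lebesgue_measure_set1 mul0e.
Qed.

Lemma measurable_pt p : measurable ([set p] : set T).
Proof.
have -> : [set p] = [set p.1] `*` [set p.2] :> set (R * R).
  by apply/seteqP; split=> [q ->//|[x y] /= [-> ->]]; case: p.
by apply: measurableX; exact: measurable_set1.
Qed.

End Squares.

(** * Concentration on the torus with variable coefficients *)

Section Concentration.
Variable R : realType.
Local Notation C := R[i].
Local Notation T := (measurableTypeR R * measurableTypeR R)%type.
Local Notation area := (@area R).
Variables w1 w2 : C.
Hypothesis hw : 0 < Im (w2 / w1).
Local Notation E := (fundamental_domain w1 w2 : set T).
Local Notation pper := (pper w1 w2).
Local Notation cs := (cs w1 w2).
Local Notation ct := (ct w1 w2).
Local Notation harm := (@harmonic R).
Implicit Types (p q : R * R) (m theta : R * R -> R).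

(** The parallelogram centred at the origin; unlike [E], it contains a
    neighbourhood of its lattice point. *)
Definition cdom : set T := dom w1 w2 (vec ((2^-1)%:C * w1 + (2^-1)%:C * w2)).

Lemma measurable_cdom : measurable cdom.
Proof. exact: measurable_dom. Qed.

Lemma int_cdom (g : R * R -> R) : (forall p, {for p, continuous g}) -> area.-integrable cdom (EFin \o g).
Proof. exact: (@int_cont R w1 w2 hw). Qed.

Lemma cdomE p : cdom p <-> (- 2^-1 <= cs p < 2^-1 /\ - 2^-1 <= ct p < 2^-1).
Proof.
rewrite /cdom /dom /= (E_coords hw).
have [-> ->] := coords_sh hw (vec ((2^-1)%:C * w1 + (2^-1)%:C * w2)) p.
have [-> ->] := coords_inj hw (pt_vec ((2^-1)%:C * w1 + (2^-1)%:C * w2)).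
by split=> -[/andP[a b] /andP[c d]]; split; apply/andP; split; lra.
Qed.

Lemma coords0 : cs 0 = 0 /\ ct 0 = 0.
Proof. by apply: (coords_inj hw); rewrite /pt /= !mul0r addr0. Qed.

Lemma sqr0_cdom : exists2 d : R, 0 < d & sqr0 d `<=` cdom.
Proof.
have [c1 c2] := coords_cont hw (0 : R * R).
have [z1 z2] := coords0.
have h0 : 0 < (2^-1 : R) by rewrite invr_gt0.
have /(@cvgrPdist_lt _ R^o)/(_ _ h0) n1 := c1.
have /(@cvgrPdist_lt _ R^o)/(_ _ h0) n2 := c2.
have [D D0 H] := near_box (filterI n1 n2).
exists (D / 2); first by rewrite divr_gt0.
move=> p /sqr0_bounded[p1 p2]; apply/cdomE.
have D2 : D / 2 < D by lra.
have [] := H p; rewrite ?subr0; [exact: le_lt_trans D2|exact: le_lt_trans D2|].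
by rewrite z1 z2 !sub0r !normrN !ltr_norml => /andP[a b] /andP[c d]; split; apply/andP; split=> //; exact: ltW.
Qed.

Lemma cdom_sqr0 : exists2 M : R, 0 < M & cdom `<=` sqr0 M.
Proof.
have [M M0 H] := dom_bounded w1 w2 (vec ((2^-1)%:C * w1 + (2^-1)%:C * w2)).
exists M => // p /H[p1 p2]; rewrite /sqr0; split=> /=; rewrite in_itv /= -ler_norml //.
Qed.

Lemma cdom_lattice p : - 2^-1 <= cs p <= 2^-1 -> - 2^-1 <= ct p <= 2^-1 -> lattice w1 w2 (pt p) -> p = 0.
Proof.
move=> /andP[a b] /andP[c d] [i [j e]].
have [e1 e2] : cs p = i%:~R /\ ct p = j%:~R.
  by have := coords_lv hw (i, j); rewrite /lv /= -e; case: p {a b c d e}.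
have F (k : int) : - 2^-1 <= k%:~R :> R -> k%:~R <= 2^-1 :> R -> k = 0.
  move=> k1 k2.
  have h1 : (k < 1)%R by rewrite -(ltr_int R); lra.
  have h2 : (- 1 < k)%R by rewrite -(ltr_int R); lra.
  by lia.
have i0 : i = 0 by apply: F; rewrite -e1.
have j0 : j = 0 by apply: F; rewrite -e2.
move: e; rewrite i0 j0 !mulr0z addr0 => e.
by case: p e {a b c d e1 e2} => x y [-> ->].
Qed.

(** Outside the closed parallelogram [m] may vanish at lattice points. Adding the terms in [pos],
    which are 0 on [cdom], gives a function [F] positive on the whole plane, whose inverse is
    continuous and hence bounded on a square containing [cdom]. *)
Lemma cdom_lower m : (forall p, {for p, continuous m}) -> (forall p, 0 <= m p) -> 0 < m 0 ->
  (forall p, ~ lattice w1 w2 (pt p) -> 0 < m p) -> exists2 c : R, 0 < c & forall p, cdom p -> c <= m p.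
Proof.
move=> cm m0 m00 mpos.
pose pos (x : R) := `|x| + x.
have pos_ge0 x : 0 <= pos x by rewrite /pos -lerBlDr sub0r (le_trans (ler_norm _)) // normrN.
have pos_le0 x : x <= 0 -> pos x = 0 by move=> x0; rewrite /pos ler0_norm // addNr.
have pos_eq0 x : pos x = 0 -> x <= 0.
  by move=> /eqP; rewrite /pos addr_eq0 => /eqP e; rewrite -oppr_ge0 -e.
have cpos (g : R * R -> R) p : {for p, continuous g} -> {for p, continuous (fun q => pos (g q))}.
  by move=> cg; apply: addp_cont => //; apply: (@continuous_comp _ R^o R g (fun x => `|x|) p cg); exact: norm_continuous.
have csq (g : R * R -> R) p : {for p, continuous g} -> {for p, continuous (fun q => g q * g q - 4^-1)}.
  by move=> cg; apply: subp_cont; [exact: mulp_cont|exact: cst_cont].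
pose F p := m p + (pos (cs p * cs p - 4^-1) + pos (ct p * ct p - 4^-1)).
have cF p : {for p, continuous F}.
  have [c1 c2] := coords_cont hw p.
  apply: addp_cont => //; apply: addp_cont; [exact: cpos (csq _ _ c1)|exact: cpos (csq _ _ c2)].
have sq (x : R) : x * x - 4^-1 <= 0 -> - 2^-1 <= x <= 2^-1.
  by move=> h; apply/andP; split; nra.
have Fpos p : 0 < F p.
  rewrite ltNge; apply/negP => Fle.
  have [mp h1 h2] : [/\ m p = 0, pos (cs p * cs p - 4^-1) = 0 & pos (ct p * ct p - 4^-1) = 0].
    move: Fle (m0 p) (pos_ge0 (cs p * cs p - 4^-1)) (pos_ge0 (ct p * ct p - 4^-1)); rewrite /F.
    by move: (m p) (pos _) (pos _) => x y z; split; lra.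
  have [L|nL] := pselect (lattice w1 w2 (pt p)); last by have := mpos _ nL; rewrite mp ltxx.
  by have p0 := cdom_lattice (sq _ (pos_eq0 _ h1)) (sq _ (pos_eq0 _ h2)) L; move: m00; rewrite -p0 mp ltxx.
have cI p : {for p, continuous (fun q => (F q)^-1)} by apply: inv_cont => //; rewrite gt_eqF.
have [M M0 HM] := cdom_sqr0.
have [B B0 HB] := cont_rect_bounded cI (ltW M0).
exists B^-1; first by rewrite invr_gt0.
move=> p Dp; have [p1 p2] := sqr0_bounded (HM _ Dp).
have /cdomE[/andP[a b] /andP[c d]] := Dp.
have FE : F p = m p by rewrite /F !pos_le0 ?addr0 //; nra.
have := HB p p1 p2; rewrite FE ger0_norm ?invr_ge0 // => H.
have mp : 0 < m p by rewrite -FE.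
by rewrite -[m p]invrK lef_pV2 // posrE ?invr_gt0.
Qed.

Lemma kern_cdom_cvg a : 0 < a -> (fun n => \int[area]_(p in cdom) kern a (harm n) p) @ \oo --> pi / a.
Proof.
move=> a0; have [d d0 Hd] := sqr0_cdom; have [M M0 HM] := cdom_sqr0.
apply: (squeeze_cvgr _ (int_kern_cvg d0 a0) (int_kern_cvg M0 a0)).
apply: nearW => n; have h0 := harm_gt0 R n.
have ck p : {for p, continuous (kern a (harm n))} := kern_cont (p := p) (ltW a0) h0.
have k0 p : 0 <= kern a (harm n) p := kern_ge0 p (ltW a0) h0.
apply/andP; split; apply: le_int_sub => //;
  [exact: measurable_sqr0|exact: measurable_cdom|exact: int_cdom|exact: measurable_cdom|exact: measurable_sqr0|].
exact: int_sqr0 (ltW M0) ck.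
Qed.

Lemma kern_cdom_le c eps : 0 < c -> 0 < eps -> \int[area]_(p in cdom) kern c eps p <= 2 * pi / c.
Proof.
move=> c0 e0; have [M M0 HM] := cdom_sqr0.
apply: (le_trans _ (int_kern_le M0 c0 e0)).
apply: le_int_sub => //; [exact: measurable_cdom|exact: measurable_sqr0| |by move=> p; exact: kern_ge0 (ltW c0) e0].
by apply: int_sqr0 (ltW M0) _ => p; exact: kern_cont (ltW c0) e0.
Qed.

Lemma kern_weight_cont m theta eps p : {for p, continuous m} -> {for p, continuous theta} -> 0 <= m p -> 0 < eps ->
  {for p, continuous (fun q => eps * theta q * ((N2 q * m q + eps) * (N2 q * m q + eps))^-1)}.
Proof.
move=> cm ct m0 e0.
have c : {for p, continuous (fun q => N2 q * m q + eps)}.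
  by apply: addp_cont; [apply: mulp_cont => //; exact: N2_cont|exact: cst_cont].
apply: mulp_cont; first by apply: mulp_cont => //; exact: cst_cont.
apply: inv_cont; first exact: mulp_cont.
have x0 : 0 < N2 p * m p + eps by rewrite ltr_wpDl // mulr_ge0 // N2_ge0.
by rewrite gt_eqF // mulr_gt0.
Qed.

Lemma concentration m theta : (forall p, {for p, continuous m}) -> (forall p, {for p, continuous theta}) ->
  (forall p, 0 <= m p) -> 0 < m 0 -> (forall p, ~ lattice w1 w2 (pt p) -> 0 < m p) ->
  (fun n => \int[area]_(p in cdom)
      (harm n * theta p * ((N2 p * m p + harm n) * (N2 p * m p + harm n))^-1)) @ \oo --> theta 0 * (pi / m 0).
Proof.
move=> cm cth m0 m00 mpos.
have [c c0 Hc] := cdom_lower cm m0 m00 mpos.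
set a := m 0; set s := theta 0.
have [d0' d0p Hd0] := sqr0_cdom.
have ca : c <= a by apply: Hc; apply: Hd0; split; rewrite /= in_itv /= oppr_le0 (ltW d0p).
have [M M0 HM] := cdom_sqr0.
have [B B0 HB] := cont_rect_bounded cth (ltW M0).
pose F n p := harm n * theta p * ((N2 p * m p + harm n) * (N2 p * m p + harm n))^-1.
pose G n p := s * kern a (harm n) p.
have cF n p : {for p, continuous (F n)} by apply: kern_weight_cont => //; exact: harm_gt0.
have ck (b : R) n p : 0 < b -> {for p, continuous (kern b (harm n))}.
  by move=> b0; apply: kern_cont; [exact: ltW|exact: harm_gt0].
have cG n p : {for p, continuous (G n)} by apply: mulp_cont; [exact: cst_cont|exact: ck].
have IG n : \int[area]_(p in cdom) G n p = s * \int[area]_(p in cdom) kern a (harm n) p.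
  by apply: RintegralZl; [exact: measurable_cdom|apply: int_cdom => p; exact: ck].
have cvG : (fun n => \int[area]_(p in cdom) G n p) @ \oo --> s * (pi / a).
  rewrite (_ : (fun n => \int[area]_(p in cdom) G n p) = (fun n => s * \int[area]_(p in cdom) kern a (harm n) p)).
    by apply: (@cvgM _ _ _ _ (fun=> s)); [exact: cvg_cst|exact: kern_cdom_cvg].
  by apply/funext => n; exact: IG.
pose K := 1 + 2 * `|s| / c.
have K0 : 0 < K by rewrite ltr_pwDl // divr_ge0 ?mulr_ge0 // ltW.
pose A := fine (area cdom).
have A0 : 0 <= A by rewrite fine_ge0.
have pp : 0 < pi :> R := pi_gt0 R.
apply/(@cvgrPdist_lt _ R^o) => e e0.
pose P := K * (2 * pi / c).
have P0 : 0 < P by rewrite mulr_gt0 // divr_gt0 // mulr_gt0.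
(* The number [P] bounds [K] times the integral of [kern c], so the part near the origin costs at
   most [e / 3]. *)
pose eta := e / 3 / P.
have eta0 : 0 < eta by rewrite !divr_gt0.
have /(@cvgrPdist_lt _ R^o)/(_ _ eta0) n1 := cth 0.
have /(@cvgrPdist_lt _ R^o)/(_ _ eta0) n2 := cm 0.
have [d d0 Hd] := near_box (filterI n1 n2).
pose L := (B + `|s|) * ((c * (d * d))^-1 * (c * (d * d))^-1).
have cd0 : 0 < c * (d * d) by rewrite !mulr_gt0.
have L0 : 0 <= L by rewrite !mulr_ge0 ?addr_ge0 ?invr_ge0 // ltW.
have pw n p : cdom p -> `|F n p - G n p| <= eta * K * kern c (harm n) p + harm n * L.
  move=> Dp; have h0 := harm_gt0 R n; have kk := kern_ge0 p (ltW c0) h0.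
  have [near_p|far_p] := pselect (`|p.1| < d /\ `|p.2| < d).
    have [] := Hd p; rewrite ?subr0; [exact: near_p.1|exact: near_p.2|].
    move=> h1 h2; apply: (@le_trans _ _ (eta * K * kern c (harm n) p)); last by rewrite lerDl mulr_ge0 // ltW.
    apply: (kern_compare (N2_ge0 p) c0 (Hc _ Dp) ca h0); rewrite distrC; exact: ltW.
  apply: (@le_trans _ _ (harm n * L)); last by rewrite lerDr mulr_ge0 // mulr_ge0 // ltW.
  have Nd : d * d <= N2 p.
    have [h|h] : d <= `|p.1| \/ d <= `|p.2|.
      by have [x|x] := leP d `|p.1|; [left|right]; rewrite // leNgt; apply/negP => y; apply: far_p.
    - apply: (@le_trans _ _ (p.1 * p.1)); last by rewrite lerDl -expr2 sqr_ge0.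
      by rewrite -!expr2 -(real_normK (x := p.1)) ?num_real // ler_pXn2r // nnegrE // ltW.
    - apply: (@le_trans _ _ (p.2 * p.2)); last by rewrite lerDr -expr2 sqr_ge0.
      by rewrite -!expr2 -(real_normK (x := p.2)) ?num_real // ler_pXn2r // nnegrE // ltW.
  have Z b : c <= b -> `|((N2 p * b + harm n) * (N2 p * b + harm n))^-1| <= (c * (d * d))^-1 * (c * (d * d))^-1.
    move=> cb; have x0 : c * (d * d) <= N2 p * b + harm n.
      apply: (@le_trans _ _ (N2 p * b)); last by rewrite lerDl ltW.
      by rewrite mulrC; apply: ler_pM => //; [rewrite mulr_ge0 // ltW|exact: ltW].
    have x1 := lt_le_trans cd0 x0.
    rewrite invfM ger0_norm ?mulr_ge0 ?invr_ge0 ?(ltW x1) //.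
    by apply: ler_pM; rewrite ?invr_ge0 ?(ltW x1) // lef_pV2.
  apply: (le_trans (ler_normB _ _)); rewrite /L mulrDl mulrDr; apply: lerD.
    rewrite /F 2!normrM (gtr0_norm h0) -mulrA ler_pM2l //.
    have [q1 q2] := sqr0_bounded (HM _ Dp).
    by apply: ler_pM => //; [exact: HB|exact: Z (Hc _ Dp)].
  rewrite /G /kern 2!normrM (gtr0_norm h0) mulrCA ler_pM2l //.
  by apply: ler_wpM2l => //; rewrite (mulrC a); exact: Z.
have IK n : area.-integrable cdom (EFin \o (fun p => eta * K * kern c (harm n) p)).
  by apply: int_cdom => p; apply: mulp_cont; [exact: cst_cont|exact: ck].
have IC n : area.-integrable cdom (EFin \o (fun p => harm n * L)) by apply: int_cdom => p; exact: cst_cont.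
have diff n : `|\int[area]_(p in cdom) F n p - \int[area]_(p in cdom) G n p| <= e / 3 + harm n * L * A.
  have h0 := harm_gt0 R n.
  have IF := int_cdom (cF n) : area.-integrable cdom (EFin \o F n).
  have IG' := int_cdom (cG n) : area.-integrable cdom (EFin \o G n).
  have cFG p : {for p, continuous (fun q => F n q - G n q)} by exact: subp_cont.
  have IFG := int_cdom cFG : area.-integrable cdom (EFin \o (fun q => F n q - G n q)).
  rewrite -(RintegralB measurable_cdom IF IG').
  apply: (le_trans (le_normr_Rintegral measurable_cdom IFG)).
  have cR p : {for p, continuous (fun q => eta * K * kern c (harm n) q + harm n * L)}.
    by apply: addp_cont; [apply: mulp_cont; [exact: cst_cont|exact: ck]|exact: cst_cont].
  have cN p : {for p, continuous (fun q => `|F n q - G n q|)}.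
    by apply: (@continuous_comp _ R^o R (fun q => F n q - G n q) (fun x => `|x|) p (cFG p)); exact: norm_continuous.
  have St := le_Rintegral measurable_cdom (int_cdom cN) (int_cdom cR) (pw n).
  apply: (le_trans St).
  rewrite (RintegralD measurable_cdom (IK n) (IC n)) Rintegral_cst; last exact: measurable_cdom.
  apply: lerD => //.
  rewrite RintegralZl; [|exact: measurable_cdom|by apply: int_cdom => p; exact: ck].
  have := kern_cdom_le c0 h0 => k1.
  have k2 := ler_wpM2l (ltW (mulr_gt0 eta0 K0)) k1; apply: (le_trans k2).
  by rewrite -mulrA -/P /eta divfK // gt_eqF.
have e3 : 0 < e / 3 by rewrite divr_gt0.
have cvH : (fun n => harm n * (L * A)) @ \oo --> 0.
  by rewrite -(mul0r (L * A)); apply: cvgM; [exact: cvg_harmonic|exact: cvg_cst].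
have /(@cvgrPdist_lt _ R^o)/(_ _ e3) E1 := cvG.
have /(@cvgrPdist_lt _ R^o)/(_ _ e3) E2 := cvH.
apply: filterS2 E1 E2 => n h1 e2.
have h2 : harm n * (L * A) < e / 3.
  by move: e2; rewrite sub0r normrN; apply: le_lt_trans; exact: ler_norm.
have h3 := diff n; rewrite -mulrA in h3.
apply: (@le_lt_trans _ _ (`|s * (pi / a) - \int[area]_(p in cdom) G n p| + `|\int[area]_(p in cdom) F n p - \int[area]_(p in cdom) G n p|)).
  rewrite (distrC (\int[area]_(p in cdom) F n p)); exact: ler_distD.
by move: h1 h2 h3; move: (`|_ - _|) (`|_ - _|) (harm n * _) => x y z; lra.
Qed.

End Concentration.

(** * Passage to the limit in the regularised equation *)

Section Regularization.
Variable R : realType.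
Local Notation C := R[i].
Local Notation T := (measurableTypeR R * measurableTypeR R)%type.
Local Notation area := (@area R).
Variables w1 w2 : C.
Hypothesis hw : 0 < Im (w2 / w1).
Local Notation E := (fundamental_domain w1 w2 : set T).
Local Notation pper := (pper w1 w2).
Local Notation harm := (@harmonic R).
Local Notation cdom := (cdom w1 w2).
Implicit Types (p q : R * R) (m w h : R * R -> R).

Lemma ae_neq0 (Q : T -> Prop) : (forall p, p <> 0 -> Q p) -> {ae area, forall p, Q p}.
Proof.
move=> H; exists [set 0]; split; [exact: measurable_pt|exact: area_pt|].
by move=> p /= nQ; apply: contrapT => p0; apply: nQ; exact: H.
Qed.

Lemma dct (F : nat -> R * R -> R) (f g : R * R -> R) :
  (forall n, measurable_fun setT (F n : T -> R)) -> measurable_fun setT (f : T -> R) ->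
  area.-integrable cdom (EFin \o g) ->
  (forall p, cdom p -> p <> 0 -> (fun n => F n p) @ \oo --> f p) ->
  (forall n p, cdom p -> p <> 0 -> `|F n p| <= g p) ->
  area.-integrable cdom (EFin \o f) /\
  (fun n => \int[area]_(p in cdom) F n p) @ \oo --> \int[area]_(p in cdom) f p.
Proof.
move=> mF mf ig cv dm.
have mF' n : measurable_fun cdom (EFin \o F n : T -> \bar R).
  by apply/measurable_EFinP; exact: measurable_funTS.
have mf' : measurable_fun cdom (EFin \o f : T -> \bar R).
  by apply/measurable_EFinP; exact: measurable_funTS.
have A1 : {ae area, forall p : T, cdom p -> (EFin \o F n) p @[n --> \oo] --> (EFin \o f) p}.
  apply: ae_neq0 => p p0 Dp; apply: cvg_EFin; first exact: nearW.
  exact: cv.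
have A2 : {ae area, forall p : T, forall n, cdom p -> (`|(EFin \o F n) p| <= (EFin \o g) p)%E}.
  by apply: ae_neq0 => p p0 n Dp; rewrite lee_fin; exact: dm.
have [i1 _ c1] := dominated_convergence (measurable_cdom hw) mF' mf' A1 ig A2.
split=> //; have fin := integrable_fin_num (measurable_cdom hw) i1.
by apply: (@fine_cvg R nat \oo _ (fun n => \int[area]_(p in cdom) (EFin \o F n) p)%E); rewrite fineK.
Qed.

Lemma powp_cont w n p : {for p, continuous w} -> {for p, continuous (fun q => w q ^+ n)}.
Proof.
move=> cw; elim: n => [|n IH]; first exact: cst_cont.
apply: (@continuous_near _ (fun q => w q * w q ^+ n)); last exact: mulp_cont.
by apply: near_all => q; rewrite (exprS (w q) n).
Qed.

Lemma ln_plus_cont w eps p : {for p, continuous w} -> 0 <= w p -> 0 < eps ->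
  {for p, continuous (fun q => ln (w q + eps))}.
Proof.
move=> cw w0 e0.
have c : {for p, continuous (fun q => w q + eps)} by apply: addp_cont => //; exact: cst_cont.
apply: (@continuous_comp _ R R (fun q => w q + eps) (@ln R) p c); apply: continuous_ln.
by rewrite ltr_wpDl.
Qed.

Lemma ln_plus_cvg (x : R) : 0 < x -> (fun n => ln (x + harm n)) @ \oo --> ln x.
Proof.
move=> x0; have c : (fun n => x + harm n) @ \oo --> x + 0 by apply: cvgD; [exact: cvg_cst|exact: cvg_harmonic].
rewrite addr0 in c; exact: (cvg_comp _ _ c (continuous_ln x0)).
Qed.

Lemma meas_ln w : (forall p, {for p, continuous w}) -> measurable_fun setT ((fun p => ln (w p)) : T -> R).
Proof. by move=> cw; apply: measurableT_comp; [exact: measurable_ln|exact: cont_meas]. Qed.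

(* [lnG eps] is [d/dx (x ln (x ^ 2 + eps))], whose integral is explicit; it differs by at most 2 from
   [ln (x ^ 2 + eps)], which bounds [ln (w + eps)] from below. *)
Lemma ln_integrable w c : (forall p, {for p, continuous w}) -> (forall p, 0 <= w p) -> 0 < c -> c <= 1 ->
  (forall p, cdom p -> c * N2 p <= w p) -> (forall p, cdom p -> p <> 0 -> 0 < w p) ->
  area.-integrable cdom (EFin \o (fun p => ln (w p))).
Proof.
move=> cw w0 c0 c1 lw wpos.
have mD : measurable cdom := measurable_cdom hw.
have [M M0 HM] := cdom_sqr0 w1 w2.
have [B B0 HB] := cont_rect_bounded cw (ltW M0).
pose C0 := ln (B + 1).
have C00 : 0 <= C0 by apply: ln_ge0; rewrite lerDr ltW.
have lnC (e : R) p : cdom p -> 0 <= e -> e <= 1 -> 0 < w p + e -> ln (w p + e) <= C0.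
  move=> Dp e0 e1 we; have [p1 p2] := sqr0_bounded (HM _ Dp).
  rewrite /C0 ler_ln ?posrE //; last by rewrite addr_gt0.
  apply: lerD => //.
  by apply: le_trans (HB p p1 p2); exact: ler_norm.
pose f n p := 2 * C0 - ln (w p + harm n).
have cf n p : {for p, continuous (f n)}.
  by apply: subp_cont; [exact: cst_cont|apply: ln_plus_cont => //; exact: harm_gt0].
have f0 n p : cdom p -> 0 <= f n p.
  move=> Dp; have h0 := harm_gt0 R n.
  by have := lnC (harm n) p Dp (ltW h0) (harm_le1 R n); rewrite ltr_wpDl // => /(_ isT); rewrite /f; lra.
pose K := 2 * C0 - ln c + 2 + `|ln (M * M + 1)| + 2.
have lnc : ln c <= 0 by rewrite ln_le0.
have fK n p : cdom p -> f n p <= K - lnG (harm n) p.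
  move=> Dp; have h0 := harm_gt0 R n.
  set x := p.1 * p.1; have x0 : 0 <= x by rewrite /x -expr2 sqr_ge0.
  have xe : 0 < x + harm n by rewrite ltr_wpDl.
  have h1 : ln c + ln (x + harm n) <= ln (w p + harm n).
    rewrite -lnM ?posrE // ler_ln ?posrE ?mulr_gt0 ?ltr_wpDl //.
    rewrite mulrDr; apply: lerD; last by rewrite ler_piMl // ltW.
    apply: le_trans (lw p Dp); rewrite ler_pM2l // /N2 -/x lerDl -expr2; exact: sqr_ge0.
  have h2 : 2 * x * (x + harm n)^-1 <= 2.
    by rewrite ler_pdivrMr //; move: h0; lra.
  have h3 := normr_ge0 (ln (M * M + 1)).
  rewrite /f /K /lnG -/x; move: h1 h2 h3.
  by move: (ln (w p + _)) (ln (x + _)) (2 * x * _) (ln c) (`|_|) => a1 a2 a3 a4 a5; lra.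
have Kpos n p : sqr0 M p -> 0 <= K - lnG (harm n) p.
  move=> /sqr0_bounded[p1 p2]; have h0 := harm_gt0 R n.
  set x := p.1 * p.1; have x0 : 0 <= x by rewrite /x -expr2 sqr_ge0.
  have xe : 0 < x + harm n by rewrite ltr_wpDl.
  have xM : x <= M * M.
    by rewrite /x -!expr2 -(real_normK (x := p.1)) ?num_real // ler_pXn2r // nnegrE // ltW.
  have h1 : ln (x + harm n) <= ln (M * M + 1).
    rewrite ler_ln ?posrE //; last by rewrite ltr_wpDl // mulr_ge0 // ltW.
    by apply: lerD => //; exact: harm_le1.
  have h2 : 2 * x * (x + harm n)^-1 <= 2.
    by rewrite ler_pdivrMr //; move: h0; lra.
  have h3 := ler_norm (ln (M * M + 1)).
  rewrite /K /lnG -/x; move: h1 h2 h3 lnc C00.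
  by move: (ln (x + _)) (2 * x * _) (ln c) (ln (M * M + 1)) (`|_|) => a1 a2 a3 a4 a5; lra.
pose A := fine (area (sqr0 M)).
pose K' := K * A - 2 * M * ln (M * M) * (2 * M).
have bound n : \int[area]_(p in cdom) f n p <= K'.
  have h0 := harm_gt0 R n.
  have cl p : {for p, continuous (lnG (harm n))} := lnG_cont (p := p) h0.
  have ck p : {for p, continuous (fun=> K : R)} := @cst_cont R p K.
  have cr p : {for p, continuous (fun q => K - lnG (harm n) q)} := subp_cont (ck p) (cl p).
  have S1 := le_Rintegral mD (int_cdom hw (cf n)) (int_cdom hw cr) (fK n).
  have S2 := le_int_sub_on mD (measurable_sqr0 M) HM (int_sqr0 (ltW M0) cr) (Kpos n).
  have S3 := RintegralB (measurable_sqr0 M) (int_sqr0 (ltW M0) ck) (int_sqr0 (ltW M0) cl).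
  apply: (le_trans S1); apply: (le_trans S2); rewrite S3 (int_lnG M0 h0).
  rewrite Rintegral_cst; last exact: measurable_sqr0.
  rewrite /K' lerD2l lerN2; apply: ler_wpM2r; first by rewrite mulr_ge0 // ltW.
  apply: ler_wpM2l; first by rewrite mulr_ge0 // ltW.
  by rewrite ler_ln ?posrE ?addr_gt0 ?mulr_gt0 // lerDl ltW.
have mln : measurable_fun setT ((fun p => ln (w p)) : T -> R) := meas_ln cw.
have mlnD (D : set T) : measurable_fun D (EFin \o (fun p => ln (w p)) : T -> \bar R).
  by apply/measurable_EFinP; exact: measurable_funTS.
apply: (proj2 (@negligible_integrable _ T R area cdom [set 0] _ (measurable_pt 0) mD (mlnD _) (area_pt 0))).
have mD' : measurable (cdom `\` [set 0] : set T) by apply: measurableD => //; exact: measurable_pt.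
pose H p := 2 * C0 - ln (w p).
have Hln p : (cdom `\` [set 0]) p -> `|ln (w p)| <= H p.
  move=> [Dp /= p0]; have := lnC 0 p Dp (lexx 0) ler01; rewrite addr0 => /(_ (wpos p Dp p0)).
  by rewrite /H ler_norml => h; apply/andP; split; lra.
have H0 p : (cdom `\` [set 0]) p -> 0 <= H p by move=> /Hln; apply: le_trans.
have mH : measurable_fun (cdom `\` [set 0]) (EFin \o H : T -> \bar R).
  apply/measurable_EFinP; apply: measurable_funTS; apply: measurable_funB; [exact: measurable_cst|exact: mln].
have iH : area.-integrable (cdom `\` [set 0]) (EFin \o H).
  apply/integrableP; split=> //.
  apply: (@le_lt_trans _ _ K'%:E); last exact: ltry.
  have mf n : measurable_fun (cdom `\` [set 0]) (EFin \o f n : T -> \bar R).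
    by apply/measurable_EFinP; apply: measurable_funTS; exact: cont_meas.
  have f0' n p : (cdom `\` [set 0]) p -> (0 <= (EFin \o f n) p)%E by move=> [Dp _]; rewrite lee_fin; exact: f0.
  have Fa := fatou area mD' mf f0'.
  have -> : (\int[area]_(p in cdom `\` [set 0%R]) `|(EFin \o H) p| =
      \int[area]_(p in cdom `\` [set 0%R]) limn_einf (fun n => (EFin \o f n) p))%E.
    apply: eq_integral => p; rewrite inE => pD; have [Dp p0] := pD.
    rewrite /= ger0_norm; last exact: H0.
    have cv : (fun n => f n p) @ \oo --> H p.
      by apply: cvgB; [exact: cvg_cst|exact: ln_plus_cvg (wpos p Dp p0)].
    have cvE : (EFin \o f n) p @[n --> \oo] --> (H p)%:E by apply: cvg_EFin => //; exact: nearW.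
    by rewrite (cvg_limn_einf_sup cvE).1.
  apply: (le_trans Fa); rewrite limn_einf_lim; apply: lime_le; first exact: is_cvg_einfs.
  apply: nearW => n; apply: (@le_trans _ _ (\int[area]_(p in cdom `\` [set 0%R]) (EFin \o f n) p)%E).
    by apply: ereal_inf_lbound; exists n => //=.
  apply: (@le_trans _ _ (\int[area]_(p in cdom) (EFin \o f n) p)%E).
    have mfD : measurable_fun cdom (EFin \o f n : T -> \bar R).
      by apply/measurable_EFinP; apply: measurable_funTS; exact: cont_meas.
    have f0D p : cdom p -> (0 <= (EFin \o f n) p)%E by move=> Dp; rewrite lee_fin; exact: f0.
    by apply: ge0_subset_integral; [exact: mD'|exact: mD|exact: mfD|exact: f0D|move=> p []].
  have fin := integrable_fin_num mD (int_cdom hw (cf n)).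
  by rewrite -(fineK fin) lee_fin; exact: bound.
apply: (le_integrable mD' (mlnD _) _ iH).
by move=> p pD; rewrite /= lee_fin (ger0_norm (H0 p pD)); exact: Hln.
Qed.

(** The laplacian of [ln (w + eps)] has numerator [eps * laplacian w] plus [w * laplacian w] minus
    the squared gradient, and the equation of [w] replaces the last two terms by a power of [w]. *)
Lemma lap_reg w k p eps gx gy a b c d : 0 < eps -> (forall q, 0 <= w q) ->
  (\forall q \near p, gd w q (gx q) (gy q)) -> gd gx p a b -> gd gy p c d ->
  w p * (a + d) - (gx p * gx p + gy p * gy p) = - (w p ^+ k.+2 / k%:R) ->
  laplacian (fun q => ln (w q + eps)) p =
    (eps * laplacian w p - w p ^+ k.+2 / k%:R) * ((w p + eps) * (w p + eps))^-1.
Proof.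
move=> e0 w0 G Gx Gy eqn; rewrite (gd_lap G Gx Gy).
have we q : 0 < w q + eps by rewrite ltr_wpDl.
have Gw q x y : gd w q x y -> gd (fun q => w q + eps) q x y.
  by move=> g; have := gdD g (gd_cst eps q); rewrite !addr0.
have G1 : \forall q \near p, gd (fun q => ln (w q + eps)) q ((w q + eps)^-1 * gx q) ((w q + eps)^-1 * gy q).
  by apply: filterS G => q g; apply: gd_comp (Gw _ _ _ g); exact: is_derive1_ln.
have Gp := Gw _ _ _ (nbhs_singleton G).
have Gi := gd_comp (is_derive_invr (lt0r_neq0 (we p))) Gp.
rewrite (gd_lap G1 (gdM Gi Gx) (gdM Gi Gy)).
have n0 := lt0r_neq0 (we p).
have -> : w p ^+ k.+2 / k%:R = gx p * gx p + gy p * gy p - w p * (a + d) by rewrite -[LHS]opprK -eqn; ring.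
by move: n0; move: (w p) (gx p) (gy p) => W X Y n0; field.
Qed.

Theorem regularized w m k : (0 < k)%N -> (forall p, w p = N2 p * m p) -> (forall p, {for p, continuous m}) ->
  (forall p, 0 <= m p) -> 0 < m 0 -> (forall p, ~ lattice w1 w2 (pt p) -> 0 < m p) ->
  pper w -> (forall p, Ck 2 w p) ->
  (forall p, exists gx gy a b c d, [/\ \forall q \near p, gd w q (gx q) (gy q), gd gx p a b, gd gy p c d &
     w p * (a + d) - (gx p * gx p + gy p * gy p) = - (w p ^+ k.+2 / k%:R)]) ->
  laplacian w 0 = 4 * m 0 ->
  let u p := k%:R * ln (w p) in
  [/\ area.-integrable E (EFin \o u), area.-integrable E (EFin \o (expR \o u)) &
   forall h, class_C 2 setT h -> pper h ->
    (\int[area]_(p in E) (u p * laplacian h p + expR (u p) * h p)%:E = (4 * pi * k%:R * h (0 : R * R))%:E)%E].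
Proof.
move=> k0 wE cm m0 m00 mpos perw Cw eqn lap0 u.
have mD : measurable cdom := measurable_cdom hw.
have cw p : {for p, continuous w} := Ck_cont (Cw p).
have w0 p : 0 <= w p by rewrite wE mulr_ge0 // N2_ge0.
have N2pos p : p <> 0 -> 0 < N2 p.
  move=> p0; rewrite lt_neqAle N2_ge0 andbT; apply/negP => /eqP/esym/eqP.
  rewrite /N2 -!expr2 paddr_eq0 ?sqr_ge0 // !sqrf_eq0 => /andP[/eqP a /eqP b]; apply: p0.
  by move: a b; case: (p) => x y /= -> ->.
have wpos p : cdom p -> p <> 0 -> 0 < w p.
  move=> Dp p0; rewrite wE mulr_gt0 ?N2pos //; apply: mpos => L; apply: p0.
  move/(cdomE hw): Dp => [/andP[a b] /andP[c d]].
  by apply: (cdom_lattice hw) L; apply/andP; split=> //; exact: ltW.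
have [c' c'0 Hc'] := cdom_lower hw cm m0 m00 mpos.
have iln : area.-integrable cdom (EFin \o (fun p => ln (w p))).
  apply: (@ln_integrable w (Num.min c' 1)) => //.
  - by rewrite lt_min c'0 ltr01.
  - by rewrite ge_min lexx orbT.
  - move=> p Dp; rewrite wE mulrC; apply: ler_wpM2l; first exact: N2_ge0.
    by apply: le_trans (Hc' _ Dp); rewrite ge_min lexx.
have mln := meas_ln cw.
have mu' : measurable_fun setT (u : T -> R) by apply: measurable_funM => //; exact: measurable_cst.
have meu : measurable_fun setT ((fun p => expR (u p)) : T -> R).
  by apply: measurableT_comp => //; exact: measurable_expR.
have peru : pper u by move=> n p; rewrite /u perw.
have eu p : 0 < w p -> expR (u p) = w p ^+ k by move=> wp; rewrite /u expRM_natl lnK.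
have iu : area.-integrable cdom (EFin \o u) by exact: (integrableZl mD k%:R iln).
have cwk p : {for p, continuous (fun q => w q ^+ k)} := powp_cont (n := k) (cw p).
have ieu : area.-integrable cdom (EFin \o (fun p => expR (u p))).
  (* The summand 1 covers the points where [w] vanishes: there [ln] is 0 by convention and
     [expR (u p)] is 1. *)
  have c1 p : {for p, continuous (fun q => w q ^+ k + 1)} := addp_cont (cwk p) (@cst_cont R p 1).
  apply: (le_integrable mD _ _ (int_cdom hw c1)).
    by apply/measurable_EFinP; exact: measurable_funTS.
  move=> p Dp; rewrite /= lee_fin (ger0_norm (expR_ge0 _)).
  have wk0 : 0 <= w p ^+ k by exact: exprn_ge0.
  rewrite ger0_norm; last by rewrite addr_ge0.
  have [wp|] := ltP 0 (w p); first by rewrite (eu _ wp) lerDl.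
  move=> wp; have -> : u p = 0 by rewrite /u ln0 // mulr0.
  by rewrite expR0 lerDr.
split.
- apply: (integrable_tile hw (v := vec ((2^-1)%:C * w1 + (2^-1)%:C * w2))) => //.
  + by apply/measurable_EFinP.
  + by move=> n p; rewrite /= peru.
- apply: (integrable_tile hw (v := vec ((2^-1)%:C * w1 + (2^-1)%:C * w2))) => //.
  + by apply/measurable_EFinP.
  + by move=> n p; rewrite /= peru.
move=> h Ch perh.
have [ch _ _ _] := class_C2_facts Ch.
have clh p : {for p, continuous (laplacian h)} := lap_cont Ch (p := p).
have Cwf : class_C 2 setT w by apply: class_C_Ck.
have clw p : {for p, continuous (laplacian w)} := lap_cont Cwf (p := p).
pose v n p := ln (w p + harm n).
have Cv n p : Ck 2 (v n) p.
  apply: Ck_ln; first by rewrite ltr_wpDl // harm_gt0.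
  by apply: CkD; [exact: Cw|exact: Ck_cst].
have Cvf n : class_C 2 setT (v n) by apply: class_C_Ck.
have perv n : pper (v n) by move=> i p; rewrite /v perw.
have cv n p : {for p, continuous (v n)} := Ck_cont (Cv n p).
have lapv n p : laplacian (v n) p = (harm n * laplacian w p - w p ^+ k.+2 / k%:R) * ((w p + harm n) * (w p + harm n))^-1.
  have [gx [gy [a [b [c [d [G Gx Gy e]]]]]]] := eqn p.
  exact: (lap_reg (harm_gt0 R n) w0 G Gx Gy e).
pose F n p := v n p * laplacian h p.
have cF n p : {for p, continuous (F n)} := mulp_cont (cv n p) (clh p).
(* The two parts of [h * laplacian (v n)]: [G1] carries the concentrating kernel, while [G2]
   converges to [h * w ^+ k], the term [h * expR u] of the equation. *)
pose G1 n p := harm n * (h p * laplacian w p) * ((N2 p * m p + harm n) * (N2 p * m p + harm n))^-1.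
pose G2 n p := h p * w p ^+ k.+2 * ((w p + harm n) * (w p + harm n))^-1.
have cth p : {for p, continuous (fun q => h q * laplacian w q)} := mulp_cont (ch p) (clw p).
have cG1 n p : {for p, continuous (G1 n)} by apply: kern_weight_cont => //; exact: harm_gt0.
have cwn n p : {for p, continuous (fun q => w q + harm n)} := addp_cont (cw p) (@cst_cont R p (harm n)).
have wn0 n p : 0 < w p + harm n by rewrite ltr_wpDl // harm_gt0.
have cG2 n p : {for p, continuous (G2 n)}.
  apply: (mulp_cont (mulp_cont (ch p) (powp_cont (n := k.+2) (cw p)))).
  by apply: inv_cont; [exact: mulp_cont|rewrite gt_eqF // mulr_gt0].
have greenE n : \int[area]_(p in cdom) F n p =
    \int[area]_(p in cdom) G1 n p - (k%:R)^-1 * \int[area]_(p in cdom) G2 n p.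
  have tl (g : R * R -> R) : (forall p, {for p, continuous g}) -> pper g ->
      \int[area]_(p in cdom) g p = \int[area]_(p in E) g p.
    move=> cg pg; congr fine.
    apply: (tile hw (vec ((2^-1)%:C * w1 + (2^-1)%:C * w2)) (f := EFin \o g)).
      by apply/measurable_EFinP; exact: cont_meas.
    by move=> i p; rewrite /= pg.
  have pF : pper (F n) by move=> i p; rewrite /F perv (pper_lap perh).
  have cH p : {for p, continuous (fun q => h q * laplacian (v n) q)} := mulp_cont (ch p) (lap_cont (Cvf n) (p := p)).
  have pH : pper (fun q => h q * laplacian (v n) q) by move=> i p; rewrite perh (pper_lap (perv n)).
  rewrite (tl _ (cF n) pF).
  apply: (eq_trans (green hw (Cvf n) (perv n) Ch perh)); rewrite -(tl _ cH pH).
  have cG2' p : {for p, continuous (fun q => (k%:R)^-1 * G2 n q)} := mulp_cont (@cst_cont R p _) (cG2 n p).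
  rewrite -(@RintegralZl _ _ _ area cdom (G2 n) (k%:R)^-1 mD (int_cdom hw (cG2 n))) -(RintegralB mD (int_cdom hw (cG1 n)) (int_cdom hw cG2')).
  apply: eq_Rintegral => p _; rewrite lapv /G1 /G2 -wE.
  by move: (_^-1) (k%:R^-1) => x y; ring.
(* The weight at the origin is [h 0 * (4 * m 0)] and the kernel contributes [pi / m 0], so the
   unknown value [m 0] cancels. *)
have lim1 : (fun n => \int[area]_(p in cdom) G1 n p) @ \oo --> 4 * pi * h 0.
  have := concentration hw cm cth m0 m00 mpos.
  rewrite lap0; have -> // : h 0 * (4 * m 0) * (pi / m 0) = 4 * pi * h 0.
  by move: (pi : R) (lt0r_neq0 m00) => t t0; field.
have wcv p : 0 < w p -> (fun n => w p + harm n) @ \oo --> w p.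
  move=> wp; have c : (fun n => w p + harm n) @ \oo --> w p + 0 by apply: cvgD; [exact: cvg_cst|exact: cvg_harmonic].
  by rewrite addr0 in c.
have [iG2 lim2] : area.-integrable cdom (EFin \o (fun p => h p * w p ^+ k)) /\
    (fun n => \int[area]_(p in cdom) G2 n p) @ \oo --> \int[area]_(p in cdom) (h p * w p ^+ k).
  have chw p : {for p, continuous (fun q => h q * w q ^+ k)} := mulp_cont (ch p) (cwk p).
  have cn p : {for p, continuous (fun q => `|h q * w q ^+ k|)}.
    by apply: (@continuous_comp _ R^o R (fun q => h q * w q ^+ k) (fun x => `|x|) p (chw p)); exact: norm_continuous.
  apply: (dct (fun n => cont_meas (cG2 n)) (cont_meas chw) (int_cdom hw cn)).
  - move=> p Dp p0; have wp := wpos p Dp p0.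
    have -> : h p * w p ^+ k = h p * w p ^+ k.+2 * (w p * w p)^-1.
      by rewrite (exprS (w p) k.+1) (exprS (w p) k); move: (w p ^+ k) (lt0r_neq0 wp) => x x0; field.
    apply: (@cvgM _ _ _ _ (fun=> h p * w p ^+ k.+2)); first exact: cvg_cst.
    apply: cvgV; first by rewrite gt_eqF // mulr_gt0.
    by apply: cvgM; exact: wcv.
  - move=> n p Dp p0; have wp := wpos p Dp p0; rewrite /G2 2!normrM [leRHS]normrM -mulrA.
    apply: ler_wpM2l => //.
    rewrite !ger0_norm ?exprn_ge0 ?invr_ge0 ?mulr_ge0 ?(ltW (wn0 n p)) //.
    rewrite ler_pdivrMr ?mulr_gt0 // (exprS (w p) k.+1) (exprS (w p) k) mulrA mulrC.
    apply: ler_wpM2l; first exact: exprn_ge0.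
    by apply: ler_pM => //; rewrite lerDl ltW // harm_gt0.
have [BL BL0 HBL] := pper_bounded hw clh (pper_lap perh).
have [C0 C00 HC0] : exists2 C0 : R, 0 <= C0 & forall n p, cdom p -> ln (w p + harm n) <= C0.
  have [B B0 HB] := pper_bounded hw cw perw.
  exists (ln (B + 1)); first by apply: ln_ge0; rewrite lerDr ltW.
  move=> n p Dp; rewrite ler_ln ?posrE ?wn0 //; last by rewrite addr_gt0.
  apply: lerD; last exact: harm_le1.
  by apply: le_trans (HB p); exact: ler_norm.
have [iF lim3] : area.-integrable cdom (EFin \o (fun p => ln (w p) * laplacian h p)) /\
    (fun n => \int[area]_(p in cdom) F n p) @ \oo --> \int[area]_(p in cdom) (ln (w p) * laplacian h p).
  have iD : area.-integrable cdom (EFin \o (fun p => BL * (C0 + `|ln (w p)|))).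
    have i1 : area.-integrable cdom (EFin \o (fun=> C0 : R)) by apply: (int_cdom hw) => p; exact: cst_cont.
    have i2 : area.-integrable cdom (EFin \o (fun p => `|ln (w p)|)) := integrable_abse iln.
    have i3 : area.-integrable cdom (EFin \o (fun p => C0 + `|ln (w p)|)) := integrableD mD i1 i2.
    exact: (integrableZl mD BL i3).
  have mF n : measurable_fun setT (F n : T -> R) := cont_meas (cF n).
  have mlh : measurable_fun setT ((fun p => ln (w p) * laplacian h p) : T -> R).
    exact: (measurable_funM mln (cont_meas clh)).
  have cvF p : cdom p -> p <> 0 -> (fun n => F n p) @ \oo --> ln (w p) * laplacian h p.
    move=> Dp p0; apply: (@cvgM _ _ _ _ _ (fun=> laplacian h p)); last exact: cvg_cst.
    exact: ln_plus_cvg (wpos p Dp p0).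
  apply: (dct mF mlh iD cvF) => n p Dp p0; rewrite /F normrM mulrC; apply: ler_pM => //.
  have wp := wpos p Dp p0; have l1 := HC0 n p Dp.
  have l2 : ln (w p) <= ln (w p + harm n) by rewrite ler_ln ?posrE // lerDl ltW // harm_gt0.
  have l3 := ler_norm (- ln (w p)); rewrite normrN in l3.
  have l4 := normr_ge0 (ln (w p)).
  by rewrite ler_norml /v; apply/andP; split; lra.
have limE : \int[area]_(p in cdom) (ln (w p) * laplacian h p) =
    4 * pi * h 0 - (k%:R)^-1 * \int[area]_(p in cdom) (h p * w p ^+ k).
  have lim4 : (fun n => \int[area]_(p in cdom) G1 n p - (k%:R)^-1 * \int[area]_(p in cdom) G2 n p) @ \oo -->
      4 * pi * h 0 - (k%:R)^-1 * \int[area]_(p in cdom) (h p * w p ^+ k).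
    by apply: cvgB => //; apply: (@cvgM _ _ _ _ (fun=> (k%:R)^-1)) => //; exact: cvg_cst.
  rewrite -(funext greenE) in lim4.
  exact: (cvg_unique (@Rhausdorff R) lim3 lim4).
pose f p := u p * laplacian h p + expR (u p) * h p.
pose f' p := k%:R * (ln (w p) * laplacian h p) + h p * w p ^+ k.
have mf : measurable_fun setT (f : T -> R).
  exact: (measurable_funD (measurable_funM mu' (cont_meas clh)) (measurable_funM meu (cont_meas ch))).
have mf' : measurable_fun setT (f' : T -> R).
  exact: (measurable_funD (measurable_funM (measurable_cst _) (measurable_funM mln (cont_meas clh)))
    (measurable_funM (cont_meas ch) (cont_meas cwk))).
have pf : pper (EFin \o f) by move=> i p; rewrite /f /= peru perh (pper_lap perh).
have St := tile hw (vec ((2^-1)%:C * w1 + (2^-1)%:C * w2)) (f := EFin \o f) ((measurable_EFinP _ _).2 mf) pf.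
apply: (eq_trans (esym St)).
(* At the origin [w] vanishes, [expR (u p)] is 1 by the convention for [ln] and [w p ^+ k] is 0; the
   two integrands agree elsewhere. *)
have ae : ae_eq area cdom (EFin \o f : T -> \bar R) (EFin \o f').
  apply: ae_neq0 => p p0 Dp; congr (_%:E).
  by rewrite /f /f' (eu _ (wpos p Dp p0)) /u mulrA (mulrC (h p)).
have mfc : measurable_fun cdom (EFin \o f : T -> \bar R) by apply/measurable_EFinP; exact: measurable_funTS.
have mfc' : measurable_fun cdom (EFin \o f' : T -> \bar R) by apply/measurable_EFinP; exact: measurable_funTS.
apply: (eq_trans (ae_eq_integral _ _ mD mfc mfc' ae)).
have iZ : area.-integrable cdom (EFin \o (fun p => k%:R * (ln (w p) * laplacian h p))) := integrableZl mD k%:R iF.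
have if' : area.-integrable cdom (EFin \o f') := integrableD mD iZ iG2.
rewrite -(fineK (integrable_fin_num mD if')); congr (_%:E).
apply: (eq_trans (RintegralD mD iZ iG2)); rewrite (@RintegralZl _ _ _ area cdom _ k%:R mD iF) limE.
have kn : (k%:R : R) != 0 by rewrite pnatr_eq0 -lt0n.
by move: (\int[area]_(p in cdom) _) (pi : R) => x y; field.
Qed.

End Regularization.

(** * Solutions from local charts *)

Section Bridge.
Variable R : realType.
Local Notation C := R[i].
Local Notation T := (measurableTypeR R * measurableTypeR R)%type.
Local Notation area := (@area R).
Variables w1 w2 : C.
Hypothesis hw : 0 < Im (w2 / w1).
Local Notation E := (fundamental_domain w1 w2 : set T).
Local Notation L := (lattice w1 w2).
Implicit Types (p q v : R * R) (z : C) (g : R * R -> R) (f : C -> sphere R) (phi h : C -> C).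

Lemma sh_cont v p : {for p, continuous (sh v : R * R -> R * R)}.
Proof.
apply: (@cvg_pair (R * R)%type R R (nbhs p) (nbhs (p.1 + v.1)) (nbhs (p.2 + v.2)) _ _ _
  (fun q => q.1 + v.1) (fun q => q.2 + v.2)).
  exact: (addp_cont (@fst_cont R p) (@cst_cont R p v.1)).
exact: (addp_cont (@snd_cont R p) (@cst_cont R p v.2)).
Qed.

Lemma sh_near v p (P : R * R -> Prop) : (\forall q \near sh v p, P q) -> \forall q \near p, P (sh v q).
Proof. by move=> H; exact: (@sh_cont v p _ H). Qed.

Lemma sh_comp_cont g v p : {for sh v p, continuous g} -> {for p, continuous (fun q => g (sh v q))}.
Proof. by move=> cg; apply: (@continuous_comp _ _ _ (sh v : R * R -> R * R) g p (@sh_cont v p)). Qed.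

Lemma gd_sh g v p a b : gd g (sh v p) a b -> gd (fun q => g (sh v q)) p a b.
Proof.
move=> [A [B [cA cB Aa Bb H]]]; exists (fun q => A (sh v q)), (fun q => B (sh v q)).
split=> //; [exact: sh_comp_cont|exact: sh_comp_cont|].
apply: filterS (sh_near H) => q ->; rewrite /sh /=.
have e (x y t : R) : x + t - (y + t) = x - y by ring.
by rewrite !e.
Qed.

Lemma Ck_sh n g v p : Ck n g (sh v p) -> Ck n (fun q => g (sh v q)) p.
Proof.
elim: n g => [|n IH] g [cg X].
  by split=> //; apply: filterS (sh_near cg) => q; exact: sh_comp_cont.
split; first by apply: filterS (sh_near cg) => q; exact: sh_comp_cont.
move: X => [gx [gy [H X Y]]]; exists (fun q => gx (sh v q)), (fun q => gy (sh v q)).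
by split; [apply: filterS (sh_near H) => q; exact: gd_sh|exact: IH|exact: IH].
Qed.

Lemma lattice_isolated : exists2 D : R, 0 < D & forall z, L z -> normc z < D -> z = 0.
Proof.
have [d d0 H] := sqr0_cdom hw; exists d => // z Lz zd.
have z1 := le_lt_trans (normc_Re z) zd; have z2 := le_lt_trans (normc_Im z) zd.
have : sqr0 d (vec z) by rewrite /sqr0 /vec; split; rewrite /= in_itv /= -ler_norml ltW.
move=> /H/(cdomE hw)[/andP[a b] /andP[c e]].
have : vec z = 0 :> R * R.
  by apply: (cdom_lattice hw); rewrite ?a ?c ?(ltW b) ?(ltW e) // pt_vec.
by case: z {Lz zd z1 z2 a b c e} => x y [-> ->].
Qed.

Lemma lattice_off z : dnearc z (fun w => ~ L w).
Proof.
have [D D0 H] := lattice_isolated.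
have D2 : 0 < D / 2 by rewrite divr_gt0.
have [[w0 [w0z w0n Lw0]]|no] := pselect (exists w0, [/\ w0 != z, normc (w0 - z) < D / 2 & L w0]); last first.
  by exists (D / 2) => // w wD wz Lw; apply: no; exists w.
exists (normc (w0 - z)); first by rewrite normc_gt0 // subr_eq0.
move=> w wD wz Lw.
have : w - w0 = 0.
  apply: H.
    by have := lattice_per (V := Prop) (f := L); move: Lw Lw0 => [a [b ->]] [c [d ->]]; exists (a - c), (b - d); rewrite !mulrzBr; ring.
  have -> : w - w0 = (w - z) + - (w0 - z) by ring.
  by apply: (le_lt_trans (le_normcD _ _)); rewrite normcN; lra.
by move=> /eqP; rewrite subr_eq0 => /eqP e; move: wD; rewrite e ltxx.
Qed.

Lemma lattice_off_near z : ~ L z -> nearc z (fun w => ~ L w).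
Proof.
move=> nL; apply: nearc_imp (lattice_off z) => w H; have [->//|wz] := eqVneq w z.
exact: H.
Qed.

Lemma logdens_chart f phi z : chart f z phi -> nearc z (fun w => ln (spherical_density f w) = logdens (dC phi) phi w).
Proof. by move=> /chart_density; apply: nearc_imp => w ->. Qed.

(** * The function [w = exp (U / k)] in local charts *)

Section WithCharts.
Variables (f : C -> sphere R) (U : C -> R) (k : nat).
Hypothesis k0 : (0 < k)%N.
Hypothesis off : forall z, ~ L z -> exists phi, chart f z phi /\ has_order (dC phi) z 0.
Hypothesis at0 : exists phi, chart f 0 phi /\ has_order (dC phi) 0 k.
Hypothesis perU : lattice_periodic w1 w2 U.
Hypothesis UE : forall z, ~ L z -> U z = ln (spherical_density f z).
Hypothesis U0 : forall z, L z -> U z = 0.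

(** With the value 0 on the lattice, [k * ln w] is equal to [U] everywhere: on the lattice this is
    the convention [ln 0 = 0] together with [U0]. *)
Let w p : R := if `[< L (pt p) >] then 0 else expR (k%:R^-1 * U (pt p)).

Lemma has_order0_nz (h : C -> C) z : has_order h z 0 -> h z != 0.
Proof. by move=> [q [_ q0 e]]; rewrite (nearc_self e) expr0 mul1r. Qed.

Lemma U_near z : ~ L z -> exists phi, [/\ nearc z (hol phi), dC phi z != 0 &
  nearc z (fun y => U y = logdens (dC phi) phi y)].
Proof.
move=> nL; have [phi [c o]] := off nL; exists phi; split; [by case: c|exact: has_order0_nz|].
by apply: nearc_imp (nearc_and (lattice_off_near nL) (logdens_chart c)) => v [/UE -> ->].
Qed.

Lemma kn0 : (k%:R : R) != 0.
Proof. by rewrite pnatr_eq0 -lt0n. Qed.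

Lemma w_near_off p : ~ L (pt p) -> exists phi, [/\ nearc (pt p) (hol phi), dC phi (pt p) != 0 &
  \forall q \near p, w q = expR (k%:R^-1 * logdens (dC phi) phi (pt q))].
Proof.
move=> nL; have [phi [hp d0 e]] := U_near nL; exists phi; split=> //.
have := nearc_near (nearc_and (lattice_off_near nL) e); apply: filterS => q [nq <-].
by rewrite /w asboolF.
Qed.

Lemma class_C_U : class_C 2 [set p | ~ L (p.1 +i* p.2)] (in_coords U).
Proof.
apply: class_C_Ck => p nL; have [phi [hp d0 e]] := U_near nL.
apply: (@Ck_near _ _ (fun q => logdens (dC phi) phi (pt q))); last by apply: Ck_logdens => //; exact: dC_hol.
by apply: filterS (nearc_near e) => q; rewrite /in_coords -/(pt q) => ->.
Qed.

Lemma per_w : pper w1 w2 w.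
Proof.
move=> n p; rewrite /w pt_sh /lv pt_vec perU; last by exists n.1, n.2.
congr (if _ then _ else _); apply/asboolP/asboolP => [[a [b e]]|[a [b ->]]].
  exists (a - n.1), (b - n.2); rewrite !mulrzBr.
  move: (w1 *~ a) (w2 *~ b) (w1 *~ n.1) (w2 *~ n.2) (pt p) e => x1 x2 y1 y2 z e.
  by rewrite addrACA -opprD -e addrK.
by exists (a + n.1), (b + n.2); rewrite !mulrzDr addrACA.
Qed.

(** Where the derivative of the chart is [z ^+ k * h z], the logarithm of the density is
    [k * ln (N2 q)] plus a regular term; division by [k] leaves exactly one factor [N2]. *)
Lemma w_near0 : exists M, [/\ Ck 2 M (0 : R * R), 0 < M 0 & \forall q \near (0 : R * R), w q = N2 q * M q].
Proof.
have [phi [c [h [hh h0 e]]]] := at0; have hphi := proj1 c.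
pose M q := expR (k%:R^-1 * logdens h phi (pt q)).
exists M; split; [|exact: expR_gt0|].
  by apply: Ck_expR; apply: CkZ; apply: Ck_logdens.
have nh := cont_neq0 (hol_cont (nearc_self hh)) h0.
have := nearc_and (nearc_and e nh) (nearc_and (lattice_off 0) (logdens_chart c)).
move=> /(nearc_near (p := 0)); apply: filterS => q [[eq hq] [nq lq]].
have [q0|q0] := eqVneq (pt q) 0.
  have -> : N2 q = 0 by move: q0; case: (q) => x y [-> ->]; rewrite /N2 /= mulr0 addr0.
  rewrite mul0r /w asboolT // q0; exists 0, 0; by rewrite !mulr0z addr0.
have nLq := nq q0; rewrite /w asboolF // UE // lq.
have N0 : 0 < N2 q.
  rewrite lt_neqAle N2_ge0 andbT; apply/negP => /eqP/esym/eqP.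
  rewrite /N2 -!expr2 paddr_eq0 ?sqr_ge0 // !sqrf_eq0 => /andP[/eqP a /eqP b].
  by move: q0; rewrite /pt a b eqxx.
have nc : normc (pt q) ^+ 2 = N2 q by rewrite normc_sqr /= /N2 !expr2.
have dn : 0 < 8 * normc (h (pt q)) ^+ 2 / (1 + normc (phi (pt q)) ^+ 2) ^+ 2 := dens_gt0 phi hq.
have -> : logdens (dC phi) phi (pt q) = k%:R * ln (N2 q) + logdens h phi (pt q).
  rewrite /logdens eq subr0 normcM normcX.
  have -> : 8 * (normc (pt q) ^+ k * normc (h (pt q))) ^+ 2 / (1 + normc (phi (pt q)) ^+ 2) ^+ 2 =
     N2 q ^+ k * (8 * normc (h (pt q)) ^+ 2 / (1 + normc (phi (pt q)) ^+ 2) ^+ 2).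
    by rewrite -nc exprMn -!exprM (mulnC k 2); ring.
  rewrite lnM ?posrE //; last exact: exprn_gt0.
  by rewrite lnXn // (mulr_natl (ln (N2 q)) k).
rewrite mulrDr mulrA mulVf ?kn0 // mul1r expRD lnK //.
Qed.

Lemma w_lattice n p : w (sh (lv w1 w2 n) p) = w p.
Proof. exact: per_w. Qed.

Lemma w_eq_sh n : w = fun q => w (sh (lv w1 w2 n) q).
Proof. by apply/funext => q; rewrite w_lattice. Qed.

Lemma lattice_sh0 p : L (pt p) -> exists n, sh (lv w1 w2 n) p = 0.
Proof.
move=> [a [b e]]; exists (- a, - b); rewrite /sh /lv /vec /=.
have := e; rewrite !mulrNz -opprD -e /pt; case: (p) => x y _ /=.
by rewrite !subrr.
Qed.

Lemma w_Ck p : Ck 2 w p.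
Proof.
have [/lattice_sh0[n e]|nL] := pselect (L (pt p)).
  rewrite (w_eq_sh n); apply: Ck_sh; rewrite e.
  have [M [CM _ eM]] := w_near0.
  apply: (@Ck_near _ _ (fun q => N2 q * M q)); first by apply: filterS eM => q ->.
  by apply: CkM => //; apply: CkD; apply: CkM; [exact: Ck_fst|exact: Ck_fst|exact: Ck_snd|exact: Ck_snd].
have [phi [hp d0 e]] := w_near_off nL.
apply: (@Ck_near _ _ (fun q => expR (k%:R^-1 * logdens (dC phi) phi (pt q)))); first by apply: filterS e => q ->.
by apply: Ck_expR; apply: CkZ; apply: Ck_logdens => //; exact: dC_hol.
Qed.

(** The value at 0 of the factor [M] is determined by [w] through continuity. Quantifying over [M]
    lets the lemma be used with any choice of it. *)
Lemma w_gd0 : exists gx gy a b c d, [/\ \forall q \near (0 : R * R), gd w q (gx q) (gy q),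
   gd gx 0 a b, gd gy 0 c d, gx 0 = 0 /\ gy 0 = 0 &
   forall M, Ck 2 M (0 : R * R) -> (\forall q \near (0 : R * R), w q = N2 q * M q) -> a + d = 4 * M 0].
Proof.
have [M [CM M0 eM]] := w_near0.
have [_ [Mx [My [GM CMx CMy]]]] := CM.
have [_ [Mxx [Mxy [/nbhs_singleton Gxx _ _]]]] := CMx.
have [_ [Myx [Myy [/nbhs_singleton Gyy _ _]]]] := CMy.
have G1 := nbhs_singleton GM.
have z1 : (0 : R * R).1 = 0 :> R by [].
have z2 : (0 : R * R).2 = 0 :> R by [].
have N00 : N2 (0 : R * R) = 0 by rewrite /N2 z1 z2 mulr0 addr0.
have gN q : gd (@N2 R) q (2 * q.1) (2 * q.2).
  have := gdD (gdM (@gd_fst R q) (@gd_fst R q)) (gdM (@gd_snd R q) (@gd_snd R q)).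
  by rewrite !mul1r !mulr1 !mul0r !mulr0 !addr0 !add0r !mulr_natl !mulr2n.
have g2x : gd (fun q : R * R => 2 * q.1) 0 2 0.
  by have := gdM (gd_cst 2 (0 : R * R)) (@gd_fst R 0); rewrite !mul0r !add0r mulr1 mulr0.
have g2y : gd (fun q : R * R => 2 * q.2) 0 0 2.
  by have := gdM (gd_cst 2 (0 : R * R)) (@gd_snd R 0); rewrite !mul0r !add0r mulr1 mulr0.
have Gw : \forall q \near (0 : R * R), gd w q (2 * q.1 * M q + N2 q * Mx q) (2 * q.2 * M q + N2 q * My q).
  apply: filterS2 GM (near_near eM) => q g e.
  by apply: (@gd_near _ (fun q => N2 q * M q)); [apply: filterS e => r ->|exact: gdM].
have Gx := gdD (gdM g2x G1) (gdM (gN 0) Gxx).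
have Gy := gdD (gdM g2y G1) (gdM (gN 0) Gyy).
exists (fun q => 2 * q.1 * M q + N2 q * Mx q), (fun q => 2 * q.2 * M q + N2 q * My q).
eexists _, _, _, _; split; [exact: Gw|exact: Gx|exact: Gy| |].
  by rewrite z1 z2 N00 !mulr0 !mul0r addr0.
move=> M' CM' eM'.
have -> : M' 0 = M 0.
  have c1 := Ck_cont CM; have c2 := Ck_cont CM'.
  have D0 : {for (0 : R * R), continuous (fun q => M q - M' q)} := subp_cont c1 c2.
  apply/eqP; rewrite eq_sym -subr_eq0; apply: contrapT => /negP nz.
  have [D Dp H] := near_box (filterI (near_neq0 D0 nz) (filterI eM eM')).
  have := H (D / 2, 0); rewrite /= !subr0 normr0 gtr0_norm ?divr_gt0 //.
  move=> /(_ _ Dp)[]; first by lra.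
  move=> n1 [e1 e2]; move: n1; rewrite subr_eq0 => /eqP; apply.
  have N0 : N2 (D / 2, 0 : R) != 0 by rewrite /N2 /= mulr0 addr0 mulf_neq0 // gt_eqF // divr_gt0.
  by apply: (mulfI N0); rewrite -e1 -e2.
by rewrite z1 z2 N00; ring.
Qed.

(** For [w = exp (V / k)] the left-hand side is [w ^ 2 / k] times the laplacian of [V], and
    Liouville's equation turns this laplacian into [- exp V = - w ^ k]. On the lattice [w] and its
    gradient vanish. *)
Lemma w_eqn p : exists gx gy a b c d, [/\ \forall q \near p, gd w q (gx q) (gy q), gd gx p a b, gd gy p c d &
     w p * (a + d) - (gx p * gx p + gy p * gy p) = - (w p ^+ k.+2 / k%:R)].
Proof.
have [Lp|nL] := pselect (L (pt p)).
  have [n e] := lattice_sh0 Lp.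
  have [gx [gy [a [b [c [d [G Gx Gy [x0 y0] _]]]]]]] := w_gd0.
  exists (fun q => gx (sh (lv w1 w2 n) q)), (fun q => gy (sh (lv w1 w2 n) q)), a, b, c, d.
  rewrite -e in G Gx Gy; split; [|exact: gd_sh|exact: gd_sh|].
    by apply: filterS (sh_near G) => q /gd_sh; rewrite -(w_eq_sh n).
  have -> : w p = 0 by rewrite /w asboolT.
  by rewrite e x0 y0 exprS !mul0r addr0 subr0 oppr0.
have [phi [hp d0 e]] := w_near_off nL.
have [ux [uy [uxx [uxy [uyx [uyy [G Gx Gy eq]]]]]]] := liouville_eq hp d0.
pose V q := logdens (dC phi) phi (pt q).
have kG q a b : gd V q a b -> gd (fun q => expR (k%:R^-1 * V q)) q
    (expR (k%:R^-1 * V q) * (k%:R^-1 * a)) (expR (k%:R^-1 * V q) * (k%:R^-1 * b)).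
  move=> g; apply: (gd_comp (is_derive_expR _)).
  by have := gdM (gd_cst k%:R^-1 q) g; rewrite !mul0r !add0r.
pose W q := expR (k%:R^-1 * V q).
have GW : \forall q \near p, gd w q (W q * (k%:R^-1 * ux q)) (W q * (k%:R^-1 * uy q)).
  apply: filterS2 G (near_near e) => q g e'.
  by apply: (@gd_near _ W); [apply: filterS e' => r ->|exact: kG].
have GWp := kG p _ _ (nbhs_singleton G).
have kx a b g : gd g p a b -> gd (fun q => k%:R^-1 * g q) p (k%:R^-1 * a) (k%:R^-1 * b).
  by move=> gg; have := gdM (gd_cst k%:R^-1 p) gg; rewrite !mul0r !add0r.
have GX := gdM GWp (kx _ _ _ Gx); have GY := gdM GWp (kx _ _ _ Gy).
exists (fun q => W q * (k%:R^-1 * ux q)), (fun q => W q * (k%:R^-1 * uy q)).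
eexists _, _, _, _; split; [exact: GW|exact: GX|exact: GY|].
have -> : w p = W p by exact: (nbhs_singleton e).
have WV : W p ^+ k = expR (V p) by rewrite /W -expRM_natl mulrA divff ?kn0 // mul1r.
rewrite (exprS (W p) k.+1) (exprS (W p) k) WV.
have -> : expR (V p) = - (uxx + uyy) by rewrite eq opprK.
rewrite -/(W p); move: (W p) kn0 => X kk; move: (k%:R : R) kk => K kk.
by field.
Qed.

Lemma mean_field_charts : mean_field_solution w1 w2 (4 * pi * k%:R) U.
Proof.
have [M [CM M0 eM]] := w_near0.
(* Only the zero of [w] at the origin is divided out; at the other lattice points [m] vanishes,
   which [regularized] allows. *)
pose m p := if p == 0 then M 0 else w p / N2 p.
have N0 p : p != 0 -> N2 p != 0.
  move=> p0; apply: contra p0; rewrite /N2 -!expr2 paddr_eq0 ?sqr_ge0 // !sqrf_eq0 => /andP[/eqP a /eqP b].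
  by apply/eqP; move: a b; case: (p) => x y /= -> ->.
have w00 : w 0 = 0 by rewrite /w asboolT //; exists 0, 0; rewrite !mulr0z addr0.
have wE p : w p = N2 p * m p.
  rewrite /m; case: eqVneq => [->|p0]; last by rewrite mulrC divfK // N0.
  by rewrite w00 /N2 /= mulr0 addr0 mul0r.
have mM : \forall q \near (0 : R * R), M q = m q.
  apply: filterS eM => q e; rewrite /m; case: eqVneq => [->//|q0].
  by rewrite e mulrC mulKf // N0.
have cm p : {for p, continuous m}.
  have [->|p0] := eqVneq p 0; first exact: continuous_near mM (Ck_cont CM).
  apply: (@continuous_near _ (fun q => w q * (N2 q)^-1)).
    have : {for p, continuous (@N2 R)} by exact: N2_cont.
    move=> /near_neq0/(_ (N0 _ p0)); apply: filterS => q q0; rewrite /m.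
    by case: eqVneq => [e|//]; move: q0; rewrite e /N2 /= mulr0 addr0 eqxx.
  by apply: (mulp_cont (Ck_cont (w_Ck p))); apply: inv_cont; [exact: N2_cont|exact: N0].
have w0 p : 0 <= w p by rewrite /w; case: ifP => // _; exact: expR_ge0.
have m00 : m 0 = M 0 by rewrite /m eqxx.
have m0 p : 0 <= m p.
  rewrite /m; case: eqVneq => [_|p0]; first exact: ltW.
  by rewrite divr_ge0 // N2_ge0.
have mpos p : ~ L (pt p) -> 0 < m p.
  move=> nL; have wp : 0 < w p by rewrite /w asboolF // expR_gt0.
  by rewrite lt_neqAle m0 andbT; apply/eqP => e; move: wp; rewrite wE -e mulr0 ltxx.
have lap0 : laplacian w 0 = 4 * m 0.
  have [gx [gy [a [b [c [d [G Gx Gy _ H]]]]]]] := w_gd0.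
  by rewrite (gd_lap G Gx Gy) (H M CM eM) m00.
have m0p : 0 < m 0 by rewrite m00.
have [i1 i2 i3] := regularized hw k0 wE cm m0 m0p mpos per_w w_Ck w_eqn lap0.
have uU : (fun p => k%:R * ln (w p)) = in_coords U.
  apply/funext => p; rewrite /in_coords -/(pt p) /w; case: asboolP => [Lp|nL].
    by rewrite ln0 // mulr0 U0.
  by rewrite expRK mulrA divff ?kn0 // mul1r.
have uUp p : k%:R * ln (w p) = in_coords U p by rewrite -uU.
rewrite uU in i1 i2; split; [exact: perU|exact: class_C_U|exact: i1|exact: i2|].
move=> h perh sm; have ph : pper w1 w2 (in_coords h).
  move=> n p; rewrite /in_coords -/(pt p) -(perh (pt p) (w1 *~ n.1 + w2 *~ n.2)); last by exists n.1, n.2.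
  by have := pt_sh (lv w1 w2 n) p; rewrite /lv pt_vec => <-.
apply: (eq_trans _ (i3 _ (sm 2) ph)).
by apply: eq_integral => p _; rewrite uUp.
Qed.

End WithCharts.

End Bridge.

(** * Existence for odd l *)

Section Existence.
Variable R : realType.
Local Notation C := R[i].
Implicit Types (z w a b c d : C) (x y : sphere R).

Definition mk22 a b c d : 'M[C]_2 :=
  \matrix_(i < 2, j < 2) if i == ord0 then (if j == ord0 then a else b) else (if j == ord0 then c else d).

Lemma conj_opp a : conjc (- a) = - conjc a.
Proof. by case: a. Qed.

Lemma conj_conj a : conjc (conjc a) = a.
Proof. by case: a => x y; rewrite /= opprK. Qed.

Lemma conj_1 : conjc (1 : C) = 1.
Proof. by apply/eqP; rewrite eq_complex /= oppr0 !eqxx. Qed.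

Lemma conj_0 : conjc (0 : C) = 0.
Proof. by apply/eqP; rewrite eq_complex /= oppr0 !eqxx. Qed.

Lemma SU2_mk22 a b : a * conjc a + b * conjc b = 1 -> SU2 (mk22 a b (- conjc b) (conjc a)).
Proof.
move=> h; split.
  apply/matrixP => i j; rewrite !mxE !big_ord_recl big_ord0 !mxE /=.
  case: i => [[|[|//]] hi]; case: j => [[|[|//]] hj] /=; rewrite ?conj_opp ?conj_conj ?addr0.
  - exact: h.
  - by ring.
  - by ring.
  - by rewrite -h; ring.
rewrite (expand_det_row _ ord0) !big_ord_recl big_ord0 /cofactor !det_mx11 !mxE /=.
by rewrite -[(0 + 0)%N]/0%N -[(0 + bump 0 0)%N]/1%N expr0 expr1; apply: (eq_trans _ h); ring.
Qed.

(** The Klein group of the transformations [x], [- x], [1 / x] and [- 1 / x], indexed by pairs of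
    Booleans under addition modulo 2. *)
Definition tau (e1 e2 : bool) x : sphere R :=
  let y := if e2 then sphere_inv x else x in if e1 then omap -%R y else y.

Lemma ex_i : exists I : C, [/\ I != 0, I * I = -1 & conjc I = - I].
Proof.
exists (0 +i* 1); split; apply/eqP; rewrite ?eq_complex /= ?oppr0 ?eqxx //.
  by move=> /eqP; rewrite eq_complex /= oner_eq0 andbF.
by rewrite !mul0r !mulr0 mulr1 addr0 sub0r !eqxx.
Qed.

(** Determinant 1 brings in the imaginary unit [I]: the sign change comes from the diagonal matrix
    with entries [I] and [- I], the inversion from the antidiagonal one with both entries [I]. *)
Lemma tau_PSU2 e1 e2 : PSU2 (tau e1 e2).
Proof.
have [I [i0 ii ci]] := ex_i.
have mE (p q r s : C) x : mobius (mk22 p q r s) x = match x with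
   | None => if r == 0 then None else Some (p / r)
   | Some y => if r * y + s == 0 then None else Some ((p * y + q) / (r * y + s)) end.
  by rewrite /mobius !mxE.
case: e1; case: e2.
- exists (mk22 0 (- 1) (- conjc (- 1)) (conjc 0)).
    by apply: SU2_mk22; rewrite conj_opp conj_1 mulrNN mul0r mulr1 add0r.
  apply/funext => x; rewrite mE conj_opp conj_1 opprK conj_0; case: x => [x|]; rewrite /tau /=.
    by rewrite mul1r addr0; have [//|x0] := eqVneq x 0; rewrite mul0r add0r mulN1r.
  by rewrite oner_eq0 mul0r oppr0.
- exists (mk22 I 0 (- conjc 0) (conjc I)).
    by apply: SU2_mk22; rewrite ci conj_0 mulrN ii mul0r opprK addr0.
  apply/funext => x; rewrite mE conj_0 oppr0 ci; case: x => [x|]; rewrite /tau /= ?eqxx //.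
  rewrite mul0r add0r oppr_eq0 (negbTE i0) addr0.
  by congr Some; field.
- exists (mk22 0 I (- conjc I) (conjc 0)).
    by apply: SU2_mk22; rewrite ci conj_0 mulrN ii mul0r opprK add0r.
  apply/funext => x; rewrite mE conj_0 ci opprK; case: x => [x|]; rewrite /tau /=; last by rewrite (negbTE i0) mul0r.
  rewrite addr0 mulf_eq0 (negbTE i0) /=; have [//|x0] := eqVneq x 0.
  by congr Some; rewrite mul0r add0r invfM mulrA mulfV // mul1r.
- exists (mk22 1 0 (- conjc 0) (conjc 1)).
    by apply: SU2_mk22; rewrite conj_1 conj_0 mul0r mulr1 addr0.
  apply/funext => x; rewrite mE conj_0 oppr0 conj_1; case: x => [x|]; rewrite /tau /= ?eqxx //.
  by rewrite mul0r add0r oner_eq0 mul1r addr0 divr1.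
Qed.

Lemma sphere_invN x : sphere_inv (omap -%R x) = omap -%R (sphere_inv x).
Proof.
case: x => [a|] /=; last by rewrite oppr0.
by rewrite oppr_eq0; case: eqVneq => //= _; rewrite invrN.
Qed.

Lemma omapNK x : omap -%R (omap -%R x) = x.
Proof. by case: x => //= a; rewrite opprK. Qed.

Lemma tauD e1 e2 e1' e2' : tau (e1 (+) e1') (e2 (+) e2') = tau e1 e2 \o tau e1' e2'.
Proof.
apply/funext => x; case: e1; case: e2; case: e1'; case: e2';
  by rewrite /tau /= ?sphere_invN ?omapNK ?sphere_invK.
Qed.

(** Evaluation at 2 separates the four maps: the nontrivial ones give [- 2], [1 / 2] and
    [- 1 / 2]. *)
Lemma tau_id e1 e2 : tau e1 e2 = id -> e1 = false /\ e2 = false.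
Proof.
move=> h; have := congr1 (fun k => k (Some (2 : C))) h; rewrite /tau /=.
have n2 : (2 : C) != 0 by rewrite pnatr_eq0.
have n5 : (5 : C) != 0 by rewrite pnatr_eq0.
have n3 : (3 : C) != 0 by rewrite pnatr_eq0.
have n4 : (4 : C) != 0 by rewrite pnatr_eq0.
rewrite (negbTE n2); case: e1 {h}; case: e2 => // H; exfalso.
- have e : - (2^-1 : C) = 2 := congr1 (odflt 0) H.
  have q : (5 : C) = 2 * 2 + 1 by ring.
  by move: n5; rewrite q -{1}e mulNr mulVf // addNr eqxx.
- have e : - (2 : C) = 2 := congr1 (odflt 0) H.
  have q : (4 : C) = 2 + 2 by ring.
  by move: n4; rewrite q -{1}e addNr eqxx.
- have e : (2^-1 : C) = 2 := congr1 (odflt 0) H.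
  have q : (3 : C) = 2 * 2 - 1 by ring.
  by move: n3; rewrite q -{1}e mulVf // subrr eqxx.
Qed.

Lemma tau_inj e1 e2 e1' e2' : tau e1 e2 = tau e1' e2' -> e1 = e1' /\ e2 = e2'.
Proof.
move=> h; have [] := @tau_id (e1 (+) e1') (e2 (+) e2').
  by rewrite tauD h -tauD !addbb.
by case: e1 {h}; case: e1'; case: e2; case: e2'.
Qed.

Lemma involution_mulz (f : C -> sphere R) (s : sphere R -> sphere R) w :
  (forall x, s (s x) = x) -> (forall z, f (z + w) = s (f z)) ->
  forall (m : int) z, f (z + w *~ m) = if odd `|m|%N then s (f z) else f z.
Proof.
move=> ss H m z; have Hn (n : nat) (y : C) : f (y + w *+ n) = if odd n then s (f y) else f y.
  elim: n => [|n IH]; first by rewrite mulr0n addr0.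
  by rewrite mulrS [w + _]addrC addrA H IH /=; case: (odd n) => //=; rewrite ss.
case: m => n; first by rewrite -pmulrn Hn.
have -> : w *~ Negz n = - (w *+ n.+1) by rewrite NegzE mulrNz -pmulrn.
rewrite -[`|Negz n|%N]/(n.+1).
have := Hn n.+1 (z - w *+ n.+1); rewrite subrK => ->.
by case: (odd n.+1); rewrite ?ss.
Qed.

Lemma has_order_shift (h : C -> C) z a n : has_order h (z + a) n -> has_order (fun w => h (w + a)) z n.
Proof.
move=> [q [hq q0 e]]; exists (fun w => q (w + a)); split=> //; first exact: hol_shift.
by apply: nearc_imp (nearc_shift e) => w ->; congr (_ ^+ _ * _); ring.
Qed.

Lemma has_order_opp (h : C -> C) z n : has_order h z n -> has_order (fun w => - h w) z n.
Proof.
move=> [q [hq q0 e]]; exists (fun w => - q w); split.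
- by apply: nearc_imp hq => w; exact: holN.
- by rewrite oppr_eq0.
- by apply: nearc_imp e => w ->; rewrite mulrN.
Qed.

Definition good_chart (f : C -> sphere R) z := exists phi n, chart f z phi /\ has_order (dC phi) z n.

Lemma good_shift f z a : good_chart f (z + a) -> good_chart (fun w => f (w + a)) z.
Proof.
move=> [phi [n [c o]]]; exists (fun w => phi (w + a)), n; split; first exact: chart_shift.
apply: (@has_order_near _ (fun w => dC phi (w + a))); last exact: has_order_shift.
by apply: nearcT => w; rewrite dC_shift.
Qed.

Lemma good_opp f z : good_chart f z -> good_chart (fun w => omap -%R (f w)) z.
Proof.
move=> [phi [n [c o]]]; exists (fun w => - phi w), n; split; first exact: chart_opp.
apply: (@has_order_near _ (fun w => - dC phi w)); last exact: has_order_opp.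
by apply: nearc_imp (proj1 c) => w hw; exact: (dC_eq (cderivN (dCP hw))).
Qed.

Lemma good_inv f z : good_chart f z -> good_chart (fun w => sphere_inv (f w)) z.
Proof. by move=> [phi [n [c o]]]; exists phi, n; split=> //; exact: chart_inv. Qed.

Variables (w1 w2 : C).
Hypothesis hw : 0 < Im (w2 / w1).
Local Notation L := (lattice w1 w2).

Section Dev.
Variables (f : C -> sphere R) (k : nat).
Hypothesis k0 : (0 < k)%N.
Hypothesis f1 : forall z, f (z + w1) = omap -%R (f z).
Hypothesis f2 : forall z, f (z + w2) = sphere_inv (f z).
Hypothesis off : forall z, ~ L z -> exists phi, chart f z phi /\ has_order (dC phi) z 0.
Hypothesis at0 : exists phi, chart f 0 phi /\ has_order (dC phi) 0 k.

Lemma good_per : lattice_periodic w1 w2 (good_chart f).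
Proof.
have e1 : (fun w => omap -%R (f (w + w1))) = f by apply/funext => w; rewrite f1 omapNK.
have e2 : (fun w => sphere_inv (f (w + w2))) = f by apply/funext => w; rewrite f2 sphere_invK.
have e1' : (fun w => omap -%R (f (w - w1))) = f by apply/funext => w; rewrite -f1 subrK.
have e2' : (fun w => sphere_inv (f (w - w2))) = f by apply/funext => w; rewrite -f2 subrK.
apply: lattice_per => z; apply/propext; split => H.
- by have := good_opp (good_shift H); rewrite e1.
- have H' : good_chart f (z + w1 - w1) by rewrite addrK.
  by have := good_opp (good_shift H'); rewrite e1'.
- by have := good_inv (good_shift H); rewrite e2.
- have H' : good_chart f (z + w2 - w2) by rewrite addrK.
  by have := good_inv (good_shift H'); rewrite e2'.
Qed.

Lemma good_all z : good_chart f z.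
Proof.
have [Lz|nL] := pselect (L z); last by have [phi [c o]] := off nL; exists phi, 0%N.
have := good_per 0 Lz; rewrite add0r => ->.
by have [phi [c o]] := at0; exists phi, k.
Qed.

Lemma density_per : lattice_periodic w1 w2 (spherical_density f).
Proof.
apply: lattice_per => z.
  have [phi [n [c _]]] := good_all (z + w1); have [psi [n' [c' _]]] := good_all z.
  by rewrite -(density_shift c) -(density_opp c'); congr spherical_density; apply/funext => w; rewrite f1.
have [phi [n [c _]]] := good_all (z + w2); have [psi [n' [c' _]]] := good_all z.
by rewrite -(density_shift c) -(density_sphere_inv c'); congr spherical_density; apply/funext => w; rewrite f2.
Qed.

Let U z : R := if `[< L z >] then 0 else ln (spherical_density f z).

Lemma U_sol : mean_field_solution w1 w2 (4 * pi * k%:R) U.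
Proof.
apply: (mean_field_charts hw k0 off at0).
- move=> z w Lw; rewrite /U density_per //; congr (if _ then _ else _).
  apply/asboolP/asboolP => [[a [b e]]|[a [b ->]]]; move: Lw => [a' [b' e']].
    by exists (a - a'), (b - b'); rewrite !mulrzBr addrACA -opprD -e -e' addrK.
  by exists (a + a'), (b + b'); rewrite !mulrzDr addrACA e'.
- by move=> z nL; rewrite /U asboolF.
- by move=> z Lz; rewrite /U asboolT.
Qed.

Lemma U_dev : developing_map w1 w2 U f.
Proof.
split; first by apply: chart_mer; exact: good_all.
move=> z nL; rewrite /U asboolF //; split=> //.
have [phi [c o]] := off nL; rewrite (nearc_self (chart_density c)); apply: dens_gt0.
exact: has_order0_nz o.
Qed.

(** The monodromy has to be given on all of the plane. On the lattice the coordinates are integers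
    and [Num.floor] returns them; other points do not matter. *)
Let par1 w := odd `|Num.floor (cs w1 w2 (vec w))|%N.
Let par2 w := odd `|Num.floor (ct w1 w2 (vec w))|%N.

Lemma par_lattice (m n : int) : par1 (w1 *~ m + w2 *~ n) = odd `|m|%N /\ par2 (w1 *~ m + w2 *~ n) = odd `|n|%N.
Proof. by have [e1 e2] := coords_lv hw (m, n); rewrite /par1 /par2 -/(lv w1 w2 (m, n)) e1 e2 !intrKfloor. Qed.

Lemma f_mono (m n : int) z : f (z + (w1 *~ m + w2 *~ n)) = tau (odd `|m|%N) (odd `|n|%N) (f z).
Proof.
have -> : z + (w1 *~ m + w2 *~ n) = z + w2 *~ n + w1 *~ m by rewrite addrCA addrC.
by rewrite (involution_mulz omapNK f1) (involution_mulz (@sphere_invK R) f2).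
Qed.

Lemma U_type_I : type_I w1 w2 U.
Proof.
exists f, (fun w => tau (par1 w) (par2 w)); split; first exact: U_dev.
  move=> w [m [n ->]]; have [-> ->] := par_lattice m n; split; first exact: tau_PSU2.
  by move=> z; exact: f_mono.
have z2 (a b : 'Z_2) : (a + b == 1) = (a == 1) (+) (b == 1).
  by case: a => [[|[|//]] ha]; case: b => [[|[|//]] hb].
have z2i (a b : 'Z_2) : (a == 1) = (b == 1) -> a = b.
  by case: a => [[|[|//]] ha]; case: b => [[|[|//]] hb] // _; exact: val_inj.
exists (fun x : 'Z_2 * 'Z_2 => tau (x.1 == 1) (x.2 == 1)); split.
- by move=> [a b] [a' b'] /tau_inj[/= /z2i -> /z2i ->].
- by move=> a b; rewrite /= !z2 tauD.
- apply/seteqP; split=> [_ [[a b] _ <-]|_ [w [m [n ->]] <-]] /=.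
    exists (w1 *~ (a == 1) + w2 *~ (b == 1)); first by exists (a == 1), (b == 1).
    by have [-> ->] := par_lattice (a == 1) (b == 1); case: (a == 1); case: (b == 1).
  have [-> ->] := par_lattice m n.
  exists ((odd `|m|%N)%:R, (odd `|n|%N)%:R) => //=.
  by case: (odd _); case: (odd _).
Qed.

End Dev.

Theorem odd_type_I l : odd l -> exists u : C -> R,
  mean_field_solution w1 w2 (4 * pi * l%:R) u /\ type_I w1 w2 u.
Proof.
move=> ol; have -> : l = (l./2).*2.+1 by rewrite -[LHS]odd_double_half ol.
have [g [c0 [kap [p J]]]] := jacobi_exists hw.
have [gam hgam] := lame_root l./2 kap.
have f1 := dev_map_w1 J hgam; have f2 := dev_map_w2 J hw hgam.
have off z nL := dev_chart_off J hw hgam (z := z) nL; have at0 := dev_chart0 J hgam.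
eexists; split; [exact: (U_sol (ltn0Sn _) f1 f2 off at0)|exact: (U_type_I f1 f2 off at0)].
Qed.

End Existence.

(** * Square roots of the derivative *)

Section SquareRoots.
Variable R : realType.
Local Notation C := R[i].
Implicit Types (z w a : C) (f g h s : C -> C).

(** The branch with nonnegative real part, which is continuous on the right half plane. *)
Definition csqrt a : C := if 0 <= Re (sqrtc a) then sqrtc a else - sqrtc a.

Lemma csqrt2 a : csqrt a * csqrt a = a.
Proof. by rewrite /csqrt; case: ifP => _; rewrite ?mulrNN -expr2 sqr_sqrtc. Qed.

Lemma csqrt_Re a : 0 < Re a -> 0 < Re (csqrt a).
Proof.
move=> a0; have e : Re a = Re (csqrt a) ^+ 2 - Im (csqrt a) ^+ 2.
  by rewrite -{1}(csqrt2 a); case: (csqrt a) => x y /=; rewrite !expr2.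
have n0 : Re (csqrt a) != 0.
  apply/eqP => r0; move: a0; rewrite e r0 expr0n /= sub0r oppr_gt0 ltNge sqr_ge0 //.
rewrite lt_neqAle eq_sym n0 /= /csqrt; case: ifPn => //.
by rewrite -ltNge => h; case: (sqrtc a) h => x y /=; rewrite oppr_ge0 => /ltW.
Qed.

Lemma csqrt_cont h z : cont_at h z -> nearc z (fun w => 0 < Re (h w)) -> cont_at (fun w => csqrt (h w)) z.
Proof.
move=> ch hp e e0; have r0 := csqrt_Re (nearc_self hp).
have := nearc_and hp (ch _ (mulr_gt0 e0 r0)); apply: nearc_imp => w [hw lt].
have r1 := csqrt_Re hw.
have E : (csqrt (h w) - csqrt (h z)) * (csqrt (h w) + csqrt (h z)) = h w - h z.
  by rewrite -[RHS](f_equal2 (fun x y => x - y) (csqrt2 (h w)) (csqrt2 (h z))); ring.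
have N : Re (csqrt (h z)) <= normc (csqrt (h w) + csqrt (h z)).
  apply: (le_trans _ (le_trans (ler_norm _) (normc_Re _))).
  by case: (csqrt (h w)) r1 => x y; case: (csqrt (h z)) => x' y' /= r1; rewrite lerDr ltW.
rewrite -(ltr_pM2r r0); apply: le_lt_trans lt; rewrite -E normcM.
by apply: ler_wpM2l => //; exact: normc_ge0.
Qed.

Lemma csqrt_hol h z : nearc z (hol h) -> nearc z (fun w => 0 < Re (h w)) -> hol (fun w => csqrt (h w)) z.
Proof.
move=> hh hp; have [G [hG _ EG]] := hol_factor hh.
have cs := csqrt_cont (hol_cont (nearc_self hh)) hp.
have r0 := csqrt_Re (nearc_self hp).
have nz w : 0 < Re (h w) -> csqrt (h w) + csqrt (h z) != 0.
  move=> /csqrt_Re; move: r0; case: (csqrt (h w)) => x y; case: (csqrt (h z)) => x' y' /= x'0 x0.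
  by apply/eqP => -[e _]; have := addr_gt0 x0 x'0; rewrite e ltxx.
exists (G z * (csqrt (h z) + csqrt (h z))^-1).
apply: (@cderiv_slope _ _ _ _ (fun w => G w * (csqrt (h w) + csqrt (h z))^-1)) => //.
  apply: contM; first exact: hol_cont (nearc_self hG).
  apply: contV; first exact: nz (nearc_self hp).
  by apply: contD => //; exact: cont_cst.
apply: nearc_imp hp => w hw; have n := nz w hw.
have K : (w - z) * G w = (csqrt (h w) - csqrt (h z)) * (csqrt (h w) + csqrt (h z)).
  have -> : (csqrt (h w) - csqrt (h z)) * (csqrt (h w) + csqrt (h z)) =
     csqrt (h w) * csqrt (h w) - csqrt (h z) * csqrt (h z) by ring.
  by rewrite !csqrt2 (EG w) addrAC subrr add0r.
by rewrite mulrA K mulfK // addrC subrK.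
Qed.

(** Division by [h z] brings the values close to 1, into the half plane where [csqrt] is
    holomorphic. *)
Lemma hol_sqrt h z : nearc z (hol h) -> h z != 0 -> exists s, nearc z (hol s) /\ nearc z (fun w => s w ^+ 2 = h w).
Proof.
move=> hh h0; pose k w := h w * (h z)^-1.
have hk : nearc z (hol k) by apply: nearc_imp hh => w hw; apply: holM => //; exact: hol_cst.
have kz : k z = 1 by rewrite /k divff.
have kp : nearc z (fun w => 0 < Re (k w)).
  have := hol_cont (nearc_self hk) ltr01; apply: nearc_imp => w lt.
  have := le_lt_trans (normc_Re _) lt; rewrite kz ReB /= ltr_norml => /andP[a _]; lra.
exists (fun w => sqrtc (h z) * csqrt (k w)); split.
  apply: nearc_imp (nearc_and (nearc_nearc hk) (nearc_nearc kp)) => w [a b].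
  by apply: holM; [exact: hol_cst|exact: csqrt_hol].
by apply: nearcT => w; rewrite exprMn sqr_sqrtc expr2 csqrt2 /k mulrC divfK.
Qed.

Definition root_at g s z := mer_at s z /\ dnearc z (fun w => s w ^+ 2 = g w).

Lemma root_near g s z : root_at g s z -> nearc z (root_at g s).
Proof.
move=> [m e]; have := nearc_and (dnearc_open (mer_hol_punct m)) (dnearc_open e); apply: nearc_imp => w [h1 h2].
have [->|wz] := eqVneq w z; first by split.
by split; [apply: mer_hol; exact: h1|apply: nearc_dnearc; exact: h2].
Qed.

Lemma root_eq g s s' z : dnearc z (fun w => s w = s' w) -> root_at g s z -> root_at g s' z.
Proof.
move=> E [m e]; split; first exact: mer_near E m.
by apply: dnearc_imp (dnearc_and E e) => w [<-].
Qed.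

Lemma root_sign g s (eps : C) z : eps ^+ 2 = 1 -> root_at g s z -> root_at g (fun w => eps * s w) z.
Proof.
move=> e1 [m e]; split; first by apply: merM => //; exact: mer_cst.
by apply: dnearc_imp e => w <-; rewrite exprMn e1 mul1r.
Qed.

Lemma root_pm g s s' z : root_at g s z -> root_at g s' z -> exists2 eps : C, eps ^+ 2 = 1 &
  dnearc z (fun w => s w - eps * s' w = 0).
Proof.
move=> [m e] [m' e']; case: (mer_zero (merB m m')) => H.
  by exists 1; rewrite ?expr1n //; apply: dnearc_imp H => w; rewrite mul1r.
exists (- 1); first by rewrite sqrrN expr1n.
apply: dnearc_imp (dnearc_and H (dnearc_and e e')) => w [n [h1 h2]].
have : (s w - s' w) * (s w + s' w) = 0 by rewrite -subr_sqr h1 h2 subrr.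
by move=> /eqP; rewrite mulf_eq0 (negbTE n) /= => /eqP; rewrite mulN1r opprK.
Qed.

(** The rectangle is the common edge of two regions and [lf] the signed distance to its line. The
    two roots differ by a sign near [z0], and by the identity theorem by the same sign along the
    edge; this sign corrects the root on the positive side. *)
Lemma glue g (A B D : C -> Prop) (lf : C -> R) (a b c d : R) z0 : a <= b -> c <= d -> in_rect a b c d z0 ->
  (forall z, cont_at (fun w => (lf w)%:C) z) ->
  (forall z, in_rect a b c d z -> A z /\ B z) ->
  (forall z, D z -> lf z < 0 -> A z) -> (forall z, D z -> 0 < lf z -> B z) ->
  (forall z, D z -> lf z = 0 -> in_rect a b c d z) ->
  (exists s, forall z, A z -> root_at g s z) -> (exists s, forall z, B z -> root_at g s z) ->
  exists s, forall z, D z -> root_at g s z.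
Proof.
move=> ab cd z0r clf AB Dn Dp D0 [s HA] [s' HB].
have [A0 B0] := AB z0 z0r.
have [eps e1 E] := root_pm (HA _ A0) (HB _ B0).
have I : forall z, in_rect a b c d z -> dnearc z (fun w => s w - eps * s' w = 0).
  apply: (identity_rect ab cd _ z0r E) => z /AB[Az Bz].
  by apply: merB; [exact: (HA _ Az).1|exact: (root_sign e1 (HB _ Bz)).1].
have lfn z : lf z != 0 -> nearc z (fun w => normc ((lf w)%:C - (lf z)%:C) < `|lf z|).
  by move=> n; apply: clf; rewrite normr_gt0.
exists (fun w => if lf w <= 0 then s w else eps * s' w) => z Dz.
have [l0|l0|l0] := ltgtP (lf z) 0.
- apply: (root_eq (s := s)); last exact: HA (Dn _ Dz l0).
  apply: nearc_dnearc; apply: nearc_imp (lfn z (ltr0_neq0 l0)) => w.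
  rewrite -rmorphB normcR (ltr0_norm l0) ltr_norml => /andP[_ h].
  by have -> : lf w <= 0 by lra.
- apply: (root_eq (s := fun w => eps * s' w)); last exact: root_sign (HB _ (Dp _ Dz l0)).
  apply: nearc_dnearc; apply: nearc_imp (lfn z (lt0r_neq0 l0)) => w.
  rewrite -rmorphB normcR (gtr0_norm l0) ltr_norml => /andP[h _].
  by have -> : lf w <= 0 = false by apply/negbTE; rewrite -ltNge; lra.
- have zr := D0 _ Dz l0; apply: (root_eq (s := s)); last exact: HA (AB _ zr).1.
  apply: dnearc_imp (I _ zr) => w /eqP; rewrite subr_eq0 => /eqP e.
  by case: ifP.
Qed.

Lemma cont_ReIm z : cont_at (fun w => (Re w)%:C) z /\ cont_at (fun w => (Im w)%:C) z.
Proof.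
split=> e e0; exists e => // w wD; rewrite -rmorphB normcR -?ReB -?ImB.
  exact: le_lt_trans (normc_Re _) wD.
exact: le_lt_trans (normc_Im _) wD.
Qed.

(** The monodromy theorem for a rectangle: roots on adjacent halves are glued along their common
    side, and [bisection] starts from local roots. *)
Lemma rect_root g (r : R) : 0 <= r -> (forall z, exists s, root_at g s z) ->
  exists s, forall z, in_rect (- r) r (- r) r z -> root_at g s z.
Proof.
move=> r0 loc; have rr : - r <= r by lra.
pose P (a b c d : R) := exists s, forall z, in_rect a b c d z -> root_at g s z.
have hm (a m b c d : R) : a <= m -> m <= b -> c <= d -> P a m c d -> P m b c d -> P a b c d.
  move=> am mb cd; apply: (@glue g _ _ _ (fun w => Re w - m) m m c d (m +i* c)) => //.
  - by split; rewrite /= !lexx.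
  - by move=> z; under eq_fun do rewrite rmorphB; apply: contB; [case: (cont_ReIm z)|exact: cont_cst].
  - by move=> z [/andP[h1 h2] h3]; split; split=> //; apply/andP; split; lra.
  - by move=> z [/andP[h1 h2] h3] h4; split=> //; apply/andP; split; lra.
  - by move=> z [/andP[h1 h2] h3] h4; split=> //; apply/andP; split; lra.
  - by move=> z [/andP[h1 h2] h3] h4; split=> //; apply/andP; split; lra.
have vm (a b c n d : R) : a <= b -> c <= n -> n <= d -> P a b c n -> P a b n d -> P a b c d.
  move=> ab cn nd; apply: (@glue g _ _ _ (fun w => Im w - n) a b n n (a +i* n)) => //.
  - by split; rewrite /= !lexx.
  - by move=> z; under eq_fun do rewrite rmorphB; apply: contB; [case: (cont_ReIm z)|exact: cont_cst].
  - by move=> z [h3 /andP[h1 h2]]; split; split=> //; apply/andP; split; lra.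
  - by move=> z [h3 /andP[h1 h2]] h4; split=> //; apply/andP; split; lra.
  - by move=> z [h3 /andP[h1 h2]] h4; split=> //; apply/andP; split; lra.
  - by move=> z [h3 /andP[h1 h2]] h4; split=> //; apply/andP; split; lra.
apply: (@bisection R P) => //.
- move=> a b c d ab cd p1 p2 p3 p4.
  have h1 : a <= (a + b) / 2 by lra.
  have h2 : (a + b) / 2 <= b by lra.
  have h3 : c <= (c + d) / 2 by lra.
  have h4 : (c + d) / 2 <= d by lra.
  by apply: (vm a b c ((c + d) / 2) d) => //; [apply: (hm a ((a + b) / 2) b)|apply: (hm a ((a + b) / 2) b)].
- move=> x y hx hy; have [s Hs] := loc (x +i* y); have [D D0 H] := root_near Hs.
  exists (D / 2); first by rewrite divr_gt0.
  move=> a b c d _ ax xb _ _ cy yd _ b1 d1; exists s => z [/andP[z1 z2] /andP[z3 z4]]; apply: H.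
  apply: le_lt_trans (normc_ReIm _) _; rewrite ReB ImB /=.
  have e1 : `|Re z - x| < D / 2 by rewrite ltr_norml; apply/andP; split; lra.
  have e2 : `|Im z - y| < D / 2 by rewrite ltr_norml; apply/andP; split; lra.
  by lra.
Qed.

End SquareRoots.

(** * Lifting the monodromy *)

Section Mobius.
Variable R : realType.
Local Notation C := R[i].
Implicit Types (a b c d t : C) (x : sphere R).

Definition mob a b c d x : sphere R :=
  match x with
  | None => if c == 0 then None else Some (a / c)
  | Some x => if c * x + d == 0 then None else Some ((a * x + b) / (c * x + d))
  end.

Lemma det22 (M : 'M[C]_2) : \det M = M ord0 ord0 * M ord_max ord_max - M ord0 ord_max * M ord_max ord0.
Proof.
rewrite (expand_det_row _ ord0) !big_ord_recl big_ord0 /cofactor !det_mx11 !mxE /=.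
rewrite -[(0 + 0)%N]/0%N -[(0 + bump 0 0)%N]/1%N expr0 expr1.
have -> : lift ord0 ord0 = ord_max :> 'I_2 by exact: val_inj.
have -> : lift ord_max ord0 = ord0 :> 'I_2 by exact: val_inj.
by ring.
Qed.

Lemma mob_scale t a b c d : t != 0 -> mob (t * a) (t * b) (t * c) (t * d) = mob a b c d.
Proof.
move=> t0; apply/funext => -[x|] /=.
  have -> : t * c * x + t * d = t * (c * x + d) by ring.
  rewrite mulf_eq0 (negbTE t0) /=; case: eqVneq => // n.
  by congr Some; field; rewrite n t0.
rewrite mulf_eq0 (negbTE t0) /=; case: eqVneq => // n.
by congr Some; field; rewrite n t0.
Qed.

Lemma mob_cross a b c d a' b' c' d' (z : C) : mob a b c d (Some z) = mob a' b' c' d' (Some z) ->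
  (a * z + b) * (c' * z + d') = (a' * z + b') * (c * z + d).
Proof.
rewrite /mob; case: eqVneq => [->|n]; case: eqVneq => [->|n'] //; first by rewrite !mulr0.
move=> H; have E : (a * z + b) / (c * z + d) = (a' * z + b') / (c' * z + d') := congr1 (odflt 0) H.
by rewrite -[a * z + b](divfK n) E mulrAC divfK.
Qed.

(** The two expressions for [t] are the diagonal entries of the inverse of the second matrix times
    the first. The hypotheses make this product scalar, so the matrices are proportional. *)
Lemma mob_eq_coef a b c d a' b' c' d' : a * d - b * c = 1 -> a' * d' - b' * c' = 1 ->
  a * c' = a' * c -> b * d' = b' * d -> a * d' + b * c' = a' * d + b' * c ->
  mob a b c d = mob a' b' c' d'.
Proof.
move=> D D' e1 e2 e3; pose t := d' * a - b' * c.
have t' : t = a' * d - c' * b.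
  apply/eqP; rewrite -subr_eq0 /t.
  have -> : d' * a - b' * c - (a' * d - c' * b) = a * d' + b * c' - (a' * d + b' * c) by ring.
  by rewrite e3 subrr.
have ea : a = t * a'.
  have -> : t * a' = a * (a' * d' - b' * c') + b' * (a * c' - a' * c) by rewrite /t; ring.
  by rewrite D' e1 subrr mulr0 mulr1 addr0.
have ec : c = t * c'.
  have -> : t * c' = c * (a' * d' - b' * c') + d' * (a * c' - a' * c) by rewrite /t; ring.
  by rewrite D' e1 subrr mulr0 mulr1 addr0.
have eb : b = t * b'.
  have -> : t * b' = b * (a' * d' - b' * c') - a' * (b * d' - b' * d) by rewrite t'; ring.
  by rewrite D' e2 subrr mulr0 mulr1 subr0.
have ed : d = t * d'.
  have -> : t * d' = d * (a' * d' - b' * c') - c' * (b * d' - b' * d) by rewrite t'; ring.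
  by rewrite D' e2 subrr mulr0 mulr1 subr0.
rewrite ea eb ec ed mob_scale //.
apply/eqP => t0; move: D; rewrite ea ec t0 !mul0r mulr0 subr0 => /eqP.
by rewrite eq_sym oner_eq0.
Qed.

(* Two commuting matrices of determinant 1 and trace 0 agree up to sign. *)
Lemma traceless_commute a b c a' b' c' : a * (- a) - b * c = 1 -> a' * (- a') - b' * c' = 1 ->
  b * c' = b' * c -> a * b' = a' * b -> a * c' = a' * c -> mob a b c (- a) = mob a' b' c' (- a').
Proof.
move=> D D' e1 e2 e3; apply: mob_eq_coef => //; first by rewrite !mulrN mulrC -e2; ring.
by rewrite e1 !mulrN (mulrC a a').
Qed.

End Mobius.

(** * Square roots of the derivative under translation *)

Section Monodromy.
Variable R : realType.
Local Notation C := R[i].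
Variables w1 w2 : C.
Hypothesis hw : 0 < Im (w2 / w1).
Local Notation L := (lattice w1 w2).
Variables (f : C -> sphere R) (k : nat).
Hypothesis off : forall z, ~ L z -> exists phi, chart f z phi /\ has_order (dC phi) z 0.
Hypothesis at0 : exists phi, chart f 0 phi /\ has_order (dC phi) 0 k.
Hypothesis good : forall z, good_chart f z.
Implicit Types (z w a b c d : C).

Let F : C -> C := affine_part f.

(** The derivative of the affine part differs from that of the chart by a square: [q] is 1 where
    [f = phi], and [I / phi] with [I ^+ 2 = -1] where [f = 1 / phi]. Poles of [f] thus never
    obstruct a square root. *)
Lemma chart_affine z phi n : chart f z phi -> has_order (dC phi) z n ->
  dnearc z (fun w => f w = Some (F w)) /\
  exists q, [/\ mer_at q z, dnearc z (fun w => q w != 0), mer_at F z & dnearc z (fun w => dC F w = q w ^+ 2 * dC phi w)].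
Proof.
move=> [hphi E] o; have nz := has_order_dC_nz hphi o.
case: E => E.
  have E' : nearc z (fun w => phi w = F w) by apply: nearc_imp E => w e; rewrite /F /affine_part e.
  split; first by apply: nearc_dnearc; apply: nearc_imp E => w e; rewrite /F /affine_part e.
  exists (fun=> 1); split; [exact: mer_cst|by apply: nearcT => w _; rewrite oner_eq0| |].
    by apply: mer_hol; apply: nearc_imp (nearc_and hphi (nearc_nearc E')) => w [h1 h2]; exact: hol_near h2 h1.
  by apply: nearc_dnearc; apply: nearc_imp (dC_near E') => w ->; rewrite expr1n mul1r.
have E' : dnearc z (fun w => f w = Some ((phi w)^-1)).
  by apply: dnearc_imp (dnearc_and (nearc_dnearc E) nz) => w [-> m] /=; rewrite (negbTE m).
have E2 : dnearc z (fun w => (phi w)^-1 = F w).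
  by apply: dnearc_imp E' => w e; rewrite /F /affine_part e.
have mphi := mer_hol hphi.
have [I [i0 ii _]] := ex_i R.
split; first by apply: dnearc_imp E' => w e; rewrite /F /affine_part e.
exists (fun w => I * (phi w)^-1); split.
- by apply: merM; [exact: mer_cst|exact: merV].
- by apply: dnearc_imp nz => w m; rewrite mulf_neq0 // invr_eq0.
- exact: mer_near E2 (merV mphi).
- apply: dnearc_imp (dnearc_and (dnearc_open E2) (dnearc_and nz (nearc_dnearc hphi))) => w [e [m hw']].
  rewrite (dC_eq (cderiv_near e (cderivV m (dCP hw')))) exprMn (expr2 I) ii.
  by move: (dC phi w) (phi w) m => u v v0; field.
Qed.

Lemma F_mer z : mer_at F z.
Proof. by have [phi [n [c o]]] := good z; have [_ [q [_ _ m _]]] := chart_affine c o. Qed.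

Lemma f_F z : dnearc z (fun w => f w = Some (F w)).
Proof. by have [phi [n [c o]]] := good z; have [] := chart_affine c o. Qed.

Lemma F_hol z : dnearc z (hol F).
Proof. exact: mer_hol_punct (F_mer z). Qed.

Lemma dF_nz z : dnearc z (fun w => dC F w != 0).
Proof.
have [phi [n [c o]]] := good z; have [_ [q [_ nq _ e]]] := chart_affine c o.
apply: dnearc_imp (dnearc_and (dnearc_and nq e) (has_order_nz o)) => w [[h1 ->] h2].
by rewrite mulf_neq0 // expf_neq0.
Qed.

Lemma even_root z phi n : ~~ odd n -> chart f z phi -> has_order (dC phi) z n -> exists s, root_at (dC F) s z.
Proof.
move=> ev c o; have [_ [q [mq nq _ e]]] := chart_affine c o.
have [h [hh h0 eh]] := o; have [r [hr er]] := hol_sqrt hh h0.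
exists (fun w => q w * ((w - z) ^+ n./2 * r w)); split.
  apply: merM => //; apply: mer_hol; apply: nearc_imp hr => w hw'.
  by apply: holM => //; exact: hol_pow.
apply: dnearc_imp (dnearc_and e (nearc_dnearc (nearc_and eh er))) => w [-> [-> er']].
rewrite !exprMn er' -exprM muln2.
by have -> : (n./2).*2 = n by rewrite -[RHS]odd_double_half (negbTE ev).
Qed.

(** Differentiating and dividing by [dC F], which does not vanish near [z], lowers the degree of the
    relation. The lemma serves to identify coefficients in identities between values of [F]. *)
Lemma quad0 (al be ga : C) z : dnearc z (fun w => al * F w ^+ 2 + be * F w + ga = 0) ->
  [/\ al = 0, be = 0 & ga = 0].
Proof.
have D (X : C -> C) : dnearc z (fun w => X w = 0) -> dnearc z (fun w => dC X w = 0).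
  move=> /dnearc_open; apply: dnearc_imp => w e; apply: dC_eq.
  by apply: (@cderiv_near _ (fun=> 0)); [apply: nearc_imp e => v ->|exact: cderiv_cst].
have lin (b c : C) : dnearc z (fun w => b * F w + c = 0) -> b = 0 /\ c = 0.
  move=> e; have e' := D _ e.
  have b0 : b = 0.
    apply: (@dnearc_extract _ z); apply: dnearc_imp (dnearc_and e' (dnearc_and (F_hol z) (dF_nz z))) => w [h1 [h2 h3]].
    have := dC_eq (cderivD (cderivM (cderiv_cst b w) (dCP h2)) (cderiv_cst c w)).
    by rewrite h1 mul0r add0r addr0 => /esym/eqP; rewrite mulf_eq0 (negbTE h3) orbF => /eqP.
  split=> //; apply: (@dnearc_extract _ z); apply: dnearc_imp e => w.
  by rewrite b0 mul0r add0r.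
move=> e; have e' := D _ e.
have [a2 b0] : 2 * al = 0 /\ be = 0.
  apply: lin; apply: dnearc_imp (dnearc_and e' (dnearc_and (F_hol z) (dF_nz z))) => w [h1 [h2 h3]].
  have dd := cderivD (cderivD (cderivM (cderiv_cst al w) (cderivX 2 (dCP h2))) (cderivM (cderiv_cst be w) (dCP h2))) (cderiv_cst ga w).
  have := dC_eq dd; rewrite h1 => /esym E.
  apply: (mulIf h3); rewrite mul0r -[RHS]E /=; ring.
have a0 : al = 0.
  by move: a2 => /eqP; rewrite mulf_eq0 pnatr_eq0 /= => /eqP.
split=> //; apply: (@dnearc_extract _ z); apply: dnearc_imp e => w.
by rewrite a0 b0 !mul0r !add0r.
Qed.

Lemma mob_unique a b c d a' b' c' d' : a * d - b * c = 1 -> a' * d' - b' * c' = 1 ->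
  (forall z, mob a b c d (f z) = mob a' b' c' d' (f z)) -> mob a b c d = mob a' b' c' d'.
Proof.
move=> D D' H.
have [] := @quad0 (a * c' - a' * c) (a * d' + b * c' - (a' * d + b' * c)) (b * d' - b' * d) 0.
  apply: dnearc_imp (f_F 0) => w e; have := H w; rewrite e => /mob_cross E.
  transitivity ((a * F w + b) * (c' * F w + d') - (a' * F w + b') * (c * F w + d)); first by ring.
  by rewrite E subrr.
by move=> /eqP; rewrite subr_eq0 => /eqP e1 /eqP; rewrite subr_eq0 => /eqP e2 /eqP; rewrite subr_eq0 => /eqP e3; exact: mob_eq_coef.
Qed.

Section Translation.
Variables (v a b c d : C).
Hypothesis D : a * d - b * c = 1.
Hypothesis H : forall z, f (z + v) = mob a b c d (f z).

Lemma F_trans z : dnearc z (fun w => c * F w + d != 0 /\ F (w + v) = (a * F w + b) / (c * F w + d)).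
Proof.
apply: dnearc_imp (dnearc_and (f_F z) (dnearc_shift (f_F (z + v)))) => w [e1 e2].
by have := H w; rewrite e1 e2 /mob; case: eqVneq => // n h; split=> //; exact: (congr1 (odflt 0) h).
Qed.

Lemma dF_trans z : dnearc z (fun w => dC F (w + v) * (c * F w + d) ^+ 2 = dC F w).
Proof.
apply: dnearc_imp (dnearc_and (dnearc_open (F_trans z)) (F_hol z)) => w [e h].
have n : c * F w + d != 0 by have [] := nearc_self e.
have d1 := cderivD (cderivM (cderiv_cst a w) (dCP h)) (cderiv_cst b w).
have d2 := cderivD (cderivM (cderiv_cst c w) (dCP h)) (cderiv_cst d w).
have d3 := cderivM d1 (@cderivV _ (fun w => c * F w + d) w _ n d2).
have E : nearc w (fun y => (a * F y + b) * (c * F y + d)^-1 = F (y + v)) by apply: nearc_imp e => y [_ ->].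
rewrite -dC_shift (dC_eq (cderiv_near E d3)) -[RHS]mul1r -D.
by move: (F w) (dC F w) n => x y n; field.
Qed.

End Translation.

Hypothesis mono : forall v, L v -> exists a b c d, a * d - b * c = 1 /\ forall z, f (z + v) = mob a b c d (f z).
Hypothesis k_even : ~~ odd k.

(** At a lattice point the root is carried over from the origin: if [s ^+ 2 = dC F] near 0, then the
    square of [s / (c * F + d)] is the translated derivative. *)
Lemma root_all z : exists s, root_at (dC F) s z.
Proof.
have [Lz|nL] := pselect (L z); last first.
  by have [phi [c o]] := off nL; apply: (even_root _ c o).
have [phi [ch o]] := at0; have [s [ms es]] := even_root k_even ch o.
have [a [b [c [d [D H]]]]] := mono Lz.
have e1 := F_trans H 0; have e2 := dF_trans D H 0.
pose q w := s w * (c * F w + d)^-1.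
have mq : mer_at q 0.
  apply: merM => //; apply: merV; apply: merD; last exact: mer_cst.
  by apply: merM; [exact: mer_cst|exact: F_mer].
have sh0 : z + - z = 0 by rewrite subrr.
exists (fun w => q (w - z)); split.
  by apply: (@mer_shift _ q z (- z)); rewrite sh0.
have : dnearc (z + - z) (fun w => q w ^+ 2 = dC F (w + z)).
  rewrite sh0; apply: dnearc_imp (dnearc_and es (dnearc_and e1 e2)) => w [h1 [[h2 _] h3]].
  by rewrite /q exprMn h1 -h3 exprVn mulfK // expf_neq0.
by move=> /dnearc_shift; apply: dnearc_imp => w ->; rewrite subrK.
Qed.

(** The square [small] contains 0, [w1] and [w2], and [big] contains its translates by both periods.
    A root on [big] is enough to compare the two ways from 0 to [w1 + w2]. *)
Let r0 : R := normc w1 + normc w2.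
Let small z := in_rect (- r0) r0 (- r0) r0 z.
Let big z := in_rect (- (2 * r0)) (2 * r0) (- (2 * r0)) (2 * r0) z.

Lemma rect_normc (r : R) z : normc z <= r -> in_rect (- r) r (- r) r z.
Proof. by move=> h; split; rewrite -ler_norml; apply: le_trans h; [exact: normc_Re|exact: normc_Im]. Qed.

Lemma r0_ge0 : 0 <= r0.
Proof. by rewrite addr_ge0 // normc_ge0. Qed.

Lemma small_big z v : small z -> normc v <= r0 -> big (z + v).
Proof.
move=> [/andP[a b] /andP[c d]] vr.
have := le_trans (normc_Re v) vr; have := le_trans (normc_Im v) vr.
rewrite !ler_norml => /andP[e1 e2] /andP[e3 e4].
by case: z a b c d => x y /= a b c d; case: v vr e1 e2 e3 e4 => x' y' /= _ e1 e2 e3 e4; split; apply/andP; split => /=; lra.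
Qed.

(** By [dF_trans], [s (w + v) * (c * F w + d)] is another root of the derivative, so it is [s] up to
    one sign on all of [small]. The sign is put into the matrix, whose determinant it does not
    change. *)
Lemma sqrt_trans s v : (forall z, big z -> root_at (dC F) s z) -> L v -> normc v <= r0 ->
  exists a b c d, [/\ a * d - b * c = 1, forall z, f (z + v) = mob a b c d (f z) &
    forall z, small z -> dnearc z (fun w => s (w + v) * (c * F w + d) = s w)].
Proof.
move=> Hs Lv vr; have [a [b [c [d [D H]]]]] := mono Lv.
pose h w := s (w + v) * (c * F w + d).
have z0 : small 0 by apply: rect_normc; rewrite normc0 r0_ge0.
have n00 : normc (0 : C) <= r0 by rewrite normc0 r0_ge0.
have sb z : small z -> big z by move=> sz; have := small_big sz n00; rewrite addr0.
have hroot z : small z -> root_at (dC F) h z.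
  move=> sz; have [m e] := Hs _ (small_big sz vr); split.
    apply: merM; first exact: mer_shift.
    by apply: merD; [apply: merM; [exact: mer_cst|exact: F_mer]|exact: mer_cst].
  apply: dnearc_imp (dnearc_and (dnearc_shift e) (dF_trans D H z)) => w [h1 h2].
  by rewrite /h exprMn h1.
have [eps e2 E] := root_pm (Hs _ (sb _ z0)) (hroot _ z0).
have rr : - r0 <= r0 by have := r0_ge0; lra.
have I : forall z, small z -> dnearc z (fun w => s w - eps * h w = 0).
  apply: (identity_rect rr rr _ z0 E) => z sz; apply: merB; first exact: (Hs _ (sb _ sz)).1.
  by apply: merM; [exact: mer_cst|exact: (hroot _ sz).1].
have n0 : eps != 0 by apply/eqP => n; move: e2; rewrite n expr0n /= => /esym/eqP; rewrite oner_eq0.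
exists (eps * a), (eps * b), (eps * c), (eps * d); split.
- by rewrite -[RHS]D -[RHS]mul1r -e2; ring.
- by move=> z; rewrite mob_scale.
- move=> z sz; apply: dnearc_imp (I z sz) => w /eqP; rewrite subr_eq0 => /eqP ->.
  by rewrite /h; ring.
Qed.

(** A matrix of determinant 1 satisfies [M ^ 2 = (a + d) M - 1]. Since [M ^ 2] acts trivially it is
    scalar, so either the trace vanishes or [M] itself is scalar. *)
Lemma period2 v a b c d : a * d - b * c = 1 -> (forall z, f (z + v) = mob a b c d (f z)) ->
  (forall z, f (z + v + v) = f z) -> (forall z, f (z + v) = f z) \/ d = - a.
Proof.
move=> D H P; have [e|ne] := eqVneq (a + d) 0; first by right; apply/eqP; rewrite -subr_eq0 opprK addrC e.
left=> z; rewrite H.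
have [] := @quad0 (c * (a + d)) ((d - a) * (a + d)) (- (b * (a + d))) 0.
  apply: dnearc_imp (dnearc_and (F_trans H 0) (dnearc_and (f_F 0) (dnearc_shift (F_trans H (0 + v))))) => w [[n1 e1] [e2 [n2 e3]]].
  have : F (w + v + v) = F w by rewrite /F /affine_part P.
  rewrite e3 => E; have E' : a * F (w + v) + b = F w * (c * F (w + v) + d) by rewrite -E divfK.
  rewrite e1 in E'; have : (a * (a * F w + b) + b * (c * F w + d)) = F w * (c * (a * F w + b) + d * (c * F w + d)).
    have := congr1 (fun t => t * (c * F w + d)) E'; move: (F w) n1 => x n1.
    have -> : (a * ((a * x + b) / (c * x + d)) + b) * (c * x + d) = a * (a * x + b) + b * (c * x + d) by field.
    by have -> : x * (c * ((a * x + b) / (c * x + d)) + d) * (c * x + d) = x * (c * (a * x + b) + d * (c * x + d)) by field.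
  move=> K; transitivity (F w * (c * (a * F w + b) + d * (c * F w + d)) - (a * (a * F w + b) + b * (c * F w + d))); first by ring.
  by rewrite K subrr.
move=> /eqP; rewrite mulf_eq0 (negbTE ne) orbF => /eqP c0 /eqP; rewrite mulf_eq0 (negbTE ne) orbF subr_eq0 => /eqP da.
move=> /eqP; rewrite oppr_eq0 mulf_eq0 (negbTE ne) orbF => /eqP b0.
have a0 : a != 0 by apply/eqP => a0; move: ne; rewrite da a0 addr0 eqxx.
by rewrite c0 b0 da; case: (f z) => [x|] /=; rewrite ?eqxx // mul0r add0r (negbTE a0) addr0 [a * x]mulrC mulfK.
Qed.

(* With [s ^ 2 = f'] on a rectangle, the row [(f / s, 1 / s)] transforms linearly under [w1] and [w2], by
   lifts of the monodromy to [SL(2)]; comparing the two ways to reach [w1 + w2] makes the lifts commute. *)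
Lemma even_degenerate : (forall z, f (z + w1 + w1) = f z) -> (forall z, f (z + w2 + w2) = f z) ->
  [\/ forall z, f (z + w1) = f z, forall z, f (z + w2) = f z | forall z, f (z + w1) = f (z + w2)].
Proof.
move=> P1 P2.
have r20 : 0 <= 2 * r0 by have := r0_ge0; lra.
have [s Hs] := rect_root r20 root_all.
have n1 : normc w1 <= r0 by rewrite lerDl normc_ge0.
have n2 : normc w2 <= r0 by rewrite lerDr normc_ge0.
have [a [b [c [d [D H S]]]]] := sqrt_trans Hs (lattice_l w1 w2) n1.
have [a' [b' [c' [d' [D' H' S']]]]] := sqrt_trans Hs (lattice_r w1 w2) n2.
have [|dE] := period2 D H P1; first by constructor 1.
have [|dE'] := period2 D' H' P2; first by constructor 2.
constructor 3 => z; rewrite H H' dE dE'; congr (_ (f z)).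
have z0 : small 0 by apply: rect_normc; rewrite normc0 r0_ge0.
have sw1 : small w1 by exact: rect_normc.
have sw2 : small w2 by exact: rect_normc.
have T1 := F_trans H 0; have T2 := F_trans H' 0.
have S1 := S 0 z0; have S2 := S' 0 z0.
have S21 : dnearc 0 (fun w => s (w + w1 + w2) * (c' * F (w + w1) + d') = s (w + w1)).
  by apply: (@dnearc_shift _ 0 w1 (fun y => s (y + w2) * (c' * F y + d') = s y)); rewrite add0r; exact: S'.
have S12 : dnearc 0 (fun w => s (w + w2 + w1) * (c * F (w + w2) + d) = s (w + w2)).
  by apply: (@dnearc_shift _ 0 w2 (fun y => s (y + w1) * (c * F y + d) = s y)); rewrite add0r; exact: S.
have T21 : dnearc 0 (fun w => F (w + w1 + w2) = (a' * F (w + w1) + b') / (c' * F (w + w1) + d') /\ c' * F (w + w1) + d' != 0).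
  apply: (@dnearc_shift _ 0 w1 (fun y => F (y + w2) = (a' * F y + b') / (c' * F y + d') /\ c' * F y + d' != 0)).
  by apply: dnearc_imp (F_trans H' (0 + w1)) => w [].
have T12 : dnearc 0 (fun w => F (w + w2 + w1) = (a * F (w + w2) + b) / (c * F (w + w2) + d) /\ c * F (w + w2) + d != 0).
  apply: (@dnearc_shift _ 0 w2 (fun y => F (y + w1) = (a * F y + b) / (c * F y + d) /\ c * F y + d != 0)).
  by apply: dnearc_imp (F_trans H (0 + w2)) => w [].
have snz : dnearc 0 (fun w => s w != 0).
  have b0 : big 0 by apply: rect_normc; rewrite normc0.
  by apply: dnearc_imp (dnearc_and (Hs _ b0).2 (dF_nz 0)) => w [<-]; rewrite expf_eq0.
have bot : dnearc 0 (fun w => c' * (a * F w + b) + d' * (c * F w + d) = c * (a' * F w + b') + d * (c' * F w + d')).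
  apply: dnearc_imp (dnearc_and (dnearc_and S1 S2) (dnearc_and (dnearc_and S21 S12) (dnearc_and snz (dnearc_and T1 T2)))).
  move=> w [[s1 s2] [[s21 s12] [nz [[m1 t1] [m2 t2]]]]].
  have A : s (w + w1 + w2) * (c' * (a * F w + b) + d' * (c * F w + d)) = s w.
    rewrite -s1 -s21 t1; move: (s (w + w1 + w2)) (F w) m1 => x y m1; field; exact: m1.
  have B : s (w + w1 + w2) * (c * (a' * F w + b') + d * (c' * F w + d')) = s w.
    rewrite -(addrA w) (addrC w1) addrA -s2 -s12 t2; move: (s (w + w2 + w1)) (F w) m2 => x y m2; field; exact: m2.
  have x0 : s (w + w1 + w2) != 0 by apply/eqP => x0; move: nz; rewrite -A x0 mul0r eqxx.
  by apply: (mulfI x0); rewrite A B.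
have top : dnearc 0 (fun w => a' * (a * F w + b) + b' * (c * F w + d) = a * (a' * F w + b') + b * (c' * F w + d')).
  apply: dnearc_imp (dnearc_and bot (dnearc_and (dnearc_and T21 T12) (dnearc_and T1 T2))).
  move=> w [bo [[[t21 m21] [t12 m12]] [[m1 t1] [m2 t2]]]].
  have X : (a' * (a * F w + b) + b' * (c * F w + d)) = F (w + w1 + w2) * (c' * (a * F w + b) + d' * (c * F w + d)).
    have := t21; rewrite t1 => e; have := m21; rewrite t1 => n.
    have n' : c' * (a * F w + b) + d' * (c * F w + d) != 0.
      have -> : c' * (a * F w + b) + d' * (c * F w + d) = (c' * ((a * F w + b) / (c * F w + d)) + d') * (c * F w + d).
        by move: (F w) m1 => x m1; field.
      by rewrite mulf_neq0.
    by rewrite e; move: (F w) m1 n n' => x m1 n n'; field; rewrite m1 n'.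
  have Y : (a * (a' * F w + b') + b * (c' * F w + d')) = F (w + w1 + w2) * (c * (a' * F w + b') + d * (c' * F w + d')).
    rewrite -(addrA w) (addrC w1) addrA; have := t12; rewrite t2 => e; have := m12; rewrite t2 => n.
    have n' : c * (a' * F w + b') + d * (c' * F w + d') != 0.
      have -> : c * (a' * F w + b') + d * (c' * F w + d') = (c * ((a' * F w + b') / (c' * F w + d')) + d) * (c' * F w + d').
        by move: (F w) m2 => x m2; field.
      by rewrite mulf_neq0.
    by rewrite e; move: (F w) m2 n n' => x m2 n n'; field; rewrite m2 n'.
  by rewrite X Y bo.
have two0 : (2 : C) != 0 by rewrite pnatr_eq0.
have [_ q1 q2] : [/\ 0 = 0 :> C, (a' * a + b' * c) - (a * a' + b * c') = 0 & (a' * b + b' * d) - (a * b' + b * d') = 0].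
  apply: (@quad0 _ _ _ 0); apply: dnearc_imp top => w e.
  transitivity ((a' * (a * F w + b) + b' * (c * F w + d)) - (a * (a' * F w + b') + b * (c' * F w + d'))); first by ring.
  by rewrite e subrr.
have [_ q3 _] : [/\ 0 = 0 :> C, (c' * a + d' * c) - (c * a' + d * c') = 0 & (c' * b + d' * d) - (c * b' + d * d') = 0].
  apply: (@quad0 _ _ _ 0); apply: dnearc_imp bot => w e.
  transitivity ((c' * (a * F w + b) + d' * (c * F w + d)) - (c * (a' * F w + b') + d * (c' * F w + d'))); first by ring.
  by rewrite e subrr.
rewrite dE in D q2 q3; rewrite dE' in D' q2 q3.
apply: traceless_commute => //.
- by apply/eqP; rewrite eq_sym -subr_eq0 -q1; apply/eqP; ring.
- apply: (mulfI two0); apply/eqP; rewrite eq_sym -subr_eq0; apply/eqP; rewrite -[RHS]q2; ring.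
- apply: (mulfI two0); apply/eqP; rewrite -subr_eq0; apply/eqP; rewrite -[RHS]q3; ring.
Qed.

End Monodromy.

(** * Necessity *)

Section Necessity.
Variable R : realType.
Local Notation C := R[i].
Local Notation T2 := (measurableTypeR R * measurableTypeR R)%type.
Local Notation area := (@area R).
Variables w1 w2 : C.
Hypothesis hw : 0 < Im (w2 / w1).
Local Notation E := (fundamental_domain w1 w2 : set T2).
Local Notation L := (lattice w1 w2).
Implicit Types (z v : C) (u : C -> R) (f : C -> sphere R).

(** Positivity of the density off the lattice prevents the derivative of a chart from vanishing
    identically, so it has a finite order, also at lattice points. *)
Lemma dev_good u f : developing_map w1 w2 u f -> forall z, good_chart f z.
Proof.
move=> [mf D] z; have [phi c] := mer_chart mf z; exists phi.
have [e|[n o]] := order_dichotomy (dC_hol (proj1 c)); last by exists n.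
exfalso; apply: (@dnearc_false _ z).
apply: dnearc_imp (dnearc_and (lattice_off hw z) (nearc_dnearc (nearc_and e (chart_density c)))) => w [nL [e0 de]].
by have [] := D w nL; rewrite de /dens e0 normc0 expr0n /= mulr0 mul0r ltxx.
Qed.

Lemma dev_off u f : developing_map w1 w2 u f -> forall z, ~ L z -> exists phi, chart f z phi /\ has_order (dC phi) z 0.
Proof.
move=> [mf D] z nL; have [phi c] := mer_chart mf z; exists phi; split=> //.
apply: has_order0; first by apply: dC_hol; case: c.
apply/eqP => e0; have [] := D z nL.
by rewrite (nearc_self (chart_density c)) /dens e0 normc0 expr0n /= mulr0 mul0r ltxx.
Qed.

Lemma PSU2_mob (t : sphere R -> sphere R) : PSU2 t -> exists a b c d, a * d - b * c = 1 /\ t = mob a b c d.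
Proof.
move=> [M [_ dM] <-]; exists (M ord0 ord0), (M ord0 ord_max), (M ord_max ord0), (M ord_max ord_max).
by split=> //; rewrite -det22.
Qed.

Lemma half_period (V : Type) (g : C -> V) w : (forall z, g (z + w + w) = g z) ->
  forall m : int, (forall z, g (z + w *~ m) = g z) \/ (forall z, g (z + w *~ m) = g (z + w)).
Proof.
move=> H m; have P : forall z, g (z + (w + w)) = g z by move=> z; rewrite addrA.
have [q [->|->]] : exists q : int, m = q + q \/ m = q + q + 1 by exists (m %/ 2)%Z; lia.
  by left=> z; rewrite mulrzDr -mulrzDl (periodic_mulz P).
by right=> z; rewrite !mulrzDr mulr1z -mulrzDl addrA addrAC (periodic_mulz P).
Qed.

(** For even [k], [even_degenerate] makes [w1], [w2] or their difference act trivially. Every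
    lattice translation then acts like 0 or like one fixed [mu], and three distinct elements of the
    Klein group cannot share two values. *)
Lemma klein_odd f (T : C -> sphere R -> sphere R) k : (forall z, good_chart f z) ->
  (forall z, ~ L z -> exists phi, chart f z phi /\ has_order (dC phi) z 0) ->
  (exists phi, chart f 0 phi /\ has_order (dC phi) 0 k) ->
  monodromy w1 w2 f T -> klein_four (T @` L) -> odd k.
Proof.
move=> good off at0 mono [phi [inj hom rg]]; apply: contrapT => /negP ek.
have mono' v : L v -> exists a b c d, a * d - b * c = 1 /\ forall z, f (z + v) = mob a b c d (f z).
  move=> /mono[/PSU2_mob[a [b [c [d [D e]]]]] H]; exists a, b, c, d; split=> // z.
  by rewrite H e.
have T_eq v v' : L v -> L v' -> (forall z, f (z + v) = f (z + v')) -> T v = T v'.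
  move=> /mono[/PSU2_mob[a [b [c [d [D e]]]]] H] /mono[/PSU2_mob[a' [b' [c' [d' [D' e']]]]] H'] K.
  rewrite e e'; apply: (mob_unique good D D') => z.
  by rewrite -e -e' -H -H' K.
have inT x : exists2 v, L v & T v = phi x.
  have : (T @` L) (phi x) by rewrite -rg; exists x.
  by move=> [v Lv <-]; exists v.
have xx (x : 'Z_2 * 'Z_2) : x + x = 0.
  by case: x => -[[|[|//]] h] [[|[|//]] h']; congr pair; exact: val_inj.
(* The map [phi 0] is idempotent; that it fixes the values of [f] follows because it is the action
   of some translation, and this is all that is used. *)
have phi0 z : phi 0 (f z) = f z.
  have [v Lv e] := inT 0; have [_ H] := mono _ Lv.
  have K y : f (y + v + v) = f (y + v).
    by rewrite !H e -[LHS]/((phi 0 \o phi 0) (f y)) -hom addr0.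
  by rewrite -{1}(subrK v z) -e -H K subrK.
have per v : L v -> forall z, f (z + v + v) = f z.
  move=> Lv z; have [_ H] := mono _ Lv.
  have [x _ e] : range phi (T v) by rewrite rg; exists v.
  by rewrite !H -e -[LHS]/((phi x \o phi x) (f z)) -hom xx phi0.
have L1 := lattice_l w1 w2; have L2 := lattice_r w1 w2.
have L0 : L 0 by exists 0, 0; rewrite !mulr0z addr0.
have P1 := per _ L1; have P2 := per _ L2.
have [mu Lmu [S1 S2]] : exists2 mu, L mu &
   ((forall z, f (z + w1) = f z) \/ (forall z, f (z + w1) = f (z + mu))) /\
   ((forall z, f (z + w2) = f z) \/ (forall z, f (z + w2) = f (z + mu))).
  have [e|e|e] := even_degenerate off at0 good mono' ek P1 P2.
  - by exists w2 => //; split; [left|right].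
  - by exists w1 => //; split; [right|left].
  - by exists w1 => //; split; right.
have step w : (forall z, f (z + w + w) = f z) -> (forall z, f (z + w) = f z) \/ (forall z, f (z + w) = f (z + mu)) ->
    forall m : int, (forall z, f (z + w *~ m) = f z) \/ (forall z, f (z + w *~ m) = f (z + mu)).
  move=> P S m; have [e|e] := half_period P m; first by left.
  by case: S => S; [left|right] => z; rewrite e S.
have two v : L v -> T v = T 0 \/ T v = T mu.
  move=> Lv; have := Lv => -[m [n ev]].
  have Z : (forall z, f (z + v) = f z) \/ (forall z, f (z + v) = f (z + mu)).
    have [e1|e1] := step _ P1 S1 m; have [e2|e2] := step _ P2 S2 n; rewrite ev.
    - by left=> z; rewrite addrA e2 e1.
    - by right=> z; rewrite addrA e2 addrAC e1.
    - by right=> z; rewrite addrA e2 e1.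
    - by left=> z; rewrite addrA e2 addrAC e1 per.
  case: Z => Z; [left|right]; apply: T_eq => //.
  by move=> z; rewrite Z addr0.
have two' x : phi x = T 0 \/ phi x = T mu.
  by have [v Lv <-] := inT x; exact: two.
have n1 : phi (0, 0) = phi (0, 1) -> False by move=> /inj/(congr1 (fun x => val x.2)).
have n2 : phi (0, 0) = phi (1, 0) -> False by move=> /inj/(congr1 (fun x => val x.1)).
have n3 : phi (0, 1) = phi (1, 0) -> False by move=> /inj/(congr1 (fun x => val x.1)).
have [a|a] := two' (0, 0); have [b|b] := two' (0, 1); have [c|c] := two' (1, 0);
  by [apply: n1; rewrite a b|apply: n2; rewrite a c|apply: n3; rewrite b c].
Qed.

Lemma fundamental_lattice p : E p -> L (pt p) -> p = 0.
Proof.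
move=> Ep Lp; have [n e] := lattice_sh0 Lp.
have E0 : E (0 : R * R).
  by apply/(E_coords hw); have [-> ->] := coords0 hw; rewrite lexx ltr01.
have n0 : n = (0, 0) by apply: (E_unique hw Ep); rewrite e.
rewrite n0 in e; change (sh (vec (w1 *~ 0 + w2 *~ 0)) p = 0) in e; rewrite !mulr0z addr0 in e.
by move: e; rewrite /sh /vec /= !addr0; case: (p).
Qed.

(** The equation is tested with the constant function 1. This recovers [rho] from [u] and so
    identifies the order of the derivative at the origin with [l]. *)
Lemma total_mass rho u : mean_field_solution w1 w2 rho u ->
  (\int[area]_(p in E) (expR (in_coords u p))%:E = rho%:E)%E.
Proof.
move=> [_ _ _ _ /(_ (fun=> 1))]; have sm : smooth (in_coords (fun=> 1 : R)).
  by move=> n; apply: class_C_Ck => p _; exact: Ck_cst.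
move=> /(_ (fun _ _ _ => erefl) sm); rewrite mulr1 => <-.
apply: eq_integral => p _; congr (_%:E).
have G q := gd_cst (1 : R) q.
have -> : laplacian (in_coords (fun=> 1 : R)) p = 0.
  rewrite (@gd_lap _ (in_coords (fun=> 1 : R)) (fun=> 0) (fun=> 0) p 0 0 0 0) ?addr0 //.
  - by apply: near_all => q; exact: gd_cst.
  - exact: gd_cst.
  - exact: gd_cst.
by rewrite mulr0 add0r /in_coords mulr1.
Qed.

Theorem type_I_odd l u : mean_field_solution w1 w2 (4 * pi * l%:R) u -> type_I w1 w2 u -> odd l.
Proof.
move=> sol [f [T [dev mono klein]]].
have good := dev_good dev; have off := dev_off dev.
have [phi [k [c o]]] := good 0.
have at0 : exists phi, chart f 0 phi /\ has_order (dC phi) 0 k by exists phi.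
have ok := klein_odd good off at0 mono klein.
have k0 : (0 < k)%N by case: (k) ok.
(* The values of [u] on the lattice are arbitrary, whereas [mean_field_charts] requires 0 there; the
   change affects one point of the fundamental domain and no integral. *)
pose U z : R := if `[< L z >] then 0 else u z.
have [peru _ _ iu _] := sol.
have LD z v : L v -> L (z + v) <-> L z.
  move=> [a [b ->]]; split=> [[m [n e]]|[m [n ->]]].
    by exists (m - a), (n - b); rewrite !mulrzBr addrACA -opprD -e addrK.
  by exists (m + a), (n + b); rewrite !mulrzDr addrACA.
have solU : mean_field_solution w1 w2 (4 * pi * k%:R) U.
  apply: (mean_field_charts hw k0 off at0).
  - move=> z v Lv; rewrite /U peru //; congr (if _ then _ else _).
    by apply/asboolP/asboolP => /(LD z v Lv).
  - by move=> z nL; rewrite /U asboolF //; have [] := dev.2 z nL.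
  - by move=> z Lz; rewrite /U asboolT.
have [_ _ _ iU _] := solU.
have m1 := total_mass sol; have m2 := total_mass solU.
have : (4 * pi * l%:R)%:E = (4 * pi * k%:R)%:E :> \bar R.
  rewrite -m1 -m2; apply: ae_eq_integral; [exact: measurable_E|exact: (measurable_int _ iu)|exact: (measurable_int _ iU)|].
  apply: ae_neq0 => p p0 Ep; rewrite /in_coords /U asboolF // => Lp.
  by apply: p0; exact: fundamental_lattice.
move=> [/eqP]; rewrite (inj_eq (mulfI _)); last by rewrite mulf_neq0 ?pnatr_eq0 // gt_eqF // pi_gt0.
by rewrite eqr_nat => /eqP ->.
Qed.

End Necessity.

Theorem theorem0p3 (R : realType) (w1 w2 : R[i])
    (Hbasis : 0 < complex.Im (w2 / w1)) (l : nat) (Hl : (0 < l)%N) :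
  (exists u : R[i] -> R,
     mean_field_solution w1 w2 (4 * pi * l%:R) u /\ type_I w1 w2 u) <-> odd l.
Proof.
split=> [[u [sol tI]]|ol]; first exact: (type_I_odd Hbasis sol tI).
exact: odd_type_I.
Qed.
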